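(* Assume that the linear transport problem $\nabla\cdot(\boldsymbol\beta u)+cu=f$ in $\Omega$, $u=g$ on $\Gamma_-$, has a unique solution, and that the adjoint problem $\boldsymbol\beta\cdot\nabla\Psi-c\Psi=\theta$ in $\Omega$, $\Psi=0$ on $\Gamma_+$, has a unique solution. Consider the $L^p$-PDWG algorithm with polynomial degrees $k\ge 1$ and $j\ge 0$ and parameters $\rho>0$, $\tau\ge 0$: find $(u_h;\lambda_h)\in M_{k-1,h}\times W_{j,h}^{0,\Gamma_+}$ such that $$s(\lambda_h,\sigma)+b(u_h,\sigma)=\sum_{e\subset\Gamma_-}\langle\sigma_b,\boldsymbol\beta\cdot\mathbf n\,g\rangle_e-(f,\sigma_0)\quad\forall\sigma=\{\sigma_0,\sigma_b\}\in W_{j,h}^{0,\Gamma_+},\qquad b(v,\lambda_h)=0\quad\forall v\in M_{k-1,h}.$$ Then: (i) if $j=k-1$, the algorithm has one and only one solution $(u_h;\lambda_h)$ for every $\tau\ge 0$; (ii) if $j=k$, the algorithm has a unique solution $(u_h;\lambda_h)$ for every $\tau>0$.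
   Context: Setting. $\Omega\subset\mathbb R^d$ ($d=2,3$) is an open bounded connected domain with Lipschitz boundary, with outward unit normal $\mathbf n$. $p>1$ and $\frac1p+\frac1q=1$. $\mathcal T_h$ is a shape-regular finite partition of $\Omega$ into polygons ($d=2$) or polyhedra ($d=3$), $h_T$ is the meshsize (diameter) of $T\in\mathcal T_h$, and $\mathcal E_h$ is the set of all edges (flat faces if $d=3$). The convection vector $\boldsymbol\beta\in[L^\infty(\Omega)]^d$ and reaction coefficient $c\in L^\infty(\Omega)$ are piecewise constant with respect to $\mathcal T_h$; $f\in L^q(\Omega)$. $\Gamma_-=\{\mathbf x\in\partial\Omega:\boldsymbol\beta(\mathbf x)\cdot\mathbf n<0\}$, $\Gamma_+=\partial\Omega\setminus\Gamma_-$, and $g\in L^q(\Gamma_-)$. $(\cdot,\cdot)_D$ and $\langle\cdot,\cdot\rangle_{\partial D}$ denote integrals of products over $D$ and $\partial D$ (over $\Omega$ if no subscript). Solution of the transport problem: $u\in L^q(\Omega)$ with $(u,\boldsymbol\beta\cdot\nabla\sigma-c\sigma)=\langle g,\boldsymbol\beta\cdot\mathbf n\,\sigma\rangle_{\Gamma_-}-(f,\sigma)$ for all $\sigma\in W^{1,p}_{0,\Gamma_+}(\Omega)=\{v\in W^{1,p}(\Omega): v=0\text{ on }\Gamma_+\}$. Adjoint problem: given $\theta\in L^q(\Omega)$, find $\Psi$ with $\boldsymbol\beta\cdot\nabla\Psi-c\Psi=\theta$ in $\Omega$, $\Psi=0$ on $\Gamma_+$; its unique solvability means in particular that the only $\Psi\in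 W^{1,p}_{0,\Gamma_+}(\Omega)$ with $\boldsymbol\beta\cdot\nabla\Psi-c\Psi=0$ in $\Omega$ is $\Psi=0$. Discrete spaces. $P_r(D)$ denotes polynomials of degree at most $r$ on $D$. $M_{k-1,h}=\{w: w|_T\in P_{k-1}(T)\ \forall T\in\mathcal T_h\}$. $W_{j,h}$ is the space of weak functions $\sigma=\{\sigma_0,\sigma_b\}$ with $\sigma_0|_T\in P_j(T)$ for each $T\in\mathcal T_h$ and $\sigma_b|_e\in P_j(e)$ for each $e\in\mathcal E_h$ ($\sigma_b$ is single valued on each interior $e$ and need not be the trace of $\sigma_0$). $W_{j,h}^{0,\Gamma_+}$ is the subspace with $\sigma_b|_e=0$ for all $e\subset\Gamma_+$. Discrete weak gradient: for $\sigma\in W_{j,h}$, $\nabla_w\sigma|_T\in[P_{k-1}(T)]^d$ is the unique polynomial vector with $(\nabla_w\sigma,\boldsymbol\psi)_T=-(\sigma_0,\nabla\cdot\boldsymbol\psi)_T+\langle\sigma_b,\boldsymbol\psi\cdot\mathbf n\rangle_{\partial T}$ for all $\boldsymbol\psi\in[P_{k-1}(T)]^d$, where $\mathbf n$ is the outward unit normal on $\partial T$. Forms: $b(v,\sigma)=\sum_{T\in\mathcal T_h}(v,\boldsymbol\beta\cdot\nabla_w\sigma-c\sigma_0)_T$ and $$s(\lambda,\sigma)=\sum_{T\in\mathcal T_h}\Big[\rho h_T^{1-p}\int_{\partial T}|\lambda_0-\lambda_b|^{p-1}\mathrm{sgn}(\lambda_0-\lambda_b)(\sigma_0-\sigma_b)\,ds+\tau\int_T|\boldsymbol\beta\cdot\nabla\lambda_0-c\lambda_0|^{p-1}\mathrm{sgn}(\boldsymbol\beta\cdot\nabla\lambda_0-c\lambda_0)(\boldsymbol\beta\cdot\nabla\sigma_0-c\sigma_0)\,dT\Big].$$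 *)

(* Defs.v *)
From HB Require Import structures.
From mathcomp Require Import all_boot all_order all_algebra.
From mathcomp Require Import all_classical all_reals all_analysis.
Set Implicit Arguments. Unset Strict Implicit. Unset Printing Implicit Defensive.
Import Order.TTheory GRing.Theory Num.Theory.
Import numFieldNormedType.Exports.
Local Open Scope classical_set_scope.
Local Open Scope ring_scope.

(* The library has no measurable structure on row vectors and no Lebesgue
   measure in dimension > 1.  R^n is 'rV[R]_n with the sigma-algebra generated
   by the coordinates (as the library does for n.-tuple R), and its Lebesgue
   measure is the iterated product of the one-dimensional one. *)
Section measurable_rV.
Context {R : realType} (n : nat).

Definition rV_coord (i : 'I_n) (x : 'rV[R]_n) : R := x ord0 i.

Let rV_set0 : g_sigma_preimage rV_coord set0.
Proof. exact: sigma_algebra0. Qed.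

Let rV_setC A : g_sigma_preimage rV_coord A -> g_sigma_preimage rV_coord (~` A).
Proof. exact: sigma_algebraC. Qed.

Let rV_bigcup (F : (set 'rV[R]_n)^nat) :
  (forall i, g_sigma_preimage rV_coord (F i)) ->
  g_sigma_preimage rV_coord (\bigcup_i F i).
Proof. exact: sigma_algebra_bigcup. Qed.

HB.instance Definition _ :=
  @isMeasurable.Build (measure_tuple_display default_measure_display)
    'rV[R]_n (g_sigma_preimage rV_coord) rV_set0 rV_setC rV_bigcup.

Lemma measurable_rV_coord (i : 'I_n) :
  measurable_fun [set: 'rV[R]_n] (fun x : 'rV[R]_n => x ord0 i).
Proof.
move=> _ Y mY; rewrite setTI; apply: sub_sigma_algebra => /=.
rewrite -bigcup_seq/=; exists i => /=; first by rewrite mem_index_enum.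
by exists Y => //; rewrite setTI.
Qed.

Lemma measurable_fun_rV d (T : measurableType d) (f : T -> 'rV[R]_n) :
  (forall i, measurable_fun [set: T] (fun t => f t ord0 i)) ->
  measurable_fun [set: T] f.
Proof.
move=> mf _ A mA; rewrite setTI.
have : g_sigma_preimage (fun i => rV_coord i \o f) (f @^-1` A).
  by rewrite g_sigma_preimage_comp; exists A => //; rewrite setTI.
apply: smallest_sub; first exact: sigma_algebra_measurable.
rewrite -bigcup_seq/=; apply: bigcup_sub => i _ B [C mC <-].
exact: mf.
Qed.
End measurable_rV.

Section lebesgue_rV.
Context {R : realType}.

Definition rV_cons n (xy : R * 'rV[R]_n) : 'rV[R]_n.+1 :=
  row_mx (xy.1)%:M xy.2.

Definition rV_uncons n (x : 'rV[R]_n.+1) : R * 'rV[R]_n :=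
  (x ord0 ord0, \row_i x ord0 (lift ord0 i)).

Lemma rV_consE0 n (xy : R * 'rV[R]_n) : rV_cons xy ord0 ord0 = xy.1.
Proof. by rewrite mxE; case: splitP => //= j _; rewrite !ord1 mxE. Qed.

Lemma rV_consES n (xy : R * 'rV[R]_n) i :
  rV_cons xy ord0 (lift ord0 i) = xy.2 ord0 i.
Proof.
rewrite mxE; case: splitP => [[[|//] ?]//|k /=].
by rewrite /bump/= !add1n => -[/val_inj ->].
Qed.

Lemma rV_consK n : cancel (@rV_cons n) (@rV_uncons n).
Proof.
case=> x y; rewrite /rV_uncons rV_consE0; congr pair.
by apply/rowP => i; rewrite mxE rV_consES.
Qed.

Lemma rV_unconsK n : cancel (@rV_uncons n) (@rV_cons n).
Proof.
move=> x; apply/rowP => i; case: (unliftP ord0 i) => [j|] ->.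
  by rewrite rV_consES mxE.
by rewrite rV_consE0.
Qed.

Lemma measurable_rV_cons n : measurable_fun setT (@rV_cons n).
Proof.
apply: measurable_fun_rV => i; case: (unliftP ord0 i) => [j|] ->.
  rewrite (_ : (fun _ => _) = (fun v : 'rV[R]_n => v ord0 j) \o snd); last first.
    by apply/funext => x /=; rewrite rV_consES.
  exact: measurableT_comp (measurable_rV_coord j) _.
rewrite (_ : (fun _ => _) = fst)//; apply/funext => x; exact: rV_consE0.
Qed.

Lemma measurable_rV_uncons n : measurable_fun setT (@rV_uncons n).
Proof.
apply/measurable_fun_pairP; split; first exact: measurable_rV_coord.
apply: measurable_fun_rV => i /=.
by under eq_fun do rewrite mxE; exact: measurable_rV_coord.
Qed.

Section step.
Variables (n : nat) (m : {sigma_finite_measure set 'rV[R]_n -> \bar R}).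

Definition lebesgue_rV_step : set 'rV[R]_n.+1 -> \bar R :=
  pushforward (@lebesgue_measure R \x m)%E (@rV_cons n).

Let pm : {measure set 'rV[R]_n.+1 -> \bar R} :=
  measure_function_pushforward__canonical__measure_function_Measure
    (@lebesgue_measure R \x m)%E (@measurable_rV_cons n).

HB.instance Definition _ := isMeasure.Build _ _ _ lebesgue_rV_step
  (measure0 pm) (measure_ge0 pm) (@measure_semi_sigma_additive _ _ _ pm).

Let step_sigma_finite : sigma_finite setT lebesgue_rV_step.
Proof.
have /sigma_finiteP[F [FT ndF Foo]] := sigma_finiteT (@lebesgue_measure R).
have /sigma_finiteP[G [GT ndG Goo]] := sigma_finiteT m.
exists (fun i => @rV_uncons n @^-1` (F i `*` G i)).
  rewrite -preimage_bigcup; apply/esym/seteqP; split => // x _ /=.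
  have : [set: R] (rV_uncons x).1 by [].
  have : [set: 'rV[R]_n] (rV_uncons x).2 by [].
  rewrite FT GT => -[k _ Gk] [l _ Fl]; exists (maxn k l) => //; split.
    by move: Fl; exact/subsetPset/ndF/leq_maxr.
  by move: Gk; exact/subsetPset/ndG/leq_maxl.
move=> i; have [mF Fi] := Foo i; have [mG Gi] := Goo i; split.
  rewrite -[X in measurable X]setTI; apply: measurable_rV_uncons => //.
  exact: measurableX.
rewrite /lebesgue_rV_step /pushforward -comp_preimage.
rewrite (_ : _ \o _ = id); last by apply/funext => x /=; exact: rV_consK.
by rewrite preimage_id product_measure1E// lte_mul_pinfty// ge0_fin_numE.
Qed.

HB.instance Definition _ := Measure_isSigmaFinite.Build _ _ _ lebesgue_rV_step
  step_sigma_finite.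
End step.

Fixpoint lebesgue_rV (n : nat) : {sigma_finite_measure set 'rV[R]_n -> \bar R} :=
  match n with
  | 0 => \d_(0 : 'rV[R]_0)
  | n'.+1 => lebesgue_rV_step (lebesgue_rV n')
  end.

Lemma lebesgue_rV_box n (A : 'I_n -> set R) : (forall i, measurable (A i)) ->
  lebesgue_rV n [set x | forall i, A i (x ord0 i)] =
    (\prod_(i < n) @lebesgue_measure R (A i))%E.
Proof.
elim: n A => [|n IH] A mA.
  by rewrite big_ord0 /= diracE mem_set//= => -[].
rewrite big_ord_recl -IH//= /lebesgue_rV_step /pushforward.
have mB : measurable [set x : 'rV[R]_n | forall i, A (lift ord0 i) (x ord0 i)].
  rewrite (_ : [set x | _] = \bigcap_i
      ((fun x : 'rV[R]_n => x ord0 i) @^-1` A (lift ord0 i))); last first.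
    by apply/seteqP; split => x /= Ax i => [_|]; exact: Ax.
  apply: fin_bigcap_measurable.
    have -> : [set: 'I_n] = [set` predT] by apply/seteqP; split.
    exact: finite_finpred.
  move=> i _; rewrite -[X in measurable X]setTI.
  exact: measurable_rV_coord.
rewrite -product_measure1E//.
congr product_measure1; apply/seteqP; split => -[x y] /=.
  move=> Axy; split; first by have := Axy ord0; rewrite rV_consE0.
  by move=> i; have := Axy (lift ord0 i); rewrite rV_consES.
move=> [Ax Ay] i; case: (unliftP ord0 i) => [j|] ->.
  by rewrite rV_consES; exact: Ay.
by rewrite rV_consE0.
exact: mA.
Qed.
End lebesgue_rV.

Section euclidean.
Context {R : realType}.

Definition dot n (x y : 'rV[R]_n) : R := \sum_i x ord0 i * y ord0 i.

(* The library norm `|x| on 'rV[R]_n is the max norm. *)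
Definition enorm n (x : 'rV[R]_n) : R := Num.sqrt (dot x x).

Definition diam n (A : set 'rV[R]_n) : R :=
  sup [set enorm (xy.1 - xy.2) | xy in A `*` A].

Definition boundary n (A : set 'rV[R]_n) : set 'rV[R]_n := closure A `\` A°.

Definition pderiv n (i : 'I_n) (f : 'rV[R]_n -> R) (x : 'rV[R]_n) : R :=
  'D_(delta_mx ord0 i) f x.

Definition grad n (f : 'rV[R]_n -> R) (x : 'rV[R]_n) : 'rV[R]_n :=
  \row_i pderiv i f x.

Definition divergence n (F : 'rV[R]_n -> 'rV[R]_n) (x : 'rV[R]_n) : R :=
  \sum_i pderiv i (fun y => F y ord0 i) x.

Fixpoint Ck n (m : nat) (f : 'rV[R]_n -> R) : Prop :=
  match m with
  | 0 => continuous f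
  | m'.+1 => (forall x, differentiable f x) /\ forall i, Ck m' (pderiv i f)
  end.

Definition is_poly n (r : nat) (f : 'rV[R]_n -> R) : Prop :=
  exists a : {ffun 'I_n -> 'I_r.+1} -> R, forall x,
    f x = \sum_(al : {ffun 'I_n -> 'I_r.+1} | (\sum_i al i <= r)%N)
            a al * \prod_i x ord0 i ^+ al i.

Definition is_poly_vec n (r : nat) (F : 'rV[R]_n -> 'rV[R]_n) : Prop :=
  forall i, is_poly r (fun x => F x ord0 i).

(* The boundary is locally, in some orthonormal frame, the graph of a
   Lipschitz function, with A on one side of it. *)
Definition lipschitz_boundary n (A : set 'rV[R]_n.+1) : Prop :=
  forall x0, boundary A x0 ->
  exists (Q : 'M[R]_n.+1) (gam : 'rV[R]_n -> R) (L : R),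
    [/\ Q *m Q^T = 1%:M,
        forall y z, `|gam y - gam z| <= L * enorm (y - z) &
        \forall x \near x0,
          A x <-> gam (rV_uncons (x *m Q)).2 < (rV_uncons (x *m Q)).1].

Definition lipschitz_domain n (A : set 'rV[R]_n.+1) : Prop :=
  [/\ A !=set0, open A, bounded_set A, connected A & lipschitz_boundary A].

Definition simplex n (v : 'I_n.+1 -> 'rV[R]_n) : set 'rV[R]_n :=
  [set x | exists t : 'I_n.+1 -> R,
     [/\ forall i, 0 <= t i, \sum_i t i = 1 & x = \sum_i t i *: v i]].

Definition affinely_independent n (v : 'I_n.+1 -> 'rV[R]_n) : Prop :=
  \matrix_(i < n) (v (lift ord0 i) - v ord0) \in unitmx.

(* An open interval (n = 1), polygon (n = 2) or polyhedron (n = 3), not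
   necessarily convex: the connected interior of a finite union of
   nondegenerate closed simplices. *)
Definition open_polytope n (A : set 'rV[R]_n) : Prop :=
  [/\ A !=set0, connected A &
      exists (N : nat) (v : 'I_N -> 'I_n.+1 -> 'rV[R]_n),
        (forall i, affinely_independent (v i)) /\
        A = (\bigcup_i simplex (v i))°].

End euclidean.

(* From here on the space dimension is d = n + 1, and faces have dimension n. *)
Section mesh.
Context {R : realType} {n : nat}.

(* Cells T and faces e (edges in the plane) are open subsets of R^(n+1) and of
   a hyperplane, respectively; their closures are the usual closed polytopes.
   The face e is the isometric image, under y |-> face_org e + y *m face_frm e,
   of the set face_ref e of R^n, so that the surface measure on e is the image
   of the Lebesgue measure of R^n.  incident T e says that e is a face of T,
   and normal T e is then the unit normal to e pointing out of T. *)
Record mesh := Mesh {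
  cells : finType;
  faces : finType;
  cell : cells -> set 'rV[R]_n.+1;
  face_ref : faces -> set 'rV[R]_n;
  face_org : faces -> 'rV[R]_n.+1;
  face_frm : faces -> 'M[R]_(n, n.+1);
  incident : cells -> faces -> bool;
  normal : cells -> faces -> 'rV[R]_n.+1 }.

Implicit Types (M : mesh) (Omega : set 'rV[R]_n.+1).

Definition chart M (e : faces M) (y : 'rV[R]_n) : 'rV[R]_n.+1 :=
  face_org e + y *m face_frm e.

Definition face M (e : faces M) : set 'rV[R]_n.+1 := @chart M e @` face_ref e.

Record outward_normal (T e : set 'rV[R]_n.+1) (B : 'M[R]_(n, n.+1))
    (nu : 'rV[R]_n.+1) : Prop := OutwardNormal {
  normal_unit : dot nu nu = 1;
  normal_orth : B *m nu^T = 0;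
  normal_out : forall x, e x -> \forall t \near (0 : R)^'+,
    T (x - t *: nu) /\ ~ T (x + t *: nu) }.

Record polytopal_partition Omega M : Prop := PolytopalPartition {
  cell_polytope : forall T : cells M, open_polytope (cell T);
  cell_disjoint : forall T T' : cells M, T != T' ->
    cell T `&` cell T' = set0;
  cell_cover : closure Omega = \bigcup_(T : cells M) closure (cell T);
  face_polytope : forall e : faces M, open_polytope (face_ref e);
  face_isometry : forall e : faces M, face_frm e *m (face_frm e)^T = 1%:M;
  face_disjoint : forall e e' : faces M, e != e' ->
    face e `&` face e' = set0;
  incidentE : forall (T : cells M) (e : faces M),
    incident T e <-> face e `<=` boundary (cell T);
  face_incident : forall e : faces M, exists T, incident T e;
  face_cover : forall T : cells M, boundary (cell T) =
    \bigcup_(e in [set e | incident T e]) closure (face e);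
  normalP : forall (T : cells M) (e : faces M), incident T e ->
    outward_normal (cell T) (face e) (face_frm e) (normal T e) }.

Definition meshsize M (T : cells M) : R := diam (cell T).

(* A uniform bound along a family of meshes; any single finite mesh satisfies
   it for some gamma > 0. *)
Definition shape_regular (gamma : R) M : Prop :=
  forall T : cells M,
    (exists x, forall y, enorm (y - x) < gamma * meshsize T -> cell T y) /\
    (forall e, incident T e -> gamma * meshsize T <= diam (face e)).

Definition cell_int M (T : cells M) (f : 'rV[R]_n.+1 -> R) : R :=
  \int[lebesgue_rV n.+1]_(x in cell T) f x.

Definition face_int M (e : faces M) (f : 'rV[R]_n.+1 -> R) : R :=
  \int[lebesgue_rV n]_(y in face_ref e) f (chart e y).

Definition cell_bnd_int M (T : cells M)
    (f : faces M -> 'rV[R]_n.+1 -> R) : R :=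
  \sum_(e | incident T e) face_int e (f e).

End mesh.
Arguments mesh : clear implicits.

Section transport.
Context {R : realType} {n : nat}.
Variables (Omega : set 'rV[R]_n.+1) (M : mesh R n).
Variables (beta : cells M -> 'rV[R]_n.+1) (c : cells M -> R).
Local Notation vec := ('rV[R]_n.+1).
Local Notation fn := (vec -> R).

(* beta T and c T are the constant values on the cell T. *)
Definition betaf (x : vec) : vec := \sum_(T : cells M) \1_(cell T) x *: beta T.

Definition cf (x : vec) : R := \sum_(T : cells M) \1_(cell T) x * c T.

(* The inflow boundary consists of whole open faces, beta being piecewise
   constant; the skeleton, where the normal is not defined, falls in
   Gamma_plus and is negligible. *)
Definition Gamma_minus : set vec :=
  [set x | exists (T : cells M) (e : faces M),
     [/\ incident T e, face e `<=` boundary Omega, face e x &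
         dot (beta T) (normal T e) < 0]].

Definition Gamma_plus : set vec := boundary Omega `\` Gamma_minus.

Definition in_Lp d (T : measurableType d) (mu : {measure set T -> \bar R})
    (r : R) (D : set T) (f : T -> R) : Prop :=
  measurable_fun D f /\ (\int[mu]_(x in D) (`|f x| `^ r)%:E < +oo)%E.

Definition in_Lp_face (r : R) (e : faces M) (f : fn) : Prop :=
  in_Lp (lebesgue_rV n) r (face_ref e) (f \o chart e).

Definition in_Lp_bnd (r : R) (G : set vec) (f : fn) : Prop :=
  forall e : faces M, face e `<=` G -> in_Lp_face r e f.

Definition Lp_cvg d (T : measurableType d) (mu : {measure set T -> \bar R})
    (r : R) (D : set T) (f_ : nat -> T -> R) (f : T -> R) : Prop :=
  (fun m => \int[mu]_(x in D) (`|f_ m x - f x| `^ r)%:E)%E @ \oo --> 0%E.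

Definition ae_eq_on d (T : measurableType d) (mu : {measure set T -> \bar R})
    (D : set T) (f g : T -> R) : Prop :=
  {ae mu, forall x, D x -> f x = g x}.

Definition test_function (phi : fn) : Prop :=
  (forall m, Ck m phi) /\
  exists K, [/\ compact K, K `<=` Omega & forall x, ~ K x -> phi x = 0].

Definition weak_gradient (v : fn) (G : vec -> vec) : Prop :=
  forall phi, test_function phi -> forall i,
    \int[lebesgue_rV n.+1]_(x in Omega) (v x * pderiv i phi x) =
    - \int[lebesgue_rV n.+1]_(x in Omega) (G x ord0 i * phi x).

Definition in_W1p (p : R) (v : fn) (G : vec -> vec) : Prop :=
  [/\ in_Lp (lebesgue_rV n.+1) p Omega v,
      forall i, in_Lp (lebesgue_rV n.+1) p Omega (fun x => G x ord0 i) &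
      weak_gradient v G].

(* The trace operator is the continuous extension to W^{1,p} of the
   restriction to the boundary of functions that are C^1 up to the boundary. *)
Definition has_trace (p : R) (v : fn) (G : vec -> vec) (t : fn) : Prop :=
  in_Lp_bnd p (boundary Omega) t /\
  exists phi : nat -> fn,
    [/\ forall m, Ck 1 (phi m),
        Lp_cvg (lebesgue_rV n.+1) p Omega phi v,
        forall i, Lp_cvg (lebesgue_rV n.+1) p Omega
          (fun m => pderiv i (phi m)) (fun x => G x ord0 i) &
        forall e : faces M, face e `<=` boundary Omega ->
          Lp_cvg (lebesgue_rV n) p (face_ref e)
            (fun m => phi m \o chart e) (t \o chart e)].

(* v is in W^{1,p}, with weak gradient G and trace t, and vanishes on
   Gamma_plus. *)
Definition in_W1p0 (p : R) (v : fn) (G : vec -> vec) (t : fn) : Prop :=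
  [/\ in_W1p p v G, has_trace p v G t &
      forall e : faces M, face e `<=` Gamma_plus ->
        ae_eq_on (lebesgue_rV n) (face_ref e) (t \o chart e) (fun=> 0)].

(* \sum_(e in Gamma_minus) < w e, beta . n >_e; a face of the boundary belongs
   to a single cell. *)
Definition inflow_int (w : faces M -> fn) : R :=
  \sum_(e : faces M | `[< face e `<=` Gamma_minus >])
    \sum_(T : cells M | incident T e)
      face_int e (fun x => w e x * dot (beta T) (normal T e)).

Definition transport_solution (p q : R) (f g u : fn) : Prop :=
  in_Lp (lebesgue_rV n.+1) q Omega u /\
  forall v G t, in_W1p0 p v G t ->
    \int[lebesgue_rV n.+1]_(x in Omega)
       (u x * (dot (betaf x) (G x) - cf x * v x)) =
    inflow_int (fun _ x => g x * t x) -
    \int[lebesgue_rV n.+1]_(x in Omega) (f x * v x).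

Definition transport_well_posed (p q : R) (f g : fn) : Prop :=
  (exists u, transport_solution p q f g u) /\
  forall u u', transport_solution p q f g u -> transport_solution p q f g u' ->
    ae_eq_on (lebesgue_rV n.+1) Omega u u'.

Definition adjoint_solution (p : R) (theta Psi : fn) : Prop :=
  exists G t, in_W1p0 p Psi G t /\
    ae_eq_on (lebesgue_rV n.+1) Omega
      (fun x => dot (betaf x) (G x) - cf x * Psi x) theta.

(* Well-posedness for one datum theta already gives uniqueness for all data,
   the problem being linear; existence of a W^{1,p} solution for every theta in
   L^q cannot be expected. *)
Definition adjoint_well_posed (p : R) (theta : fn) : Prop :=
  (exists Psi, adjoint_solution p theta Psi) /\
  forall Psi Psi', adjoint_solution p theta Psi ->
    adjoint_solution p theta Psi' ->
    ae_eq_on (lebesgue_rV n.+1) Omega Psi Psi'.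

(* Discrete functions are given by polynomials on the whole space; only their
   values on the cell or face that indexes them are relevant. *)
Definition in_M (r : nat) (v : cells M -> fn) : Prop :=
  forall T, is_poly r (v T).

Record weak_fun := WeakFun { w0 : cells M -> fn; wb : faces M -> fn }.

Definition in_W (j : nat) (s : weak_fun) : Prop :=
  (forall T, is_poly j (w0 s T)) /\ (forall e, is_poly j (wb s e)).

Definition in_W0 (j : nat) (s : weak_fun) : Prop :=
  in_W j s /\
  forall e, face e `<=` Gamma_plus -> forall x, face e x -> wb s e x = 0.

Definition is_wgrad (r : nat) (s : weak_fun) (T : cells M) (G : vec -> vec) :
    Prop :=
  is_poly_vec r G /\
  forall psi, is_poly_vec r psi ->
    cell_int T (fun x => dot (G x) (psi x)) =
    - cell_int T (fun x => w0 s T x * divergence psi x) +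
    cell_bnd_int T (fun e x => wb s e x * dot (psi x) (normal T e)).

(* is_wgrad has exactly one solution on a partition as above; get picks it. *)
Definition wgrad (r : nat) (s : weak_fun) (T : cells M) : vec -> vec :=
  get (is_wgrad r s T).

Definition form_b (r : nat) (v : cells M -> fn) (s : weak_fun) : R :=
  \sum_(T : cells M)
    cell_int T (fun x => v T x *
      (dot (beta T) (wgrad r s T x) - c T * w0 s T x)).

(* |z|^(p-1) sgn z *)
Definition spow (p z : R) : R := `|z| `^ (p - 1) * Num.sg z.

Definition residual (s : weak_fun) (T : cells M) (x : vec) : R :=
  dot (beta T) (grad (w0 s T) x) - c T * w0 s T x.

Definition form_s (p rho tau : R) (l s : weak_fun) : R :=
  \sum_(T : cells M)
    (rho * meshsize T `^ (1 - p) *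
       cell_bnd_int T (fun e x =>
         spow p (w0 l T x - wb l e x) * (w0 s T x - wb s e x)) +
     tau * cell_int T (fun x =>
         spow p (residual l T x) * residual s T x)).

Definition PDWG_solution (p rho tau : R) (k j : nat) (f g : fn)
    (u : cells M -> fn) (l : weak_fun) : Prop :=
  [/\ in_M k.-1 u, in_W0 j l,
      forall s, in_W0 j s ->
        form_s p rho tau l s + form_b k.-1 u s =
        inflow_int (fun e x => wb s e x * g x) -
        \sum_(T : cells M) cell_int T (fun x => f x * w0 s T x) &
      forall v, in_M k.-1 v -> form_b k.-1 v l = 0].

Definition PDWG_uniquely_solvable (p rho tau : R) (k j : nat) (f g : fn) :
    Prop :=
  (exists u l, PDWG_solution p rho tau k j f g u l) /\
  forall u l u' l', PDWG_solution p rho tau k j f g u l ->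
    PDWG_solution p rho tau k j f g u' l' ->
    [/\ forall T x, cell T x -> u T x = u' T x,
        forall T x, cell T x -> w0 l T x = w0 l' T x &
        forall e x, face e x -> wb l e x = wb l' e x].

End transport.

(* Main.v *)
(* Let e be the difference of the multipliers of two discrete solutions.  Testing
   with e and using the strict monotonicity of z |-> |z|^(p-1) sgn z gives
   e_0 = e_b on the boundary of every cell, and beta . grad e_0 = c e_0 on every
   cell: for j = k by the second part of the stabilizer, as tau > 0, and for
   j = k - 1 because, the jumps being zero, b(v, e) is the integral of v times
   this residual, which is itself an admissible v.  The pieces of e_0 then glue
   to a function which is Lipschitz on Omega, hence in W^{1,p}, and vanishes on
   Gamma_+; it solves the homogeneous adjoint problem, so that e = 0.  The
   difference w of the two primal solutions satisfies b(w, sigma) = 0 for all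
   sigma.  Integration by parts on the cells turns this into
   beta . grad w + c w = 0 on the cells, continuity of the flux across the
   interior faces and w = 0 at the inflow; thus w solves the homogeneous
   transport problem and vanishes.

   For existence, minimize s(l, l) / p - F(l) over the l with b(., l) = 0, where
   F is the right-hand side.  The energy s(l, l) is convex and p-homogeneous;
   modulo its null space in this subspace, on which F vanishes by the argument
   above, it is coercive.  The primal variable is the Lagrange multiplier of
   the constraint, obtained by duality of row spaces in finite dimension.

   The two analytic ingredients are the divergence theorem on a cell, proved by
   Fubini in a direction transversal to its faces (a generic line meets the
   boundary in finitely many face points, where the indicator of the cell
   jumps), and the gluing, for which two points of a Lipschitz domain are joined
   by a short polygonal path avoiding the codimension-two skeleton. *)
Require Import Defs.
From HB Require Import structures.
From mathcomp Require Import all_boot all_order all_algebra.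
From mathcomp Require Import all_classical all_reals all_analysis measurable_realfun.
From mathcomp Require Import ring lra.
Set Implicit Arguments.
Unset Strict Implicit.
Unset Printing Implicit Defensive.
Import Order.TTheory GRing.Theory Num.Theory.
Import numFieldNormedType.Exports.
Local Open Scope classical_set_scope.
Local Open Scope ring_scope.

(** * Lebesgue measure on row vectors *)

Section lebesgue1.
Context {R : realType}.
Local Notation mu := (@lebesgue_measure R).

(** The trace in [in_W1p0] is a limit of functions that are C^1 on the whole space, whereas the
    glued multiplier is only Lipschitz: it must be approximated with gradients that stay bounded and
    converge almost everywhere, and with values that converge on the boundary. Bernstein polynomials
    achieve all of this at once: their derivative is a Bernstein polynomial of difference quotients,
    so it inherits the Lipschitz constant, and it converges wherever the function is C^1 nearby.
    Bounded convergence then yields the weak gradient and the trace from one sequence. Gluing is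
    delicate because cells may touch in a ridge only, where no compatibility is given. Only
    relatively open faces carry information; every exceptional set is placed inside finitely many
    hyperplanes, so that a generic line or a generic detour avoids it. In the existence proof weak
    functions are given by redundant polynomial coefficients. The null space of the energy under the
    constraint is exactly this redundancy, which is why it is split off rather than shown to be
    zero. *)

Lemma measurable_affine (s t : R) :
  measurable_fun setT ((fun u => t + s * u) : R -> R).
Proof. by apply: measurable_funD => //; apply: measurable_funM. Qed.

(** Uniqueness of Lebesgue measure reduces the claim to half-open intervals. For negative [s] the
    preimage of []a, b]] is closed at the other end, which is why the two signs are treated
    apart. *)
Lemma lebesgue_measure_affine (s t : R) (A : set R) : s != 0 -> measurable A ->
  mu A = (`|s|%:E * mu ((fun u => t + s * u)%R @^-1` A))%E.
Proof.
move=> s0 mA.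
pose phi : R -> measurableTypeR R := fun u => t + s * u.
have mphi : measurable_fun setT phi by exact: measurable_affine.
pose nu := measure_function_pushforward__canonical__measure_function_Measure
   mu mphi.
rewrite (@lebesgue_measure_unique R (mscale (NngNum (normr_ge0 s)) nu))// => _ [[a b] _] /= <-.
rewrite /mscale/= /pushforward.
have s0' : 0 < `|s| by rewrite normr_gt0.
rewrite lebesgue_measure_itv/= lte_fin.
move: s0; rewrite neq_lt => /orP[sn|sp].
- have -> : phi @^-1` `]a, b] = `[(b - t)/s, (a - t)/s[%classic.
    apply/seteqP; split => x /=; rewrite /phi !in_itv/= => /andP[ax xb].
      by rewrite ler_ndivrMr // ltr_ndivlMr //; apply/andP; split; lra.
    move: ax xb; rewrite ler_ndivrMr // ltr_ndivlMr // => ? ?.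
    by apply/andP; split; lra.
  rewrite lebesgue_measure_itv/= lte_fin ltr_ndivrMr// divfK ?lt_eqF//.
  rewrite ltrD2r; case: ifPn => ab; last by rewrite mule0.
  rewrite -!EFinD -EFinM; congr EFin; rewrite ltr0_norm//.
  by field; rewrite lt_eqF.
- have -> : phi @^-1` `]a, b] = `](a - t)/s, (b - t)/s]%classic.
    apply/seteqP; split => x /=; rewrite /phi !in_itv/= => /andP[ax xb].
      by rewrite ler_pdivlMr // ltr_pdivrMr //; apply/andP; split; lra.
    move: ax xb; rewrite ler_pdivlMr // ltr_pdivrMr // => ? ?.
    by apply/andP; split; lra.
  rewrite lebesgue_measure_itv/= lte_fin ltr_pdivrMr// divfK ?gt_eqF//.
  rewrite ltrD2r; case: ifPn => ab; last by rewrite mule0.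
  rewrite -!EFinD -EFinM; congr EFin; rewrite gtr0_norm//.
  by field; rewrite gt_eqF.
Qed.

Lemma ge0_integral_affine (s t : R) (f : R -> \bar R) : s != 0 ->
  measurable_fun setT f -> (forall x, 0 <= f x)%E ->
  (\int[mu]_x f x = `|s|%:E * \int[mu]_x f (t + s * x)%R)%E.
Proof.
move=> s0 mf f0.
pose phi : R -> measurableTypeR R := fun u => t + s * u.
have mphi : measurable_fun setT phi by exact: measurable_affine.
pose nu := measure_function_pushforward__canonical__measure_function_Measure
   mu mphi.
have -> : (\int[mu]_x f (t + s * x)%R = \int[nu]_x f x)%E.
  rewrite /nu /= ge0_integral_pushforward//.
pose k : {nonneg R} := NngNum (normr_ge0 s).
have -> : (`|s|%:E * \int[nu]_x f x = \int[mscale k nu]_x f x)%E.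
  by rewrite ge0_integral_mscale.
apply: eq_measure_integral => A mA _ /=.
by rewrite /mscale/= -lebesgue_measure_affine.
Qed.
End lebesgue1.

Section tonelli_rV.
Context {R : realType}.
Local Notation mu := (@lebesgue_measure R).

Lemma measurable_rV_cons2 n (s : R) :
  measurable_fun setT (fun y : 'rV[R]_n => rV_cons (s, y)).
Proof.
exact: (measurableT_comp (measurable_rV_cons (n:=n)) (pair1_measurable s)).
Qed.

Lemma measurable_rV_cons1 n (y : 'rV[R]_n) :
  measurable_fun setT (fun s : R => rV_cons (s, y)).
Proof.
exact: (measurableT_comp (measurable_rV_cons (n:=n)) (pair2_measurable y)).
Qed.

Section ge0.
Variables (n : nat) (f : 'rV[R]_n.+1 -> \bar R).
Hypothesis mf : measurable_fun setT f.
Hypothesis f0 : forall x, (0 <= f x)%E.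

Lemma ge0_integral_rV_prod :
  (\int[lebesgue_rV n.+1]_x f x =
   \int[(mu \x lebesgue_rV n)]_z f (rV_cons z))%E.
Proof.
rewrite /= ge0_integral_pushforward//; exact: measurable_rV_cons.
Qed.

Let mfc : measurable_fun setT (f \o @rV_cons R n).
Proof. apply: measurableT_comp => //; exact: measurable_rV_cons. Qed.

Let f0' z : (0 <= (f \o @rV_cons R n) z)%E. Proof. exact: f0. Qed.

(* The conversions below hide that [mu] lives on [measurableTypeR R], whose
   display is not the one of [R]. *)
Lemma tonelli_rV1 : (\int[lebesgue_rV n.+1]_x f x =
  \int[mu]_s \int[lebesgue_rV n]_y f (rV_cons (s, y)))%E.
Proof.
rewrite ge0_integral_rV_prod.
refine (@fubini_tonelli1 _ _ _ _ R mu (lebesgue_rV n) _ mfc f0').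
Qed.

Lemma tonelli_rV2 : (\int[lebesgue_rV n.+1]_x f x =
  \int[lebesgue_rV n]_y \int[mu]_s f (rV_cons (s, y)))%E.
Proof.
rewrite tonelli_rV1.
refine (@fubini_tonelli _ _ _ _ R mu (lebesgue_rV n) _ mfc f0').
Qed.

Lemma measurable_tonelli_rV2 :
  measurable_fun setT (fun y => \int[mu]_s f (rV_cons (s, y)))%E.
Proof.
refine (@measurable_fun_fubini_tonelli_G _ _ _ _ R mu _ mfc f0').
Qed.

End ge0.

Lemma measurable_rV_affine m n (o : 'rV[R]_n) (S : 'M[R]_(m, n)) :
  measurable_fun setT (fun z : 'rV[R]_m => o + z *m S).
Proof.
apply: measurable_fun_rV => i.
under eq_fun do rewrite !mxE.
apply: measurable_funD => //; apply: measurable_sum => j.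
by apply: measurable_funM => //; exact: measurable_rV_coord.
Qed.

Lemma rV_consD n (s t : R) (x y : 'rV[R]_n) :
  rV_cons (s, x) + rV_cons (t, y) = rV_cons (s + t, x + y).
Proof.
apply/rowP => i; case: (unliftP ord0 i) => [j|] ->.
  by rewrite mxE !rV_consES mxE.
by rewrite mxE !rV_consE0.
Qed.

(** Induction on the dimension: the one-dimensional formula with slope [1] shifts the first
    coordinate, the induction hypothesis shifts the others. *)
Lemma ge0_integral_rV_translate n (o : 'rV[R]_n) (f : 'rV[R]_n -> \bar R) :
  measurable_fun setT f -> (forall x, 0 <= f x)%E ->
  (\int[lebesgue_rV n]_x f x = \int[lebesgue_rV n]_x f (o + x)%R)%E.
Proof.
elim: n o f => [|n IH] o f mf f0.
  by apply: eq_integral => x _; rewrite thinmx0 [in RHS]thinmx0.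
have mo m (o' : 'rV[R]_m) : measurable_fun setT (fun x : 'rV[R]_m => o' + x).
  under eq_fun do rewrite -[X in o' + X]mulmx1.
  exact: measurable_rV_affine.
have mfo : measurable_fun setT (fun x => f (o + x)).
  exact: (measurableT_comp mf (mo _ o)).
rewrite tonelli_rV2// [RHS]tonelli_rV2//; set o2 := (rV_uncons o).2.
rewrite (IH o2); last 2 first.
- exact: measurable_tonelli_rV2.
- by move=> x; apply: integral_ge0.
apply: eq_integral => y _.
rewrite (@ge0_integral_affine _ 1 (rV_uncons o).1) ?oner_eq0//; last first.
  by apply: measurableT_comp => //; exact: measurable_rV_cons1.
rewrite normr1 mul1e; apply: eq_integral => s _.
rewrite mul1r -rV_consD; congr (f (_ + _)).
by rewrite -[RHS]rV_unconsK; case: (rV_uncons o) @o2.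
Qed.

End tonelli_rV.

(** No finiteness is required: a positive factor also respects the value given to a difference of
    infinities. The change of variables for signed functions can thus be stated without
    integrability. *)
Lemma gt0_muleBr (R : realType) (d : R) (x y : \bar R) : 0 < d ->
  (d%:E * (x - y) = d%:E * x - d%:E * y)%E.
Proof.
move=> d0; case: x => [x| |]; case: y => [y| |] /=;
  rewrite ?gt0_muley ?gt0_muleNy ?lte_fin//=
    ?gt0_muley ?gt0_muleNy ?lte_fin//.
exact: (congr1 EFin (mulrBr _ _ _)).
Qed.

(** * Linear changes of variables *)

Section linear_change.
Context {R : realType}.
Local Notation mu := (@lebesgue_measure R).

(** The change of variables formula as a property of the matrix, so that it can be carried through a
    factorisation. *)
Definition det_scaling n (S : 'M[R]_n) :=
  forall f : 'rV[R]_n -> \bar R, measurable_fun setT f ->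
  (forall x, 0 <= f x)%E ->
  (\int[lebesgue_rV n]_x f x =
   `|\det S|%:E * \int[lebesgue_rV n]_x f (x *m S))%E.

Lemma measurable_mulmx m n (S : 'M[R]_(m, n)) :
  measurable_fun setT (fun z : 'rV[R]_m => z *m S).
Proof.
have -> : (fun z : 'rV[R]_m => z *m S) = (fun z => 0 + z *m S).
  by apply/funext => z; rewrite add0r.
exact: measurable_rV_affine.
Qed.

Lemma det_scalingM n (S T : 'M[R]_n) :
  det_scaling S -> det_scaling T -> det_scaling (S *m T).
Proof.
move=> hS hT f mf f0; rewrite hT// hS//; last first.
  exact: (measurableT_comp mf (measurable_mulmx T)).
rewrite muleA -EFinM det_mulmx normrM [(`|\det T| * _)%R]mulrC.
by under eq_integral do rewrite -mulmxA.
Qed.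

(** For a fixed first coordinate the shear is a translation of the others. The order of integration
    is chosen accordingly, and it is reversed for [det_scaling_shear_col]. *)
Lemma det_scaling_shear_row n (r : 'rV[R]_n) :
  @det_scaling (1 + n) (block_mx 1%:M r 0 1%:M).
Proof.
move=> f mf f0; rewrite det_ublock !det1 mulr1 normr1 mul1e.
have mfS : measurable_fun setT
    (fun x : 'rV[R]_(1 + n) => f (x *m block_mx 1%:M r 0 1%:M)).
  exact: (measurableT_comp mf (measurable_mulmx _)).
rewrite (tonelli_rV1 mf)// [RHS](tonelli_rV1 mfS)//.
apply: eq_integral => s _.
rewrite (@ge0_integral_rV_translate _ _ (s *: r))//; last first.
  by apply: measurableT_comp => //; exact: measurable_rV_cons2.
apply: eq_integral => y _; congr f.
rewrite /rV_cons/= [RHS](_ : _ = @row_mx _ 1 1 n s%:M y *m block_mx 1%:M r 0 1%:M)//.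
by rewrite mul_row_block !mulmx0 !mulmx1 addr0 mul_scalar_mx.
Qed.

Lemma det_scaling_shear_col n (c : 'cV[R]_n) :
  @det_scaling (1 + n) (block_mx 1%:M 0 c 1%:M).
Proof.
move=> f mf f0; rewrite det_lblock !det1 mulr1 normr1 mul1e.
have mfS : measurable_fun setT
    (fun x : 'rV[R]_(1 + n) => f (x *m block_mx 1%:M 0 c 1%:M)).
  exact: (measurableT_comp mf (measurable_mulmx _)).
rewrite (tonelli_rV2 mf)// [RHS](tonelli_rV2 mfS)//.
apply: eq_integral => y _.
rewrite (@ge0_integral_affine _ 1 ((y *m c) ord0 ord0)) ?oner_eq0//; last first.
  by apply: measurableT_comp => //; exact: measurable_rV_cons1.
rewrite normr1 mul1e; apply: eq_integral => s _; congr f.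
rewrite /rV_cons/= [RHS](_ : _ = @row_mx _ 1 1 n s%:M y *m block_mx 1%:M 0 c 1%:M)//.
rewrite mul_row_block !mulmx0 !mulmx1 add0r mul1r addrC raddfD/=.
by rewrite -mx11_scalar.
Qed.

Lemma det_scaling_diag n (a : R) (S : 'M[R]_n) : a != 0 ->
  det_scaling S -> @det_scaling (1 + n) (block_mx a%:M 0 0 S).
Proof.
move=> a0 hS f mf f0; rewrite det_lblock det_scalar1 normrM EFinM -muleA.
have mfS : measurable_fun setT
    (fun x : 'rV[R]_(1 + n) => f (x *m block_mx a%:M 0 0 S)).
  exact: (measurableT_comp mf (measurable_mulmx _)).
rewrite (tonelli_rV2 mf)// [in RHS](tonelli_rV2 mfS)//.
rewrite hS; last 2 first.
- exact: measurable_tonelli_rV2.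
- by move=> x; apply: integral_ge0.
rewrite muleCA; congr (_ * _)%E.
rewrite -ge0_integralZl//; last 2 first.
- exact: (measurable_tonelli_rV2 mfS (fun x => f0 _)).
- by move=> x _; apply: integral_ge0.
apply: eq_integral => y _.
rewrite (@ge0_integral_affine _ a 0)//; last first.
  by apply: measurableT_comp => //; exact: measurable_rV_cons1.
congr (_ * _)%E; apply: eq_integral => s _; congr f.
rewrite /rV_cons/= [RHS](_ : _ = @row_mx _ 1 1 n s%:M y *m block_mx a%:M 0 0 S)//.
by rewrite mul_row_block !mulmx0 addr0 !add0r -scalar_mxM mulrC.
Qed.

(** Induction on the size through the factorisation into a lower shear, a block diagonal matrix and
    an upper shear, with pivot [S ord0 ord0] and the Schur complement [S'] as the remaining
    block. *)
Lemma det_scaling_unit n (S : 'M[R]_n) : S \in unitmx -> det_scaling S.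
Proof.
elim: n S => [|n IH] S uS.
  move=> f mf f0; rewrite det_mx00 normr1 mul1e.
  by apply: eq_integral => x _; congr f; rewrite [LHS]thinmx0 [RHS]thinmx0.
(* If the pivot vanishes, some other entry of the first row does not, the determinant being nonzero.
   Multiplication by the shear [E] adds that column to the first one; [E'] undoes it. *)
wlog S00 : S uS / S ord0 ord0 != 0.
  move=> hw.
  have [S00|] := eqVneq (S ord0 ord0) 0; last exact: hw.
  have [j Sj] : exists j : 'I_n, S ord0 (lift ord0 j) != 0.
    apply: contrapT => /forallNP nS; move: uS; rewrite unitmxE.
    rewrite (expand_det_row _ ord0) big_ord_recl S00 mul0r add0r big1 ?unitr0//.
    by move=> j _; have /negP := nS j; rewrite negbK => /eqP ->; rewrite mul0r.
  pose c : 'cV[R]_n := delta_mx j 0.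
  pose E : 'M[R]_(1 + n) := block_mx 1%:M 0 c 1%:M.
  pose E' : 'M[R]_(1 + n) := block_mx 1%:M 0 (- c) 1%:M.
  have EE' : E *m E' = 1%:M.
    rewrite mulmx_block !(mulmx1, mul1mx, mulmx0, mul0mx, addr0, add0r) subrr.
    by rewrite -scalar_mx_block.
  have uE : E \in unitmx by rewrite unitmxE det_lblock !det1 mulr1 unitr1.
  rewrite -[S]mulmx1 -EE' mulmxA; apply: det_scalingM; last first.
    exact: det_scaling_shear_col.
  apply: hw; first by rewrite unitmx_mul uS.
  have Ei i : (E : 'M[R]_n.+1) (lift ord0 i) ord0 = (i == j)%:R.
    transitivity (E (rshift 1 i) (lshift n 0)).
      by congr (E _ _); apply: val_inj.
    by rewrite /E block_mxEdl mxE andbT.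
  rewrite mxE big_ord_recl S00 mul0r add0r (bigD1 j)//= big1 => [|i ij].
    by rewrite Ei eqxx mulr1 addr0.
  by rewrite Ei (negbTE ij) mulr0.
pose S1 : 'M[R]_(1 + n) := S.
set a := S ord0 ord0 in S00.
pose r := a^-1 *: ursubmx S1; pose c := a^-1 *: dlsubmx S1.
pose S' := drsubmx S1 - a *: (c *m r).
have Sul : ulsubmx S1 = a%:M.
  rewrite [LHS]mx11_scalar; congr (_ %:M); rewrite !mxE.
  by congr (S _ _); apply: val_inj.
have ES : S1 = block_mx 1%:M 0 c 1%:M *m block_mx a%:M 0 0 S' *m
    block_mx 1%:M r 0 1%:M.
  rewrite !mulmx_block !(mulmx1, mul1mx, mulmx0, mul0mx, addr0, add0r).
  rewrite -{1}[S1]submxK Sul; congr block_mx.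
  - by rewrite mul_scalar_mx scalerA divff// scale1r.
  - by rewrite mul_mx_scalar scalerA divff// scale1r.
  - by rewrite mul_mx_scalar -scalemxAl addrC subrK.
have uS' : S' \in unitmx.
  move: uS; rewrite -[S]/S1 ES !unitmx_mul => /andP[/andP[_ uB] _].
  have : \det (@block_mx _ 1 n 1 n a%:M 0 0 S') \is a GRing.unit.
    by rewrite -unitmxE.
  by rewrite det_lblock unitrM -[X in _ && X]unitmxE => /andP[].
rewrite -[S]/S1 ES; apply: det_scalingM; last exact: det_scaling_shear_row.
apply: det_scalingM; first exact: det_scaling_shear_col.
by apply: det_scaling_diag => //; exact: IH.
Qed.

Lemma ge0_integral_rV_affine n (o : 'rV[R]_n) (S : 'M[R]_n)
    (f : 'rV[R]_n -> \bar R) : S \in unitmx ->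
  measurable_fun setT f -> (forall x, 0 <= f x)%E ->
  (\int[lebesgue_rV n]_x f x =
   `|\det S|%:E * \int[lebesgue_rV n]_x f (o + x *m S)%R)%E.
Proof.
move=> uS mf f0; rewrite (@ge0_integral_rV_translate _ _ o)//.
rewrite (det_scaling_unit uS)//.
apply: (measurableT_comp mf).
have -> : +%R o = (fun z : 'rV[R]_n => o + z *m 1%:M).
  by apply/funext => z; rewrite mulmx1.
exact: measurable_rV_affine.
Qed.

Lemma integral_rV_affine n (o : 'rV[R]_n) (S : 'M[R]_n)
    (f : 'rV[R]_n -> \bar R) : S \in unitmx ->
  measurable_fun setT f ->
  (\int[lebesgue_rV n]_x f x =
   `|\det S|%:E * \int[lebesgue_rV n]_x f (o + x *m S)%R)%E.
Proof.
move=> uS mf; rewrite [LHS]integralE.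
rewrite (@ge0_integral_rV_affine _ o S f^\+%E)//; last exact: measurable_funepos.
rewrite (@ge0_integral_rV_affine _ o S f^\-%E)//; last exact: measurable_funeneg.
have dS : 0 < `|\det S| by rewrite normr_gt0 -unitfE -unitmxE.
rewrite -gt0_muleBr//; congr (_ * _)%E; rewrite [RHS]integralE.
congr (_ - _)%E; apply: eq_integral => x _.
  by rewrite (funepos_comp f (fun z => o + z *m S)).
by rewrite (funeneg_comp f (fun z => o + z *m S)).
Qed.

End linear_change.

Lemma continuous_sumr (R : realType) (T : topologicalType) (I : Type)
    (r : seq I) (P : pred I) (F : I -> T -> R) :
  (forall i, P i -> continuous (F i)) ->
  continuous (fun x => \sum_(i <- r | P i) F i x).
Proof. by apply: continuous_big; exact: add_continuous. Qed.

Lemma continuousDr (R : realType) (T : topologicalType) (f g : T -> R) :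
  continuous f -> continuous g -> continuous (fun x => f x + g x).
Proof. by move=> cf cg x; apply: cvgD; [exact: cf|exact: cg]. Qed.

Lemma continuousMr (R : realType) (T : topologicalType) (f g : T -> R) :
  continuous f -> continuous g -> continuous (fun x => f x * g x).
Proof. by move=> cf cg x; apply: cvgM; [exact: cf|exact: cg]. Qed.

Section rV_norm.
Context {R : realType}.

Lemma rV_norm_ltP n (x : 'rV[R]_n) (e : R) : 0 < e ->
  (`|x| < e) <-> (forall i, `|x ord0 i| < e).
Proof.
move=> e0; rewrite [`|x|]mx_normrE; split.
  by move=> /bigmax_ltP[_ h] i; exact: (h (ord0, i)).
by move=> h; apply/bigmax_ltP; split => // -[i j] _ /=; rewrite ord1.
Qed.

Lemma rV_norm_leP n (x : 'rV[R]_n) (e : R) : 0 <= e ->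
  (`|x| <= e) <-> (forall i, `|x ord0 i| <= e).
Proof.
move=> e0; rewrite [`|x|]mx_normrE; split.
  by move=> /bigmax_leP[_ h] i; exact: (h (ord0, i)).
by move=> h; apply/bigmax_leP; split => // -[i j] _ /=; rewrite ord1.
Qed.

Lemma rV_norm_coord n (x : 'rV[R]_n) i : `|x ord0 i| <= `|x|.
Proof. by move: i; apply/rV_norm_leP. Qed.

Lemma rV_norm_delta n (i : 'I_n) : `|delta_mx ord0 i : 'rV[R]_n| <= 1.
Proof.
apply/rV_norm_leP => // j; rewrite mxE eqxx/=.
by case: (j == i); rewrite ?normr1 ?normr0.
Qed.

Lemma nbhs_rV_normP n (x : 'rV[R]_n) (A : set 'rV[R]_n) :
  nbhs x A <-> exists2 e : R, 0 < e & forall y, `|y - x| < e -> A y.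
Proof.
rewrite -nbhs_ballE; split => -[e e0 h]; exists e => // y.
  by move=> yx; apply: h; rewrite -ball_normE /ball_/= distrC.
by rewrite -ball_normE /ball_/= distrC; exact: h.
Qed.

Lemma bounded_rVP n (A : set 'rV[R]_n) : bounded_set A <->
  exists2 M : R, 0 < M & forall x, A x -> `|x| < M.
Proof.
split=> [[M [Mr h]]|[M M0 h]].
  exists (`|M| + 2) => [|x Ax]; first by rewrite ltr_wpDl.
  apply: le_lt_trans (h (`|M| + 1) _ x Ax) _; last lra.
  by rewrite (le_lt_trans (ler_norm M))// ltrDl.
exists M; split; first exact: num_real.
by move=> N MN x /h xM; exact: ltW (lt_trans xM MN).
Qed.
End rV_norm.

(** * Open sets, continuous functions and Lebesgue measure *)

Section measure_rV.
Context {R : realType}.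
Local Notation mu := (@lebesgue_measure R).

Lemma measurable_cube n (q : 'rV[R]_n) (e : R) :
  measurable [set x : 'rV[R]_n | forall i, `|x ord0 i - q ord0 i| < e].
Proof.
rewrite (_ : [set x | _] = \bigcap_i
    ((fun x : 'rV[R]_n => x ord0 i - q ord0 i) @^-1` (ball 0 e))); last first.
  apply/seteqP; split => x /= Ax i => [_|]; rewrite /ball/= ?sub0r ?normrN//.
  by have := Ax i Logic.I; rewrite /ball/= sub0r normrN.
apply: fin_bigcap_measurable.
  have -> : [set: 'I_n] = [set` predT] by apply/seteqP; split.
  exact: finite_finpred.
move=> i _; rewrite -[X in measurable X]setTI.
apply: (measurable_funB (measurable_rV_coord i) (measurable_cst _)) => //.
exact: measurable_ball.
Qed.

(** The sigma-algebra is the one generated by the coordinates, so an open set has to be exhibited as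
    a countable union of cubes, here with rational centres and radii [1 / (k + 1)]. *)
Lemma open_measurable_rV n (A : set 'rV[R]_n) : open A -> measurable A.
Proof.
move=> oA.
pose B (qk : 'rV[rat]_n * nat) := [set x : 'rV[R]_n |
  forall i, `|x ord0 i - (map_mx ratr qk.1 : 'rV[R]_n) ord0 i| < qk.2.+1%:R^-1].
pose C qk := if `[< B qk `<=` A >] then B qk else set0.
have -> : A = \bigcup_qk C qk.
  apply/seteqP; split => [x Ax|x [qk _]]; last first.
    by rewrite /C; case: asboolP => // BA; exact: BA.
  have /nbhs_rV_normP[e e0 xe] : nbhs x A by exact: open_nbhs_nbhs.
  have [k ke] : exists k, k.+1%:R^-1 < e / 2.
    have [k _ /(_ k (leqnn k)) /= hk] := near_infty_natSinv_lt (PosNum (divr_gt0 e0 (ltr0Sn R 1))).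
    by exists k.
  have qP i : exists q : rat, `|x ord0 i - ratr q| < k.+1%:R^-1.
    have [q] : exists q : rat, ratr q \in `](x ord0 i - k.+1%:R^-1),
       (x ord0 i + k.+1%:R^-1)[.
      by apply: rat_in_itvoo; rewrite ltrD2l gtrN.
    rewrite in_itv/= => /andP[h1 h2]; exists q; rewrite ltr_norml.
    by rewrite ltrBrDl addrC -ltrBrDl opprK h2 ltrBlDl addrC -ltrBlDl h1.
  have [q hq] := choice qP.
  exists (\row_i q i, k) => //; rewrite /C; case: asboolP => /= [_|nBA].
    by move=> i; rewrite !mxE.
  exfalso; apply: nBA => y By; apply: xe; apply/rV_norm_ltP => // i.
  rewrite !mxE; have := By i; rewrite !mxE /= => By_i.
  rewrite (splitr e) -(subrKA (ratr (q i))); apply: le_lt_trans (ler_normD _ _) _.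
  apply: ltrD; first exact: lt_trans By_i ke.
  by rewrite distrC; exact: lt_trans (hq i) ke.
apply: countable_bigcupT_measurable => [|qk]; first exact: countableP.
rewrite /C.
by case: asboolP => // _; exact: measurable_cube.
Qed.

Lemma closed_measurable_rV n (A : set 'rV[R]_n) : closed A -> measurable A.
Proof. by move/closed_openC/open_measurable_rV/measurableC; rewrite setCK. Qed.

Lemma continuous_measurable_rV n (f : 'rV[R]_n -> R) (D : set 'rV[R]_n) :
  continuous f -> measurable D -> measurable_fun D f.
Proof.
move=> /continuousP cf mD; apply: (measurable_funS measurableT) => //.
apply: (measurability _ (RGenOpens.measurableE R)).
move=> _ [_ [a [b ->] <-]]; rewrite setTI.
by apply: open_measurable_rV; apply: cf; apply: interval_open.
Qed.

Lemma lebesgue_rV_cube n (q : 'rV[R]_n) (e : R) : 0 < e ->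
  lebesgue_rV n [set x : 'rV[R]_n | forall i, `|x ord0 i - q ord0 i| < e] =
  ((e *+ 2) ^+ n)%:E.
Proof.
move=> e0; transitivity (\prod_(i < n) mu (ball (q ord0 i) e))%E.
  rewrite -(@lebesgue_rV_box R n (fun i => ball (q ord0 i) e)); last first.
    by move=> i; exact: measurable_ball.
  congr (lebesgue_rV n _); apply/seteqP.
  by split => x /= + i => /(_ i); rewrite /ball/= distrC.
under eq_bigr do rewrite lebesgue_measure_ball ?(ltW e0)//.
by rewrite prodEFin prodr_const card_ord.
Qed.

Lemma lebesgue_rV_open_gt0 n (A : set 'rV[R]_n) : open A -> A !=set0 ->
  (0 < lebesgue_rV n A)%E.
Proof.
move=> oA [x Ax]; have /nbhs_rV_normP[e e0 xe] : nbhs x A by exact: open_nbhs_nbhs.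
apply: (@lt_le_trans _ _ ((e *+ 2) ^+ n)%:E); first by rewrite lte_fin exprn_gt0// pmulrn_lgt0.
rewrite -(lebesgue_rV_cube x e0); apply: le_measure.
- by rewrite inE; exact: measurable_cube.
- by rewrite inE; exact: open_measurable_rV.
- move=> y /= yx; apply: xe; apply/rV_norm_ltP => // i; rewrite !mxE; exact: yx.
Qed.

Lemma lebesgue_rV_bounded_lty n (A : set 'rV[R]_n) : measurable A ->
  bounded_set A -> (lebesgue_rV n A < +oo)%E.
Proof.
move=> mA /bounded_rVP[M M0 AM].
apply: (@le_lt_trans _ _ ((M *+ 2) ^+ n)%:E); last exact: ltry.
rewrite -(lebesgue_rV_cube 0 M0); apply: le_measure.
- by rewrite inE.
- by rewrite inE; exact: measurable_cube.
- by move=> x /AM /(rV_norm_ltP x M0) xM i; rewrite mxE subr0.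
Qed.

Lemma continuous_bounded_rV n (f : 'rV[R]_n -> R) (A : set 'rV[R]_n) :
  continuous f -> bounded_set A ->
  exists2 K, 0 < K & forall x, A x -> `|f x| <= K.
Proof.
move=> cf /bounded_rVP[M M0 AM].
have Kc : compact [set v : 'rV[R]_n | forall i, v ord0 i \in `[(- M), M]].
  by apply: (@rV_compact _ _ (fun=> `[(- M), M]%classic)) => _; exact: segment_compact.
set K := [set v | _] in Kc.
have K0 : K !=set0.
  by exists 0 => i /=; rewrite mxE in_itv/= oppr_le0 ltW.
have cn : {within K, continuous (fun x => `|f x|)}.
  apply: continuous_subspaceT => x.
  by apply: continuous_comp; [exact: cf|exact: norm_continuous].
have [c _ cM] := EVT_max_rV K0 Kc cn.
exists (`|f c| + 1) => [|x Ax]; first by rewrite ltr_wpDl.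
rewrite (le_trans (cM x _)) ?lerDl// inE /= => i.
by rewrite in_itv/= -ler_norml (le_trans (rV_norm_coord _ _))// ltW// AM.
Qed.

Lemma continuous_integrable_rV n (f : 'rV[R]_n -> R) (A : set 'rV[R]_n) :
  continuous f -> measurable A -> bounded_set A ->
  (lebesgue_rV n).-integrable A (EFin \o f).
Proof.
move=> cf mA bA; apply: measurable_bounded_integrable => //.
- exact: lebesgue_rV_bounded_lty.
- exact: continuous_measurable_rV.
- have [K K0 hK] := continuous_bounded_rV cf bA.
  exists K; split; first exact: num_real.
  by move=> N KN x /hK fK; exact: le_trans fK (ltW KN).
Qed.

Lemma continuous_ae_eq_rV n (f g : 'rV[R]_n -> R) (A : set 'rV[R]_n) :
  continuous f -> continuous g -> open A -> ae_eq_on (lebesgue_rV n) A f g ->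
  forall x, A x -> f x = g x.
Proof.
move=> cf cg oA [N [mN N0 AN]] x Ax; apply: contrapT => fg.
pose B := A `&` [set y | f y - g y != 0].
have oB : open B.
  apply: openI => //.
  have : continuous (f \- g) by move=> y; apply: continuousB; [exact: cf|exact: cg].
  move=> /continuousP /(_ [set~ 0]).
  rewrite (_ : _ @^-1` _ = [set y | f y - g y != 0]).
    by apply; apply: closed_openC; exact: closed_eq.
  by apply/seteqP; split => y /= /eqP.
have : (0 < lebesgue_rV n B)%E.
  by apply: lebesgue_rV_open_gt0 => //; exists x; split => //=; rewrite subr_eq0; apply/eqP.
rewrite ltNge => /negP; apply; rewrite -N0; apply: le_measure.
- by rewrite inE; exact: open_measurable_rV.
- by rewrite inE.
- move=> y [Ay /= fgy]; apply: AN => /=; apply: contra_not (elimN eqP fgy).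
  by move=> /(_ Ay) ->; rewrite subrr.
Qed.

Lemma ge0_continuous_Rintegral_eq0 n (f : 'rV[R]_n -> R) (A : set 'rV[R]_n) :
  continuous f -> open A -> bounded_set A -> (forall x, A x -> 0 <= f x) ->
  \int[lebesgue_rV n]_(x in A) f x = 0 -> forall x, A x -> f x = 0.
Proof.
move=> cf oA bA f0 If; apply: (continuous_ae_eq_rV cf (g := cst 0)) => //.
  by move=> x; exact: cst_continuous.
have mA := open_measurable_rV oA.
have intf := continuous_integrable_rV cf mA bA.
have : (\int[lebesgue_rV n]_(x in A) `|(EFin \o f) x| = 0)%E.
  have -> : (\int[lebesgue_rV n]_(x in A) `|(EFin \o f) x| =
      \int[lebesgue_rV n]_(x in A) (f x)%:E)%E.
    by apply: eq_integral => x /[!inE] Ax /=; rewrite ger0_norm ?f0.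
  rewrite -[LHS]fineK; last exact: integrable_fin_num.
  by rewrite [fine _]If.
move/(@ae_eq_integral_abs _ _ _ _ _ mA _ (measurable_int _ intf)).
apply: filterS => x /= h Ax; have := h Ax; by case.
Qed.

End measure_rV.

(** * Finite unions of hyperplanes are negligible *)

Section hyperplane.
Context {R : realType}.
Local Notation mu := (@lebesgue_measure R).

Definition hyperplane n (l : 'rV[R]_n) (a : R) : set 'rV[R]_n :=
  [set x | dot l x = a].

Lemma dot_continuous n (l : 'rV[R]_n) : continuous (dot l).
Proof.
rewrite /dot; apply: continuous_sumr => i _ x.
exact: (continuousM (@cst_continuous _ _ _ x) (@coord_continuous _ _ _ _ _ x)).
Qed.

Lemma closed_hyperplane n (l : 'rV[R]_n) a : closed (hyperplane l a).
Proof.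
rewrite (_ : hyperplane l a = dot l @^-1` [set a])//.
apply: closed_comp; last exact: closed_eq.
by move=> x _; exact: dot_continuous.
Qed.

Lemma measurable_hyperplane n (l : 'rV[R]_n) a : measurable (hyperplane l a).
Proof. by apply: closed_measurable_rV; exact: closed_hyperplane. Qed.

(** If the first coefficient of [l] is zero, the slices at a fixed first coordinate are hyperplanes
    of one dimension less; otherwise each line along the first axis meets the hyperplane in a single
    point. *)
Lemma lebesgue_hyperplane n (l : 'rV[R]_n) a : l != 0 ->
  lebesgue_rV n (hyperplane l a) = 0.
Proof.
elim: n l a => [|n IH] l a l0; first by move: l0; rewrite thinmx0 eqxx.
have mH := measurable_hyperplane l a.
have mI : measurable_fun setT (fun x => (\1_(hyperplane l a) x)%:E : \bar R).
  by apply/measurable_EFinP; exact: measurable_indic.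
have I0 x : (0 <= (\1_(hyperplane l a) x)%:E :> \bar R)%E by rewrite lee_fin.
rewrite -(setIT (hyperplane l a)) -integral_indic//.
pose l' : 'rV[R]_n := \row_i l ord0 (lift ord0 i).
have dl s y : dot l (rV_cons (s, y)) = l ord0 ord0 * s + dot l' y.
  rewrite /dot big_ord_recl rV_consE0; congr (_ + _).
  by apply: eq_bigr => i _; rewrite rV_consES mxE.
have [l00|l00] := eqVneq (l ord0 ord0) 0.
  rewrite (tonelli_rV1 mI)//; apply: integral0_eq => s _.
  have -> : (\int[lebesgue_rV n]_y (\1_(hyperplane l a) (rV_cons (s, y)))%:E =
     \int[lebesgue_rV n]_y (\1_(hyperplane l' a) y)%:E)%E.
    apply: eq_integral => y _; congr (_%:E); rewrite !indicE.
    by congr (nat_of_bool _)%:R; apply/idP/idP; rewrite !inE /hyperplane/= dl l00 mul0r add0r.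
  rewrite integral_indic ?setIT//; last exact: measurable_hyperplane.
  apply: IH; apply: contraNneq l0 => l'0; apply/eqP/rowP => i; rewrite mxE.
  by case: (unliftP ord0 i) => [j|] ->//; move/rowP: l'0 => /(_ j); rewrite !mxE.
rewrite (tonelli_rV2 mI)//; apply: integral0_eq => y _.
have -> : (\int[mu]_s (\1_(hyperplane l a) (rV_cons (s, y)))%:E =
   \int[mu]_s (\1_([set (a - dot l' y) / l ord0 ord0]) s)%:E)%E.
  apply: eq_integral => s _; congr (_%:E); rewrite !indicE.
  congr (nat_of_bool _)%:R; apply/idP/idP; rewrite !inE /hyperplane/= dl.
    by move=> <-; rewrite addrK mulrC mulKf.
  by move=> ->; rewrite mulrC divfK// subrK.
rewrite integral_indic ?setIT//.
exact: lebesgue_measure_set1.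
Qed.

(** Exceptional sets are enclosed in such finite unions, kept as lists of a normal and an offset:
    they are closed, and when all normals are nonzero they are null and have a dense complement. *)
Definition hyperplanes n (s : seq ('rV[R]_n * R)) : set 'rV[R]_n :=
  [set x | exists2 la, la \in s & hyperplane la.1 la.2 x].

Definition proper_hyperplanes n (s : seq ('rV[R]_n * R)) :=
  forall la, la \in s -> la.1 != 0.

Lemma hyperplanes_bigsetU n (s : seq ('rV[R]_n * R)) :
  hyperplanes s = \big[setU/set0]_(la <- s) hyperplane la.1 la.2.
Proof.
by rewrite -bigcup_seq; apply/seteqP; split => x [la ? ?]; exists la.
Qed.

Lemma closed_hyperplanes n (s : seq ('rV[R]_n * R)) : closed (hyperplanes s).
Proof.
rewrite hyperplanes_bigsetU; apply: closed_bigsetU => la _.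
exact: closed_hyperplane.
Qed.

Lemma negligible_hyperplanes n (s : seq ('rV[R]_n * R)) :
  proper_hyperplanes s -> (lebesgue_rV n).-negligible (hyperplanes s).
Proof.
move=> ps; exists (hyperplanes s); split => //.
  by apply: closed_measurable_rV; exact: closed_hyperplanes.
rewrite hyperplanes_bigsetU.
elim: s ps => [|la s IH] ps; first by rewrite big_nil measure0.
rewrite big_cons; apply: null_set_setU.
- exact: measurable_hyperplane.
- by apply: bigsetU_measurable => ? _; exact: measurable_hyperplane.
- by apply: lebesgue_hyperplane; apply: ps; rewrite mem_head.
- by apply: IH => ma hma; apply: ps; rewrite in_cons hma orbT.
Qed.

Lemma proper_hyperplanes_dense n (s : seq ('rV[R]_n * R)) (x : 'rV[R]_n) (e : R) :
  proper_hyperplanes s -> 0 < e ->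
  exists y, `|y - x| < e /\ ~ hyperplanes s y.
Proof.
move=> ps e0; apply: contrapT => /forallNP h.
have [N [mN N0 sN]] := negligible_hyperplanes ps.
have oB : open [set y : 'rV[R]_n | `|y - x| < e].
  rewrite (_ : [set y | _] = ball x e); first exact: ball_open.
  by apply/seteqP; split => y /=; rewrite -ball_normE /ball_/= distrC.
set B := [set y | _] in oB.
have : (0 < lebesgue_rV n B)%E.
  by apply: lebesgue_rV_open_gt0 => //; exists x; rewrite /B/= subrr normr0.
rewrite ltNge => /negP; apply; rewrite -N0; apply: le_measure.
- by rewrite inE; exact: open_measurable_rV.
- by rewrite inE.
- by move=> y yx; apply: sN; apply: contrapT => nsy; exact: (h y).
Qed.
End hyperplane.

(** * Continuously differentiable functions and polynomials *)

Section C1.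
Context {R : realType} {n : nat}.
Local Notation vec := 'rV[R]_n.
Implicit Types (f g : vec -> R).

Definition C1 f := Ck 1 f.

Lemma C1_differentiable f x : C1 f -> differentiable f x.
Proof. by case=> + _; exact. Qed.

Lemma C1_derivable f x v : C1 f -> derivable f x v.
Proof. by move=> f1; apply: diff_derivable; exact: C1_differentiable. Qed.

Lemma C1_continuous f : C1 f -> continuous f.
Proof. by move=> f1 x; apply: differentiable_continuous; exact: C1_differentiable. Qed.

Lemma C1_pderiv f i : C1 f -> continuous (pderiv i f).
Proof. by case=> _; exact. Qed.

Lemma pderivD f g i : C1 f -> C1 g ->
  pderiv i (fun x => f x + g x) = fun x => pderiv i f x + pderiv i g x.
Proof.
move=> f1 g1; apply/funext => x; rewrite /pderiv.
rewrite (_ : (fun x => f x + g x) = f + g)// deriveD//; exact: C1_derivable.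
Qed.

Lemma pderivM f g i : C1 f -> C1 g ->
  pderiv i (fun x => f x * g x) =
  fun x => f x * pderiv i g x + g x * pderiv i f x.
Proof.
move=> f1 g1; apply/funext => x; rewrite /pderiv.
rewrite (_ : (fun x => f x * g x) = f * g)// deriveM//; exact: C1_derivable.
Qed.

Lemma pderiv_cst i (a : R) : pderiv i (fun _ : vec => a) = fun=> 0.
Proof. by apply/funext => x; rewrite /pderiv derive_cst. Qed.

Lemma C1_cst (a : R) : C1 (fun _ => a).
Proof.
split=> [x|i]; first exact: differentiable_cst.
by rewrite pderiv_cst => x; exact: cst_continuous.
Qed.

Lemma C1D f g : C1 f -> C1 g -> C1 (fun x => f x + g x).
Proof.
move=> f1 g1; split=> [x|i].
  by apply: differentiableD; exact: C1_differentiable.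
by rewrite pderivD// => x; apply: continuousD; exact: C1_pderiv.
Qed.

Lemma C1M f g : C1 f -> C1 g -> C1 (fun x => f x * g x).
Proof.
move=> f1 g1; split=> [x|i].
  by apply: differentiableM; exact: C1_differentiable.
rewrite pderivM//; apply: continuousDr; apply: continuousMr;
  solve [exact: C1_pderiv|exact: C1_continuous].
Qed.

Lemma C1Z (a : R) f : C1 f -> C1 (fun x => a * f x).
Proof. by move=> f1; apply: C1M => //; exact: C1_cst. Qed.

Lemma pderivZ (a : R) f i : C1 f ->
  pderiv i (fun x => a * f x) = fun x => a * pderiv i f x.
Proof.
move=> f1; rewrite pderivM//; last exact: C1_cst.
by rewrite pderiv_cst; apply/funext => x; rewrite mulr0 addr0.
Qed.

Lemma C1B f g : C1 f -> C1 g -> C1 (fun x => f x - g x).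
Proof.
move=> f1 g1; have -> : (fun x => f x - g x) = fun x => f x + -1 * g x.
  by apply/funext => x; rewrite mulN1r.
by apply: C1D => //; exact: C1Z.
Qed.

Lemma pderivB f g i : C1 f -> C1 g ->
  pderiv i (fun x => f x - g x) = fun x => pderiv i f x - pderiv i g x.
Proof.
move=> f1 g1; have -> : (fun x => f x - g x) = fun x => f x + -1 * g x.
  by apply/funext => x; rewrite mulN1r.
rewrite pderivD ?pderivZ//; last exact: C1Z.
by apply/funext => x; rewrite mulN1r.
Qed.

Lemma C1_sum I (r : seq I) (P : pred I) (F : I -> vec -> R) :
  (forall i, P i -> C1 (F i)) -> C1 (fun x => \sum_(i <- r | P i) F i x).
Proof.
move=> F1; elim: r => [|i r IH].
  by under eq_fun do rewrite big_nil; exact: C1_cst.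
under eq_fun do rewrite big_cons.
by case Pi : (P i) => //; apply: C1D => //; exact: F1.
Qed.

Lemma C1_prod I (r : seq I) (P : pred I) (F : I -> vec -> R) :
  (forall i, P i -> C1 (F i)) -> C1 (fun x => \prod_(i <- r | P i) F i x).
Proof.
move=> F1; elim: r => [|i r IH].
  by under eq_fun do rewrite big_nil; exact: C1_cst.
under eq_fun do rewrite big_cons.
by case Pi : (P i) => //; apply: C1M => //; exact: F1.
Qed.

Lemma pderiv_sum I (r : seq I) (P : pred I) (F : I -> vec -> R) j :
  (forall i, P i -> C1 (F i)) ->
  pderiv j (fun x => \sum_(i <- r | P i) F i x) =
  fun x => \sum_(i <- r | P i) pderiv j (F i) x.
Proof.
move=> F1; elim: r => [|i r IH].
  under eq_fun do rewrite big_nil; rewrite pderiv_cst.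
  by apply/funext => x; rewrite big_nil.
under eq_fun do rewrite big_cons.
under [RHS]eq_fun do rewrite big_cons.
case Pi : (P i) => //; rewrite pderivD ?IH//; first exact: F1.
exact: C1_sum.
Qed.

Lemma C1X f k : C1 f -> C1 (fun x => f x ^+ k).
Proof.
move=> f1; elim: k => [|k IH].
  by under eq_fun do rewrite expr0; exact: C1_cst.
by under eq_fun do rewrite exprS; exact: C1M.
Qed.

Lemma pderiv_coord i j (x : vec) :
  pderiv i (fun x : vec => x ord0 j) x = (i == j)%:R.
Proof.
rewrite /pderiv /derive.
have -> : (fun h : R => h^-1 *: (((fun x0 : vec => x0 ord0 j) \o shift x)
   (h *: delta_mx ord0 i) - x ord0 j)) =
   fun h : R => h^-1 * (h * (i == j)%:R).
  by apply/funext => h /=; rewrite !mxE eqxx/= addrK eq_sym.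
apply: cvg_lim => //; apply: cvg_near_cst.
by near=> h; rewrite mulKf//; near: h; exact: nbhs_dnbhs_neq.
Unshelve. all: by end_near. Qed.

Lemma C1_coord j : C1 (fun x : vec => x ord0 j).
Proof.
split=> [x|i]; first exact: differentiable_coord.
have -> : pderiv i (fun x : vec => x ord0 j) = fun=> (i == j)%:R.
  by apply/funext => x; exact: pderiv_coord.
by move=> x; exact: cst_continuous.
Qed.

Lemma derive_grad f x v : C1 f -> 'D_v f x = dot v (grad f x).
Proof.
move=> f1; have df := C1_differentiable x f1.
rewrite deriveE// {1}[v]row_sum_delta linear_sum/=.
apply: eq_bigr => i _; rewrite linearZ/= mxE /pderiv deriveE//.
Qed.

Lemma is_derive_line f x v (s : R) : C1 f ->
  is_derive s 1 (fun s => f (x + s *: v)) ('D_v f (x + s *: v)).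
Proof.
move=> f1.
have E : (fun h : R => h^-1 *: (((fun s => f (x + s *: v)) \o shift s) (h *: 1)
     - f (x + s *: v))) =
   (fun h : R => h^-1 *: ((f \o shift (x + s *: v)) (h *: v) - f (x + s *: v))).
  apply/funext => h /=; congr (_ *: (f _ - _)).
  by rewrite [h *: 1]mulr1 scalerDl addrCA.
apply: DeriveDef; first by rewrite /derivable E; exact: C1_derivable.
by rewrite /derive E.
Qed.

Lemma line_continuous (x v : vec) : continuous (fun s : R => x + s *: v).
Proof.
move=> s; apply: cvgD; first exact: cvg_cst.
by apply: cvgZr_tmp; exact: cvg_id.
Qed.

Lemma C1_lipschitz f (M : R) : C1 f -> exists2 L, 0 < L &
  forall x y, `|x| < M -> `|y| < M -> `|f x - f y| <= L * `|x - y|.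
Proof.
move=> f1.
have bB : bounded_set [set x : vec | `|x| < M].
  apply/bounded_rVP; exists (`|M| + 1); first by rewrite ltr_wpDl.
  move=> x /= /lt_le_trans; apply.
  by rewrite (le_trans (ler_norm M))// lerDl.
have hK i : exists K : R, 0 < K /\ forall x : vec, `|x| < M -> `|pderiv i f x| <= K.
  by have [K K0 hK] := continuous_bounded_rV (C1_pderiv (i := i) f1) bB; exists K.
have [K HK] := choice hK.
exists (1 + \sum_i K i).
  by rewrite ltr_wpDr// sumr_ge0// => i _; apply: ltW; have [] := HK i.
move=> x y xM yM.
pose h (s : R) : R := f (y + s *: (x - y)).
have dh (s : R) : is_derive s (1 : R) h ('D_(x - y) f (y + s *: (x - y))).
  exact: is_derive_line.
have ch : continuous h.
  by move=> s; apply: differentiable_continuous; apply/derivable1_diffP; exact: ex_derive.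
have [s s01] := @MVT_segment R h (fun s => 'D_(x - y) f (y + s *: (x - y))) 0 1
  ler01 (fun s _ => dh s) (continuous_subspaceT ch).
have -> : h 1 = f x by rewrite /h scale1r addrC subrK.
have -> : h 0 = f y by rewrite /h scale0r addr0.
rewrite subr0 mulr1 => ->.
rewrite derive_grad// /dot; apply: le_trans (ler_norm_sum _ _ _) _.
rewrite mulrDl mul1r mulr_suml; apply: ler_wpDl => //.
apply: ler_sum => i _; rewrite normrM mulrC mxE ler_pM//; last exact: rV_norm_coord.
apply: (HK i).2; move: s01; rewrite in_itv/= => /andP[s0 s1].
have -> : y + s *: (x - y) = (1 - s) *: y + s *: x.
  by rewrite scalerBr scalerBl scale1r addrA addrAC.
apply: le_lt_trans (ler_normD _ _) _; rewrite !normrZ.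
rewrite (ger0_norm s0) ger0_norm ?subr_ge0//.
have [->|sn0] := eqVneq s 0; first by rewrite subr0 mul1r mul0r addr0.
have : s * `|x| < s * M by rewrite ltr_pM2l// lt_neqAle eq_sym sn0.
have : (1 - s) * `|y| <= (1 - s) * M by rewrite ler_wpM2l ?subr_ge0// ltW.
lra.
Qed.

Lemma Ck_C1 f : (forall m, Ck m f) -> C1 f. Proof. exact. Qed.

End C1.

Section polynomials.
Context {R : realType} {n : nat}.
Local Notation vec := 'rV[R]_n.
Implicit Types (f g : vec -> R).

Definition multi_index r := {ffun 'I_n -> 'I_r.+1}.

Definition monomial r (al : multi_index r) (x : vec) : R :=
  \prod_i x ord0 i ^+ al i.

Definition poly_of r (a : multi_index r -> R) (x : vec) : R :=
  \sum_(al : multi_index r | (\sum_i al i <= r)%N) a al * monomial al x.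

Lemma is_polyP r f : is_poly r f <-> exists a, f = @poly_of r a.
Proof.
split=> -[a fa]; exists a; last by rewrite fa.
by apply/funext => x; rewrite fa.
Qed.

Lemma is_polyD r f g : is_poly r f -> is_poly r g ->
  is_poly r (fun x => f x + g x).
Proof.
move=> [a fa] [b gb]; exists (fun al => a al + b al) => x.
by rewrite fa gb -big_split; apply: eq_bigr => al _; rewrite mulrDl.
Qed.

Lemma is_polyZ r (c : R) f : is_poly r f -> is_poly r (fun x => c * f x).
Proof.
move=> [a fa]; exists (fun al => c * a al) => x.
by rewrite fa mulr_sumr; apply: eq_bigr => al _; rewrite mulrA.
Qed.

Lemma is_poly0 r : is_poly r (fun _ : vec => 0).
Proof. by exists (fun=> 0) => x; rewrite big1// => al _; rewrite mul0r. Qed.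

Lemma is_poly_sum r I (s : seq I) (P : pred I) (F : I -> vec -> R) :
  (forall i, P i -> is_poly r (F i)) ->
  is_poly r (fun x => \sum_(i <- s | P i) F i x).
Proof.
move=> hF; elim: s => [|i s IH].
  by under eq_fun do rewrite big_nil; exact: is_poly0.
under eq_fun do rewrite big_cons.
by case Pi : (P i) => //; apply: is_polyD => //; exact: hF.
Qed.

Lemma is_poly_monomial r (al : multi_index r) :
  (\sum_i al i <= r)%N -> is_poly r (monomial al).
Proof.
move=> alr; exists (fun be => (be == al)%:R) => x.
rewrite (bigD1 al alr)/= eqxx mul1r.
rewrite [X in _ = _ + X]big1 ?addr0// => be.
by case/andP => _ /negbTE ->; rewrite mul0r.
Qed.

Lemma C1_monomial r (al : multi_index r) : C1 (monomial al).
Proof. by apply: C1_prod => i _; apply: C1X; exact: C1_coord. Qed.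

Lemma is_poly_C1 r f : is_poly r f -> C1 f.
Proof.
move=> /is_polyP[a ->]; apply: C1_sum => al _; apply: C1Z.
exact: C1_monomial.
Qed.

Lemma pderivX f i k : C1 f ->
  pderiv i (fun x => f x ^+ k.+1) = fun x => k.+1%:R * f x ^+ k * pderiv i f x.
Proof.
move=> f1; elim: k => [|k IH].
  rewrite (_ : (fun x => f x ^+ 1) = f); last by apply/funext => x; rewrite expr1.
  by apply/funext => x; rewrite expr0 !mul1r.
rewrite (_ : (fun x => f x ^+ k.+2) = fun x => f x * f x ^+ k.+1); last first.
  by apply/funext => x; rewrite exprS.
rewrite pderivM//; last exact: C1X.
rewrite IH; apply/funext => x; rewrite [k.+2%:R]mulrS !exprS; ring.
Qed.

Lemma is_poly_pderiv r f i : is_poly r f -> is_poly r (pderiv i f).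
Proof.
move=> /is_polyP[a ->]; rewrite /poly_of pderiv_sum; last first.
  by move=> al _; apply: C1Z; exact: C1_monomial.
apply: is_poly_sum => al alr; rewrite pderivZ; last exact: C1_monomial.
apply: is_polyZ.
have E : monomial al = fun x => x ord0 i ^+ al i * \prod_(j | j != i) x ord0 j ^+ al j.
  by apply/funext => x; rewrite /monomial (bigD1 i).
have rest s : pderiv i (fun x : vec => \prod_(j <- s | j != i) x ord0 j ^+ al j) = fun=> 0.
  elim: s => [|j s IH].
    by under eq_fun do rewrite big_nil; exact: pderiv_cst.
  under eq_fun do rewrite big_cons; case ji : (j != i) => //.
  rewrite pderivM; last 2 first.
  - by apply: C1X; exact: C1_coord.
  - by apply: C1_prod => l _; apply: C1X; exact: C1_coord.
  rewrite IH; apply/funext => x; rewrite mulr0 add0r.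
  case: (nat_of_ord (al j)) => [|k].
    by under [X in pderiv i X]eq_fun do rewrite expr0; rewrite pderiv_cst mulr0.
  rewrite pderivX; last exact: C1_coord.
  by rewrite pderiv_coord eq_sym (negbTE ji) !mulr0.
have rest0 := rest (index_enum 'I_n).
have c1 : C1 (fun x : vec => \prod_(j | j != i) x ord0 j ^+ al j).
  by apply: C1_prod => l _; apply: C1X; exact: C1_coord.
case ali : (nat_of_ord (al i)) => [|k].
  rewrite E ali (_ : (fun x => _) = fun x : vec => \prod_(j | j != i) x ord0 j ^+ al j).
    by rewrite rest0; exact: is_poly0.
  by apply/funext => x; rewrite expr0 mul1r.
have kr : (k < r.+1)%N by rewrite -ltnS -ali ltnS ltnW.
pose be : multi_index r := [ffun j => if j == i then Ordinal kr else al j].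
have -> : pderiv i (monomial al) = fun x => k.+1%:R * monomial be x.
  rewrite E ali pderivM//; last by apply: C1X; exact: C1_coord.
  rewrite rest0 pderivX; last exact: C1_coord.
  apply/funext => x; rewrite pderiv_coord eqxx/=.
  have -> : monomial be x = x ord0 i ^+ k * \prod_(j | j != i) x ord0 j ^+ al j.
    rewrite /monomial (bigD1 i)//= ffunE eqxx; congr (_ * _).
    by apply: eq_bigr => j /negbTE ji; rewrite ffunE ji.
  ring.
apply/is_polyZ/is_poly_monomial; apply: leq_trans alr.
apply: leq_sum => j _; rewrite ffunE; case: eqP => [->|//] /=.
by rewrite ali.
Qed.

End polynomials.

(** * The divergence theorem on a cell *)

Section jumps.
Context {R : realType}.
Local Notation mu := (@lebesgue_measure R).

(** The points with a punctured neighbourhood on which [D] vanishes form an open set. So does the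
    complement, because [D] is constant on some punctured neighbourhood of every point; the line
    being connected, one of the two is empty. Punctured neighbourhoods ignore the value of [D] at a
    jump. *)
Lemma locally_zero (D : R -> R) (x1 : R) :
  (forall x0, exists c, exists2 d : R, 0 < d &
     forall x, 0 < `|x - x0| < d -> D x = c) ->
  (exists2 d : R, 0 < d & forall x, 0 < `|x - x1| < d -> D x = 0) ->
  forall x0, exists2 d : R, 0 < d & forall x, 0 < `|x - x0| < d -> D x = 0.
Proof.
move=> hD D1.
pose A := [set x0 | exists2 d : R, 0 < d & forall x, 0 < `|x - x0| < d -> D x = 0].
pose B := [set x0 | exists2 d : R, 0 < d &
   forall x, 0 < `|x - x0| < d -> D x != 0].
have key (Q : set R) : open [set x0 | exists2 d : R, 0 < d &
   forall x, 0 < `|x - x0| < d -> Q (D x)].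
  rewrite openE => x0 [d d0 hd].
  rewrite /interior; apply/nbhs_ballP; exists d => //= y.
  rewrite /ball/= => yd; have [->|yx0] := eqVneq y x0; first by exists d.
  have y0 : 0 < `|y - x0| by rewrite normr_gt0 subr_eq0.
  exists (Num.min `|y - x0| (d - `|x0 - y|)).
    by rewrite lt_min y0 subr_gt0.
  move=> x /andP[xy]; rewrite lt_min => /andP[xy1 xy2]; apply: hd.
  apply/andP; split.
    rewrite normr_gt0 subr_eq0; apply: contraTneq xy1 => ->.
    by rewrite distrC ltxx.
  rewrite -(subrKA y); apply: le_lt_trans (ler_normD _ _) _.
  by rewrite (distrC y) -ltrBrDr.
have AB : ~` A = B.
  apply/seteqP; split => x0.
    have [c [d d0 hd]] := hD x0.
    have [c0|c0] := eqVneq c 0; first by case; exists d => // x /hd ->.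
    by move=> _; exists d => // x /hd ->.
  move=> [d d0 hd] [d' d0' hd'].
  pose m := Num.min d d' / 2.
  have m0 : 0 < m by rewrite divr_gt0// lt_min d0.
  have md : m < Num.min d d' by rewrite ltr_pdivrMr// ltr_pMr ?lt_min ?d0// ltr1n.
  have E : `|x0 + m - x0| = m by rewrite addrAC subrr add0r gtr0_norm.
  move: md; rewrite lt_min => /andP[m1 m2].
  have hm : 0 < `|x0 + m - x0| < d by rewrite E m0.
  by have := hd _ hm; rewrite hd' ?eqxx// E m0.
have /(_ A) : connected [set: R] by apply/connected_intervalP.
move=> hc; have AT : A = setT; last first.
  by move=> x0; have : [set: R] x0 by []; rewrite -AT.
apply: hc; first by exists x1.
- by exists A; [exact: (key [set 0])|rewrite setTI].
- exists A; last by rewrite setTI.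
  by rewrite -[A]setCK AB; apply: open_closedC; exact: (key [set x | x != 0]).
Qed.

Variables (E : finType) (P : pred E) (s : E -> R) (eps : E -> bool).
Variable U : set R.
Hypothesis oU : open U.
Hypothesis bU : bounded_set U.
Hypothesis s_inj : {in P &, injective s}.
Hypothesis Us : forall x, closure U x -> ~ U x -> exists2 e, P e & s e = x.
(* the orientation of the boundary point [s e]: [U] lies on its left iff
   [eps e] *)
Hypothesis Ueps : forall e, P e -> \forall t \near (0 : R)^'+,
  if eps e then U (s e - t) /\ ~ U (s e + t) else U (s e + t) /\ ~ U (s e - t).

Let sg e : R := if eps e then 1 else -1.

(** The error of writing the indicator of [U] as a signed sum of half-lines ending at the boundary
    points: a right end of [U] counts positively, a left end negatively. *)
Let D (x : R) : R := \1_U x - \sum_(e | P e) sg e * (x <= s e)%R%:R.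

Lemma jump_off (x0 : R) : (forall e, P e -> s e != x0) ->
  exists2 d : R, 0 < d & forall x, `|x - x0| < d -> D x = D x0.
Proof.
move=> nx0.
have [d1 d10 hd1] : exists2 d : R, 0 < d &
    forall x, `|x - x0| < d -> (\1_U x : R) = \1_U x0.
  have [Ux0|nUx0] := pselect (U x0).
    have /nbhs_ballP[d d0 hd] : nbhs x0 U by exact: open_nbhs_nbhs.
    exists d => // x xd; rewrite !indicE !mem_set//.
    by apply: hd; rewrite /ball/= distrC.
  have ncl : ~ closure U x0.
    by move=> /Us/(_ nUx0)[e Pe se]; have := nx0 e Pe; rewrite se eqxx.
  have /nbhs_ballP[d d0 hd] : nbhs x0 (~` closure U).
    by apply: open_nbhs_nbhs; split => //; apply: closed_openC; exact: closed_closure.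
  exists d => // x xd; rewrite !indicE !memNset//.
  move=> /subset_closure; apply: hd; by rewrite /ball/= distrC.
have [d2 d20 hd2] : exists2 d : R, 0 < d &
    forall x e, `|x - x0| < d -> P e -> (x <= s e) = (x0 <= s e).
  have : \forall x \near x0, forall e, P e -> (x <= s e) = (x0 <= s e).
    apply: (@filter_forall _ _ (fun e x => P e -> (x <= s e) = (x0 <= s e))
      (nbhs x0) (nbhs_filter x0)) => e.
    have [Pe|] := boolP (P e); last by move=> _; near=> x.
    apply/nbhs_ballP; exists `|s e - x0|; first by rewrite /= normr_gt0 subr_eq0 nx0.
    move=> x; rewrite /ball/= distrC => xs _.
    have := nx0 e Pe; move: xs; rewrite neq_lt ltr_norml => /andP[h1 h2] /orP[h|h].
      move: h1 h2; rewrite ltr0_norm ?subr_lt0// => h1 h2.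
      by rewrite [RHS]leNgt h; apply/negbTE; rewrite -ltNge; lra.
    move: h1 h2; rewrite gtr0_norm ?subr_gt0// => h1 h2.
    by rewrite (ltW h); lra.
  by move=> /nbhs_ballP[d d0 hd]; exists d => // x e xd; apply: hd; rewrite /ball/= distrC.
exists (Num.min d1 d2); first by rewrite lt_min d10.
move=> x; rewrite lt_min => /andP[xd1 xd2]; rewrite /D hd1//; congr (_ - _).
by apply: eq_bigr => e Pe; rewrite (hd2 x).
Unshelve. all: by end_near. Qed.

(** At a boundary point the jump of the indicator is the one of the half-line ending there; by
    injectivity of [s] no other half-line ends at this point. *)
Lemma jump_on (e0 : E) : P e0 ->
  exists c, exists2 d : R, 0 < d & forall x, 0 < `|x - s e0| < d -> D x = c.
Proof.
move=> Pe0; set x0 := s e0.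
have [d1 d10 hd1] : exists2 d : R, 0 < d & forall t, 0 < t < d ->
  if eps e0 then U (x0 - t) /\ ~ U (x0 + t) else U (x0 + t) /\ ~ U (x0 - t).
  have := Ueps Pe0; rewrite -/x0 /at_right => /nbhs_ballP[d d0 hd].
  exists d => // t /andP[t0 td]; apply: hd => //.
  by rewrite /ball/= sub0r normrN gtr0_norm.
have [d2 d20 hd2] : exists2 d : R, 0 < d &
    forall x e, `|x - x0| < d -> P e -> e != e0 -> (x <= s e) = (x0 <= s e).
  have : \forall x \near x0, forall e, P e -> e != e0 -> (x <= s e) = (x0 <= s e).
    apply: (@filter_forall _ _
      (fun e x => P e -> e != e0 -> (x <= s e) = (x0 <= s e))
      (nbhs x0) (nbhs_filter x0)) => e.
    have [Pe|] := boolP (P e); last by move=> _; near=> x.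
    have [->|ee0] := eqVneq e e0; first by near=> x.
    have nx0 : s e != x0.
      by apply: contra ee0 => /eqP see; apply/eqP; exact: s_inj.
    apply/nbhs_ballP; exists `|s e - x0|; first by rewrite /= normr_gt0 subr_eq0.
    move=> x; rewrite /ball/= distrC => xs _ _.
    move: nx0 xs; rewrite neq_lt ltr_norml => /orP[h|h] /andP[].
      rewrite ltr0_norm ?subr_lt0// => h1 h2.
      by rewrite [RHS]leNgt h; apply/negbTE; rewrite -ltNge; lra.
    rewrite gtr0_norm ?subr_gt0// => h1 h2.
    by rewrite (ltW h); lra.
  by move=> /nbhs_ballP[d d0 hd]; exists d => // x e xd; apply: hd; rewrite /ball/= distrC.
(* Just left of [s e0] the indicator minus [sg e0] is [1 - 1] or [0 + 1]; just right of it the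
   indicator alone is [0] or [1]. In both cases this is [~~ eps e0]. *)
exists ((~~ eps e0)%:R - \sum_(e | P e && (e != e0)) sg e * (x0 <= s e)%R%:R).
exists (Num.min d1 d2); first by rewrite lt_min d10.
move=> x /andP[x0x]; rewrite lt_min => /andP[xd1 xd2].
rewrite /D (bigD1 e0)//= opprD addrA; congr (_ - _); last first.
  by apply: eq_bigr => e /andP[Pe ee0]; rewrite (hd2 x).
rewrite -/x0; move: x0x; rewrite normr_gt0 subr_eq0 neq_lt => /orP[xx0|xx0].
  move: xd1; rewrite ltr0_norm ?subr_lt0// opprB => xd1.
  have := hd1 (x0 - x); rewrite subr_gt0 xx0 xd1 => /(_ isT).
  have -> : x0 - (x0 - x) = x by rewrite opprB addrC subrK.
  rewrite (ltW xx0) mulr1 indicE /sg.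
  by case: (eps e0) => -[h1 h2]; [rewrite mem_set// subrr|rewrite memNset// add0r opprK].
move: xd1; rewrite gtr0_norm ?subr_gt0// => xd1.
have := hd1 (x - x0); rewrite subr_gt0 xx0 xd1 => /(_ isT).
have -> : x0 + (x - x0) = x by rewrite addrC subrK.
rewrite leNgt xx0 mulr0 subr0 indicE.
by case: (eps e0) => -[h1 h2]; [rewrite memNset|rewrite mem_set].
Unshelve. all: by end_near. Qed.

(** The error [D] is zero to the right of [U] and of all jumps, hence on punctured neighbourhoods of
    all points by [locally_zero]; away from the jumps it is locally constant, so it vanishes at the
    point itself. *)
Lemma indic_jumps (x : R) : (forall e, P e -> s e != x) ->
  \1_U x = \sum_(e | P e) sg e * (x <= s e)%R%:R.
Proof.
move=> nx.
have [M M0 UM] : exists2 M : R, 0 < M & forall x, U x -> `|x| < M.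
  have [M [Mr h]] := bU; exists (`|M| + 2) => [|y Uy]; first by rewrite ltr_wpDl.
  apply: le_lt_trans (h (`|M| + 1) _ y Uy) _; last lra.
  by rewrite (le_lt_trans (ler_norm M))// ltrDl.
pose N : R := M + \sum_(e | P e) `|s e| + 1.
have sN e : P e -> s e < N - 1.
  move=> Pe; rewrite /N addrK (le_lt_trans (ler_norm _))//.
  by rewrite (bigD1 e)//= addrCA ltrDl ltr_wpDr// sumr_ge0.
have DN y : N - 1 < y -> D y = 0.
  move=> Ny; rewrite /D big1 ?subr0 => [|e Pe]; last first.
    by rewrite leNgt (lt_trans (sN e Pe))// mulr0.
  rewrite indicE memNset// => /UM; rewrite ltNge => /negP; apply.
  rewrite (le_trans _ (ler_norm _))// (le_trans _ (ltW Ny))// /N addrK lerDl.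
  exact: sumr_ge0.
have [d d0 hd] : exists2 d : R, 0 < d & forall y, 0 < `|y - x| < d -> D y = 0.
  apply: (@locally_zero D N); last first.
    by exists 1 => // y /andP[_]; rewrite ltr_norml => /andP[yN _]; apply: DN; lra.
  move=> x0; have [/existsP[e /andP[Pe /eqP <-]]|nx0] :=
    boolP [exists e, P e && (s e == x0)]; first exact: jump_on.
  have [|d d0 hd] := @jump_off x0.
    by move=> e Pe; move: nx0 => /existsPn/(_ e); rewrite Pe.
  by exists (D x0); exists d => // y /andP[_ yd]; exact: hd.
have [d' d0' hd'] := jump_off nx.
pose m := Num.min d d' / 2.
have m0 : 0 < m by rewrite divr_gt0// lt_min d0.
have md : m < Num.min d d' by rewrite ltr_pdivrMr// ltr_pMr ?lt_min ?d0// ltr1n.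
have mE : `|x + m - x| = m by rewrite addrAC subrr add0r gtr0_norm.
move: md; rewrite lt_min => /andP[m1 m2].
apply/eqP; rewrite -subr_eq0; apply/eqP; rewrite -/(D x).
by rewrite -(hd' (x + m)) ?mE// hd// mE m0.
Qed.

Variables (phi dphi : R -> R).
Hypothesis phi' : forall x, is_derive (x : R) (1 : R) phi (dphi x).
Hypothesis cdphi : continuous dphi.

(** Off the finite set of jumps the integrand is a signed sum of restrictions of [dphi] to
    half-lines cut at [- N], and the fundamental theorem of calculus applies to each of them. *)
Lemma integral_jumps :
  (\int[mu]_(x in U) (dphi x)%:E = (\sum_(e | P e) sg e * phi (s e))%:E)%E.
Proof.
have [M M0 UM] : exists2 M : R, 0 < M & forall x, U x -> `|x| < M.
  have [M [Mr h]] := bU; exists (`|M| + 2) => [|y Uy]; first by rewrite ltr_wpDl.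
  apply: le_lt_trans (h (`|M| + 1) _ y Uy) _; last lra.
  by rewrite (le_lt_trans (ler_norm M))// ltrDl.
pose N : R := M + \sum_(e | P e) `|s e| + 1.
have MN : M < N by rewrite /N -addrA ltrDl ltr_wpDl// sumr_ge0.
have sN e : P e -> `|s e| < N.
  move=> Pe; rewrite /N (bigD1 e)//= (addrC M) -!addrA ltrDl ltr_wpDl//.
    exact: sumr_ge0.
  by rewrite addr_gt0.
(* To the left of [U] all half-lines are present, so the jump formula says that the signs cancel.
   This removes the contributions of [phi (- N)]. *)
have sg0 : \sum_(e | P e) sg e = 0.
  have := @indic_jumps (- N); rewrite indicE memNset; last first.
    by move=> /UM; rewrite normrN gtr0_norm ?(lt_trans M0)// ltNge (ltW MN).
  rewrite mulr0n => h0; rewrite [RHS]h0 => [|e Pe]; last first.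
    by apply: contraTneq (sN e Pe) => ->; rewrite normrN gtr0_norm ?ltxx ?(lt_trans M0).
  apply: eq_bigr => e Pe; have := sN e Pe; rewrite ltr_norml => /andP[/ltW -> _].
  by rewrite mulr1.
have mdphi (A : set R) : measurable A -> measurable_fun A (EFin \o dphi).
  move=> mA; apply/measurable_EFinP; apply: (measurable_funS measurableT) => //.
  exact: continuous_measurable_fun.
pose I0 : set R := `[(- N), N]%classic.
have mI : measurable I0 by exact: measurable_itv.
have inti (a b : R) : mu.-integrable `[a, b] (EFin \o dphi).
  by apply: continuous_compact_integrable;
    [exact: segment_compact|exact: continuous_subspaceT].
pose J e : set R := `[(- N), s e]%classic.
pose h e x : \bar R := ((sg e)%:E * ((EFin \o dphi) \_ (J e)) x)%E.
have intJ e : mu.-integrable I0 ((EFin \o dphi) \_ (J e)).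
  apply/integrable_restrict; [exact: measurable_itv..|].
  apply: (integrableS _ _ _ (inti (- N) N)); first exact: measurable_itv.
    by apply: measurableI; exact: measurable_itv.
  exact: subIsetl.
have inth e : mu.-integrable I0 (h e) by exact: integrableZl.
transitivity (\int[mu]_(x in I0) \sum_(e | P e) h e x)%E.
  rewrite integral_mkcond [RHS]integral_mkcond; apply: ae_eq_integral => //.
  - apply/measurable_restrict => //; first exact: open_measurable.
    by rewrite setTI; apply: mdphi; exact: open_measurable.
  - apply/measurable_restrict => //; rewrite setTI.
    have hs := @integrable_sum _ _ _ mu I0 mI E (index_enum E) P h
      (fun e _ => inth e).
    refine (measurable_int mu hs).
  pose F := [set s e | e in [set e | P e]].
  have cF : countable F.
    by apply: finite_set_countable; apply: finite_image; exact: finite_finset.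
  have F0 : mu F = 0 by exact: countable_lebesgue_measure0.
  exists F; split => //.
    by apply: countable_measurable => // t; exact: measurable_set1.
  move=> x /= nx; apply: contrapT => nFx; apply: nx => _.
  have nsx e : P e -> s e != x by move=> Pe; apply/eqP => sx; apply: nFx; exists e.
  have := indic_jumps nsx; rewrite indicE !patchE => UE.
  have -> : (if x \in I0 then \sum_(e | P e) h e x else 0)%E =
     (\sum_(e | P e) sg e * (x <= s e)%R%:R * dphi x)%:E.
    case: ifPn => [|]; rewrite mem_setE/= in_itv/=.
      move=> /andP[Nx xN]; rewrite -sumEFin; apply: eq_bigr => e Pe.
      rewrite /h patchE /J mem_setE in_itv/= Nx/=; case: ifPn => _ /=.
        by rewrite -EFinM mulr1.
      by rewrite mule0 mulr0 mul0r.
    rewrite negb_and -!ltNge => /orP[xN|Nx].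
      rewrite (eq_bigr (fun e => sg e * dphi x)) => [|e Pe].
        by rewrite -mulr_suml sg0 mul0r.
      have := sN e Pe; rewrite ltr_norml => /andP[/(lt_trans xN)/ltW -> _].
      by rewrite mulr1.
    rewrite big1// => e Pe; rewrite leNgt.
    by have := sN e Pe; rewrite ltr_norml => /andP[_ /lt_trans -> //]; rewrite mulr0 mul0r.
  rewrite -mulr_suml -UE; case: ifPn => _ /=; first by rewrite mul1r.
  by rewrite mul0r.
rewrite integral_sum// -sumEFin.
transitivity (\sum_(e | P e) (sg e * (phi (s e) - phi (- N)))%:E)%E; last first.
  rewrite !sumEFin; congr EFin; under eq_bigr do rewrite mulrBr.
  by rewrite big_split/= sumrN -mulr_suml sg0 mul0r subr0.
apply: eq_bigr => e Pe; rewrite /h integralZl//.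
rewrite EFinM; congr (_ * _)%E.
have := sN e Pe; rewrite ltr_norml => /andP[Ns sN'].
rewrite -integral_mkcondr (_ : _ `&` _ = `[(- N), s e]%classic); last first.
  apply/seteqP; split => x; first by case.
  rewrite /= in_itv/=.
  by move=> /andP[Nx xs]; rewrite /I0 /J /= !in_itv/= Nx xs (le_trans xs (ltW sN')).
apply: continuous_FTC2 => //.
- exact: continuous_subspaceT.
- have cphi : continuous phi.
    by move=> x; apply: differentiable_continuous; apply/derivable1_diffP; exact: ex_derive.
  split; first by move=> x _; exact: ex_derive.
  + by apply: cvg_at_right_filter; exact: cphi.
  + by apply: cvg_at_left_filter; exact: cphi.
- by move=> x _; rewrite derive1E; exact: derive_val.
Qed.

End jumps.

Section dot_products.
Context {R : realType}.

Lemma dotE n (x y : 'rV[R]_n) : dot x y = (x *m y^T) ord0 ord0.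
Proof. by rewrite mxE; apply: eq_bigr => i _; rewrite mxE. Qed.

Lemma dotC n (x y : 'rV[R]_n) : dot x y = dot y x.
Proof. by apply: eq_bigr => i _; rewrite mulrC. Qed.

Lemma dotDr n (l x y : 'rV[R]_n) : dot l (x + y) = dot l x + dot l y.
Proof. by rewrite /dot -big_split; apply: eq_bigr => i _; rewrite mxE mulrDr. Qed.

Lemma dotZr n (l x : 'rV[R]_n) (a : R) : dot l (a *: x) = a * dot l x.
Proof. by rewrite /dot mulr_sumr; apply: eq_bigr => i _; rewrite mxE mulrCA. Qed.

Lemma dotNr n (l x : 'rV[R]_n) : dot l (- x) = - dot l x.
Proof. by rewrite -scaleN1r dotZr mulN1r. Qed.

Lemma dotBr n (l x y : 'rV[R]_n) : dot l (x - y) = dot l x - dot l y.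
Proof. by rewrite dotDr dotNr. Qed.

Lemma dotDl n (l x y : 'rV[R]_n) : dot (x + y) l = dot x l + dot y l.
Proof. by rewrite dotC dotDr !(dotC l). Qed.

Lemma dotZl n (l x : 'rV[R]_n) (a : R) : dot (a *: x) l = a * dot x l.
Proof. by rewrite dotC dotZr dotC. Qed.

Lemma dotNl n (l x : 'rV[R]_n) : dot (- x) l = - dot x l.
Proof. by rewrite dotC dotNr dotC. Qed.

Lemma dot0l n (x : 'rV[R]_n) : dot 0 x = 0.
Proof. by rewrite /dot big1// => i _; rewrite mxE mul0r. Qed.

Lemma dot_mulmx m n (l : 'rV[R]_n) (x : 'rV[R]_m) (A : 'M[R]_(m, n)) :
  dot l (x *m A) = dot (l *m A^T) x.
Proof. by rewrite !dotE trmx_mul mulmxA. Qed.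

Lemma dot_suml n I (r : seq I) (P : pred I) (F : I -> 'rV[R]_n) x :
  dot (\sum_(i <- r | P i) F i) x = \sum_(i <- r | P i) dot (F i) x.
Proof.
elim/big_rec2 : _ => [|i y1 y2 _ <-]; first exact: dot0l.
by rewrite dotDl.
Qed.

Lemma norm_mulmx m n (A : 'M[R]_(m, n)) :
  exists2 K : R, 0 < K & forall x : 'rV[R]_m, `|x *m A| <= K * `|x|.
Proof.
exists (1 + \sum_j \sum_i `|A i j|).
  by rewrite ltr_wpDr// sumr_ge0// => j _; exact: sumr_ge0.
move=> x; apply/rV_norm_leP.
  by rewrite mulr_ge0// addr_ge0// sumr_ge0// => j _; exact: sumr_ge0.
move=> j; rewrite mxE; apply: le_trans (ler_norm_sum _ _ _) _.
apply: (@le_trans _ _ ((\sum_i `|A i j|) * `|x|)).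
  by rewrite mulr_suml; apply: ler_sum => i _; rewrite normrM mulrC ler_wpM2l// rV_norm_coord.
rewrite ler_wpM2r// (bigD1 j)//= addrCA lerDl addr_ge0//.
by apply: sumr_ge0 => k _; exact: sumr_ge0.
Qed.

Lemma mulmx_continuous m n (A : 'M[R]_(m, n)) :
  continuous (fun x : 'rV[R]_m => x *m A).
Proof.
have [K K0 hK] := norm_mulmx A => x B /nbhs_rV_normP[e e0 hB].
apply/nbhs_rV_normP; exists (e / K); first by rewrite divr_gt0.
move=> y xy; apply: hB; rewrite -mulmxBl; apply: le_lt_trans (hK _) _.
by rewrite mulrC -ltr_pdivlMr.
Qed.

Lemma affine_continuous m n (o : 'rV[R]_n) (A : 'M[R]_(m, n)) :
  continuous (fun x : 'rV[R]_m => o + x *m A).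
Proof.
have [K K0 hK] := norm_mulmx A => x B /nbhs_rV_normP[e e0 hB].
apply/nbhs_rV_normP; exists (e / K); first by rewrite divr_gt0.
move=> y xy; apply: hB; rewrite opprD addrACA subrr add0r -mulmxBl.
by apply: le_lt_trans (hK _) _; rewrite mulrC -ltr_pdivlMr.
Qed.

End dot_products.

(** * Boundaries of polytopes *)

Section polytopes.
Context {R : realType} {n : nat}.
Implicit Types A : set 'rV[R]_n.

(** The functions [dot (l i) x - a i] are the barycentric coordinates: the columns of the inverse
    edge matrix give all but the first one, which is one minus their sum. The second part,
    positivity at the own vertex, ensures that an equation attained at some point has a nonzero
    normal. *)
Lemma simplex_halfspaces (v : 'I_n.+1 -> 'rV[R]_n) : affinely_independent v ->
  exists (l : 'I_n.+1 -> 'rV[R]_n) (a : 'I_n.+1 -> R),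
    simplex v = [set x | forall i, a i <= dot (l i) x] /\
    forall i, a i < dot (l i) (v i).
Proof.
rewrite /affinely_independent; set D := \matrix_(i < n) _ => uD.
pose lj (j : 'I_n) : 'rV[R]_n := (col j (invmx D))^T.
pose l i := if unlift ord0 i is Some j then lj j else - \sum_j lj j.
pose a i := dot (l i) (v ord0) - (i == ord0)%:R.
have lS j : l (lift ord0 j) = lj j by rewrite /l liftK.
have l0 : l ord0 = - \sum_j lj j by rewrite /l unlift_none.
have aS j : a (lift ord0 j) = dot (lj j) (v ord0).
  by rewrite /a lS eq_sym (negbTE (neq_lift _ _)) subr0.
have a0 : a ord0 = dot (l ord0) (v ord0) - 1 by rewrite /a eqxx.
have ljE j x : dot (lj j) x = (x *m invmx D) ord0 j.
  by rewrite mxE; apply: eq_bigr => i _; rewrite !mxE mulrC.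
have rowD i : row i D = v (lift ord0 i) - v ord0 by rewrite rowK.
have vD (t : 'rV[R]_n) : t *m D = \sum_j t ord0 j *: (v (lift ord0 j) - v ord0).
  by rewrite mulmx_sum_row; apply: eq_bigr => j _; rewrite rowD.
have bary (t : 'I_n.+1 -> R) : \sum_i t i = 1 ->
   forall i, dot (l i) (\sum_i t i *: v i) - a i = t i.
  move=> t1; pose t' : 'rV[R]_n := \row_j t (lift ord0 j).
  have E : \sum_i t i *: v i = v ord0 + t' *m D.
    rewrite vD big_ord_recl; under [in RHS]eq_bigr do rewrite mxE scalerBr.
    rewrite sumrB -scaler_suml addrCA [in RHS]addrC; congr (_ + _).
    rewrite -[X in _ = X - _](scale1r (v ord0)) -scalerBl; congr (_ *: _).
    by rewrite -t1 big_ord_recl addrK.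
  have hS j : dot (lj j) (\sum_i t i *: v i) - dot (lj j) (v ord0) = t (lift ord0 j).
    by rewrite E dotDr addrAC subrr add0r ljE mulmxK// mxE.
  move=> i; case: (unliftP ord0 i) => [j|] ->; first by rewrite lS aS hS.
  have -> : t ord0 = 1 - \sum_j t (lift ord0 j).
    by rewrite -t1 big_ord_recl addrK.
  rewrite (eq_bigr (fun j => dot (lj j) (\sum_i t i *: v i) - dot (lj j) (v ord0))).
    rewrite sumrB a0 l0 !dotNl !dot_suml; ring.
  by move=> j _; rewrite hS.
exists l, a; split; last first.
  move=> i; have := bary (fun j => (j == i)%:R).
  rewrite (bigD1 i)//= eqxx big1 ?addr0 => [/(_ erefl i)|j /negbTE ->//].
  rewrite (bigD1 i)//= eqxx scale1r big1 ?addr0 => [h|j /negbTE ->].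
    by rewrite -subr_gt0 h ltr01.
  by rewrite scale0r.
apply/seteqP; split => x /=.
  move=> [t [t0 t1 ->]] i; rewrite -subr_ge0 bary//.
move=> ax; exists (fun i => dot (l i) x - a i); split.
- by move=> i; rewrite subr_ge0.
- rewrite big_ord_recl; under eq_bigr do rewrite lS aS.
  rewrite a0 l0 sumrB -!dot_suml !dotNl; ring.
pose t' := (x - v ord0) *m invmx D.
have xE : x = v ord0 + t' *m D by rewrite mulmxKV// addrC subrK.
have hS j : dot (l (lift ord0 j)) x - a (lift ord0 j) = t' ord0 j.
  by rewrite lS aS -dotBr ljE.
rewrite [LHS]xE vD big_ord_recl; under [in RHS]eq_bigr do rewrite hS.
under [in LHS]eq_bigr do rewrite scalerBr.
rewrite sumrB -scaler_suml addrCA [in RHS]addrC; congr (_ + _).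
rewrite -[X in X - _ = _](scale1r (v ord0)) -scalerBl; congr (_ *: _).
under eq_bigr do rewrite -hS lS aS.
rewrite a0 l0 sumrB -!dot_suml !dotNl; ring.
Qed.

Lemma closed_halfspaces I (l : I -> 'rV[R]_n) (a : I -> R) :
  closed [set x | forall i, a i <= dot (l i) x].
Proof.
rewrite (_ : [set x | _] = \bigcap_i (dot (l i) @^-1` [set y | a i <= y])).
  apply: closed_bigI => i _; apply: closed_comp; last exact: closed_ge.
  by move=> x _; exact: dot_continuous.
by apply/seteqP; split => x /= h i; [move=> _; exact: h|exact: h].
Qed.

Lemma simplex_bounded (v : 'I_n.+1 -> 'rV[R]_n) x :
  simplex v x -> `|x| <= \sum_i `|v i|.
Proof.
move=> [t [t0 t1 ->]]; apply: le_trans (ler_norm_sum _ _ _) _.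
apply: ler_sum => i _; rewrite normrZ ger0_norm// ler_piMl//.
by rewrite -t1 (bigD1 i)//= lerDl sumr_ge0.
Qed.

Lemma open_polytope_open A : open_polytope A -> open A.
Proof. by move=> [_ _ [N [v [_ ->]]]]; exact: open_interior. Qed.

Lemma open_polytope_bounded A : open_polytope A -> bounded_set A.
Proof.
move=> [_ _ [N [v [_ ->]]]]; apply/bounded_rVP.
exists (1 + \sum_k \sum_i `|v k i|).
  by rewrite ltr_wpDr// sumr_ge0// => k _; exact: sumr_ge0.
move=> x /interior_subset[k _ /simplex_bounded xk].
apply: le_lt_trans xk _; rewrite (bigD1 k)//= addrCA ltrDl ltr_wpDr//.
by rewrite sumr_ge0// => ? _; exact: sumr_ge0.
Qed.

(** A point of the closure lies in one of the finitely many closed simplices. If it satisfied all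
    inequalities of that simplex strictly, the simplex would be a neighbourhood of it and the point
    would be interior. *)
Lemma open_polytope_boundary A : open_polytope A ->
  exists2 s, proper_hyperplanes s &
    forall x, closure A x -> ~ A x -> hyperplanes s x.
Proof.
move=> [_ _ [N [v [av AE]]]].
have /choice[l /choice[a la]] k : exists l, exists a,
    simplex (v k) = [set x | forall i, a i <= dot (l i) x] /\
    forall i, a i < dot (l i) (v k i).
  by have [l [a h]] := simplex_halfspaces (av k); exists l, a.
pose s0 := [seq (l ki.1 ki.2, a ki.1 ki.2) | ki : 'I_N * 'I_n.+1].
(* Zero normals occur only in dimension zero. The filter discards them, and the end of the proof
   checks that the equation attained at [x] survives. *)
exists [seq la <- s0 | la.1 != 0]; first by move=> lb; rewrite mem_filter => /andP[].
move=> x; rewrite AE => clx nx.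
have cU : closed (\bigcup_k simplex (v k)).
  rewrite (_ : \bigcup_k _ = \big[setU/set0]_k simplex (v k)); last first.
    rewrite -(bigcup_seq (index_enum 'I_N)).
    by apply/seteqP; split => y [k _ ?]; exists k => //=; rewrite mem_index_enum.
  by apply: closed_bigsetU => k _; rewrite (la k).1; exact: closed_halfspaces.
have [k _ sx] : (\bigcup_k simplex (v k)) x.
  by apply: cU; apply: closure_subset clx; exact: interior_subset.
have [i lix] : exists i, dot (l k i) x = a k i.
  apply: contrapT => /forallNP nE; apply: nx.
  have : nbhs x [set y | forall i, a k i < dot (l k i) y].
    apply: (@filter_forall _ _ (fun i y => a k i < dot (l k i) y)
      (nbhs x) (nbhs_filter x)) => i.
    have : nbhs (dot (l k i) x) [set z | a k i < z].
      apply: open_nbhs_nbhs; split; first exact: open_gt.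
      rewrite /= lt_neqAle; apply/andP; split.
        by apply/eqP => ?; apply: (nE i).
      by move: sx; rewrite (la k).1; exact.
    exact: dot_continuous.
  apply: filterS => y ay; exists k => //; rewrite (la k).1 => i; exact: ltW.
exists (l k i, a k i) => //=.
rewrite mem_filter /=; apply/andP; split; last first.
  by apply/mapP; exists (k, i) => //; rewrite mem_enum.
apply: contraTneq ((la k).2 i) => l0.
by rewrite -lix l0 !dot0l ltxx.
Qed.

End polytopes.

Section fubini_rV.
Context {R : realType} {n : nat}.
Local Notation mu := (@lebesgue_measure R).

Lemma fubini_rV (f : 'rV[R]_n.+1 -> \bar R) :
  (lebesgue_rV n.+1).-integrable setT f ->
  (\int[lebesgue_rV n.+1]_x f x =
   \int[lebesgue_rV n]_y \int[mu]_s f (rV_cons (s, y)))%E.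
Proof.
move=> intf; have mf := measurable_int _ intf.
have mp : measurable_fun setT (f^\+)%E by exact: measurable_funepos.
have mn : measurable_fun setT (f^\-)%E by exact: measurable_funeneg.
have ip := integrable_funepos measurableT intf.
have im := integrable_funeneg measurableT intf.
have key (g : 'rV[R]_n.+1 -> \bar R) : measurable_fun setT g ->
    (forall x, 0 <= g x)%E -> (lebesgue_rV n.+1).-integrable setT g ->
    (lebesgue_rV n).-integrable setT
      (fun y => \int[mu]_s g (rV_cons (s, y)))%E.
  move=> mg g0 /integrableP[_ ig]; apply/integrableP; split.
    exact: measurable_tonelli_rV2.
  apply: le_lt_trans ig; rewrite le_eqVlt; apply/orP; left; apply/eqP.
  rewrite [RHS](eq_integral g) => [|x _]; last by rewrite gee0_abs.
  rewrite (tonelli_rV2 mg)//; apply: eq_integral => y _.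
  by rewrite gee0_abs// integral_ge0.
rewrite [LHS]integralE (tonelli_rV2 mp)// (tonelli_rV2 mn)//.
rewrite -integralB//; [|exact: key..].
apply: eq_integral => y _; rewrite [RHS]integralE; congr (_ - _)%E.
  by apply: eq_integral => s _; rewrite (funepos_comp f (fun s => rV_cons (s, y))).
by apply: eq_integral => s _; rewrite (funeneg_comp f (fun s => rV_cons (s, y))).
Qed.

Lemma measurable_fubini_rV (f : 'rV[R]_n.+1 -> \bar R) :
  measurable_fun setT f ->
  measurable_fun setT (fun y => \int[mu]_s f (rV_cons (s, y)))%E.
Proof.
move=> mf.
have mp : measurable_fun setT (f^\+)%E by exact: measurable_funepos.
have mn : measurable_fun setT (f^\-)%E by exact: measurable_funeneg.
have -> : (fun y => \int[mu]_s f (rV_cons (s, y)))%E =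
   (fun y => \int[mu]_s f^\+%E (rV_cons (s, y)) -
             \int[mu]_s f^\-%E (rV_cons (s, y)))%E.
  apply/funext => y; rewrite [LHS]integralE; congr (_ - _)%E.
    by apply: eq_integral => s _; rewrite (funepos_comp f (fun s => rV_cons (s, y))).
  by apply: eq_integral => s _; rewrite (funeneg_comp f (fun s => rV_cons (s, y))).
by apply: emeasurable_funB; apply: measurable_tonelli_rV2.
Qed.
End fubini_rV.

(** * Coordinates along a given direction *)

Section slanted_coordinates.
Context {R : realType} {n : nat}.
Local Notation mu := (@lebesgue_measure R).
Local Notation vec := 'rV[R]_n.+1.
Variable S : 'M[R]_(1 + n).
Hypothesis uS : S \in unitmx.

(** The rows of [S] form a basis: the first one directs the lines of integration, the others span
    the base. [pt s y] is the point with parameter [s] on the line over [y]; [sc] and [yc] are the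
    inverse coordinates. *)
Definition axis : vec := usubmx S.
Definition pt (s : R) (y : 'rV[R]_n) : vec := s *: axis + y *m dsubmx S.
Definition sc (x : vec) : R :=
  (lsubmx ((x : 'rV_(1 + n)) *m invmx S)) ord0 ord0.
Definition yc (x : vec) : 'rV[R]_n := (x : 'rV_(1 + n)) *m rsubmx (invmx S).

Lemma ptE s y : (rV_cons (s, y) : 'rV_(1 + n)) *m S = pt s y.
Proof.
rewrite /rV_cons/= [LHS](_ : _ = @row_mx _ 1 1 n s%:M y *m S)//.
by rewrite -{1}[S]vsubmxK mul_row_col mul_scalar_mx.
Qed.

Lemma ycE x : yc x = rsubmx ((x : 'rV_(1 + n)) *m invmx S).
Proof. by rewrite /yc -{2}[invmx S]hsubmxK mul_mx_row row_mxKr. Qed.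

Lemma pt_coord x : pt (sc x) (yc x) = x.
Proof.
rewrite -ptE ycE /rV_cons/=.
rewrite [LHS](_ : _ = @row_mx _ 1 1 n (sc x)%:M
  (rsubmx ((x : 'rV_(1 + n)) *m invmx S)) *m S)//.
rewrite (_ : (sc x)%:M = lsubmx ((x : 'rV_(1 + n)) *m invmx S)).
  by rewrite hsubmxK mulmxKV.
by rewrite [RHS]mx11_scalar.
Qed.

Lemma pt_inj s y : sc (pt s y) = s /\ yc (pt s y) = y.
Proof.
rewrite ycE /sc -ptE mulmxK// /rV_cons/=.
rewrite [X in lsubmx X](_ : _ = @row_mx _ 1 1 n s%:M y)//.
rewrite [X in rsubmx X](_ : _ = @row_mx _ 1 1 n s%:M y)//.
by rewrite row_mxKl row_mxKr mxE eqxx mulr1n.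
Qed.

Lemma ptDl s t y : pt (s + t) y = pt s y + t *: axis.
Proof. by rewrite /pt scalerDl addrAC. Qed.

Lemma integral_slanted (f : vec -> \bar R) :
  measurable_fun setT f ->
  (lebesgue_rV n.+1).-integrable setT (fun x => f (x *m (S : 'M[R]_(n.+1)))) ->
  (\int[lebesgue_rV n.+1]_x f x =
   `|\det S|%:E * \int[lebesgue_rV n]_y \int[mu]_s f (pt s y))%E.
Proof.
move=> mf intf; rewrite (@integral_rV_affine _ _ 0 (S : 'M[R]_(n.+1)))//.
congr (_ * _)%E.
transitivity (\int[lebesgue_rV n.+1]_x f (x *m (S : 'M[R]_(n.+1))))%E.
  by apply: eq_integral => x _; rewrite add0r.
rewrite (fubini_rV intf); apply: eq_integral => y _; apply: eq_integral => s _.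
by rewrite -ptE.
Qed.

(* Jacobian of the projection of a hyperplane along [axis] *)
Lemma det_projection (nu : vec) (B : 'M[R]_(n, n.+1)) :
  dot nu nu = 1 -> B *m nu^T = 0 -> B *m B^T = 1%:M ->
  `|\det S| * `|\det (B *m rsubmx (invmx S))| = `|dot axis nu|.
Proof.
move=> nn Bn BB.
pose nu1 : 'M[R]_(1, 1 + n) := nu; pose B1 : 'M[R]_(n, 1 + n) := B.
pose a1 : 'M[R]_(1, 1 + n) := usubmx S.
have aS : a1 *m invmx S = row_mx 1%:M 0.
  have : S *m invmx S = 1%:M by rewrite mulmxV.
  rewrite -{1}[S]vsubmxK mul_col_mx (@scalar_mx_block _ 1 n 1).
  by rewrite /block_mx => /eq_col_mx[-> _].
(* The determinant with rows [axis] and [B] is computed twice: multiplied by the inverse of [S] it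
   is block triangular with the projected frame as block, and multiplied by the transpose of the
   orthogonal matrix [Q] it has the corner [dot axis nu] and an identity block. *)
have dM : \det (col_mx a1 B1) = \det (B *m rsubmx (invmx S)) * \det S.
  rewrite -[col_mx a1 B1](mulmxKV uS) det_mulmx; congr (_ * _).
  rewrite mul_col_mx aS -[B1 *m _]hsubmxK -/(block_mx _ _ _ _) det_lblock det1 mul1r.
  by congr (\det _); rewrite -{1}[invmx S]hsubmxK mul_mx_row row_mxKr.
pose Q := col_mx nu1 B1.
have QQ : Q *m Q^T = 1%:M.
  rewrite /Q tr_col_mx mul_col_row [RHS](@scalar_mx_block _ 1 n 1).
  congr block_mx => //.
  - by rewrite [LHS]mx11_scalar; congr (_%:M); rewrite -nn dotE.
  - by apply: trmx_inj; rewrite trmx_mul trmxK Bn trmx0.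
have dQ : `|\det Q| = 1.
  have : \det Q * \det Q = 1 by rewrite -{2}det_tr -det_mulmx QQ det1.
  move/(congr1 Num.norm); rewrite normrM normr1 -expr2 => /eqP.
  by rewrite sqrp_eq1// => /eqP.
have : \det (col_mx a1 B1) * \det Q = dot axis nu.
  rewrite -[\det Q]det_tr -det_mulmx /Q tr_col_mx mul_col_row.
  rewrite (_ : B1 *m nu1^T = 0)// (_ : B1 *m B1^T = 1%:M)// det_ublock det1 mulr1.
  by rewrite [X in \det X]mx11_scalar det_scalar1 dotE.
move/(congr1 Num.norm); rewrite normrM dQ mulr1 dM normrM => <-.
by rewrite mulrC.
Qed.

End slanted_coordinates.

(** * Cells in the neighbourhood of a face *)

Section cell_geometry.
Context {R : realType} {n : nat}.
Local Notation vec := 'rV[R]_n.+1.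
Variables (Omega : set vec) (M : mesh R n).
Hypothesis meshM : polytopal_partition Omega M.
Implicit Types (T : cells M) (e : faces M).

Lemma cell_open T : open (cell T).
Proof. exact: open_polytope_open (cell_polytope meshM T). Qed.

Lemma cell_bounded T : bounded_set (cell T).
Proof. exact: open_polytope_bounded (cell_polytope meshM T). Qed.

Lemma face_ref_open e : open (face_ref e).
Proof. exact: open_polytope_open (face_polytope meshM e). Qed.

Lemma face_ref_bounded e : bounded_set (face_ref e).
Proof. exact: open_polytope_bounded (face_polytope meshM e). Qed.

Lemma cell_measurable T : measurable (cell T).
Proof. exact: open_measurable_rV (@cell_open T). Qed.

Lemma face_ref_measurable e : measurable (face_ref e).
Proof. exact: open_measurable_rV (@face_ref_open e). Qed.

Lemma boundary_cellE T : boundary (cell T) = closure (cell T) `\` cell T.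
Proof. by rewrite /boundary; have /interior_id -> := @cell_open T. Qed.

Lemma chart_continuous e : continuous (@chart R n M e).
Proof. exact: affine_continuous. Qed.

Definition unchart e (x : vec) : 'rV[R]_n := (x - face_org e) *m (face_frm e)^T.

Lemma unchart_continuous e : continuous (unchart e).
Proof.
have -> : unchart e = fun x => - (face_org e *m (face_frm e)^T) + x *m (face_frm e)^T.
  by apply/funext => x; rewrite /unchart mulmxBl addrC.
exact: affine_continuous.
Qed.

Lemma chartK e : cancel (chart e) (unchart e).
Proof.
move=> z; rewrite /unchart /chart addrAC subrr add0r -mulmxA.
by rewrite (face_isometry meshM) mulmx1.
Qed.

Lemma face_hyperplane T e x : incident T e -> face e x ->
  dot (normal T e) (x - face_org e) = 0.
Proof.
move=> Te [z _ <-]; rewrite /chart addrAC subrr add0r dotC dotE -mulmxA.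
by rewrite (normal_orth (Defs.normalP meshM Te)) mulmx0 mxE.
Qed.

Lemma closure_face_hyperplane T e x : incident T e -> closure (face e) x ->
  dot (normal T e) (x - face_org e) = 0.
Proof.
move=> Te cx.
have cl : closed [set x | dot (normal T e) (x - face_org e) = 0].
  rewrite (_ : [set x | _] = hyperplane (normal T e) (dot (normal T e) (face_org e))).
    exact: closed_hyperplane.
  apply/seteqP; split => y; rewrite /hyperplane/= dotBr; last by move=> ->; rewrite subrr.
  by move/eqP; rewrite subr_eq0 => /eqP.
by apply: cl; apply: closure_subset cx => y; exact: face_hyperplane.
Qed.

(** The closure of a face stays in its hyperplane. The normal and the rows of the frame form an
    orthonormal basis [Q], so a point of that hyperplane is recovered from its frame coordinates,
    which lie in the closure of the reference set by continuity of [unchart]. *)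
Lemma closure_face_ref e x : closure (face e) x ->
  closure (face_ref e) (unchart e x) /\ x = chart e (unchart e x).
Proof.
have [T Te] := face_incident meshM e; move=> cx; split.
  move=> V Vx; have [y [[z ez <-] Vy]] := cx _ (unchart_continuous Vx).
  by exists z; split => //; move: Vy; rewrite /= chartK.
have [nu1 Bnu _] := Defs.normalP meshM Te.
have BB := face_isometry meshM e.
have h := closure_face_hyperplane Te cx.
pose nu1' : 'M[R]_(1, 1 + n) := normal T e.
pose B1 : 'M[R]_(n, 1 + n) := face_frm e.
pose Q := col_mx nu1' B1.
have QQ : Q *m Q^T = 1%:M.
  rewrite /Q tr_col_mx mul_col_row [RHS](@scalar_mx_block _ 1 n 1).
  congr block_mx => //.
  - by rewrite [LHS]mx11_scalar; congr (_%:M); rewrite -nu1 dotE.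
  - by apply: trmx_inj; rewrite trmx_mul trmxK Bnu trmx0.
have QQ' : Q^T *m Q = 1%:M by apply: mulmx1C.
rewrite /chart /unchart -mulmxA.
have -> : (x - face_org e) *m ((face_frm e)^T *m face_frm e) = x - face_org e.
  rewrite -[RHS]mulmx1 -[1%:M]QQ' /Q tr_col_mx mul_row_col mulmxDr.
  rewrite [X in _ = X + _](_ : _ = 0) ?add0r// mulmxA.
  rewrite [X in X *m _](_ : _ = 0) ?mul0mx// [LHS]mx11_scalar -dotE dotC h.
  by rewrite raddf0.
by rewrite addrC subrK.
Qed.

(** The parameters at which the segment is in [A] form an open subset of the unit interval, and a
    closed one because the segment misses the boundary. *)
Lemma segment_in_open (A : set vec) (p q : vec) : open A -> A p ->
  (forall s : R, 0 <= s <= 1 -> ~ (closure A `\` A) (p + s *: (q - p))) -> A q.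
Proof.
move=> oA Ap h.
pose g (s : R) := p + s *: (q - p).
have cg : continuous g by exact: line_continuous.
have := @segment_connected R 0 1 (`[0, 1]%classic `&` g @^-1` A).
move=> hc; have E : `[0, 1]%classic `&` g @^-1` A = `[0, 1]%classic; last first.
  have : `[0, 1]%classic (1 : R) by rewrite /= in_itv/= ler01 lexx.
  by rewrite -E /g => -[_] /=; rewrite scale1r addrC subrK.
apply: hc.
- by exists 0; split; rewrite /= ?in_itv/= ?lexx ?ler01// /g scale0r addr0.
- by exists (g @^-1` A) => //; apply: open_comp => // s _; exact: cg.
- exists (g @^-1` closure A).
    by apply: closed_comp => [s _|]; [exact: cg|exact: closed_closure].
  apply/seteqP; split => s [s01 As]; split => //; first exact: subset_closure.
  apply: contrapT => nA; apply: (h s); first by move: s01; rewrite /= in_itv.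
  by split.
Qed.

(* [x] lies on a single closed face, hence near [x] the boundary of the cell is
   a hyperplane *)
Lemma cell_near_face T e x (a : vec) : incident T e -> face e x ->
  (forall e', incident T e' -> e' != e -> ~ closure (face e') x) ->
  0 < dot a (normal T e) ->
  \forall t \near (0 : R)^'+, cell T (x - t *: a) /\ ~ cell T (x + t *: a).
Proof.
move=> Te ex hx a0; set nu := normal T e in a0 *.
have [nu1 _ nuo] := Defs.normalP meshM Te.
have [r r0 hr] : exists2 r : R, 0 < r & forall y, `|y - x| < r ->
    forall e', incident T e' -> e' != e -> ~ closure (face e') y.
  have : \forall y \near x, forall e', incident T e' -> e' != e -> ~ closure (face e') y.
    apply: (@filter_forall _ _ (fun e' y => incident T e' -> e' != e ->
      ~ closure (face e') y) (nbhs x) (nbhs_filter x)) => e'.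
    have [Te'|] := boolP (incident T e'); last by move=> _; near=> y.
    have [->|ee'] := eqVneq e' e; first by near=> y.
    have : nbhs x (~` closure (face e')).
      by apply: open_nbhs_nbhs; split; [exact/closed_openC/closed_closure|exact: hx].
    by apply: filterS => y + _ _.
  by move=> /nbhs_rV_normP[r r0 hr]; exists r.
(* Within [r] of [x] only the closed face [e] is left, hence every boundary point of the cell lies
   on its hyperplane. *)
have nb y : `|y - x| < r -> dot nu (y - x) != 0 -> ~ (closure (cell T) `\` cell T) y.
  move=> yr yx; rewrite -boundary_cellE (face_cover meshM) => -[e' /= Te' cy].
  have [ee'|] := eqVneq e' e; last by move=> /(hr _ yr _ Te').
  rewrite ee' in Te' cy; have h1 := closure_face_hyperplane Te' cy.
  have h2 := face_hyperplane Te' ex.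
  have /eqP := yx; apply; rewrite (_ : y - x = (y - face_org e) - (x - face_org e)).
    by rewrite dotBr h1 h2 subr0.
  by rewrite opprB addrA subrK.
(* Two points near [x] strictly on one side of the hyperplane are joined by a segment that misses
   the boundary, so they are both in the cell or both outside. The sign [b] selects the side. *)
have seg (b : R) (c d : vec) : dot nu c * b > 0 -> dot nu d * b > 0 ->
   `|c| < r -> `|d| < r -> cell T (x + c) -> cell T (x + d).
  move=> cb db cr dr Tc; apply: (segment_in_open (@cell_open T) Tc) => s /andP[s0 s1].
  have -> : x + c + s *: (x + d - (x + c)) = x + ((1 - s) *: c + s *: d).
    rewrite (addrC x d) opprD addrA addrK -addrA; congr (_ + _).
    by rewrite scalerBr scalerBl scale1r addrA addrAC.
  have cs : 0 < (1 - s) * (dot nu c * b) + s * (dot nu d * b).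
    have [->|s0'] := eqVneq s 0; first by rewrite subr0 mul1r mul0r addr0.
    apply: ltr_wpDl; first by rewrite mulr_ge0 ?subr_ge0// ltW.
    by rewrite mulr_gt0// lt_neqAle eq_sym s0'.
  apply: nb; last first.
    rewrite addrAC subrr add0r dotDr !dotZr; apply: contraTneq cs => E.
    by rewrite !mulrA -mulrDl E mul0r ltxx.
  rewrite addrAC subrr add0r; apply: le_lt_trans (ler_normD _ _) _.
  rewrite !normrZ (ger0_norm s0) ger0_norm ?subr_ge0//.
  have [->|s0'] := eqVneq s 0; first by rewrite subr0 mul1r mul0r addr0.
  have : s * `|d| < s * r by rewrite ltr_pM2l// lt_neqAle eq_sym s0'.
  have : (1 - s) * `|c| <= (1 - s) * r by rewrite ler_wpM2l ?subr_ge0// ltW.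
  lra.
have small (c : vec) : \forall t \near (0 : R)^'+, `|t *: c| < r.
  near=> t; rewrite normrZ gtr0_norm//.
  rewrite (@le_lt_trans _ _ (t * (`|c| + 1)))//.
    by rewrite ler_wpM2l ?lerDl// ltW.
  rewrite -ltr_pdivlMr ?ltr_wpDl//; near: t; apply: nbhs_right_lt.
  by rewrite divr_gt0// ltr_wpDl.
(* The mesh only tells which side is inside along the normal; one such step [t0] serves as the
   reference with which the direction [a] is compared. *)
have [t0 [t00 t0r [Tt0 nTt0]]] : exists t0 : R, [/\ 0 < t0, `|t0 *: nu| < r &
    cell T (x - t0 *: nu) /\ ~ cell T (x + t0 *: nu)].
  have : \forall t \near (0 : R)^'+, [/\ 0 < t, `|t *: nu| < r &
    cell T (x - t *: nu) /\ ~ cell T (x + t *: nu)].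
    near=> t; split => //; first by near: t; exact: small.
    by near: t; exact: nuo.
  by move=> /filter_ex.
near=> t; have t_gt0 : 0 < t by [].
have tr : `|t *: a| < r by near: t; exact: small.
have da : dot nu a > 0 by rewrite dotC.
split.
  apply: (seg (-1) (- (t0 *: nu)) (- (t *: a))) => //; rewrite ?normrN//.
    by rewrite dotNr mulrNN mulr1 dotZr nu1 mulr1.
  by rewrite dotNr mulrNN mulr1 dotZr mulr_gt0.
move=> Ta; apply: nTt0; apply: (seg 1 (t *: a) (t0 *: nu)) => //.
  by rewrite mulr1 dotZr mulr_gt0.
by rewrite mulr1 dotZr nu1 mulr1.
Unshelve. all: by end_near. Qed.

End cell_geometry.

Section divergence_theorem.
Context {R : realType} {n : nat}.
Local Notation mu := (@lebesgue_measure R).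
Local Notation vec := 'rV[R]_n.+1.
Variables (Omega : set vec) (M : mesh R n).
Hypothesis meshM : polytopal_partition Omega M.
Implicit Types (T : cells M) (e : faces M).

Section direction.
Variable S : 'M[R]_(1 + n).
Hypothesis uS : S \in unitmx.
Local Notation a := (axis S).

(* [proj_frm e] and [hit e y] describe the projection of [e] along [a] and its
   inverse. *)
Definition proj_frm e : 'M[R]_n := (face_frm e : 'M[R]_(n, 1 + n)) *m rsubmx (invmx S).
Definition hit e (y : 'rV[R]_n) : 'rV[R]_n :=
  (y - yc S (face_org e)) *m invmx (proj_frm e).
Definition hit_sc e (y : 'rV[R]_n) : R := sc S (chart e (hit e y)).
Definition transversal T e := incident T e && (dot a (normal T e) != 0).

Lemma det_proj_frm T e : incident T e ->
  `|\det S| * `|\det (proj_frm e)| = `|dot a (normal T e)|.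
Proof.
move=> Te; have [nn Bn _] := Defs.normalP meshM Te.
exact: det_projection (face_isometry meshM e).
Qed.

Lemma proj_frm_unit T e : transversal T e -> proj_frm e \in unitmx.
Proof.
move=> /andP[Te a0]; rewrite unitmxE unitfE; apply: contra_neq a0 => d0.
by apply/eqP; rewrite -normr_eq0 -(det_proj_frm Te) d0 normr0 mulr0.
Qed.

Lemma yc_chart e z : yc S (chart e z) = yc S (face_org e) + z *m proj_frm e.
Proof. by rewrite /yc /chart mulmxDl mulmxA. Qed.

Lemma yc_hit T e y : transversal T e -> yc S (chart e (hit e y)) = y.
Proof.
by move=> /proj_frm_unit uP; rewrite yc_chart /hit mulmxKV// addrC subrK.
Qed.

Lemma pt_hit T e y : transversal T e -> pt S (hit_sc e y) y = chart e (hit e y).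
Proof. by move=> tT; rewrite -[RHS](pt_coord uS) (yc_hit _ tT). Qed.

Lemma hitK T e y s z : transversal T e -> pt S s y = chart e z ->
  z = hit e y /\ s = hit_sc e y.
Proof.
move=> tT E; have [s1 y1] := pt_inj uS s y.
have zE : z = hit e y.
  rewrite /hit -y1 E yc_chart addrAC subrr add0r mulmxK//.
  exact: proj_frm_unit tT.
by split => //; rewrite /hit_sc -zE -E s1.
Qed.

(** Two kinds of lines are excluded. Those meeting a face parallel to the axis lie over a hyperplane
    of the base, with normal [l]; it is nonzero, for otherwise the face normal would be orthogonal
    to every row of [S]. Those through the relative boundary of a transversal face lie over the
    facet hyperplanes of its reference set, carried over by [hit]. *)
Lemma generic_line T : exists2 s : seq ('rV[R]_n * R), proper_hyperplanes s &
  forall y, ~ hyperplanes s y -> forall e t, incident T e ->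
    closure (face e) (pt S t y) -> transversal T e /\ face e (pt S t y).
Proof.
have /choice[s hs] e : exists s : seq ('rV[R]_n * R), proper_hyperplanes s /\
  forall y, ~ hyperplanes s y -> forall t, incident T e ->
    closure (face e) (pt S t y) -> transversal T e /\ face e (pt S t y).
  have [Te|nTe] := boolP (incident T e); last by exists [::].
  have [tT|] := boolP (transversal T e); last first.
    rewrite /transversal Te/= negbK => /eqP a0.
    pose l : 'rV[R]_n := normal T e *m (dsubmx S : 'M[R]_(n, n.+1))^T.
    exists [:: (l, dot (normal T e) (face_org e))]; split.
      move=> la; rewrite inE => /eqP -> /=; apply/eqP => l0.
      have [nn _ _] := Defs.normalP meshM Te.
      have : (normal T e : 'rV_(1 + n)) *m S^T = 0.
        rewrite -[S]vsubmxK tr_col_mx mul_mx_row -[RHS]row_mx0; congr row_mx.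
          by rewrite [LHS]mx11_scalar -dotE dotC a0 raddf0.
        exact: l0.
      move/(congr1 (mulmx^~ (invmx S^T))); rewrite mulmxK ?unitmx_tr// mul0mx => n0.
      by move: nn; rewrite n0 dot0l => /esym/eqP; rewrite oner_eq0.
    move=> y ny t _ cy; exfalso; apply: ny.
    exists (l, dot (normal T e) (face_org e)); first exact: mem_head.
    have := closure_face_hyperplane meshM Te cy.
    rewrite dotBr /pt dotDr dotZr (dotC _ a) a0 mulr0 add0r dot_mulmx => /eqP.
    by rewrite subr_eq0 => /eqP.
  have [s ps hs] := open_polytope_boundary (face_polytope meshM e).
  have uP := proj_frm_unit tT.
  pose A := (invmx (proj_frm e))^T.
  pose f (lb : 'rV[R]_n * R) := (lb.1 *m A, lb.2 + dot (lb.1 *m A) (yc S (face_org e))).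
  exists [seq f lb | lb <- s]; split.
    move=> _ /mapP[lb lbs ->] /=; apply/eqP => l0; have /eqP := ps _ lbs; apply.
    by rewrite -[LHS](@mulmxK _ _ _ A) ?l0 ?mul0mx// unitmx_tr unitmx_inv.
  move=> y ny t _ cy; split=> //.
  have [clr E] := closure_face_ref meshM cy.
  have [zE _] := hitK tT E.
  apply: contrapT => nf; apply: ny.
  have nr : ~ face_ref e (unchart e (pt S t y)).
    by move=> h; apply: nf; exists (unchart e (pt S t y)).
  have [lb lbs hlb] := hs _ clr nr.
  exists (f lb); first exact: map_f.
  move: hlb; rewrite /hyperplane/= zE /hit dot_mulmx -/A dotBr => <-.
  by rewrite subrK.
exists (flatten [seq s e | e <- enum (faces M)]).
  by move=> lb /flatten_mapP[e _]; exact: (hs e).1.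
move=> y ny e t Te; apply: (hs e).2 => // -[lb lbs ylb].
by apply: ny; exists lb => //; apply/flatten_mapP; exists e; rewrite ?mem_enum.
Qed.

Definition sgR (x : R) : R := if 0 < x then 1 else -1.

Variables (T : cells M) (F : vec -> R).
Hypothesis F1 : C1 F.

Let hits y e := transversal T e && (hit e y \in face_ref e).

(** The one-dimensional jump formula for the trace of the cell on a generic line. Its boundary
    points are hits of distinct transversal faces, and the sign of [dot a (normal T e)] tells on
    which side of the hit the cell lies. *)
Lemma integral_line (y : 'rV[R]_n) :
  (forall e t, incident T e ->
    closure (face e) (pt S t y) -> transversal T e /\ face e (pt S t y)) ->
  (\int[mu]_(s in [set s : R | cell T (pt S s y)]) ('D_a F (pt S s y))%:E =
   (\sum_(e | hits y e) sgR (dot a (normal T e)) * F (chart e (hit e y)))%:E)%E.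
Proof.
move=> gen; set U := [set s | _].
have cpt : continuous (fun s => pt S s y).
  have -> : (fun s => pt S s y) = (fun s : R => y *m dsubmx S + s *: a).
    by apply/funext => s; rewrite /pt addrC.
  exact: line_continuous.
have fE e : hits y e -> face e (pt S (hit_sc e y) y).
  move=> /andP[tT]; rewrite inE => zr; rewrite (pt_hit _ tT).
  by exists (hit e y).
have -> : \sum_(e | hits y e) sgR (dot a (normal T e)) * F (chart e (hit e y)) =
   \sum_(e | hits y e) (if 0 < dot a (normal T e) then 1 else -1) *
     F (pt S (hit_sc e y) y).
  by apply: eq_bigr => e /andP[tT _]; rewrite (pt_hit _ tT).
apply: (@integral_jumps R (faces M) (hits y) (hit_sc^~ y)
  (fun e => 0 < dot a (normal T e)) U _ _ _ _ _ (fun s => F (pt S s y))).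
- apply: open_comp => [s _|]; first exact: cpt.
  exact: (@cell_open _ _ _ _ meshM).
- have /bounded_rVP[K K0 TK] := @cell_bounded _ _ _ _ meshM T.
  have [C C0 hC] := norm_mulmx (lsubmx (invmx S)).
  exists (C * K); split; first exact: num_real.
  move=> N KN s Us /=; apply: le_trans (ltW KN).
  rewrite -(pt_inj uS s y).1 /sc.
  apply: le_trans (rV_norm_coord _ _) _.
  rewrite (_ : lsubmx _ = (pt S s y : 'rV_(1 + n)) *m lsubmx (invmx S)); last first.
    by rewrite -{1}[invmx S]hsubmxK mul_mx_row row_mxKl.
  by apply: le_trans (hC _) _; rewrite ler_pM2l// ltW// TK.
- move=> e e' he he' E; apply/eqP; apply: contrapT => /negP ee'.
  have fe := fE _ he; have fe' := fE _ he'.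
  have : (face e `&` face e') (pt S (hit_sc e y) y) by split => //; rewrite E.
  by rewrite (face_disjoint meshM ee').
- move=> s cs nUs.
  have bT : boundary (cell T) (pt S s y).
    rewrite (boundary_cellE meshM); split => // V Vx.
    have [t [Ut Vt]] := cs _ (cpt s _ Vx).
    by exists (pt S t y).
  move: bT; rewrite (face_cover meshM) => -[e /= Te ce].
  have [tT [z zr zE]] := gen e s Te ce.
  have [zh sh] := hitK tT (esym zE).
  by exists e => //; rewrite /hits tT/= -zh inE.
- move=> e he; have fe := fE e he; case/andP: (he) => /andP[Te a0] _.
  have hx e' : incident T e' -> e' != e -> ~ closure (face e') (pt S (hit_sc e y) y).
    move=> Te' e'e ce'; have [_ fe'] := gen e' _ Te' ce'.
    have : (face e' `&` face e) (pt S (hit_sc e y) y) by split.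
    by rewrite (face_disjoint meshM e'e).
  case ap : (0 < dot a (normal T e)).
    have := cell_near_face meshM Te fe hx ap.
    by apply: filterS => t; rewrite /U /= !ptDl scaleNr.
  have an : 0 < dot (- a) (normal T e).
    by rewrite dotNl oppr_gt0 lt_neqAle a0 leNgt ap.
  have := cell_near_face meshM Te fe hx an.
  by apply: filterS => t; rewrite /U /= !ptDl scaleNr scalerN opprK.
- move=> s; have -> : (fun s => F (pt S s y)) = (fun s => F (y *m dsubmx S + s *: a)).
    by apply/funext => t; rewrite /pt addrC.
  by rewrite /pt addrC; exact: is_derive_line.
- move=> s; have -> : (fun s => 'D_a F (pt S s y)) =
     (fun s => \sum_i a ord0 i * pderiv i F (pt S s y)).
    apply/funext => t; rewrite derive_grad//; apply: eq_bigr => i _.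
    by rewrite [grad _ _ _ _]mxE.
  move: s; apply: continuous_sumr => i _; apply: continuousMr.
    by move=> s; exact: cst_continuous.
  by move=> s; apply: continuous_comp; [exact: cpt|exact: C1_pderiv].
Qed.

(** Fubini along the axis and the formula on almost every line leave, for each face, the values of
    [F] at the hits integrated over the base. Passing to the face costs the determinant of
    [proj_frm e]; times that of [S] this is the absolute value of [dot a (normal T e)], whose sign
    the line formula supplies. *)
Lemma divergence_direction :
  cell_int T (fun x => 'D_a F x) =
  \sum_(e | incident T e) dot a (normal T e) * face_int e F.
Proof.
have cD : continuous (fun x => 'D_a F x).
  have -> : (fun x => 'D_a F x) = (fun x => \sum_i a ord0 i * pderiv i F x).
    by apply/funext => x; rewrite derive_grad//; apply: eq_bigr => i _; rewrite [grad _ _ _ _]mxE.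
  apply: continuous_sumr => i _; apply: continuousMr.
    by move=> s; exact: cst_continuous.
  exact: C1_pderiv.
have mT := @cell_measurable _ _ _ _ meshM T.
have bT := @cell_bounded _ _ _ _ meshM T.
have cF := C1_continuous F1.
pose g : vec -> \bar R := (fun x => ('D_a F x)%:E) \_ (cell T).
have mg : measurable_fun setT g.
  apply/measurable_restrict => //; rewrite setTI; apply/measurable_EFinP.
  exact: continuous_measurable_rV.
have ig : (lebesgue_rV n.+1).-integrable setT (fun x => g (x *m (S : 'M[R]_n.+1))).
  have mS : measurable_fun setT (fun x : vec => x *m (S : 'M[R]_n.+1)).
    exact: measurable_mulmx.
  pose D := (fun x : vec => x *m (S : 'M[R]_n.+1)) @^-1` cell T.
  have mD : measurable D by rewrite -[D]setTI; exact: mS.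
  have -> : (fun x => g (x *m (S : 'M[R]_n.+1))) =
      (EFin \o (fun x => 'D_a F (x *m (S : 'M[R]_n.+1)))) \_ D.
    by apply/funext => x; rewrite /g !patchE.
  apply/integrable_restrict => //; rewrite setTI.
  apply: continuous_integrable_rV => //.
    move=> x.
    exact: (continuous_comp (@mulmx_continuous _ _ _ (S : 'M[R]_n.+1) x) (cD _)).
  move/bounded_rVP : bT => [K K0 TK]; apply/bounded_rVP.
  have [C C0 hC] := norm_mulmx (invmx S : 'M[R]_n.+1).
  exists (C * K); first by rewrite mulr_gt0.
  move=> x Dx; rewrite -[x](@mulmxK _ _ _ (S : 'M[R]_n.+1))//.
  by apply: le_lt_trans (hC _) _; rewrite ltr_pM2l// TK.
have [s ps gen] := generic_line T.
have neg := negligible_hyperplanes ps.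
pose he e y : \bar R := ((EFin \o (F \o chart e)) \_ (face_ref e)) (hit e y).
have cFe e : continuous (F \o chart e).
  by move=> z; apply: continuous_comp; [exact: chart_continuous|exact: cF].
have mref e := @face_ref_measurable _ _ _ _ meshM e.
have bref e := @face_ref_bounded _ _ _ _ meshM e.
have mrest e : measurable_fun setT ((EFin \o (F \o chart e)) \_ (face_ref e)).
  apply/measurable_restrict => //; rewrite setTI; apply/measurable_EFinP.
  exact: continuous_measurable_rV.
have hitE e y : hit e y = - (yc S (face_org e) *m invmx (proj_frm e)) +
    y *m invmx (proj_frm e) by rewrite /hit mulmxBl addrC.
have mhit e : measurable_fun setT (hit e).
  have -> : hit e = fun y => - (yc S (face_org e) *m invmx (proj_frm e)) +
    y *m invmx (proj_frm e) by apply/funext => y; exact: hitE.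
  exact: measurable_rV_affine.
have mhe e : measurable_fun setT (he e) by exact: measurableT_comp.
have ihe e : transversal T e -> (lebesgue_rV n).-integrable setT (he e).
  move=> tT; pose D := hit e @^-1` face_ref e.
  have mD : measurable D by rewrite -[D]setTI; exact: mhit.
  have -> : he e = (EFin \o (fun y => F (chart e (hit e y)))) \_ D.
    by apply/funext => y; rewrite /he !patchE.
  apply/integrable_restrict => //; rewrite setTI.
  apply: continuous_integrable_rV => //.
    move=> y; suff ch : continuous (hit e) by exact: (continuous_comp (ch y) (@cFe e _)).
    have -> : hit e = fun y => - (yc S (face_org e) *m invmx (proj_frm e)) +
      y *m invmx (proj_frm e) by apply/funext => y'; exact: hitE.
    exact: affine_continuous.
  have /bounded_rVP[K K0 eK] := bref e.
  have [C C0 hC] := norm_mulmx (proj_frm e).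
  apply/bounded_rVP; exists (`|yc S (face_org e)| + C * K).
    by rewrite ltr_wpDl// mulr_gt0.
  move=> y /= ye; rewrite -[y](yc_hit y tT) yc_chart.
  apply: le_lt_trans (ler_normD _ _) _; rewrite ltrD2l.
  by apply: le_lt_trans (hC _) _; rewrite ltr_pM2l// eK.
have int_he e : transversal T e ->
    (\int[lebesgue_rV n]_y he e y = (`|\det (proj_frm e)| * face_int e F)%:E)%E.
  move=> tT; have uP := proj_frm_unit tT.
  rewrite (@integral_rV_affine _ _ (yc S (face_org e)) (proj_frm e))// EFinM.
  congr (_ * _)%E; rewrite /face_int /Rintegral fineK; last first.
    apply: integrable_fin_num => //.
    exact: continuous_integrable_rV (cFe e) (mref e) (bref e).
  rewrite [RHS]integral_mkcond; apply: eq_integral => z _.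
  by rewrite /he /hit addrAC subrr add0r mulmxK.
apply: EFin_inj.
rewrite /cell_int /Rintegral fineK; last first.
  apply: integrable_fin_num => //.
  exact: continuous_integrable_rV.
rewrite integral_mkcond -/g (integral_slanted uS mg ig).
pose k e y := if transversal T e then
  ((sgR (dot a (normal T e)))%:E * he e y)%E else 0%E.
have ik e : (lebesgue_rV n).-integrable setT (k e).
  rewrite /k; case tT : (transversal T e); last exact: integrable0.
  by apply: integrableZl => //; exact: ihe.
transitivity (`|\det S|%:E * \int[lebesgue_rV n]_y \sum_(e : faces M) k e y)%E.
  congr (_ * _)%E; apply: ae_eq_integral => //.
  - under eq_fun do under eq_integral do rewrite -ptE.
    exact: measurable_fubini_rV (measurable_int _ ig).
  - have hs := @integrable_sum _ _ _ (lebesgue_rV n) setT measurableT _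
      (index_enum (faces M)) xpredT k (fun e _ => ik e).
    refine (measurable_int _ hs).
  case: neg => N [mN N0 sN]; exists N; split => // y /= ny; apply: sN.
  apply: contrapT => nsy; apply: ny => _.
  have gy := integral_line (gen y nsy).
  transitivity (\int[mu]_(s in [set s : R | cell T (pt S s y)]) ('D_a F (pt S s y))%:E)%E.
    by rewrite [RHS]integral_mkcond; apply: eq_integral => t _; rewrite /g !patchE.
  rewrite gy -sumEFin big_mkcond; apply: eq_bigr => e _.
  rewrite /hits /k /he patchE; case: (transversal T e) => //=.
  by case: ifPn => _ //=; rewrite mule0.
rewrite integral_sum// (eq_bigr (fun e => (if transversal T e then
   sgR (dot a (normal T e)) * (`|\det (proj_frm e)| * face_int e F) else 0)%:E)).
  rewrite sumEFin -EFinM; congr EFin; rewrite mulr_sumr [RHS]big_mkcond.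
  apply: eq_bigr => e _; rewrite /transversal; have [Te|_] := boolP (incident T e).
    rewrite andTb; have := det_proj_frm Te; set x := dot _ _ => Ex.
    have [x0|x0] := eqVneq x 0; first by rewrite x0 mulr0 mul0r.
    rewrite mulrCA 2!mulrA -[_ * _ * `|_|]mulrA Ex; congr (_ * _).
    rewrite /sgR; case: ltP => h; first by rewrite gtr0_norm ?mul1r.
    by rewrite ler0_norm// mulrNN mul1r.
  by rewrite andFb mulr0.
move=> e _; rewrite /k; case tT : (transversal T e); last exact: integral0.
by rewrite integralZl//; [rewrite int_he|exact: ihe].
Qed.

End direction.

Lemma cell_continuous_integrable T (f : vec -> R) : continuous f ->
  (lebesgue_rV n.+1).-integrable (cell T) (EFin \o f).
Proof.
move=> cf; apply: continuous_integrable_rV => //.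
  exact: (@cell_measurable _ _ _ _ meshM).
exact: (@cell_bounded _ _ _ _ meshM).
Qed.

Lemma face_continuous_integrable e (f : vec -> R) : continuous f ->
  (lebesgue_rV n).-integrable (face_ref e) (EFin \o (f \o chart e)).
Proof.
move=> cf; apply: continuous_integrable_rV => //.
- by move=> y; apply: continuous_comp; [exact: chart_continuous|exact: cf].
- exact: (@face_ref_measurable _ _ _ _ meshM).
- exact: (@face_ref_bounded _ _ _ _ meshM).
Qed.

Lemma cell_intD T (f g : vec -> R) : continuous f -> continuous g ->
  cell_int T (fun x => f x + g x) = cell_int T f + cell_int T g.
Proof.
move=> cf cg; apply: RintegralD; [|exact: cell_continuous_integrable..].
exact: (@cell_measurable _ _ _ _ meshM).
Qed.

Lemma cell_intZ T (c : R) (f : vec -> R) : continuous f ->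
  cell_int T (fun x => c * f x) = c * cell_int T f.
Proof.
move=> cf; apply: RintegralZl; last exact: cell_continuous_integrable.
exact: (@cell_measurable _ _ _ _ meshM).
Qed.

Lemma face_intD e (f g : vec -> R) : continuous f -> continuous g ->
  face_int e (fun x => f x + g x) = face_int e f + face_int e g.
Proof.
move=> cf cg; apply: (@RintegralD _ _ _ _ _ (f \o chart e) (g \o chart e));
  [|exact: face_continuous_integrable..].
exact: (@face_ref_measurable _ _ _ _ meshM).
Qed.

Lemma face_intZ e (c : R) (f : vec -> R) : continuous f ->
  face_int e (fun x => c * f x) = c * face_int e f.
Proof.
move=> cf; apply: (@RintegralZl _ _ _ _ _ (f \o chart e));
  last exact: face_continuous_integrable.
exact: (@face_ref_measurable _ _ _ _ meshM).
Qed.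

Lemma eq_cell_int T (f g : vec -> R) : (forall x, cell T x -> f x = g x) ->
  cell_int T f = cell_int T g.
Proof. by move=> fg; apply: eq_Rintegral => x /[!inE]; exact: fg. Qed.

Lemma eq_face_int e (f g : vec -> R) : (forall x, face e x -> f x = g x) ->
  face_int e f = face_int e g.
Proof.
by move=> fg; apply: eq_Rintegral => y /[!inE] ey; apply: fg; exists y.
Qed.

Lemma cell_int_sum T I (r : seq I) (P : pred I) (F : I -> vec -> R) :
  (forall i, P i -> continuous (F i)) ->
  cell_int T (fun x => \sum_(i <- r | P i) F i x) =
  \sum_(i <- r | P i) cell_int T (F i).
Proof.
move=> cF; elim: r => [|i r IH].
  rewrite big_nil; under eq_cell_int => x _ do rewrite big_nil.
  by rewrite /cell_int Rintegral_cst ?mul0r//; exact: (@cell_measurable _ _ _ _ meshM).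
rewrite big_cons; case Pi : (P i); last first.
  by rewrite -IH; apply: eq_cell_int => x _; rewrite big_cons Pi.
rewrite -IH -cell_intD; last 2 first.
- exact: cF.
- exact: continuous_sumr.
by apply: eq_cell_int => x _; rewrite big_cons Pi.
Qed.

Lemma face_int_sum e I (r : seq I) (P : pred I) (F : I -> vec -> R) :
  (forall i, P i -> continuous (F i)) ->
  face_int e (fun x => \sum_(i <- r | P i) F i x) =
  \sum_(i <- r | P i) face_int e (F i).
Proof.
move=> cF; elim: r => [|i r IH].
  rewrite big_nil; under eq_face_int => x _ do rewrite big_nil.
  by rewrite /face_int Rintegral_cst ?mul0r//; exact: (@face_ref_measurable _ _ _ _ meshM).
rewrite big_cons; case Pi : (P i); last first.
  by rewrite -IH; apply: eq_face_int => x _; rewrite big_cons Pi.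
rewrite -IH -face_intD; last 2 first.
- exact: cF.
- exact: continuous_sumr.
by apply: eq_face_int => x _; rewrite big_cons Pi.
Qed.

Theorem cell_divergence T (F : vec -> R) (b : vec) : C1 F ->
  cell_int T (fun x => dot b (grad F x)) =
  \sum_(e | incident T e) dot b (normal T e) * face_int e F.
Proof.
move=> F1.
have coord i : cell_int T (pderiv i F) =
    \sum_(e | incident T e) normal T e ord0 i * face_int e F.
  (* The first row of this permutation matrix is the [i]-th unit vector. Working by coordinates
     avoids completing [b] to a basis and covers [b = 0]. *)
  pose S : 'M[R]_(1 + n) := perm_mx (perm.tperm ord0 i).
  have uS : S \in unitmx by exact: unitmx_perm.
  have aE : axis S = delta_mx ord0 i.
    apply/rowP => j; transitivity ((S : 'M[R]_n.+1) ord0 j).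
      by rewrite [LHS]mxE; congr (S _ _); exact: val_inj.
    by rewrite /S !mxE perm.tpermL eqxx eq_sym.
  have := divergence_direction uS T F1; rewrite aE => ->.
  apply: eq_bigr => e _; congr (_ * _); rewrite /dot (bigD1 i)//= big1 => [|j ji].
    by rewrite mxE !eqxx mul1r addr0.
  by rewrite mxE (negbTE ji) andbF mul0r.
transitivity (cell_int T (fun x => \sum_i b ord0 i * pderiv i F x)).
  by apply: eq_cell_int => x _; apply: eq_bigr => i _; rewrite [grad _ _ _ _]mxE.
rewrite cell_int_sum; last first.
  by move=> i _; apply: continuousMr; [move=> x; exact: cst_continuous|exact: C1_pderiv].
rewrite (eq_bigr (fun i => \sum_(e | incident T e)
   b ord0 i * normal T e ord0 i * face_int e F)) => [|i _].
  by rewrite exchange_big/=; apply: eq_bigr => e _; rewrite -mulr_suml.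
rewrite cell_intZ; last exact: C1_pderiv.
by rewrite coord mulr_sumr; apply: eq_bigr => e _; rewrite mulrA.
Qed.

End divergence_theorem.

(** * Approximation of Lipschitz functions by Bernstein polynomials *)

Section casteljau.
Context {R : realType}.

(* de Casteljau's recursion for the Bernstein polynomial of degree [m] with
   control values [A] *)
Fixpoint bern (m : nat) (A : nat -> R) (t : R) : R :=
  if m is m'.+1 then
    (1 - t) * bern m' A t + t * bern m' (fun k => A k.+1) t
  else A 0%N.

Lemma bernD m (A B : nat -> R) t :
  bern m (fun k => A k + B k) t = bern m A t + bern m B t.
Proof.
elim: m A B => [//|m IH] A B /=.
by rewrite !IH; ring.
Qed.

Lemma bernZ m (c : R) (A : nat -> R) t :
  bern m (fun k => c * A k) t = c * bern m A t.
Proof. by elim: m A => [//|m IH] A /=; rewrite !IH; ring. Qed.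

Lemma bern_cst m (c t : R) : bern m (fun=> c) t = c.
Proof. by elim: m => [//|m IH] /=; rewrite !IH; ring. Qed.

Lemma bern_le m (A B : nat -> R) t : 0 <= t <= 1 ->
  (forall k, A k <= B k) -> bern m A t <= bern m B t.
Proof.
move=> /andP[t0 t1]; elim: m A B => [|m IH] A B AB /=; first exact: AB.
by rewrite lerD// ler_wpM2l ?subr_ge0// IH.
Qed.

Lemma bern_id m t : bern m (fun k => k%:R) t = m%:R * t.
Proof.
elim: m => [|m IH] /=; first by rewrite mul0r.
have -> : (fun k => k.+1%:R) = (fun k : nat => k%:R + 1 : R).
  by apply/funext => k; rewrite -natr1.
by rewrite bernD bern_cst IH -[m.+1%:R]natr1; ring.
Qed.

Lemma bern_sqr m t :
  bern m (fun k => k%:R ^+ 2) t = m%:R * t * (1 - t) + (m%:R * t) ^+ 2.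
Proof.
elim: m => [|m IH] /=; first by rewrite !mul0r expr0n addr0.
have -> : (fun k => k.+1%:R ^+ 2) = (fun k : nat => k%:R ^+ 2 + (2 * k%:R + 1) : R).
  by apply/funext => k; rewrite -natr1; ring.
by rewrite !bernD bernZ bern_cst bern_id IH -[m.+1%:R]natr1; ring.
Qed.

(** Binomial variance plus squared bias. The centre [c] is free because a differentiated polynomial
    has degree [m] but keeps the nodes of degree [m + 1]. *)
Lemma bern_moment m (c t : R) :
  bern m (fun k => (k%:R - c) ^+ 2) t = m%:R * t * (1 - t) + (m%:R * t - c) ^+ 2.
Proof.
have -> : (fun k : nat => (k%:R - c) ^+ 2) =
   (fun k : nat => k%:R ^+ 2 + ((-2 * c) * k%:R + c ^+ 2) : R).
  by apply/funext => k; ring.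
by rewrite !bernD bernZ bern_cst bern_id bern_sqr; ring.
Qed.

End casteljau.

Section bernstein.
Context {R : realType} {n : nat}.
Local Notation vec := 'rV[R]_n.
Implicit Types (V : vec -> R) (d : 'I_n -> nat).
Variables (a : R) (m : nat).
Hypothesis a0 : 0 < a.

Let h : R := 2 * a / m.+1%:R.
Let h0 : 0 < h. Proof. by rewrite divr_gt0// mulr_gt0. Qed.

Definition upd (z : vec) i (s : R) : vec :=
  \row_j if j == i then s else z ord0 j.
Definition node (k : nat) : R := - a + h * k%:R.
Definition rel (s : R) : R := (s + a) / (2 * a).

(* Tensor product Bernstein polynomial of degree [d i] in the coordinate
   [i \in l], the control values being those of [V] at the nodes; the
   coordinates outside [l] are frozen at [z]. *)
Fixpoint tbern d (l : seq 'I_n) V (z x : vec) : R :=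
  if l is i :: l' then
    bern (d i) (fun k => tbern d l' V (upd z i (node k)) x) (rel (x ord0 i))
  else V z.

Definition in_cube (x : vec) := forall i, `|x ord0 i| <= a.

Lemma rel01 x i : in_cube x -> 0 <= rel (x ord0 i) <= 1.
Proof.
move=> /(_ i); rewrite ler_norml => /andP[x1 x2]; rewrite /rel.
by rewrite divr_ge0 ?mulr_ge0 ?(ltW a0)//=; [rewrite ler_pdivrMr ?mulr_gt0//; lra|lra].
Qed.

Lemma tbernD d l V W z x :
  tbern d l (fun z => V z + W z) z x = tbern d l V z x + tbern d l W z x.
Proof.
elim: l z => [//|i l IH] z /=; rewrite -bernD; congr bern.
by apply/funext => k; rewrite IH.
Qed.

Lemma tbernZ d l (c : R) V z x :
  tbern d l (fun z => c * V z) z x = c * tbern d l V z x.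
Proof.
elim: l z => [//|i l IH] z /=; rewrite -bernZ; congr bern.
by apply/funext => k; rewrite IH.
Qed.

Lemma tbern_cst d l (c : R) z x : tbern d l (fun=> c) z x = c.
Proof.
elim: l z => [//|i l IH] z /=; rewrite -[RHS](bern_cst (d i) c (rel (x ord0 i))).
by congr bern; apply/funext => k; rewrite IH.
Qed.

Lemma tbern_le d l V W z x : in_cube x -> (forall z, V z <= W z) ->
  tbern d l V z x <= tbern d l W z x.
Proof.
move=> xa VW; elim: l z => [|i l IH] z /=; first exact: VW.
by apply: bern_le; [exact: rel01|move=> k; exact: IH].
Qed.

Lemma tbern_sum d l I (r : seq I) (F : I -> vec -> R) z x :
  tbern d l (fun z => \sum_(i <- r) F i z) z x = \sum_(i <- r) tbern d l (F i) z x.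
Proof.
elim: r => [|i r IH].
  rewrite big_nil -[RHS](tbern_cst d l 0 z x); congr tbern.
  by apply/funext => y; rewrite big_nil.
rewrite big_cons -IH -tbernD.
by under eq_fun do rewrite big_cons.
Qed.

Lemma updE z i s j : upd z i s ord0 j = if j == i then s else z ord0 j.
Proof. by rewrite mxE. Qed.

Lemma tbern_shift d l V z x i (s : R) : i \notin l ->
  tbern d l V (z + s *: delta_mx ord0 i) x =
  tbern d l (fun z => V (z + s *: delta_mx ord0 i)) z x.
Proof.
elim: l z => [//|j l IH] z /=; rewrite inE negb_or => /andP[ij il].
congr bern; apply/funext => k; rewrite -IH//; congr tbern.
apply/rowP => u; rewrite !mxE; case: eqP => // ->.
by rewrite eqxx/= eq_sym (negbTE ij) mulr0 addr0.
Qed.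

Lemma C1_bern k (A : nat -> vec -> R) (t : vec -> R) :
  (forall j, C1 (A j)) -> C1 t -> C1 (fun x => bern k (fun j => A j x) (t x)).
Proof.
move=> A1 t1; elim: k A A1 => [|k IH] A A1 /=; first exact: A1.
apply: C1D; apply: C1M; [|exact: IH|by []|exact: IH].
by apply: C1B => //; exact: C1_cst.
Qed.

Lemma C1_rel i : C1 (fun x : vec => rel (x ord0 i)).
Proof.
have -> : (fun x : vec => rel (x ord0 i)) = fun x => (2 * a)^-1 * (x ord0 i + a).
  by apply/funext => x; rewrite /rel mulrC.
by apply: C1Z; apply: C1D; [exact: C1_coord|exact: C1_cst].
Qed.

Lemma C1_tbern d l V z : C1 (tbern d l V z).
Proof.
elim: l z => [|i l IH] z /=; first exact: C1_cst.
by apply: (@C1_bern (d i) (fun k => tbern d l V (upd z i (node k))));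
  [move=> k; exact: IH|exact: C1_rel].
Qed.

(** The product rule when the control values also depend on [x]; the last term is the classical
    derivative formula, one degree lower and on first differences. *)
Lemma pderiv_bern i k (A : nat -> vec -> R) (t : vec -> R) :
  (forall j, C1 (A j)) -> C1 t ->
  pderiv i (fun x => bern k (fun j => A j x) (t x)) =
  fun x => bern k (fun j => pderiv i (A j) x) (t x) +
    pderiv i t x * k%:R * bern k.-1 (fun j => A j.+1 x - A j x) (t x).
Proof.
move=> A1 t1; elim: k A A1 => [|k IH] A A1 /=.
  by apply/funext => x; rewrite mulr0 mul0r addr0.
have c1 B : (forall j, C1 (B j)) -> C1 (fun x => bern k (fun j => B j x) (t x)).
  by move=> B1; exact: C1_bern.
have t1' : C1 (fun x => 1 - t x) by apply: C1B => //; exact: C1_cst.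
have mix f0 f1 : C1 f0 -> C1 f1 ->
    pderiv i (fun x => (1 - t x) * f0 x + t x * f1 x) = fun x =>
      pderiv i t x * (f1 x - f0 x) + (1 - t x) * pderiv i f0 x + t x * pderiv i f1 x.
  move=> c0 c1'; rewrite pderivD; [|exact: C1M..]; rewrite !pderivM//.
  have -> : pderiv i (fun x => 1 - t x) = fun x => pderiv i (fun=> 1) x - pderiv i t x.
    by have := @pderivB _ _ (fun=> 1) t i (C1_cst 1) t1.
  by rewrite pderiv_cst; apply/funext => x; ring.
rewrite (mix (fun x => bern k _ (t x)) (fun x => bern k _ (t x)) (c1 _ _) (c1 _ _))//.
rewrite (IH A)// (IH (fun j => A j.+1))//.
apply/funext => x.
have E : bern k (fun j => A j.+1 x - A j x) (t x) =
  bern k (fun j => A j.+1 x) (t x) - bern k (fun j => A j x) (t x).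
  rewrite -[X in _ - X]mul1r -mulNr -bernZ -bernD; congr bern.
  by apply/funext => j; rewrite mulN1r.
rewrite E -[k.+1%:R]natr1; case: k {IH c1} E => [|k] /= E; first by ring.
rewrite [X in _ = _ + _ * (_ + 1) * X](_ : _ =
  (1 - t x) * bern k (fun j => A j.+1 x - A j x) (t x) +
  t x * bern k (fun j => A j.+2 x - A j.+1 x) (t x)); last by rewrite -E.
have E' : ((1 - t x) * bern k (fun j => A j.+1 x) (t x) +
    t x * bern k (fun j => A j.+2 x) (t x)) -
   ((1 - t x) * bern k (fun j => A j x) (t x) +
    t x * bern k (fun j => A j.+1 x) (t x)) =
  (1 - t x) * bern k (fun j => A j.+1 x - A j x) (t x) +
  t x * bern k (fun j => A j.+2 x - A j.+1 x) (t x) by rewrite -E.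
move: E'; set u := bern k (fun j => A j.+1 x - A j x) _.
set v := bern k (fun j => A j.+2 x - A j.+1 x) _.
set p := bern k (A^~ x) _; set q := bern k (fun j => A j.+1 x) _.
set r := bern k (fun j => A j.+2 x) _ => E'.
apply/eqP; rewrite -subr_eq0; apply/eqP.
transitivity (pderiv i t x * (((1 - t x) * q + t x * r -
  ((1 - t x) * p + t x * q)) - ((1 - t x) * u + t x * v))); first by ring.
by rewrite E' subrr mulr0.
Qed.

Definition degm : 'I_n -> nat := fun=> m.+1.
Definition degm1 (i : 'I_n) : 'I_n -> nat := fun j => if j == i then m else m.+1.

Definition dquot i V (z : vec) : R :=
  h^-1 * (V (z + h *: delta_mx ord0 i) - V z).

Lemma pderiv_rel i j : pderiv i (fun x : vec => rel (x ord0 j)) =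
  fun=> (2 * a)^-1 * (i == j)%:R.
Proof.
have -> : (fun x : vec => rel (x ord0 j)) = fun x => (2 * a)^-1 * (x ord0 j + a).
  by apply/funext => x; rewrite /rel mulrC.
rewrite pderivZ; last by apply: C1D; [exact: C1_coord|exact: C1_cst].
rewrite pderivD; [|exact: C1_coord|exact: C1_cst].
by apply/funext => x; rewrite pderiv_coord pderiv_cst addr0.
Qed.

Lemma pderiv_tbern_notin d l V z i : i \notin l ->
  pderiv i (tbern d l V z) = fun=> 0.
Proof.
elim: l z => [|j l IH] z /=; first by rewrite pderiv_cst.
rewrite inE negb_or => /andP[ij il].
rewrite (pderiv_bern i (d j) (A := fun k => tbern d l V (upd z j (node k))));
  [|by move=> k; exact: C1_tbern|exact: C1_rel].
apply/funext => x; rewrite pderiv_rel (negbTE ij) mulr0 !mul0r addr0.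
rewrite -[RHS](bern_cst (d j) 0 (rel (x ord0 j))); congr bern.
by apply/funext => k; rewrite IH.
Qed.

Lemma eq_tbern d d' l V z x : {in l, d =1 d'} -> tbern d l V z x = tbern d' l V z x.
Proof.
elim: l z => [//|i l IH] z dd' /=; rewrite dd' ?mem_head//; congr bern.
by apply/funext => k; apply: IH => j jl; apply: dd'; rewrite inE jl orbT.
Qed.

(** Consecutive nodes differ by [h], so the derivative is a Bernstein polynomial whose control
    values are difference quotients of [V]; it is bounded by the Lipschitz constant of [V]. *)
Lemma pderiv_tbern l V z i : uniq l -> i \in l ->
  pderiv i (tbern degm l V z) = tbern (degm1 i) l (dquot i V) z.
Proof.
elim: l z => [//|j l IH] z /= /andP[jl ul]; rewrite inE => ijl.
rewrite (pderiv_bern i m.+1 (A := fun k => tbern degm l V (upd z j (node k))));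
  [|by move=> k; exact: C1_tbern|exact: C1_rel].
apply/funext => x; rewrite pderiv_rel (_ : m.+1.-1 = m)//.
have [ij|ij] := eqVneq i j; last first.
  rewrite mulr0 !mul0r addr0 /degm1 eq_sym (negbTE ij); congr bern.
  by apply/funext => k; rewrite IH//; move: ijl; rewrite (negbTE ij).
rewrite -ij in jl *; rewrite mulr1 {1}/degm1 eqxx.
rewrite [X in X + _](_ : _ = 0) ?add0r; last first.
  rewrite -[RHS](bern_cst m.+1 0 (rel (x ord0 i))).
  by congr (bern m.+1 _ _); apply/funext => k; rewrite pderiv_tbern_notin.
have -> : (2 * a)^-1 * m.+1%:R = h^-1 by rewrite /h invf_div mulrC.
rewrite -bernZ; congr bern; apply/funext => k.
have -> : upd z i (node k.+1) = upd z i (node k) + h *: delta_mx ord0 i.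
  apply/rowP => u; rewrite !mxE /node eqxx/=; case: eqP => _.
    by rewrite mulr1 -natr1; ring.
  by rewrite mulr0 addr0.
rewrite tbern_shift// (@eq_tbern (degm1 i) degm); last first.
  by move=> u ul'; rewrite /degm1; case: eqP => // ui; move: jl; rewrite -ui ul'.
rewrite /dquot tbernZ; congr (_ * _).
rewrite -[X in _ - X]mul1r -mulNr -tbernZ -tbernD; congr tbern.
by apply/funext => y; rewrite mulN1r.
Qed.

(** Only the coordinate [j] matters, the others average a constant. The remaining one-dimensional
    sum is [h ^+ 2] times a binomial second moment, of order [m], while [h] is of order [1 / m]. *)
Lemma tbern_quad d l z x j : in_cube x -> (forall i, d i = m \/ d i = m.+1) ->
  uniq l -> j \in l ->
  tbern d l (fun z => (z ord0 j - x ord0 j) ^+ 2) z x <= (2 * a) ^+ 2 / m.+1%:R.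
Proof.
move=> xa dm; elim: l z => [//|i l IH] z /= /andP[il ul]; rewrite inE.
case: (eqVneq j i) => [ji _|ji /= jl]; last first.
  rewrite -(bern_cst (d i) (_ / _) (rel (x ord0 i))).
  by apply: bern_le => [|k]; [exact: rel01|exact: IH].
rewrite -ji in il *.
have fz s : tbern d l (fun z => (z ord0 j - x ord0 j) ^+ 2) (upd z j s) x =
   (s - x ord0 j) ^+ 2.
  have : upd z j s ord0 j = s by rewrite updE eqxx.
  move: (upd z j s) => {}z; elim: l z il {IH ul} => [|u l IH] z /= il zj.
    by rewrite zj.
  move: il; rewrite inE negb_or => /andP[ju jl].
  rewrite -[RHS](bern_cst (d u) _ (rel (x ord0 u))); congr bern.
  by apply/funext => k; apply: IH => //; rewrite updE (negbTE ju).
have -> : (fun k => tbern d l (fun z => (z ord0 j - x ord0 j) ^+ 2)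
    (upd z j (node k)) x) =
   (fun k => h ^+ 2 * (k%:R - m.+1%:R * rel (x ord0 j)) ^+ 2).
  apply/funext => k; rewrite fz -exprMn; congr (_ ^+ 2).
  have -> : h * (k%:R - m.+1%:R * rel (x ord0 j)) =
      h * k%:R - h * m.+1%:R * rel (x ord0 j) by ring.
  have -> : h * m.+1%:R = 2 * a by rewrite /h divfK.
  have -> : 2 * a * rel (x ord0 j) = x ord0 j + a.
    by rewrite /rel mulrC divfK// gt_eqF// mulr_gt0.
  by rewrite /node; ring.
rewrite bernZ bern_moment.
have /andP[t0 t1] := rel01 j xa; set t := rel _ in t0 t1 *.
have -> : (2 * a) ^+ 2 / m.+1%:R = h ^+ 2 * m.+1%:R.
  have M0 : m.+1%:R != 0 :> R by rewrite pnatr_eq0.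
  by rewrite /h; move: (m.+1%:R) M0 => N N0; field.
rewrite ler_pM2l ?exprn_gt0//.
have m0 : 0 <= m%:R :> R by [].
have tt : t * t <= t by rewrite ler_piMr.
have tt0 : 0 <= t * t by rewrite mulr_ge0.
case: (dm j) => ->; rewrite -?[m.+1%:R]natr1.
  have -> : m%:R * t - (m%:R + 1) * t = - t by ring.
  have : m%:R * (t * (1 - t)) <= m%:R * 1.
    by rewrite ler_wpM2l//; lra.
  by rewrite sqrrN expr2 -mulrA; lra.
rewrite subrr expr0n addr0.
have : (m%:R + 1) * (t * (1 - t)) <= (m%:R + 1) * 1.
  by rewrite ler_wpM2l//; lra.
by rewrite -mulrA; lra.
Qed.

(* Both error estimates come from comparing [V] with a parabola. *)
Lemma tbern_close d V x (c eta K : R) : in_cube x ->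
  (forall i, d i = m \/ d i = m.+1) -> 0 <= K ->
  (forall z, `|V z - c| <= eta + K * \sum_j (z ord0 j - x ord0 j) ^+ 2) ->
  `|tbern d (enum 'I_n) V 0 x - c| <= eta + K * (n%:R * ((2 * a) ^+ 2 / m.+1%:R)).
Proof.
move=> xa dm K0 hV.
have cE : c = tbern d (enum 'I_n) (fun=> c) 0 x by rewrite tbern_cst.
pose Q (z : vec) := eta + K * \sum_j (z ord0 j - x ord0 j) ^+ 2.
have QE : tbern d (enum 'I_n) Q 0 x <= eta + K * (n%:R * ((2 * a) ^+ 2 / m.+1%:R)).
  rewrite tbernD tbern_cst lerD2l tbernZ ler_wpM2l// tbern_sum.
  rewrite -[n%:R * _](_ : \sum_(j < n) (2 * a) ^+ 2 / m.+1%:R = _); last first.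
    by rewrite sumr_const card_ord [RHS]mulr_natl.
  by apply: ler_sum => j _; apply: tbern_quad; rewrite ?enum_uniq ?mem_enum.
rewrite ler_norml; apply/andP; split.
  rewrite lerNl opprB; apply: le_trans QE.
  rewrite lerBlDr cE -tbernD; apply: tbern_le => // z.
  by have := hV z; rewrite -/(Q z) ler_norml => /andP[]; lra.
apply: le_trans QE; rewrite lerBlDr cE -tbernD; apply: tbern_le => // z.
by have := hV z; rewrite -/(Q z) ler_norml => /andP[]; lra.
Qed.

End bernstein.

Section approximation.
Context {R : realType} {n : nat}.
Local Notation vec := 'rV[R]_n.

Lemma sqr_norm_le_sum (x y : vec) :
  `|x - y| ^+ 2 <= \sum_j (x ord0 j - y ord0 j) ^+ 2.
Proof.
rewrite [`|x - y|](_ : _ = mx_norm (x - y))//.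
have [->|/mx_norm_neq0[[i j] E]] := eqVneq (mx_norm (x - y)) 0.
  by rewrite expr0n sumr_ge0// => j _; exact: sqr_ge0.
rewrite E (bigD1 j)//= ord1 !mxE real_normK ?num_real// lerDl.
by apply: sumr_ge0 => k _; exact: sqr_ge0.
Qed.

(** The last property asks for nothing but C^1 regularity near [x]. There the difference quotients
    are close to the derivative at nearby nodes by the mean value theorem, while distant nodes are
    controlled by the second moment. *)
Lemma lipschitz_approx (V : vec -> R) (L a : R) : 0 < a -> 0 <= L ->
  (forall x y, `|V x - V y| <= L * `|x - y|) ->
  exists phi : nat -> vec -> R, exists K : R,
  [/\ forall m, C1 (phi m),
      forall m x, in_cube a x -> `|phi m x - V x| <= K,
      forall x, in_cube a x -> phi ^~ x @ \oo --> V x,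
      forall m x i, in_cube a x -> `|pderiv i (phi m) x| <= L &
      forall x (f : vec -> R) i, in_cube a x -> C1 f ->
        (\forall y \near x, V y = f y) ->
        (fun m => pderiv i (phi m) x) @ \oo --> pderiv i f x].
Proof.
move=> a0 L0 hL.
pose phi m := tbern a m (degm m) (enum 'I_n) V 0.
pose C : R := n%:R * (2 * a) ^+ 2.
have C0 : 0 <= C by rewrite mulr_ge0// sqr_ge0.
have CE (m : nat) : n%:R * ((2 * a) ^+ 2 / m.+1%:R) = C / m.+1%:R by rewrite mulrA.
have d1 m i : degm m i = m \/ degm m i = m.+1 :> nat by right.
have d2 m i j : degm1 m i j = m \/ degm1 m i j = m.+1 :> nat.
  by rewrite /degm1; case: ifP => _; [left|right].
(* The bound [u <= del + u^2 / del] puts the Lipschitz estimate below a parabola, as [tbern_close]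
   requires. *)
have val m x (del : R) : 0 < del -> in_cube a x ->
    `|phi m x - V x| <= L * del + L / del * (C / m.+1%:R).
  move=> del0 xa; rewrite -CE; apply: tbern_close => //.
    by rewrite divr_ge0// ltW.
  move=> z; apply: le_trans (hL _ _) _; rewrite -mulrA -mulrDr ler_wpM2l//.
  rewrite (@le_trans _ _ (del + del^-1 * `|z - x| ^+ 2))//; last first.
    by rewrite lerD2l ler_wpM2l ?invr_ge0 ?(ltW del0)// sqr_norm_le_sum.
  set u := `|z - x|; have u0 : 0 <= u by rewrite /u normr_ge0.
  have : 0 <= (u - del) ^+ 2 by exact: sqr_ge0.
  have -> : del + del^-1 * u ^+ 2 = (del ^+ 2 + u ^+ 2) / del.
    by field; rewrite gt_eqF.
  rewrite ler_pdivlMr//.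
  have -> : (u - del) ^+ 2 = u ^+ 2 + del ^+ 2 - 2 * (u * del) by ring.
  by have := mulr_ge0 u0 (ltW del0); lra.
have dquotL (m : nat) i z : `|dquot a m i V z| <= L.
  rewrite /dquot; set h := 2 * a / _.
  have h0 : 0 < h by rewrite divr_gt0// mulr_gt0.
  rewrite normrM normfV (gtr0_norm h0) mulrC ler_pdivrMr//.
  apply: le_trans (hL _ _) _; rewrite addrAC subrr add0r normrZ gtr0_norm//.
  rewrite ler_wpM2l// -[leRHS]mulr1 ler_pM2l//.
  exact: rV_norm_delta.
have small (K eps : R) : 0 < eps -> \forall m \near \oo, K / m.+1%:R < eps.
  move=> eps0; have cK : (fun m => K / m.+1%:R) @ \oo --> (0 : R).
    by rewrite -[0](mulr0 K); apply: cvgM; [exact: cvg_cst|exact: cvg_harmonic].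
  exact: (cvgr_lt 0 cK).
exists phi, (L + L * C); split.
- by move=> m; exact: C1_tbern.
- move=> m x xa; have := @val m x 1 ltr01 xa; rewrite mulr1 divr1.
  move/le_trans; apply; rewrite lerD2l ler_wpM2l// ler_pdivrMr//.
  by rewrite ler_peMr// ler1n.
- move=> x xa; apply/cvgrPdist_lt => eps eps0.
  pose del := eps / (2 * (L + 1)).
  have L1 : 0 < L + 1 by rewrite ltr_wpDl.
  have del0 : 0 < del by rewrite divr_gt0// mulr_gt0.
  have Ldel : L * del <= eps / 2.
    have -> : eps / 2 = del * (L + 1) by rewrite /del; field; rewrite gt_eqF.
    by rewrite mulrC ler_pM2l// lerDl.
  near=> m; rewrite distrC; apply: le_lt_trans (val m x del del0 xa) _.
  rewrite [ltRHS]splitr ler_ltD// mulrA; near: m.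
  by apply: small; rewrite divr_gt0.
- move=> m x i xa; rewrite /phi pderiv_tbern ?enum_uniq ?mem_enum//.
  have := @tbern_close R n a m a0 (degm1 m i) (dquot a m i V) x 0 L 0 xa
    (d2 n m i) (lexx _).
  rewrite subr0 mul0r addr0; apply => z.
  by rewrite subr0 mul0r addr0.
- move=> x f i xa f1 /nbhs_rV_normP[r r0 Vf]; set g := pderiv i f x.
  apply/cvgrPdist_lt => eps eps0.
  have e20 : 0 < eps / 2 by rewrite divr_gt0.
  have [r1 r10 hr1] : exists2 r1 : R, 0 < r1 &
      forall y, `|y - x| < r1 -> `|pderiv i f y - g| <= eps / 2.
    have cg : pderiv i f @ x --> g by exact: C1_pderiv.
    have : nbhs x [set y | `|g - pderiv i f y| < eps / 2].
      by move/cvgrPdist_lt : cg => /(_ _ e20).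
    move=> /(iffLR (nbhs_rV_normP _ _))[r1 r10 h1].
    by exists r1 => // y /h1; rewrite distrC => /ltW.
  (* A node within [rho] of [x], moved by a step [h < rho], stays within [2 rho], where [V] is [f]
     and the derivative of [f] is close to [g]. *)
  pose rho := Num.min r r1 / 2.
  have rho0 : 0 < rho by rewrite divr_gt0// lt_min r0.
  have [rr rr1] : 2 * rho <= r /\ 2 * rho <= r1.
    by rewrite /rho mulrC divfK// !ge_min !lexx orbT.
  (* At distance at least [rho] the crude bound [L + |g|] on the error lies below the parabola with
     this coefficient. *)
  pose K := (L + `|g|) / rho ^+ 2.
  have K0 : 0 <= K by rewrite divr_ge0 ?sqr_ge0// addr_ge0.
  near=> m; rewrite distrC /phi pderiv_tbern ?enum_uniq ?mem_enum//.
  have hrho : 2 * a / m.+1%:R < rho by near: m; exact: small.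
  have hK : K * C / m.+1%:R < eps / 2 by near: m; exact: small.
  apply: (@le_lt_trans _ _ (eps / 2 + K * (C / m.+1%:R))); last first.
    by rewrite [ltRHS]splitr ler_ltD// mulrA.
  rewrite -CE; apply: tbern_close => // z.
  have [zx|zx] := ltP `|z - x| rho; last first.
    rewrite (@le_trans _ _ (K * `|z - x| ^+ 2))//; last first.
      apply: le_trans (ler_wpM2l K0 (sqr_norm_le_sum z x)) _.
      by rewrite lerDr ltW.
    rewrite (@le_trans _ _ (L + `|g|))//.
      by apply: le_trans (ler_normB _ _) _; rewrite lerD2r.
    rewrite /K mulrAC ler_pdivlMr ?exprn_gt0// ler_wpM2l ?addr_ge0//.
    by apply: lerXn2r; rewrite ?nnegrE ?normr_ge0// ltW.
  rewrite (@le_trans _ _ (eps / 2))//; last first.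
    by rewrite lerDl mulr_ge0// sumr_ge0// => j _; exact: sqr_ge0.
  rewrite /dquot; set h := 2 * a / _ in hrho *.
  have h0 : 0 < h by rewrite divr_gt0// mulr_gt0.
  have nd (s : R) : 0 <= s <= h -> `|z + s *: delta_mx ord0 i - x| < 2 * rho.
    move=> /andP[s0 sh]; rewrite addrAC; apply: le_lt_trans (ler_normD _ _) _.
    rewrite mulr_natl mulr2n; apply: ltr_leD => //; apply: le_trans (ltW hrho).
    rewrite normrZ ger0_norm// (le_trans _ sh)// ler_piMr//.
    exact: rV_norm_delta.
  have -> : V (z + h *: delta_mx ord0 i) = f (z + h *: delta_mx ord0 i).
    by apply: Vf; apply: lt_le_trans rr; apply: nd; rewrite lexx ltW.
  have -> : V z = f z.
    by apply: Vf; rewrite (lt_trans zx)//; move: rr; lra.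
  pose w (s : R) : R := f (z + s *: delta_mx ord0 i).
  have dw (s : R) : is_derive s (1 : R) w (pderiv i f (z + s *: delta_mx ord0 i)).
    exact: is_derive_line.
  have cw : continuous w.
    by move=> s; apply: differentiable_continuous; apply/derivable1_diffP; exact: ex_derive.
  have [s s01] := @MVT_segment R w (fun s => pderiv i f (z + s *: delta_mx ord0 i))
    0 h (ltW h0) (fun s _ => dw s) (continuous_subspaceT cw).
  have -> : w 0 = f z by rewrite /w scale0r addr0.
  rewrite subr0 /w => ->; rewrite mulrC mulfK ?gt_eqF//.
  apply: hr1; apply: lt_le_trans rr1; apply: nd.
  by move: s01; rewrite in_itv.
Unshelve. all: by end_near. Qed.
End approximation.

(** * Gluing across the faces of a Lipschitz domain *)

Section segments.
Context {R : realType}.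

(** The estimates are only centred at each [s], on neighbourhoods without uniform size. The supremum
    of the points reached from [0] with slope [L] is reached as well, and it cannot be less than
    [1]. *)
Lemma lipschitz_unit_interval (g : R -> R) (L : R) :
  (forall s : R, 0 <= s <= 1 -> exists2 del : R, 0 < del &
    forall t : R, 0 <= t <= 1 -> `|t - s| < del -> `|g t - g s| <= L * `|t - s|) ->
  `|g 1 - g 0| <= L.
Proof.
move=> hg.
pose P : set R := [set s | 0 <= s <= 1 /\ `|g s - g 0| <= L * s].
have P0 : P 0 by split; rewrite ?lexx ?ler01// subrr normr0 mulr0.
have P1 : ubound P 1 by move=> s [/andP[]].
have hsP : has_sup P by split; [exists 0|exists 1].
set m := sup P.
have m01 : 0 <= m <= 1.
  by rewrite ge_sup ?andbT; [exact: ub_le_sup hsP.2 _ P0|exists 0|].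
have /andP[m0 m1] := m01.
have [del del0 hdel] := hg _ m01.
have [s [s01 sP] sm] := sup_adherent del0 hsP.
have sm' : s <= m by apply: ub_le_sup => //; exact: hsP.2.
have Pm : `|g m - g 0| <= L * m.
  have := hdel s s01; rewrite [`|s - m|]distrC ger0_norm ?subr_ge0// distrC => h.
  have : m - s < del by move: sm; rewrite -/m; lra.
  move/h => {}h; apply: le_trans (ler_distD (g s) _ _) _.
  apply: le_trans (lerD h sP) _; rewrite -mulrDr.
  by rewrite (_ : m - s + s = m)//; ring.
have [m1'|m1'] := ltP m 1; last first.
  suff -> : 1 = m by apply: le_trans Pm _; rewrite (_ : m = 1) ?mulr1//; apply/eqP; rewrite eq_le m1.
  by apply/eqP; rewrite eq_le m1 m1'.
pose t := Num.min 1 (m + del / 2).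
have tm : m < t by rewrite lt_min m1' ltrDl divr_gt0.
have t1 : t <= 1 by rewrite ge_min lexx.
have tdel : t <= m + del / 2 by rewrite ge_min lexx orbT.
have t01 : 0 <= t <= 1 by rewrite t1 (le_trans m0)// ltW.
suff : P t by move=> /(ub_le_sup hsP.2); rewrite leNgt tm.
split=> //; apply: le_trans (ler_distD (g m) _ _) _.
have := hdel t t01; rewrite ger0_norm ?subr_ge0 ?(ltW tm)// => h.
have : t - m < del by lra.
move/h => {}h; apply: le_trans (lerD h Pm) _.
by rewrite -mulrDr (_ : t - m + m = t)//; ring.
Qed.

End segments.

(** * Codimension-two sets and generic directions *)

Section ridges.
Context {R : realType} {n : nat}.
Local Notation vec := 'rV[R]_n.

(** With independent normals this is an affine subspace of codimension two; relative boundaries of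
    faces lie in finitely many of these. *)
Definition ridge (r : (vec * R) * (vec * R)) : set vec :=
  hyperplane r.1.1 r.1.2 `&` hyperplane r.2.1 r.2.2.

Definition ridges (rs : seq ((vec * R) * (vec * R))) : set vec :=
  [set x | exists2 r, r \in rs & ridge r x].

Definition independent (l k : vec) : Prop :=
  forall a b : R, a *: l + b *: k = 0 -> a = 0 /\ b = 0.

Definition proper_ridges (rs : seq ((vec * R) * (vec * R))) : Prop :=
  forall r, r \in rs -> independent r.1.1 r.2.1.

Lemma independent_neq0 l k : independent l k -> l != 0.
Proof.
move=> lk; apply/eqP => l0; have [] := lk 1 0.
  by rewrite l0 scaler0 scale0r addr0.
by move/eqP; rewrite oner_eq0.
Qed.

Lemma ridges_hyperplanes rs : proper_ridges rs ->
  exists2 s, proper_hyperplanes s & ridges rs `<=` hyperplanes s.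
Proof.
move=> rsP; exists (map fst rs).
  by move=> la /mapP[r rrs ->]; exact: independent_neq0 (rsP _ rrs).
by move=> x [r rrs [h _]]; exists r.1 => //; exact: map_f.
Qed.

(** A ridge moved along the direction [w] sweeps at most a hyperplane. Its equation is the
    combination of the two given ones that eliminates [t]; if [w] is parallel to the ridge, either
    of them will do. *)
Lemma ridge_translate r x w : independent r.1.1 r.2.1 ->
  exists la : vec * R, la.1 != 0 /\
    forall d t, ridge r (x + t *: w + d) -> hyperplane la.1 la.2 d.
Proof.
case: r => -[l a] [k b] /= lk.
pose u := dot l w; pose v := dot k w.
have [uv0|uv0] := pselect (u = 0 /\ v = 0).
  exists (l, a - dot l x); split; first exact: independent_neq0 lk.
  move=> d t [/=]; rewrite /hyperplane/= !dotDr dotZr -/u uv0.1 mulr0 addr0.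
  by move=> <- _; rewrite addrAC subrr add0r.
exists (v *: l - u *: k, v * (a - dot l x) - u * (b - dot k x)); split.
  apply/eqP => E; apply: uv0.
  have [] := lk v (- u); first by rewrite scaleNr.
  by move=> -> /eqP; rewrite oppr_eq0 => /eqP.
move=> d t [/=]; rewrite /hyperplane/= !dotDr !dotZr dotDl dotNl !dotZl -/u -/v.
by move=> <- <-; ring.
Qed.

(** The cone over a ridge with apex [x] outside of it lies in a hyperplane through [x]; its equation
    is the combination of the two given ones that holds at [x]. *)
Lemma ridge_cone r x : independent r.1.1 r.2.1 -> ~ ridge r x ->
  exists la : vec * R, la.1 != 0 /\
    forall d t, ridge r (x + t *: d) -> hyperplane la.1 la.2 d.
Proof.
case: r => -[l a] [k b] /= lk rx.
pose u := a - dot l x; pose v := b - dot k x.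
exists (v *: l - u *: k, 0); split.
  apply/eqP => E; have [] := lk v (- u); first by rewrite scaleNr.
  move=> v0 /eqP; rewrite oppr_eq0 => /eqP u0; apply: rx; split => /=.
    by apply/eqP; rewrite eq_sym -subr_eq0 -/u u0.
  by apply/eqP; rewrite eq_sym -subr_eq0 -/v v0.
move=> d t [/=]; rewrite /hyperplane/= !dotDr !dotZr dotDl dotNl !dotZl => ha hb.
have [t0|t0] := eqVneq t 0.
  by case: rx; split => /=; rewrite /hyperplane/= -?ha -?hb t0 mul0r addr0.
apply: (mulfI t0); rewrite mulr0 /u /v -ha -hb; ring.
Qed.

Lemma seq_choice (S T : eqType) (t0 : T) (rs : seq S) (P : S -> T -> Prop) :
  (forall r, r \in rs -> exists t, P r t) ->
  exists h : S -> T, forall r, r \in rs -> P r (h r).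
Proof.
move=> hP; have [|h hh] := @choice S T (fun r t => r \in rs -> P r t).
  move=> r; case: (boolP (r \in rs)) => [/hP[t Pt]|_]; first by exists t.
  by exists t0.
by exists h.
Qed.

(** These are the three segments of the path through [x], [x + d], [y + d], [y]. Each meets a given
    ridge only for [d] in one hyperplane: a cone for the first two, a translate for the middle
    one. *)
Lemma generic_detour rs x y : proper_ridges rs ->
  ~ ridges rs x -> ~ ridges rs y ->
  exists2 s, proper_hyperplanes s & forall d, ~ hyperplanes s d -> forall t,
    [/\ ~ ridges rs (x + t *: d), ~ ridges rs (y + t *: d) &
        ~ ridges rs (x + d + t *: (y - x))].
Proof.
move=> rsP rx ry.
have cone z : ~ ridges rs z -> forall r, r \in rs -> exists la : vec * R,
    la.1 != 0 /\ forall d t, ridge r (z + t *: d) -> hyperplane la.1 la.2 d.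
  move=> rz r rrs; apply: ridge_cone (rsP _ rrs) _.
  by move=> h; apply: rz; exists r.
have [hx hxP] := seq_choice (0, 0) (cone x rx).
have [hy hyP] := seq_choice (0, 0) (cone y ry).
have [hm hmP] := seq_choice (0, 0)
  (fun r rrs => ridge_translate x (y - x) (rsP r rrs)).
exists (map hx rs ++ map hy rs ++ map hm rs).
  move=> la; rewrite !mem_cat => /or3P[] /mapP[r rrs ->].
  - exact: (hxP r rrs).1.
  - exact: (hyP r rrs).1.
  - exact: (hmP r rrs).1.
move=> d hd t; split=> -[r rrs h]; apply: hd.
- exists (hx r); first by rewrite mem_cat map_f.
  exact: (hxP r rrs).2 h.
- exists (hy r); first by rewrite !mem_cat map_f// orbT.
  exact: (hyP r rrs).2 h.
- exists (hm r); first by rewrite !mem_cat map_f// !orbT.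
  by apply: ((hmP r rrs).2 d t); rewrite addrAC.
Qed.

End ridges.

Section detours.
Context {R : realType}.

(** Near [z], the path through [x], [x + d], [y + d], [y] stays in [A] and has a length comparable
    to [|x - y|]. A whole ball of vectors [d] is required in order that [d] can be chosen
    generic. *)
Definition detour n (A : set 'rV[R]_n) (z : 'rV[R]_n) : Prop :=
  exists r C : R, [/\ 0 < r, 0 <= C & forall x y, A x -> A y ->
    `|x - z| < r -> `|y - z| < r -> x <> y ->
    exists d0 : 'rV[R]_n, exists2 eps : R, 0 < eps & forall d : 'rV[R]_n,
      `|d - d0| < eps -> `|d| <= C * `|x - y| /\
      forall t : R, 0 <= t <= 1 ->
        [/\ A (x + t *: d), A (y + t *: d) & A (x + d + t *: (y - x))]].

Lemma normZ_unit n (t : R) (d : 'rV[R]_n) : 0 <= t <= 1 -> `|t *: d| <= `|d|.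
Proof.
by move=> /andP[t0 t1]; rewrite normrZ ger0_norm// ler_piMl.
Qed.

Lemma detour_open n (A : set 'rV[R]_n) z : open A -> A z -> detour A z.
Proof.
move=> oA Az; have /nbhs_rV_normP[e e0 hA] : nbhs z A by exact: open_nbhs_nbhs.
(* The path strays from [z] by less than [e / 5 + |d| + |x - y|], and each of the last two terms is
   below [2 e / 5]. *)
exists (e / 5), 1; split; [by rewrite divr_gt0|by []|].
move=> x y Ax Ay xz yz xy.
have xy0 : 0 < `|x - y|.
  by rewrite normr_gt0 subr_eq0; apply/eqP.
have xy2 : `|x - y| < e / 5 + e / 5.
  by apply: le_lt_trans (ler_distD z _ _) _; rewrite [`|z - y|]distrC ltrD.
exists 0, `|x - y| => // d; rewrite subr0 mul1r => dxy; split; first exact: ltW.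
have near p w : `|p - z| < e / 5 -> `|w| <= `|d| + `|x - y| -> A (p + w).
  move=> pz hw; apply: hA; rewrite addrAC; apply: le_lt_trans (ler_normD _ _) _.
  by move: xy2 dxy; lra.
move=> t t01; have td := normZ_unit d t01.
have tw := normZ_unit (y - x) t01; split.
- by apply: near => //; rewrite (le_trans td)// lerDl.
- by apply: near => //; rewrite (le_trans td)// lerDl.
- rewrite -addrA; apply: near => //; apply: le_trans (ler_normD _ _) _.
  by rewrite lerD2l [leRHS]distrC.
Qed.

Lemma enorm_le_norm n (x : 'rV[R]_n) : enorm x <= n%:R * `|x|.
Proof.
have nx0 : 0 <= n%:R * `|x| by rewrite mulr_ge0.
rewrite -(ler_pXn2r (n := 2))// ?nnegrE ?sqrtr_ge0// sqr_sqrtr; last first.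
  by apply: sumr_ge0 => i _; rewrite -expr2 sqr_ge0.
apply: (@le_trans _ _ (\sum_(i < n) `|x| ^+ 2)).
  apply: ler_sum => i _; rewrite -expr2 -[X in X <= _]ger0_norm ?sqr_ge0// normrX.
  by apply: lerXn2r; rewrite ?nnegrE// rV_norm_coord.
rewrite sumr_const card_ord exprMn -[leLHS]mulr_natl ler_wpM2r ?sqr_ge0//.
by case: n {x nx0} => [|n]; rewrite -?natrX ler_nat// leq_pmulr.
Qed.

Lemma rV_unconsD n (x y : 'rV[R]_n.+1) :
  (rV_uncons (x + y)).2 = (rV_uncons x).2 + (rV_uncons y).2.
Proof. by apply/rowP => i; rewrite !mxE. Qed.

Lemma rV_unconsD1 n (x y : 'rV[R]_n.+1) :
  (rV_uncons (x + y)).1 = (rV_uncons x).1 + (rV_uncons y).1.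
Proof. by rewrite /= mxE. Qed.

(** The uniform cone property of the region above a Lipschitz graph: a rise by [s] compensates any
    displacement [w] with [c |w| <= s]. *)
Lemma graph_cone n (Q : 'M[R]_n.+1) (gam : 'rV[R]_n -> R) (L : R) :
  Q *m Q^T = 1%:M ->
  (forall y z, `|gam y - gam z| <= L * enorm (y - z)) ->
  exists a : 'rV[R]_n.+1, exists2 c : R, 0 < c & forall (x w : 'rV[R]_n.+1) (s : R),
    gam (rV_uncons (x *m Q)).2 < (rV_uncons (x *m Q)).1 ->
    c * `|w| <= s ->
    gam (rV_uncons ((x + s *: a + w) *m Q)).2 < (rV_uncons ((x + s *: a + w) *m Q)).1.
Proof.
move=> QQ hgam; have [K K0 hK] := norm_mulmx Q.
have QtQ : Q^T *m Q = 1%:M by exact: mulmx1C.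
(* The direction is the vertical axis of the frame. The slope counts the vertical part of [w], at
   most [K |w|], and the variation of [gam] along its horizontal part; [n] compares the euclidean
   norm with the maximum norm. *)
exists (delta_mx ord0 ord0 *m Q^T), (K + `|L| * (n%:R * K)).
  by rewrite ltr_wpDr// mulr_ge0// mulr_ge0// ltW.
move=> x w s xg hw.
have -> : (x + s *: (delta_mx ord0 ord0 *m Q^T) + w) *m Q =
    x *m Q + s *: delta_mx ord0 ord0 + w *m Q.
  by rewrite !mulmxDl -scalemxAl -mulmxA QtQ mulmx1.
rewrite !rV_unconsD !rV_unconsD1.
have -> : (rV_uncons (s *: delta_mx ord0 ord0 : 'rV[R]_n.+1)).2 = 0.
  by apply/rowP => i; rewrite !mxE eqxx/= mulr0.
have -> : (rV_uncons (s *: delta_mx ord0 ord0 : 'rV[R]_n.+1)).1 = s.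
  by rewrite /= !mxE eqxx mulr1.
have hW := hK w; rewrite addr0.
move: xg hW; move: (x *m Q) (w *m Q) => X W xg hW.
have : `|W ord0 ord0| <= K * `|w| by apply: le_trans hW; exact: rV_norm_coord.
rewrite -[W ord0 ord0]/(rV_uncons W).1 => W0.
have W2 : `|(rV_uncons W).2| <= K * `|w|.
  apply: le_trans hW; apply/rV_norm_leP => // i; rewrite mxE.
  exact: rV_norm_coord.
have := hgam ((rV_uncons X).2 + (rV_uncons W).2) (rV_uncons X).2.
rewrite addrAC subrr add0r => hg.
have hg' : gam ((rV_uncons X).2 + (rV_uncons W).2) - gam (rV_uncons X).2 <=
    `|L| * (n%:R * K) * `|w|.
  apply: le_trans (ler_norm _) _; apply: le_trans hg _.
  rewrite -!mulrA; apply: (@le_trans _ _ (`|L| * enorm (rV_uncons W).2)).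
    by rewrite ler_wpM2r ?sqrtr_ge0 ?ler_norm.
  rewrite ler_wpM2l//; apply: le_trans (enorm_le_norm _) _.
  by rewrite ler_wpM2l.
move: hg' xg hw W0; rewrite mulrDl ler_norml; set g1 := gam _; set g2 := gam _.
by move: (_.1) (_.1) => u v h1 h2 h3 /andP[]; lra.
Qed.

Lemma detour_boundary n (A : set 'rV[R]_n.+1) z :
  lipschitz_boundary A -> boundary A z -> detour A z.
Proof.
move=> lA /lA[Q [gam [L [QQ hgam /nbhs_rV_normP[e e0 hA]]]]].
have [a [c c0 hc]] := graph_cone QQ hgam.
(* [C] bounds [|d| / |x - y|]: the shift [2 c a] and a tolerance of one. The radius [r] satisfies
   [r + (C + 1) (2 r) = e], so that all three segments stay where the boundary is a graph. *)
pose C := 2 * c * `|a| + 1; have C0 : 0 < C.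
  by rewrite ltr_wpDl// mulr_ge0// mulr_ge0// ltW.
pose r := e / (2 * C + 3); have r0 : 0 < r by rewrite divr_gt0// addr_gt0// mulr_gt0.
have rE : r * (2 * C + 3) = e by rewrite /r divfK// gt_eqF// addr_gt0// mulr_gt0.
have re : r < e by rewrite -rE ltr_pMr//; move: C0; lra.
exists r, C; split=> //; first exact: ltW.
move=> x y Ax Ay xz yz xy; set h := `|x - y|.
have h0 : 0 < h by rewrite normr_gt0 subr_eq0; apply/eqP.
have h2r : h < r + r.
  by apply: le_lt_trans (ler_distD z _ _) _; rewrite [`|z - y|]distrC ltrD.
(* A rise of [2 c h] absorbs a displacement of [2 h]: an error of [h] in the choice of [d], and the
   traverse [y - x]. *)
exists ((2 * c * h) *: a), h => // d; set w := d - _ => wh.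
have dE : d = (2 * c * h) *: a + w by rewrite /w addrC subrK.
have dC : `|d| <= C * h.
  rewrite dE; apply: le_trans (ler_normD _ _) _; rewrite (_ : C * h = 2 * c * `|a| * h + h); last by rewrite /C; ring.
  rewrite lerD ?(ltW wh)//.
  have ch0 : 0 <= 2 * c * h by rewrite mulr_ge0 ?normr_ge0// mulr_ge0// ltW.
  by rewrite normrZ (ger0_norm ch0) mulrAC.
have hy : `|y - x| = h by rewrite distrC.
have inA p v s : A p -> `|p - z| < r -> `|s *: a + v| <= C * h + h ->
    c * `|v| <= s -> A (p + (s *: a + v)).
  move=> Ap pz sv cv.
  have pe : `|p - z| < e by exact: lt_trans re.
  have hCh : C * h + h < (2 * C + 2) * r.
    rewrite (_ : _ + _ = (C + 1) * h); last by ring.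
    rewrite (_ : (_ + _) * r = (C + 1) * (r + r)); last by ring.
    by rewrite ltr_pM2l// addr_gt0.
  apply/hA; last by rewrite addrA; apply: hc => //; exact/hA.
  rewrite addrAC; apply: le_lt_trans (ler_normD _ _) _.
  by apply: lt_le_trans (ltr_leD pz (le_trans sv (ltW hCh))) _; rewrite -rE; lra.
split=> // t t01; have /andP[t0 t1] := t01.
have tdE : t *: d = (t * (2 * c * h)) *: a + t *: w by rewrite dE scalerDr scalerA.
have tdC : `|(t * (2 * c * h)) *: a + t *: w| <= C * h + h.
  rewrite -tdE; apply: le_trans (normZ_unit _ t01) _.
  by apply: le_trans dC _; rewrite lerDl ltW.
have tw : c * `|t *: w| <= t * (2 * c * h).
  rewrite normrZ ger0_norm// mulrCA ler_wpM2l// -mulrA mulrCA ler_wpM2l ?ltW//.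
  by move: wh h0; lra.
split; [by rewrite tdE; exact: inA..|].
have -> : x + d + t *: (y - x) = x + ((2 * c * h) *: a + (w + t *: (y - x))).
  by rewrite dE !addrA.
apply: inA => //.
  rewrite addrA -dE; apply: le_trans (ler_normD _ _) _; rewrite lerD//.
  by rewrite -hy; exact: normZ_unit.
rewrite (_ : 2 * c * h = c * (h + h)) ?ler_pM2l//; last by ring.
apply: le_trans (ler_normD _ _) _.
have := normZ_unit (y - x) t01; rewrite hy; move: wh; lra.
Qed.

(** The partition covers closures only, and this is what places the open cells inside the domain. If
    a boundary point [x] were interior to the closure, some point of [A] would lie near
    [x - m *: a], and the cone above it would contain [x]. *)
Lemma lipschitz_open_closureE n (A : set 'rV[R]_n.+1) :
  open A -> lipschitz_boundary A -> (closure A)° = A.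
Proof.
move=> oA lA; apply/seteqP; split; last first.
  by rewrite -{1}(iffLR (interior_id _) oA); apply: interiorS; exact: subset_closure.
move=> x iAx; have [//|nAx] := pselect (A x).
have cAx : closure A x by exact: interior_subset iAx.
have bx : boundary A x by split=> //; rewrite (iffLR (interior_id _) oA).
have [Q [gam [L [QQ hgam /nbhs_rV_normP[e e0 hA]]]]] := lA _ bx.
have [a [c c0 hc]] := graph_cone QQ hgam.
move: iAx => /nbhs_rV_normP[e' e'0 hcl].
(* [m] keeps [x - m *: a] within both radii, and [del] is at most [m / c], so that a rise by [m]
   absorbs a displacement of length [del]. *)
pose m := Num.min e e' / 2 / (`|a| + 1).
have a1 : 0 < `|a| + 1 by rewrite ltr_wpDl.
have mm0 : 0 < Num.min e e' by rewrite lt_min e0.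
have m0 : 0 < m by rewrite divr_gt0// divr_gt0.
have ma : `|m *: a| < Num.min e e' / 2.
  have -> : Num.min e e' / 2 = m * (`|a| + 1) by rewrite /m divfK// gt_eqF.
  by rewrite normrZ gtr0_norm// ltr_pM2l// ltrDl.
have mme : Num.min e e' / 2 < Num.min e e' by rewrite ltr_pdivrMr// ltr_pMr// ltr1n.
have cly : closure A (x - m *: a).
  apply: hcl; rewrite addrAC subrr add0r normrN.
  by apply: lt_trans ma _; apply: lt_le_trans mme _; rewrite ge_min lexx orbT.
pose del := Num.min (Num.min e e' / 2) (m / c).
have del0 : 0 < del by rewrite lt_min !divr_gt0.
have [y [Ay /= ydel]] : A `&` [set y | `|y - (x - m *: a)| < del] !=set0.
  by apply: cly; apply/nbhs_rV_normP; exists del.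
apply/(hA x); first by rewrite subrr normr0.
have -> : x = y + m *: a + (x - m *: a - y).
  by apply/rowP => i; rewrite !mxE; ring.
apply: hc.
  apply/(hA y) => //.
  rewrite (_ : y - x = y - (x - m *: a) - m *: a); last first.
    by apply/rowP => i; rewrite !mxE; ring.
  apply: le_lt_trans (ler_normB _ _) _.
  have d1 : del <= Num.min e e' / 2 by rewrite ge_min lexx.
  have d2 : Num.min e e' <= e by rewrite ge_min lexx.
  by move: ydel ma d1 d2; lra.
rewrite distrC mulrC -ler_pdivlMr//; apply: le_trans (ltW ydel) _.
by rewrite ge_min lexx orbT.
Qed.

End detours.

(** * Lipschitz extension and passage from local to global estimates *)

Section extension.
Context {R : realType} {n : nat}.
Local Notation vec := 'rV[R]_n.

(** McShane's extension, the infimum of the cones of slope [C] standing on the graph of [v]. *)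
Lemma lipschitz_extension (D : set vec) (v : vec -> R) (C : R) :
  D !=set0 -> 0 <= C ->
  (forall x y, D x -> D y -> `|v x - v y| <= C * `|x - y|) ->
  exists V : vec -> R, (forall x y, `|V x - V y| <= C * `|x - y|) /\
    forall x, D x -> V x = v x.
Proof.
move=> [y0 Dy0] C0 hv.
pose E (x : vec) : set R := [set v y + C * `|x - y| | y in D].
have hE x x' y : D y -> v y + C * `|x - y| <= v y + C * `|x' - y| + C * `|x - x'|.
  by move=> Dy; rewrite -addrA lerD2l -mulrDr ler_wpM2l// [leRHS]addrC ler_distD.
have infE x : has_inf (E x).
  split; first by exists (v y0 + C * `|x - y0|), y0.
  exists (v y0 - C * `|x - y0|) => _ [y Dy <-].
  have := hv y0 y Dy0 Dy; rewrite ler_norml => /andP[_].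
  have := ler_wpM2l C0 (ler_distD x y0 y); rewrite mulrDr [`|y0 - x|]distrC.
  lra.
have one x x' : inf (E x) <= inf (E x') + C * `|x - x'|.
  rewrite -lerBlDr; apply: lb_le_inf; first exact: (infE x').1.
  move=> _ [y Dy <-]; rewrite lerBlDr; apply: le_trans (hE x x' y Dy).
  by apply: ge_inf; [exact: (infE x).2|exists y].
exists (fun x => inf (E x)); split.
  move=> x y; rewrite ler_norml lerBlDl; apply/andP; split; last exact: one.
  have := one y x; rewrite distrC; lra.
move=> x Dx; apply/eqP; rewrite eq_le; apply/andP; split.
  apply: ge_inf; first exact: (infE x).2.
  by exists x => //; rewrite subrr normr0 mulr0 addr0.
apply: lb_le_inf; first exact: (infE x).1.
move=> _ [y Dy <-]; rewrite -lerBlDl.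
by apply: le_trans (hv x y Dx Dy); exact: ler_norm.
Qed.

Lemma lipschitz_continuous (V : vec -> R) (C : R) : 0 <= C ->
  (forall x y, `|V x - V y| <= C * `|x - y|) -> continuous V.
Proof.
move=> C0 VC z; apply: (iffRL (@cvgrPdist_lt _ _ _ (nbhs z) (nbhs_filter z) V (V z))).
move=> eps eps0; apply/nbhs_rV_normP.
exists (eps / (C + 1)); first by rewrite divr_gt0// ltr_wpDl.
move=> y; rewrite ltr_pdivlMr ?ltr_wpDl// distrC => h.
apply: le_lt_trans (VC _ _) _; apply: le_lt_trans h.
by rewrite mulrC ler_wpM2l// lerDl.
Qed.

Lemma bounded_closure_rV (A : set vec) : bounded_set A -> bounded_set (closure A).
Proof.
move=> /bounded_rVP[M M0 hM]; apply/bounded_rVP; exists (M + 1).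
  by rewrite addr_gt0.
move=> x cx; have [y [Ay /= yx]] : A `&` [set y | `|y - x| < 1] !=set0.
  by apply: cx; apply/nbhs_rV_normP; exists 1.
rewrite -(subrK y x); apply: le_lt_trans (ler_normD _ _) _.
by rewrite addrC ltrD ?hM// distrC.
Qed.

(** Pairs closer than [r / 2] are covered by the local constant, other pairs by the bound on [v].
    Near-covering compactness, with the constant tending to infinity as second variable, makes the
    choice uniform. *)
Lemma locally_lipschitz_compact (K D : set vec) (v : vec -> R) (B : R) :
  compact K -> D `<=` K -> (forall x, D x -> `|v x| <= B) ->
  (forall z, K z -> exists r C : R, 0 < r /\ forall x y, D x -> D y ->
     `|x - z| < r -> `|y - z| < r -> `|v x - v y| <= C * `|x - y|) ->
  exists2 C : R, 0 <= C & forall x y, D x -> D y -> `|v x - v y| <= C * `|x - y|.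
Proof.
move=> /compact_near_coveringP cK DK vB loc.
pose P (C : R) x := D x -> forall y, D y -> `|v x - v y| <= C * `|x - y|.
have FF : Filter (+oo%R : set_system R) by exact: _.
have locP z : K z -> \forall x \near z & C \near +oo, P C x.
  move=> /loc[r [C1 [r0 hr]]].
  have r20 : 0 < r / 2 by rewrite divr_gt0.
  pose C := Num.max `|C1| ((B + B) / (r / 2)).
  exists ([set x | `|x - z| < r / 2], [set C' | C < C']) => /=.
    split; first by apply/nbhs_rV_normP; exists (r / 2).
    by exists C; split; [exact: num_real|].
  move=> [x C'] /= [xz CC'] Dx y Dy.
  have [xy|xy] := ltP `|x - y| (r / 2).
    apply: le_trans (hr x y Dx Dy _ _) _.
    + by apply: lt_trans xz _; rewrite ltr_pdivrMr// ltr_pMr// ltr1n.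
    + apply: le_lt_trans (ler_distD x _ _) _; rewrite distrC.
      by rewrite [ltRHS]splitr ltrD.
    rewrite ler_wpM2r//; apply: le_trans (ler_norm _) _.
    by apply: le_trans (ltW CC'); rewrite le_max lexx.
  apply: (@le_trans _ _ (B + B)).
    by apply: le_trans (ler_normB _ _) _; rewrite lerD// vB.
  have h : (B + B) / (r / 2) <= C' by apply: le_trans (ltW CC'); rewrite le_max lexx orbT.
  have B0 : 0 <= B + B by rewrite addr_ge0// (le_trans _ (vB x Dx)).
  have C'0 : 0 <= C' by apply: le_trans h; rewrite divr_ge0// ltW.
  by move: h; rewrite ler_pdivrMr// => /le_trans; apply; rewrite ler_wpM2l.
have [C0 [_ hC]] := cK _ _ P FF locP.
exists (Num.max 0 (C0 + 1)); first by rewrite le_max lexx.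
move=> x y Dx Dy; apply: le_trans (hC (C0 + 1) _ x (DK _ Dx) Dx y Dy) _.
  by rewrite ltrDl.
by rewrite ler_wpM2r// le_max lexx orbT.
Qed.

(** The estimate holds on segments that avoid the ridges. A generic detour consists of three such
    segments of total length at most [(2 C + 1) |x - y|], which gives the local constant. *)
Lemma detour_lipschitz (A : set vec) rs (v : vec -> R) (L B : R) :
  open A -> bounded_set A -> (forall z, closure A z -> detour A z) ->
  proper_ridges rs -> 0 <= L ->
  (forall x, A x -> ~ ridges rs x -> `|v x| <= B) ->
  (forall x y, (forall t : R, 0 <= t <= 1 ->
      A (x + t *: (y - x)) /\ ~ ridges rs (x + t *: (y - x))) ->
    `|v x - v y| <= L * `|x - y|) ->
  exists2 C : R, 0 <= C & forall x y, A x -> A y ->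
    ~ ridges rs x -> ~ ridges rs y -> `|v x - v y| <= C * `|x - y|.
Proof.
move=> oA bA dA rsP L0 vB hv.
have [||||C C0 hC] := @locally_lipschitz_compact (closure A) (A `\` ridges rs) v B.
- apply: bounded_closed_compact; last exact: closed_closure.
  exact: bounded_closure_rV.
- by move=> x [Ax _]; exact: subset_closure.
- by move=> x [Ax nx]; exact: vB.
- move=> z /dA[r [C [r0 C0 hd]]]; exists r, (L * (2 * C + 1)); split=> //.
  move=> x y [Ax nx] [Ay ny] xz yz.
  have [->|/eqP xy] := eqVneq x y; first by rewrite !subrr !normr0 mulr0.
  have [d0 [eps eps0 hd0]] := hd x y Ax Ay xz yz xy.
  have [s sP hs] := generic_detour rsP nx ny.
  have [d [dd0 nd]] := proper_hyperplanes_dense d0 sP eps0.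
  have [dC dA'] := hd0 d dd0; have dr := hs d nd.
  have seg p : (forall t : R, 0 <= t <= 1 -> A (p + t *: d)) ->
      (forall t : R, ~ ridges rs (p + t *: d)) -> `|v p - v (p + d)| <= L * (C * `|x - y|).
    move=> h1 h2; apply: le_trans (hv _ _ _) _.
      by move=> t t01; rewrite addrAC subrr add0r; split; [exact: h1|exact: h2].
    by rewrite distrC addrAC subrr add0r ler_wpM2l.
  have mid : `|v (x + d) - v (y + d)| <= L * `|x - y|.
    have -> : x - y = x + d - (y + d) by rewrite opprD addrACA subrr addr0.
    apply: hv => t t01.
    have -> : y + d - (x + d) = y - x by rewrite opprD addrACA subrr addr0.
    by split; [have [] := dA' t t01|have [] := dr t].
  have hx := seg x (fun t t01 => let: And3 a _ _ := dA' t t01 in a)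
    (fun t => let: And3 a _ _ := dr t in a).
  have hy := seg y (fun t t01 => let: And3 _ a _ := dA' t t01 in a)
    (fun t => let: And3 _ a _ := dr t in a).
  apply: le_trans (ler_distD (v (x + d)) _ _) _.
  have := ler_distD (v (y + d)) (v (x + d)) (v y); rewrite [`|v (y + d) - v y|]distrC.
  move: hx hy mid; set h := `|x - y|.
  rewrite (_ : L * (2 * C + 1) * h = L * (C * h) + L * (C * h) + L * h); last by ring.
  lra.
by exists C => // x y Ax Ay nx ny; exact: hC.
Qed.

End extension.

Section gluing.
Context {R : realType} {n : nat} (Omega : set 'rV[R]_n.+1) (M : mesh R n).
Hypotheses (meshM : polytopal_partition Omega M) (domOmega : lipschitz_domain Omega).
Local Notation vec := 'rV[R]_n.+1.

Lemma cell_subset (T : cells M) : cell T `<=` Omega.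
Proof.
have [_ oO _ _ lO] := domOmega.
move=> x Tx; rewrite -(lipschitz_open_closureE oO lO).
have : nbhs x (cell T) by apply: open_nbhs_nbhs; split=> //; exact: (@cell_open _ _ _ _ meshM).
apply: filterS => y Ty; rewrite (cell_cover meshM); exists T => //.
exact: subset_closure.
Qed.

(** A point of the relative boundary lies on the hyperplane of the face and on a facet hyperplane of
    the reference set carried over by the chart. The two normals are orthogonal and nonzero, hence
    independent. *)
Lemma skeleton_ridges : exists2 rs, proper_ridges rs &
  forall (E : faces M) (x : vec), closure (face E) x -> ~ face E x -> ridges rs x.
Proof.
have ex (E : faces M) : exists rs, proper_ridges rs /\
    forall x : vec, closure (face E) x -> ~ face E x -> ridges rs x.
  have [T TE] := face_incident meshM E.
  have [s sP hs] := open_polytope_boundary (face_polytope meshM E).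
  have [_ orth _] := Defs.normalP meshM TE.
  have nn : dot (normal T E) (normal T E) = 1 by have [] := Defs.normalP meshM TE.
  have BB := face_isometry meshM E.
  set nu := normal T E in orth nn; set B := face_frm E in orth BB.
  have nB l : dot nu (l *m B) = 0.
    by rewrite dot_mulmx dotC dotE trmx_mul trmxK orth mulmx0 mxE.
  exists (map (fun la => ((nu, dot nu (face_org E)),
    (la.1 *m B, la.2 + dot (la.1 *m B) (face_org E)))) s); split.
    move=> r /mapP[la las ->] /= a b E0.
    have a0 : a = 0.
      have : dot nu (a *: nu + b *: (la.1 *m B)) = 0 by rewrite E0 dotC dot0l.
      by rewrite dotDr !dotZr nn nB mulr1 mulr0 addr0.
    split=> //; move: E0; rewrite a0 scale0r add0r => /(congr1 (mulmx^~ B^T)).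
    rewrite mul0mx -scalemxAl -mulmxA BB mulmx1 => /eqP.
    by rewrite scaler_eq0 (negPf (sP _ las)) orbF => /eqP.
  move=> x cx nx; have [cy xE] := closure_face_ref meshM cx.
  have ny : ~ face_ref E (unchart E x) by move=> h; apply: nx; exists (unchart E x).
  have [la las h] := hs _ cy ny; exists ((nu, dot nu (face_org E)),
    (la.1 *m B, la.2 + dot (la.1 *m B) (face_org E))); first exact: map_f.
  rewrite xE /chart; split; rewrite /hyperplane/= dotDr.
    by rewrite nB addr0.
  by rewrite [X in _ + X]dot_mulmx -mulmxA BB mulmx1 h addrC.
have [h hP] := choice ex.
exists (flatten [seq h E | E <- enum (faces M)]).
  by move=> r /flattenP[_ /mapP[E _ ->] rE]; exact: (hP E).1.
move=> E x cx nx; have [r rE rx] := (hP E).2 x cx nx.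
by exists r => //; apply/flattenP; exists (h E) => //; apply: map_f; rewrite mem_enum.
Qed.

Variable e : cells M -> vec -> R.
Hypothesis e_C1 : forall T, C1 (e T).
Hypothesis e_agree : forall T T' E x, incident T E -> incident T' E ->
  face E x -> e T x = e T' x.

Lemma closure_cell_agree rs T T' x :
  (forall (E : faces M) (x : vec), closure (face E) x -> ~ face E x -> ridges rs x) ->
  ~ ridges rs x -> closure (cell T) x -> closure (cell T') x -> e T x = e T' x.
Proof.
move=> rsE nx cx cx'.
have meet (U U' : cells M) : cell U x -> closure (cell U') x -> U = U'.
  move=> Ux cx1; have [//|/(cell_disjoint meshM) UU'] := eqVneq U U'.
  have [y yU] : cell U `&` cell U' !=set0.
    rewrite setIC; apply: cx1; apply: open_nbhs_nbhs.
    by split => //; exact: (@cell_open _ _ _ _ meshM).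
  by have : set0 y by rewrite -UU'.
have onface (U : cells M) : closure (cell U) x -> ~ cell U x -> exists2 E, incident U E & face E x.
  move=> cU nU; have : boundary (cell U) x by rewrite (boundary_cellE meshM).
  rewrite (face_cover meshM) => -[E /= UE cE]; exists E => //.
  by apply: contrapT => nE; apply: nx; exact: rsE nE.
have [Tx|nTx] := pselect (cell T x); first by rewrite (meet _ _ Tx cx').
have [T'x|nT'x] := pselect (cell T' x); first by rewrite (meet _ _ T'x cx).
have [E TE Ex] := onface T cx nTx; have [E' TE' E'x] := onface T' cx' nT'x.
have [EE|/(face_disjoint meshM) EE'] := eqVneq E E'.
  by apply: e_agree TE _ Ex; rewrite EE.
by have : set0 x by rewrite -EE'.
Qed.

(** On a ridge the value depends on the cell picked and has no meaning. The function is used only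
    off the ridges; the values there are recovered by extension. *)
Definition glued (x : vec) : R :=
  if pselect (exists T, closure (cell T) x) is left w then e (projT1 (cid w)) x else 0.

Lemma gluedE rs T x :
  (forall (E : faces M) (x : vec), closure (face E) x -> ~ face E x -> ridges rs x) ->
  ~ ridges rs x -> closure (cell T) x -> glued x = e T x.
Proof.
move=> rsE nx cx; rewrite /glued; case: pselect => [w|]; last by case; exists T.
by case: (cid w) => T' /= cx'; exact: closure_cell_agree rsE nx cx' cx.
Qed.

(** The estimate on segments and the detours make [glued] Lipschitz on the domain minus the ridges,
    and the extension is continuous. As the complement of the ridges is dense in each cell, it
    agrees with the corresponding piece on the whole closed cell. *)
Lemma lipschitz_gluing : exists V : vec -> R, exists2 C : R, 0 <= C &
  (forall x y, `|V x - V y| <= C * `|x - y|) /\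
  forall T x, closure (cell T) x -> V x = e T x.
Proof.
have [[x0 Ox0] oO bO _ lO] := domOmega.
have [rs rsP rsE] := skeleton_ridges.
have /bounded_rVP[B B0 hB] : bounded_set (closure Omega) by exact: bounded_closure_rV.
have [L1 L1P] := choice (fun T => let: ex_intro2 L L0 h := C1_lipschitz B (e_C1 T) in
  ex_intro (fun L => 0 < L /\ forall x y, `|x| < B -> `|y| < B ->
    `|e T x - e T y| <= L * `|x - y|) L (conj L0 h)).
pose L := \sum_T L1 T.
have hL T : L1 T <= L.
  rewrite /L (bigD1 T)//= lerDl; apply: sumr_ge0 => U _.
  by rewrite ltW// (L1P U).1.
have L0 : 0 <= L by apply: sumr_ge0 => U _; rewrite ltW// (L1P U).1.
have eL T x y : closure Omega x -> closure Omega y -> `|e T x - e T y| <= L * `|x - y|.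
  move=> /hB xB /hB yB; apply: le_trans ((L1P T).2 _ _ xB yB) _.
  by rewrite ler_wpM2r.
have cellx x : closure Omega x -> exists T : cells M, closure (cell T) x.
  by rewrite (cell_cover meshM) => -[T _ cx]; exists T.
have [B' vB] : exists B' : R, forall x, closure Omega x -> ~ ridges rs x -> `|glued x| <= B'.
  exists (\sum_T (`|e T x0| + L * (B + B))) => x cx nx.
  have [T cT] := cellx x cx; rewrite (gluedE rsE nx cT).
  have h0 U : 0 <= `|e U x0| + L * (B + B).
    by rewrite addr_ge0// mulr_ge0// addr_ge0// ltW.
  rewrite (bigD1 T)//= -[leLHS]addr0 lerD ?sumr_ge0//.
  have := eL T x x0 cx (subset_closure Ox0); rewrite distrC => h.
  apply: (@le_trans _ _ (`|e T x0| + `|e T x0 - e T x|)).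
    by rewrite -{1}(subKr (e T x0) (e T x)) ler_normB.
  rewrite lerD2l (le_trans h)// ler_wpM2l//; apply: le_trans (ler_normB _ _) _.
  by apply: lerD; apply/ltW/hB => //; exact: subset_closure.
have seg x y : (forall t : R, 0 <= t <= 1 ->
      Omega (x + t *: (y - x)) /\ ~ ridges rs (x + t *: (y - x))) ->
    `|glued x - glued y| <= L * `|x - y|.
  move=> hxy; pose g (t : R) := glued (x + t *: (y - x)).
  have -> : glued x = g 0 by rewrite /g scale0r addr0.
  have -> : glued y = g 1 by rewrite /g scale1r addrC subrK.
  rewrite distrC; apply: lipschitz_unit_interval => s s01.
  have [Op np] := hxy s s01; set p := x + s *: (y - x) in Op np *.
  (* Near [p] only closed cells that contain [p] are met, so a nearby point shares a closed cell
     with [p] and a single smooth piece controls the difference. *)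
  have : nbhs p [set q | forall T : cells M, closure (cell T) q -> closure (cell T) p].
    apply: (@filter_forall _ _ (fun (T : cells M) q =>
      closure (cell T) q -> closure (cell T) p) (nbhs p) (nbhs_filter p)) => T.
    have [cT|nT] := pselect (closure (cell T) p); first by apply: filterE => q _.
    have : nbhs p (~` closure (cell T)).
      by apply: open_nbhs_nbhs; split=> //; exact/closed_openC/closed_closure.
    by apply: filterS => q.
  move=> /nbhs_rV_normP[r r0 hr].
  exists (r / (`|y - x| + 1)); first by rewrite divr_gt0// ltr_wpDl.
  move=> t t01 ts; have [Oq nq] := hxy t t01; set q := x + t *: (y - x) in Oq nq *.
  have qp : `|q - p| = `|x - y| * `|t - s|.
    by rewrite /q /p opprD addrACA subrr add0r -scalerBl normrZ [`|x - y|]distrC mulrC.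
  have [T cq] := cellx q (subset_closure Oq).
  have cp : closure (cell T) p.
    apply: (hr q) => //; rewrite qp [`|x - y|]distrC.
    move: ts; rewrite ltr_pdivlMr ?ltr_wpDl// => ts.
    by apply: le_lt_trans ts; rewrite mulrC ler_wpM2l// lerDl.
  rewrite /g (gluedE rsE nq cq) (gluedE rsE np cp) -mulrA -qp.
  by apply: eL; exact: subset_closure.
have [|C C0 hC] := @detour_lipschitz R n.+1 Omega rs glued L B' oO bO _ rsP L0
    (fun x Ox => vB x (subset_closure Ox)) seg.
  move=> z cz; have [Oz|nOz] := pselect (Omega z); first exact: detour_open.
  by apply: detour_boundary => //; split=> //; rewrite (iffLR (interior_id _) oO).
have [s sP rss] := ridges_hyperplanes rsP.
have dense x (U : set vec) : open U -> U x -> U `<=` Omega ->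
    closure (U `&` [set y | ~ hyperplanes s y]) x.
  move=> oU Ux UO A /nbhs_rV_normP[r r0 hr].
  have /nbhs_rV_normP[r' r'0 hr'] : nbhs x U by exact: open_nbhs_nbhs.
  have [|y [yx ny]] := proper_hyperplanes_dense x sP (_ : 0 < Num.min r r').
    by rewrite lt_min r0.
  move: yx; rewrite lt_min => /andP[yr yr'].
  by exists y; split; [split; [exact: hr'|]|exact: hr].
have D0 : Omega `\` ridges rs !=set0.
  have [y [[Oy ny] _]] := dense x0 Omega oO Ox0 (@subset_refl _ _) setT filterT.
  by exists y; split=> // /rss.
have [V [VC VE]] := lipschitz_extension D0 C0
  (fun x y Dx Dy => hC x y Dx.1 Dy.1 Dx.2 Dy.2).
exists V, C => //; split=> // T x cx.
have Vc : continuous V by exact: lipschitz_continuous C0 VC.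
have cZ : closed [set y | V y - e T y = 0].
  apply: (closed_comp (f := fun y => V y - e T y) (D := [set 0])).
    by move=> y _; apply: continuousB; [exact: Vc|exact: C1_continuous].
  exact: closed_eq.
apply/eqP; rewrite -subr_eq0; apply/eqP; apply: (cZ); apply: closureS cx => y Ty.
apply: (cZ); apply: (@closureS _ (cell T `&` [set z | ~ hyperplanes s z])); last first.
  apply: dense => //; last exact: cell_subset.
  exact: (@cell_open _ _ _ _ meshM T).
move=> z [Tz nz] /=; have nr : ~ ridges rs z by move=> /rss.
rewrite VE; last by split=> //; exact: cell_subset Tz.
by rewrite (gluedE rsE nr (subset_closure Tz)) subrr.
Qed.

End gluing.

(** * Bounded convergence on sets of finite measure *)

Section bounded_convergence.
Context d (T : measurableType d) {R : realType} (mu : {measure set T -> \bar R}).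

Lemma bounded_integrable (D : set T) (f : T -> R) (K : R) : measurable D ->
  (mu D < +oo)%E -> measurable_fun D f -> (forall x, D x -> `|f x| <= K) ->
  mu.-integrable D (EFin \o f).
Proof.
move=> mD Doo mf fK; apply: (@le_integrable _ _ _ mu D mD _ (cst K%:E)).
- exact/measurable_EFinP.
- move=> x Dx /=; rewrite lee_fin; apply: le_trans (fK x Dx) _; exact: ler_norm.
- exact: (@measurable_bounded_integrable _ _ _ mu (cst K) D mD Doo (measurable_cst _) (bounded_cst K _)).
Qed.

Lemma bounded_cvg_integral (D : set T) (f_ : nat -> T -> R) (f : T -> R) (K : R) :
  measurable D -> (mu D < +oo)%E -> (forall m, measurable_fun D (f_ m)) ->
  measurable_fun D f -> (forall m x, D x -> `|f_ m x| <= K) ->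
  {ae mu, forall x, D x -> f_ ^~ x @ \oo --> f x} ->
  mu.-integrable D (EFin \o f) /\
  (fun m => \int[mu]_(x in D) (f_ m x)%:E)%E @ \oo --> (\int[mu]_(x in D) (f x)%:E)%E.
Proof.
move=> mD Doo mf_ mf fK fcv.
have ik : mu.-integrable D (cst K%:E).
  exact: (@measurable_bounded_integrable _ _ _ mu (cst K) D mD Doo (measurable_cst _) (bounded_cst K _)).
have [||||| fi _ h] := @dominated_convergence _ _ _ mu D mD (fun m => EFin \o f_ m)
   (EFin \o f) (cst K%:E).
- by move=> m; exact/measurable_EFinP.
- exact/measurable_EFinP.
- apply: filterS fcv => x h Dx; apply/fine_cvgP; split; first exact: filterE.
  exact: h.
- exact: ik.
- by apply/nearW => x m Dx /=; rewrite lee_fin fK.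
- by split.
Qed.

Lemma measurable_norm_powR (D : set T) (f : T -> R) (p : R) : measurable_fun D f ->
  measurable_fun D (fun x => `|f x| `^ p).
Proof.
move=> mf; apply: (@measurableT_comp _ _ _ _ _ _ (fun r : R => r `^ p)).
  exact: measurable_powR.
exact: measurableT_comp.
Qed.


Lemma bounded_cvg_Rintegral (D : set T) (f_ : nat -> T -> R) (f : T -> R) (K : R) :
  measurable D -> (mu D < +oo)%E -> (forall m, measurable_fun D (f_ m)) ->
  measurable_fun D f -> (forall m x, D x -> `|f_ m x| <= K) ->
  {ae mu, forall x, D x -> f_ ^~ x @ \oo --> f x} ->
  (fun m => \int[mu]_(x in D) f_ m x) @ \oo --> \int[mu]_(x in D) f x.
Proof.
move=> mD Doo mf_ mf fK fcv.
have [fi h] := bounded_cvg_integral mD Doo mf_ mf fK fcv.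
apply: fine_cvg; rewrite fineK//; exact: integrable_fin_num.
Qed.

Lemma bounded_Lp_cvg (D : set T) (f_ : nat -> T -> R) (f : T -> R) (K p : R) : 0 < p ->
  measurable D -> (mu D < +oo)%E -> (forall m, measurable_fun D (f_ m)) ->
  measurable_fun D f -> (forall m x, D x -> `|f_ m x - f x| <= K) ->
  {ae mu, forall x, D x -> f_ ^~ x @ \oo --> f x} -> Lp_cvg mu p D f_ f.
Proof.
move=> p0 mD Doo mf_ mf fK fcv; rewrite /Lp_cvg.
have [|//|||fi] := @bounded_cvg_integral D (fun m x => `|f_ m x - f x| `^ p)
  (cst 0) (`|K| `^ p) mD Doo.
- by move=> m; apply: measurable_norm_powR; exact: measurable_funB.
- move=> m x Dx; rewrite ger0_norm ?powR_ge0//; apply: ge0_ler_powR => //.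
  + exact: ltW.
  + by apply: le_trans (fK m x Dx) _; exact: ler_norm.
- apply: filterS fcv => x h Dx.
  have h1 : (fun m => `|f_ m x - f x|) @ \oo --> (0 : R).
    rewrite -(normr0 R); apply: cvg_norm; rewrite -(subrr (f x)).
    by apply: cvgB; [exact: h|exact: cvg_cst].
  apply/cvgrPdist_lt => eps eps0.
  have ep : 0 < eps `^ p^-1 by rewrite powR_gt0.
  move/cvgrPdist_lt : h1 => /(_ _ ep); apply: filterS => m; rewrite sub0r normrN normr_id => hm.
  rewrite /= sub0r normrN ger0_norm ?powR_ge0//.
  have -> : eps = (eps `^ p^-1) `^ p by rewrite -powRrM mulVf ?gt_eqF// powRr1// ltW.
  by apply: gt0_ltr_powR => //; rewrite nnegrE ltW.
by rewrite integral0_eq// => x _.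
Qed.

Lemma bounded_in_Lp (D : set T) (f : T -> R) (K p : R) : 0 < p ->
  measurable D -> (mu D < +oo)%E -> measurable_fun D f ->
  (forall x, D x -> `|f x| <= K) -> in_Lp mu p D f.
Proof.
move=> p0 mD Doo mf fK; split=> //.
have : mu.-integrable D (EFin \o (fun x => `|f x| `^ p)).
  apply: (@bounded_integrable _ _ (`|K| `^ p)) => //.
    exact: measurable_norm_powR.
  move=> x Dx; rewrite ger0_norm ?powR_ge0//; apply: ge0_ler_powR => //.
  - exact: ltW.
  - by apply: le_trans (fK x Dx) _; exact: ler_norm.
move=> /integrableP[_]; apply: le_lt_trans; apply: ge0_le_integral => //.
- by apply/measurable_EFinP; exact: measurable_norm_powR.
- by apply: measurableT_comp => //; apply/measurable_EFinP; exact: measurable_norm_powR.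
- by move=> x _ /=; rewrite lee_fin ler_norm.
Qed.

Lemma Rintegral_support (A : set T) (g : T -> R) : measurable A ->
  (forall x, ~ A x -> g x = 0) -> \int[mu]_(x in A) g x = \int[mu]_x g x.
Proof.
move=> mA gA; rewrite /Rintegral integral_mkcond; congr fine.
by apply: eq_integral => x _; rewrite patchE; case: ifPn => // /negP; rewrite inE => /gA ->.
Qed.

End bounded_convergence.

Section compact_support.
Context {R : realType} {n : nat}.
Local Notation vec := 'rV[R]_n.
Local Notation mu := (lebesgue_rV n).

Lemma pderiv_support (F : vec -> R) (i : 'I_n) (K : set vec) : closed K ->
  (forall x, ~ K x -> F x = 0) -> forall x, ~ K x -> pderiv i F x = 0.
Proof.
move=> cK FK x Kx; rewrite /pderiv (@near_eq_derive _ _ _ _ (cst 0)); last first.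
  by apply: filterS (open_nbhs_nbhs (conj (closed_openC cK) Kx)) => y /= /FK.
exact: derive_cst.
Qed.

(** Difference quotients of a compactly supported function integrate to zero by translation
    invariance; they are bounded by a Lipschitz constant and converge to the derivative. *)
Lemma Rintegral_pderiv0 (F : vec -> R) (i : 'I_n) (K A : set vec) : C1 F ->
  compact K -> (forall x, ~ K x -> F x = 0) -> K `<=` A -> measurable A ->
  \int[mu]_(x in A) pderiv i F x = 0.
Proof.
move=> F1 cK FK KA mA.
have clK : closed K by apply: compact_closed => //; exact: norm_hausdorff.
rewrite Rintegral_support//; last first.
  by move=> x nA; apply: (pderiv_support _ clK FK) => /KA.
have [a a0 ha] := iffLR (bounded_rVP _) (compact_bounded cK).
(* The margin of one lets this ball contain the supports of [F] and of its translates by [h m *: v],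
   so that integrals over it are integrals over the whole space. *)
pose D : set vec := [set x | `|x| < a + 1].
have oD : open D.
  rewrite (_ : D = (fun x : vec => `|x|) @^-1` [set r | r < a + 1])//.
  apply: open_comp; last exact: open_lt.
  by move=> x _; exact: norm_continuous.
have bD : bounded_set D by apply/bounded_rVP; exists (a + 1) => //; rewrite addr_gt0.
have mD : measurable D by exact: open_measurable_rV.
have Doo : (mu D < +oo)%E by exact: lebesgue_rV_bounded_lty.
have KD : K `<=` D by move=> x /ha xa; rewrite /D/= (lt_trans xa)// ltrDl.
rewrite -(@Rintegral_support _ _ _ mu D)//; last first.
  by move=> x nD; apply: (pderiv_support _ clK FK) => /KD.
pose v : vec := delta_mx ord0 i.
have v1 : `|v| <= 1 by exact: rV_norm_delta.
pose h (m : nat) : R := m.+1%:R^-1.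
have h0 m : 0 < h m by rewrite invr_gt0.
have h1 m : h m <= 1 by rewrite invf_le1// ler1n.
pose q m (x : vec) : R := (h m)^-1 * (F (x + h m *: v) - F x).
have Fc : continuous F by exact: C1_continuous.
have Fsc m : continuous (fun x : vec => F (x + h m *: v)).
  move=> x; apply: continuous_comp; last exact: Fc.
  by apply: continuousD; [exact: id|exact: cst_continuous].
have hvl m : `|h m *: v| <= 1.
  by rewrite normrZ gtr0_norm// -[leRHS]mulr1 ler_pM// ltW.
have q0 m : \int[mu]_(x in D) q m x = 0.
  have FsD x : ~ D x -> F (x + h m *: v) = 0.
    move=> nD; apply: FK => /ha xa; apply: nD.
    rewrite /D/= -[x](addrK (h m *: v)); apply: le_lt_trans (ler_normB _ _) _.
    by rewrite ltr_leD.
  have FD x : ~ D x -> F x = 0 by move=> nD; apply: FK => /KD.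
  have iF : mu.-integrable D (EFin \o F) by exact: continuous_integrable_rV.
  have iFs : mu.-integrable D (EFin \o (fun x => F (x + h m *: v))).
    exact: continuous_integrable_rV.
  rewrite RintegralZl//; last by apply: continuous_integrable_rV => // x; apply: continuousB; [exact: Fsc|exact: Fc].
  rewrite (RintegralB mD iFs iF).
  rewrite (Rintegral_support mu mD FsD) (Rintegral_support mu mD FD).
  suff -> : \int[mu]_x F (x + h m *: v) = \int[mu]_x F x by rewrite subrr mulr0.
  rewrite /Rintegral; congr fine.
  rewrite [RHS](@integral_rV_affine _ _ (h m *: v) 1%:M (EFin \o F)) ?unitmx1//; last first.
    by apply/measurable_EFinP; apply: continuous_measurable_rV.
  rewrite det1 normr1 mul1e; apply: eq_integral => x _.
  by rewrite mulmx1 addrC.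
have [L L0 hL] := C1_lipschitz (a + 3) F1.
have qL m x : D x -> `|q m x| <= L.
  rewrite /D/= => Dx; rewrite /q normrM normfV (gtr0_norm (h0 m)) mulrC ler_pdivrMr//.
  apply: le_trans (hL _ _ _ _) _.
  - by apply: le_lt_trans (ler_normD _ _) _; have := hvl m; move: Dx; lra.
  - by move: Dx; lra.
  - rewrite addrAC subrr add0r normrZ gtr0_norm// ler_pM2l// -[leRHS]mulr1.
    by rewrite ler_pM2l.
suff cq : (fun m => \int[mu]_(x in D) q m x) @ \oo --> \int[mu]_(x in D) pderiv i F x.
  rewrite (_ : (fun m => _) = cst 0) in cq; last by apply/funext => m; exact: q0.
  exact: (cvg_unique (@Rhausdorff R) cq (cvg_cst _)).
apply: (@bounded_cvg_Rintegral _ _ _ mu D q (pderiv i F) L mD Doo) => //.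
- move=> m; apply: continuous_measurable_rV => //.
  apply: (@continuousMr _ _ (fun=> (h m)^-1)); first by move=> x; exact: cst_continuous.
  by move=> x; apply: continuousB; [exact: Fsc|exact: Fc].
- by apply: continuous_measurable_rV => //; exact: C1_pderiv.
- apply/nearW => x Dx.
  have hto : h @ \oo --> (0 : R)^'.
    move=> B; rewrite /dnbhs /within => hB.
    have H : nbhs \oo [set m | h m != 0 -> B (h m)] := @cvg_harmonic R _ hB.
    by apply: filterS H => m; apply; rewrite gt_eqF.
  have : (fun r : R => r^-1 *: (F (r *: v + x) - F x)) @ (0 : R)^' --> pderiv i F x.
    have h3 : derivable F (x : vec) v by exact: C1_derivable.
    exact: h3.
  move=> /(cvg_comp _ _ hto); apply: cvg_trans; apply: near_eq_cvg; apply: nearW => m.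
  by rewrite /= /q [x + _]addrC.
Qed.

End compact_support.

(** * The glued function belongs to the Sobolev space *)

Section glued_functions.
Context {R : realType} {n : nat} (Omega : set 'rV[R]_n.+1) (M : mesh R n)
  (beta : cells M -> 'rV[R]_n.+1) (p : R).
Hypotheses (meshM : polytopal_partition Omega M) (domOmega : lipschitz_domain Omega).
Hypothesis p_gt1 : 1 < p.
Local Notation vec := 'rV[R]_n.+1.
Local Notation mu := (lebesgue_rV n.+1).

(** The coefficients [cf] and [betaf] are the instances of [cell_sum] and [cell_sum_vec] with
    constant pieces, so the same lemmas evaluate and bound them. *)
Definition cell_sum (g : cells M -> vec -> R) (x : vec) : R :=
  \sum_T \1_(cell T) x * g T x.

Definition cell_sum_vec (g : cells M -> vec -> vec) (x : vec) : vec :=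
  \sum_T \1_(cell T) x *: g T x.

Lemma cell_indic (T T' : cells M) x : cell T x -> \1_(cell T') x = (T' == T)%:R :> R.
Proof.
move=> Tx; rewrite indicE; have [->|/(cell_disjoint meshM) h] := eqVneq; first by rewrite mem_set.
by rewrite memNset// => T'x; have : set0 x by rewrite -h.
Qed.

Lemma cell_sumE g T x : cell T x -> cell_sum g x = g T x.
Proof.
move=> Tx; rewrite /cell_sum (bigD1 T)//= (cell_indic _ Tx) eqxx mul1r big1 ?addr0// => U UT.
by rewrite (cell_indic _ Tx) (negPf UT) mul0r.
Qed.

Lemma cell_sum_vecE g T x : cell T x -> cell_sum_vec g x = g T x.
Proof.
move=> Tx; rewrite /cell_sum_vec (bigD1 T)//= (cell_indic _ Tx) eqxx scale1r big1 ?addr0// => U UT.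
by rewrite (cell_indic _ Tx) (negPf UT) scale0r.
Qed.

Lemma cell_sum_vec_coord g i x :
  cell_sum_vec g x ord0 i = cell_sum (fun T x => g T x ord0 i) x.
Proof. by rewrite /cell_sum_vec summxE; apply: eq_bigr => T _; rewrite !mxE. Qed.

Lemma measurable_cell_sum g D : measurable D -> (forall T, continuous (g T)) ->
  measurable_fun D (cell_sum g).
Proof.
move=> mD cg; apply: measurable_sum => T; apply: measurable_funM.
  apply: measurable_indic; exact: (@cell_measurable _ _ _ _ meshM).
exact: continuous_measurable_rV.
Qed.

Lemma domain_measurable : measurable Omega.
Proof. by apply: open_measurable_rV; have [] := domOmega. Qed.

Lemma domain_finite : (mu Omega < +oo)%E.
Proof.
by apply: lebesgue_rV_bounded_lty; [exact: domain_measurable|have [] := domOmega].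
Qed.

(** The domain is covered by closed cells, whose boundaries lie in the finitely many hyperplanes of
    the faces. *)
Lemma ae_cells : {ae mu, forall x, Omega x -> exists T, cell (T : cells M) x}.
Proof.
have [T TE] := choice (face_incident meshM).
pose s := [seq (normal (T E) E, dot (normal (T E) E) (face_org E)) | E <- enum (faces M)].
have sP : proper_hyperplanes s.
  move=> la /mapP[E _ ->] /=; have [n1 _ _] := Defs.normalP meshM (TE E).
  by apply/eqP => n0; move: n1; rewrite n0 dot0l => /esym/eqP; rewrite oner_eq0.
apply: negligibleS (negligible_hyperplanes sP) => x /= /not_implyP[Ox nx].
have : closure Omega x by exact: subset_closure.
rewrite (cell_cover meshM) => -[U _ cU].
have : boundary (cell U) x.
  by rewrite (boundary_cellE meshM); split=> // Ux; apply: nx; exists U.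
rewrite (face_cover meshM) => -[E /= UE cE].
exists (normal (T E) E, dot (normal (T E) E) (face_org E)).
  by apply/mapP; exists E => //; rewrite mem_enum.
by apply/eqP; rewrite -subr_eq0 -dotBr (closure_face_hyperplane meshM (TE E) cE).
Qed.

Lemma cell_sum_bounded g : (forall T, continuous (g T)) ->
  exists2 K : R, 0 < K & forall x, `|cell_sum g x| <= K.
Proof.
move=> cg.
have [K KP] := choice (fun T => let: ex_intro2 K K0 h :=
  continuous_bounded_rV (cg T) (@cell_bounded _ _ _ _ meshM T) in
  ex_intro (fun K => 0 < K /\ forall x, cell T x -> `|g T x| <= K) K (conj K0 h)).
exists (1 + \sum_T K T).
  by rewrite ltr_pwDl// sumr_ge0// => T _; rewrite ltW// (KP T).1.
move=> x; apply: (@le_trans _ _ (\sum_T K T)); last by rewrite lerDr.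
apply: le_trans (ler_norm_sum _ _ _) _; apply: ler_sum => T _.
rewrite normrM indicE; have [Tx|Tx] := pselect (cell T x).
  by rewrite mem_set// normr1 mul1r (KP T).2.
by rewrite memNset// normr0 mul0r ltW// (KP T).1.
Qed.

Lemma cell_sum_in_Lp g : (forall T, continuous (g T)) -> in_Lp mu p Omega (cell_sum g).
Proof.
move=> cg; have [K K0 hK] := cell_sum_bounded cg.
apply: (@bounded_in_Lp _ _ _ mu Omega _ K).
- exact: lt_trans p_gt1.
- exact: domain_measurable.
- exact: domain_finite.
- by apply: measurable_cell_sum => //; exact: domain_measurable.
- by move=> x _; exact: hK.
Qed.

Variable e : cells M -> vec -> R.
Hypothesis e_C1 : forall T, C1 (e T).
Hypothesis e_agree : forall T T' E x, incident T E -> incident T' E ->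
  face E x -> e T x = e T' x.

Definition glued_grad := cell_sum_vec (fun T => grad (e T)).

Lemma glued_gradE i x : glued_grad x ord0 i = cell_sum (fun T => pderiv i (e T)) x.
Proof.
by rewrite /glued_grad cell_sum_vec_coord; apply: eq_bigr => T _; rewrite mxE.
Qed.

(** One sequence serves for the weak gradient, the L^p limits and the trace: the Bernstein
    polynomials of the Lipschitz extension, on a cube containing the closed domain. The uniform
    bound [K] is what bounded convergence uses. *)
Lemma glued_approx : exists (t : vec -> R) (phi : nat -> vec -> R) (K : R),
  [/\ continuous t,
      forall T x, closure (cell T) x -> t x = e T x,
      forall m, C1 (phi m),
      forall m x, closure Omega x ->
        [/\ `|t x| <= K, `|phi m x| <= K & forall i, `|pderiv i (phi m) x| <= K] &
      (forall x, closure Omega x -> phi ^~ x @ \oo --> t x) /\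
      forall T x i, cell T x -> (fun m => pderiv i (phi m) x) @ \oo --> pderiv i (e T) x].
Proof.
have [V [C C0 [VC VE]]] := lipschitz_gluing meshM domOmega e_C1 e_agree.
have [_ _ bO _ _] := domOmega.
have [a a0 ha] := iffLR (bounded_rVP _) (bounded_closure_rV bO).
have cube x : closure Omega x -> in_cube a x.
  by move=> /ha xa i; apply: le_trans (ltW xa); exact: rV_norm_coord.
have cV : continuous V by exact: lipschitz_continuous VC.
have [K1 K10 hK1] := continuous_bounded_rV cV (bounded_closure_rV bO).
have [phi [K [phi1 phiK phic dphiK dphic]]] := lipschitz_approx a0 C0 VC.
exists V, phi, (K1 + `|K| + C); split=> //.
- move=> m x cx; have xa := cube x cx.
  have Vx := hK1 x cx; have KK : 0 <= `|K| by [].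
  split; first lra.
    rewrite -(subrK (V x) (phi m x)); apply: le_trans (ler_normD _ _) _.
    by have := phiK m x xa; have := ler_norm K; lra.
  by move=> i; have := dphiK m x i xa; lra.
split; first by move=> x /cube; exact: phic.
move=> T x i Tx; apply: dphic => //.
  exact/cube/subset_closure/(cell_subset meshM domOmega Tx).
have : nbhs x (cell T) by apply: open_nbhs_nbhs; split=> //; exact: (@cell_open _ _ _ _ meshM).
by apply: filterS => y Ty; apply: VE; exact: subset_closure.
Qed.

(** Integration by parts is done for the approximants, which are C^1 across the faces, so no jump
    terms arise; both sides then pass to the limit by bounded convergence. *)
Lemma glued_weak_gradient : weak_gradient Omega (cell_sum e) glued_grad.
Proof.
have [t [phi [K [tc tE phi1 phiK [phic dphic]]]]] := glued_approx.
move=> psi [psiCk [S [cS SO psi0]]] i.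
have psi1 : C1 psi by exact: Ck_C1.
have mO := domain_measurable; have Ofin := domain_finite.
have bO : bounded_set Omega by have [] := domOmega.
have psic := C1_continuous psi1; have dpsic := C1_pderiv (i := i) psi1.
have [K1 K10 hK1] := continuous_bounded_rV psic bO.
have [K2 K20 hK2] := continuous_bounded_rV dpsic bO.
have int_parts m : \int[mu]_(x in Omega) (phi m x * pderiv i psi x) =
    - \int[mu]_(x in Omega) (pderiv i (phi m) x * psi x).
  have c1 : continuous (fun x => phi m x * pderiv i psi x).
    by move=> x; apply: continuousM; [exact: C1_continuous|exact: C1_pderiv].
  have c2 : continuous (fun x => pderiv i (phi m) x * psi x).
    by move=> x; apply: continuousM; [exact: C1_pderiv|exact: C1_continuous].
  have h : \int[mu]_(x in Omega) pderiv i (fun x => phi m x * psi x) x = 0.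
    apply: (@Rintegral_pderiv0 R n.+1 (fun x => phi m x * psi x) i S Omega) => //.
      exact: C1M.
    by move=> x Sx; rewrite psi0// mulr0.
  apply/eqP; rewrite -addr_eq0 -RintegralD//; [|exact: continuous_integrable_rV..].
  rewrite -h; apply/eqP; apply: eq_Rintegral => x _.
  by rewrite pderivM//; ring.
have lhs : (fun m => \int[mu]_(x in Omega) (phi m x * pderiv i psi x)) @ \oo -->
    \int[mu]_(x in Omega) (cell_sum e x * pderiv i psi x).
  apply: (@bounded_cvg_Rintegral _ _ _ mu Omega (fun m x => phi m x * pderiv i psi x)
    (fun x => cell_sum e x * pderiv i psi x) (K * K2)) => //.
  - move=> m; apply: continuous_measurable_rV => // x.
    by apply: continuousM; [exact: C1_continuous|exact: C1_pderiv].
  - apply: measurable_funM; last exact: continuous_measurable_rV.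
    by apply: measurable_cell_sum => // T; exact: C1_continuous.
  - move=> m x Ox; rewrite normrM ler_pM ?hK2//.
    by have [] := phiK m x (subset_closure Ox).
  - apply: filterS ae_cells => x cx Ox; have [T Tx] := cx Ox.
    rewrite (cell_sumE _ Tx) -(tE T x (subset_closure Tx)).
    by apply: cvgM; [apply: phic; exact: subset_closure|exact: cvg_cst].
have rhs : (fun m => - \int[mu]_(x in Omega) (pderiv i (phi m) x * psi x)) @ \oo -->
    - \int[mu]_(x in Omega) (glued_grad x ord0 i * psi x).
  apply: cvgN.
  apply: (@bounded_cvg_Rintegral _ _ _ mu Omega (fun m x => pderiv i (phi m) x * psi x)
    (fun x => glued_grad x ord0 i * psi x) (K * K1)) => //.
  - move=> m; apply: continuous_measurable_rV => // x.
    by apply: continuousM; [exact: C1_pderiv|exact: C1_continuous].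
  - apply: measurable_funM; last exact: continuous_measurable_rV.
    under eq_fun do rewrite glued_gradE.
    by apply: measurable_cell_sum => // T; exact: C1_pderiv.
  - move=> m x Ox; rewrite normrM ler_pM ?hK1//.
    by have [_ _ h] := phiK m x (subset_closure Ox); exact: h.
  - apply: filterS ae_cells => x cx Ox; have [T Tx] := cx Ox.
    rewrite glued_gradE (cell_sumE _ Tx).
    by apply: cvgM; [exact: dphic|exact: cvg_cst].
rewrite (_ : (fun m => _) = (fun m => - \int[mu]_(x in Omega) (pderiv i (phi m) x * psi x)))
  in lhs; last by apply/funext => m; exact: int_parts.
exact: (cvg_unique (@Rhausdorff R) lhs rhs).
Qed.

Hypothesis e_Gamma_plus : forall T E x, incident T E ->
  face E `<=` Gamma_plus Omega beta -> face E x -> e T x = 0.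

Lemma glued_in_W1p0 : exists t, in_W1p0 Omega beta p (cell_sum e) glued_grad t.
Proof.
have [t [phi [K [tc tE phi1 phiK [phic dphic]]]]] := glued_approx.
have mO := domain_measurable; have Ofin := domain_finite.
have ec T : continuous (e T) by exact: C1_continuous.
have dec i T : continuous (pderiv i (e T)) by exact: C1_pderiv.
have p0 : 0 < p by exact: lt_trans p_gt1.
have chc E : continuous (@chart _ _ M E) by exact: chart_continuous.
have mE (E : faces M) : measurable (face_ref E) by exact: (@face_ref_measurable _ _ _ _ meshM).
have Efin (E : faces M) : (lebesgue_rV n (face_ref E) < +oo)%E.
  by apply: lebesgue_rV_bounded_lty => //; exact: (@face_ref_bounded _ _ _ _ meshM).
have mcomp (E : faces M) (f : vec -> R) : continuous f -> measurable_fun (face_ref E) (f \o chart E).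
  move=> cf; apply: continuous_measurable_rV => // y.
  exact: (continuous_comp (chc E y) (cf _)).
have bnd (E : faces M) y : face E `<=` boundary Omega -> face_ref E y -> closure Omega (chart E y).
  by move=> EO Ey; have [] := EO (chart E y) (imageP _ Ey).
exists t; split.
- split; [exact: cell_sum_in_Lp| |exact: glued_weak_gradient].
  by move=> i; under eq_fun do rewrite glued_gradE; exact: cell_sum_in_Lp.
- split.
    move=> E EO; apply: (@bounded_in_Lp _ _ _ (lebesgue_rV n) _ _ K) => //.
    - exact: Efin.
    - exact: mcomp.
    - by move=> y Ey /=; have [] := phiK 0%N _ (bnd E y EO Ey).
  exists phi; split=> //.
  + have [K1 K10 hK1] := cell_sum_bounded ec.
    apply: (@bounded_Lp_cvg _ _ _ mu Omega _ _ (K + K1)) => //.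
    * by move=> m; apply: continuous_measurable_rV => //; exact: C1_continuous.
    * exact: measurable_cell_sum.
    * move=> m x Ox; apply: le_trans (ler_normB _ _) _; apply: lerD => //.
      by have [] := phiK m x (subset_closure Ox).
    * apply: filterS ae_cells => x cx Ox; have [T Tx] := cx Ox.
      rewrite (cell_sumE _ Tx) -(tE T x (subset_closure Tx)).
      by apply: phic; exact: subset_closure.
  + move=> i; rewrite (_ : (fun x => glued_grad x ord0 i) = cell_sum (fun T => pderiv i (e T)));
      last by apply/funext => x; exact: glued_gradE.
    have [K1 K10 hK1] := cell_sum_bounded (dec i).
    apply: (@bounded_Lp_cvg _ _ _ mu Omega _ _ (K + K1)) => //.
    * by move=> m; apply: continuous_measurable_rV => //; exact: C1_pderiv.
    * exact: measurable_cell_sum.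
    * move=> m x Ox; apply: le_trans (ler_normB _ _) _; apply: lerD => //.
      by have [_ _ h] := phiK m x (subset_closure Ox); exact: h.
    * apply: filterS ae_cells => x cx Ox; have [T Tx] := cx Ox.
      by rewrite (cell_sumE _ Tx); exact: dphic.
  + move=> E EO; apply: (@bounded_Lp_cvg _ _ _ (lebesgue_rV n) _ _ _ (K + K)) => //.
    * exact: Efin.
    * by move=> m; apply: mcomp; exact: C1_continuous.
    * exact: mcomp.
    * move=> m y Ey /=; have [h1 h2 _] := phiK m _ (bnd E y EO Ey).
      by apply: le_trans (ler_normB _ _) _; exact: lerD.
    * by apply: nearW => y Ey; apply: phic; exact: bnd.
- move=> E EG; apply: nearW => y Ey /=.
  have [T TE] := face_incident meshM E; have Ex : face E (chart E y) by exact: imageP.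
  rewrite (tE T); first exact: (e_Gamma_plus TE EG Ex).
  have := iffLR (incidentE meshM T E) TE _ Ex.
  by rewrite (boundary_cellE meshM) => -[].
Qed.

End glued_functions.

(** * Discrete weak gradients *)

(** The Fredholm alternative over arbitrary finite index types. It provides Riesz representatives on
    a cell and the Lagrange multiplier of the constraint. *)
Lemma row_space_duality (R : fieldType) (I J : finType) (A : I -> J -> R) (b : J -> R) :
  (forall c : J -> R, (forall i, \sum_j A i j * c j = 0) -> \sum_j b j * c j = 0) ->
  exists u : I -> R, forall j, \sum_i u i * A i j = b j.
Proof.
move=> hb.
pose A' : 'M[R]_(#|I|, #|J|) := \matrix_(i, j) A (enum_val i) (enum_val j).
pose b' : 'rV[R]_#|J| := \row_j b (enum_val j).
have sumI (K : finType) (F : K -> R) : \sum_(k < #|K|) F (enum_val k) = \sum_k F k.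
  by rewrite [RHS](reindex (@enum_val K xpredT))//; exact/onW_bij/enum_val_bij.
have /submxP[u uE] : (b' <= A')%MS.
  rewrite submxE; apply/eqP/matrixP => i j; rewrite !mxE ord1.
  apply: etrans (hb (fun k => cokermx A' (enum_rank k) j) _).
    by rewrite -[RHS]sumI; apply: eq_bigr => k _; rewrite mxE enum_valK.
  move=> k; have := mulmx_coker A' => /matrixP/(_ (enum_rank k) j).
  rewrite !mxE; apply: etrans; rewrite -[LHS]sumI; apply: eq_bigr => l _.
  by rewrite [A' _ _]mxE enum_rankK enum_valK.
exists (fun i => u ord0 (enum_rank i)) => j.
have := congr1 (fun B : 'rV_ _ => B ord0 (enum_rank j)) uE; rewrite !mxE enum_rankK => ->.
by rewrite -sumI; apply: eq_bigr => l _; rewrite mxE enum_rankK enum_valK.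
Qed.

Section polynomial_bases.
Context {R : realType} {n : nat}.
Local Notation vec := 'rV[R]_n.

(** Indices of total degree above [r] are kept with value zero, so that arbitrary functions on a
    finite type serve as coefficients. The price is that coefficients are not unique. *)
Definition mon r (al : @multi_index n r) (x : vec) : R :=
  if (\sum_i al i <= r)%N then monomial al x else 0.

Definition poly_sum r (a : @multi_index n r -> R) (x : vec) : R := \sum_al a al * mon al x.

Lemma is_poly_mon r (al : @multi_index n r) : is_poly r (mon al).
Proof.
rewrite /mon; case E : (\sum_i al i <= r)%N; last exact: is_poly0.
exact: is_poly_monomial.
Qed.

Lemma is_poly_sumP r f : is_poly r f <-> exists a, f = @poly_sum r a.
Proof.
split=> [/is_polyP[a ->]|[a ->]]; last first.
  by apply: is_poly_sum => al _; apply: is_polyZ; exact: is_poly_mon.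
exists a; apply/funext => x; rewrite /poly_of /poly_sum [LHS]big_mkcond.
by apply: eq_bigr => al _; rewrite /mon; case: ifP => _; rewrite ?mulr0.
Qed.

Lemma is_polyN r f : is_poly r f -> is_poly r (fun x : vec => - f x).
Proof.
by move=> /(is_polyZ (-1)); under eq_fun do rewrite mulN1r.
Qed.

Lemma is_polyB r f g : is_poly r f -> is_poly r g -> is_poly r (fun x : vec => f x - g x).
Proof. by move=> hf hg; apply: is_polyD => //; exact: is_polyN. Qed.

End polynomial_bases.

Section weak_gradients.
Context {R : realType} {n : nat} (Omega : set 'rV[R]_n.+1) (M : mesh R n).
Hypothesis meshM : polytopal_partition Omega M.
Local Notation vec := 'rV[R]_n.+1.

Lemma cell_int_eq0 T (f : vec -> R) : (forall x, cell T x -> f x = 0) ->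
  @cell_int R n M T f = 0.
Proof.
by move=> f0; rewrite /cell_int /Rintegral integral0_eq// => x Tx; rewrite f0.
Qed.

Lemma face_int_eq0 E (f : vec -> R) : (forall x, face E x -> f x = 0) ->
  @face_int R n M E f = 0.
Proof.
move=> f0; rewrite /face_int /Rintegral integral0_eq// => y Ey; rewrite f0//.
by exists y.
Qed.

Lemma cell_int0_poly T (f : vec -> R) : continuous f -> cell_int T (fun x => f x * f x) = 0 ->
  forall x, @cell R n M T x -> f x = 0.
Proof.
move=> cf h x Tx.
have : f x * f x = 0.
  apply: (ge0_continuous_Rintegral_eq0 (f := fun x => f x * f x) _ _ _ _ h Tx).
  - exact: continuousMr.
  - exact: (@cell_open _ _ _ _ meshM).
  - exact: (@cell_bounded _ _ _ _ meshM).
  - by move=> y _; rewrite -expr2 sqr_ge0.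
by move/eqP; rewrite mulf_eq0 orbb => /eqP.
Qed.

(** The Gram matrix of the family [mon] may be singular, so duality replaces inversion: a kernel
    vector gives a polynomial of zero norm on the cell, on which [l] vanishes by assumption. *)
Lemma cell_riesz r (T : cells M) (l : (vec -> R) -> R) :
  (forall c : @multi_index n.+1 r -> R, l (poly_sum c) = \sum_al c al * l (mon al)) ->
  (forall q, is_poly r q -> (forall x, cell T x -> q x = 0) -> l q = 0) ->
  exists2 g, is_poly r g & forall q, is_poly r q -> cell_int T (fun x => g x * q x) = l q.
Proof.
move=> lsum l0.
have polc (q : vec -> R) : is_poly r q -> continuous q by move=> /is_poly_C1/C1_continuous.
have monc (al : @multi_index n.+1 r) : continuous (mon al : vec -> R) by apply: polc; exact: is_poly_mon.
have intsum (f : vec -> R) (c : @multi_index n.+1 r -> R) : continuous f ->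
    cell_int T (fun x => f x * poly_sum c x) = \sum_al c al * cell_int T (fun x => f x * mon al x).
  move=> cf; transitivity (\sum_al cell_int T (fun x => c al * (f x * mon al x))).
    rewrite -(cell_int_sum meshM); last first.
      move=> al _; apply: continuousMr; last exact: continuousMr.
      by move=> x; exact: cst_continuous.
    by apply: eq_cell_int => x _; rewrite /poly_sum mulr_sumr; apply: eq_bigr => al _; rewrite mulrCA.
  by apply: eq_bigr => al _; rewrite (cell_intZ meshM)//; exact: continuousMr.
have [|u hu] := @row_space_duality R _ _
  (fun al be : @multi_index n.+1 r => cell_int T (fun x => mon al x * mon be x)) (fun be => l (mon be)).
  move=> c hc; transitivity (l (poly_sum c)).
    by rewrite lsum; apply: eq_bigr => al _; rewrite mulrC.
  have pc : is_poly r (poly_sum c) by apply/is_poly_sumP; exists c.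
  apply: l0 => //; apply: cell_int0_poly; first exact: polc.
  rewrite intsum; last exact: polc.
  rewrite big1// => al _; rewrite (_ : cell_int _ _ = 0) ?mulr0//.
  transitivity (cell_int T (fun x => mon al x * poly_sum c x)).
    by apply: eq_cell_int => x _; rewrite mulrC.
  by rewrite intsum//; apply: etrans (hc al); apply: eq_bigr => be _; rewrite mulrC.
exists (poly_sum u); first by apply/is_poly_sumP; exists u.
move=> q /is_poly_sumP[c ->].
rewrite intsum; last by apply: polc; apply/is_poly_sumP; exists u.
rewrite lsum; apply: eq_bigr => be _; rewrite -hu; congr (_ * _).
transitivity (cell_int T (fun x => mon be x * poly_sum u x)).
  by apply: eq_cell_int => x _; rewrite mulrC.
by rewrite intsum//; apply: eq_bigr => al _; congr (_ * _); apply: eq_cell_int => x _; rewrite mulrC.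
Qed.

Variable s : @weak_fun R n M.
Variable j : nat.
Hypothesis s_poly : in_W j s.

Let s0_C1 T : C1 (w0 s T). Proof. exact: is_poly_C1 (s_poly.1 T). Qed.
Let sb_C1 E : C1 (wb s E). Proof. exact: is_poly_C1 (s_poly.2 E). Qed.

(** The right-hand side of the definition of the weak gradient for the test field [q] times the
    [i]-th unit vector. *)
Definition weak_deriv T (i : 'I_n.+1) (q : vec -> R) : R :=
  - cell_int T (fun x => w0 s T x * pderiv i q x) +
  \sum_(E | incident T E) normal T E ord0 i * face_int E (fun x => wb s E x * q x).

Lemma weak_deriv_sum (I : finType) T i (c : I -> R) (q : I -> vec -> R) :
  (forall k, C1 (q k)) ->
  weak_deriv T i (fun x => \sum_k c k * q k x) = \sum_k c k * weak_deriv T i (q k).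
Proof.
move=> q1; have s0c T' : continuous (w0 s T') by exact: C1_continuous.
have sbc E : continuous (wb s E) by exact: C1_continuous.
have qc k : continuous (q k) by exact: C1_continuous.
have dqc k : continuous (pderiv i (q k)) by exact: C1_pderiv.
have cc (a : R) : continuous (fun _ : vec => a : R) by move=> x; exact: cst_continuous.
rewrite /weak_deriv.
transitivity (- (\sum_k c k * cell_int T (fun x => w0 s T x * pderiv i (q k) x)) +
  \sum_(E | incident T E) \sum_k c k * (normal T E ord0 i * face_int E (fun x => wb s E x * q k x))).
  congr (- _ + _).
    rewrite pderiv_sum; last by move=> k _; exact: C1Z.
    transitivity (\sum_k cell_int T (fun x => c k * (w0 s T x * pderiv i (q k) x))).
      rewrite -(cell_int_sum meshM); last first.
        by move=> k _; apply: continuousMr => //; exact: continuousMr.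
      apply: eq_cell_int => x _; rewrite mulr_sumr; apply: eq_bigr => k _.
      by rewrite pderivZ// mulrCA.
    by apply: eq_bigr => k _; rewrite (cell_intZ meshM)//; exact: continuousMr.
  apply: eq_bigr => E _.
  transitivity (normal T E ord0 i * \sum_k face_int E (fun x => c k * (wb s E x * q k x))).
    rewrite -(face_int_sum meshM); last first.
      by move=> k _; apply: continuousMr => //; exact: continuousMr.
    congr (_ * _); apply: eq_face_int => x _; rewrite mulr_sumr; apply: eq_bigr => k _.
    by rewrite mulrCA.
  rewrite mulr_sumr; apply: eq_bigr => k _.
  by rewrite (face_intZ meshM) 1?mulrCA//; exact: continuousMr.
rewrite exchange_big/= -sumrN -big_split/=; apply: eq_bigr => k _.
by rewrite mulrDr mulrN mulr_sumr.
Qed.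

Lemma weak_deriv0 T i q : C1 q -> (forall x, cell T x -> q x = 0) -> weak_deriv T i q = 0.
Proof.
move=> q1 q0; have qc := C1_continuous q1.
have clq x : closure (cell T) x -> q x = 0.
  move=> cx; have cZ : closed [set y | q y = 0].
    apply: (closed_comp (f := q) (D := [set 0])); last exact: closed_eq.
    by move=> y _; exact: qc.
  by apply: cZ; apply: closureS cx => y /q0.
rewrite /weak_deriv cell_int_eq0; last first.
  move=> x Tx; rewrite /pderiv (@near_eq_derive _ _ _ _ (cst 0)); last first.
    have : nbhs x (cell T) by apply: open_nbhs_nbhs; split=> //; exact: (@cell_open _ _ _ _ meshM).
    by apply: filterS => y /q0.
  by rewrite derive_cst mulr0.
rewrite oppr0 add0r big1// => E TE; rewrite face_int_eq0 ?mulr0// => x Ex.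
rewrite clq ?mulr0//; have := iffLR (incidentE meshM T E) TE _ Ex.
by rewrite (boundary_cellE meshM) => -[].
Qed.

(** As [wgrad] picks a solution by [get], its defining property follows once a solution exists. The
    components are found separately as Riesz representatives of [weak_deriv]. *)
Lemma is_wgradP r T : is_wgrad r s T (wgrad r s T).
Proof.
suff [G hG] : exists G, is_wgrad r s T G by apply: getPex; exists G.
have ex i : exists g, is_poly r g /\ forall q, is_poly r q ->
    cell_int T (fun x => g x * q x) = weak_deriv T i q.
  have [||g pg hg] := @cell_riesz r T (weak_deriv T i); last by exists g.
    by move=> c; apply: weak_deriv_sum => al; apply: is_poly_C1; exact: is_poly_mon.
  by move=> q pq; apply: weak_deriv0; exact: is_poly_C1 pq.
have [g gP] := choice ex.
exists (fun x => \row_i g i x); split.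
  by move=> i; under eq_fun do rewrite mxE; exact: (gP i).1.
move=> psi ppsi.
have psi1 i : C1 (fun x => psi x ord0 i) by exact: is_poly_C1 (ppsi i).
have psic i : continuous (fun x => psi x ord0 i) by exact: C1_continuous.
have dpsic i : continuous (pderiv i (fun x => psi x ord0 i)) by exact: C1_pderiv.
have gc i : continuous (g i) by apply: C1_continuous; exact: is_poly_C1 (gP i).1.
have s0c : continuous (w0 s T) by exact: C1_continuous.
have sbc E : continuous (wb s E) by exact: C1_continuous.
transitivity (\sum_i weak_deriv T i (fun x => psi x ord0 i)).
  transitivity (\sum_i cell_int T (fun x => g i x * psi x ord0 i)).
    rewrite -(cell_int_sum meshM); last by move=> i _; exact: continuousMr.
    by apply: eq_cell_int => x _; apply: eq_bigr => i _; rewrite mxE.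
  by apply: eq_bigr => i _; exact: (gP i).2.
rewrite /weak_deriv big_split/= sumrN; congr (- _ + _).
  rewrite -(cell_int_sum meshM); last by move=> i _; exact: continuousMr.
  by apply: eq_cell_int => x _; rewrite /divergence mulr_sumr.
rewrite exchange_big/=; apply: eq_bigr => E _.
transitivity (\sum_i face_int E (fun x => normal T E ord0 i * (wb s E x * psi x ord0 i))).
  by apply: eq_bigr => i _; rewrite (face_intZ meshM)//; exact: continuousMr.
rewrite -(face_int_sum meshM); last first.
  move=> i _; apply: continuousMr; last exact: continuousMr.
  by move=> x; exact: cst_continuous.
apply: eq_face_int => x _; rewrite /dot mulr_sumr; apply: eq_bigr => i _.
by ring.
Qed.

Lemma wgrad_dot r T (b : vec) v : is_poly r v ->
  cell_int T (fun x => v x * dot b (wgrad r s T x)) =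
  - cell_int T (fun x => w0 s T x * dot b (grad v x)) +
  \sum_(E | incident T E) dot b (normal T E) * face_int E (fun x => wb s E x * v x).
Proof.
move=> pv; have v1 := is_poly_C1 pv; have [pG hG] := is_wgradP r T.
have pvb : is_poly_vec r (fun x => v x *: b).
  by move=> i; under eq_fun do rewrite mxE mulrC; exact: is_polyZ.
have := hG _ pvb.
rewrite (@eq_cell_int _ _ _ T _ (fun x => v x * dot b (wgrad r s T x))); last first.
  by move=> x _; rewrite dotZr dotC.
move=> ->; congr (- _ + _).
  apply: eq_cell_int => x _; congr (_ * _); rewrite /divergence /dot; apply: eq_bigr => i _.
  rewrite (_ : (fun y => (v y *: b) ord0 i) = fun y => b ord0 i * v y); last first.
    by apply/funext => y; rewrite mxE mulrC.
  by rewrite pderivZ// mxE.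
apply: eq_bigr => E _; rewrite -(face_intZ meshM); last first.
  by apply: continuousMr; exact: C1_continuous.
by apply: eq_face_int => x _; rewrite dotZl; ring.
Qed.

End weak_gradients.

(** * The forms of the scheme *)

Section signed_powers.
Context {R : realType} (p : R).
Hypothesis p_gt1 : 1 < p.

Let p0 : 0 < p. Proof. exact: lt_trans p_gt1. Qed.
Let p10 : 0 < p - 1. Proof. by rewrite subr_gt0. Qed.

Lemma spow0 : spow p 0 = 0. Proof. by rewrite /spow sgr0 mulr0. Qed.

Lemma spowN z : spow p (- z) = - spow p z.
Proof. by rewrite /spow normrN sgrN mulrN. Qed.

Lemma spow_mul z : spow p z * z = `|z| `^ p.
Proof. by rewrite /spow -mulrA -normrEsg mulrC mulr_powRB1. Qed.

Lemma norm_spow z : `|spow p z| = `|z| `^ (p - 1).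
Proof.
rewrite /spow normrM ger0_norm ?powR_ge0// normr_sg.
have [->|z0] := eqVneq z 0; last by rewrite mulr1.
by rewrite normr0 powR0 ?gt_eqF// mul0r.
Qed.

Lemma ltr_spow : {mono spow p : x y / x < y}.
Proof.
have pos a b : 0 <= a -> a < b -> spow p a < spow p b.
  move=> a0 ab; have b0 : 0 < b by exact: le_lt_trans ab.
  rewrite {2}/spow gtr0_sg// mulr1 (gtr0_norm b0).
  move: a0; rewrite le_eqVlt => /predU1P[<-|a0]; first by rewrite spow0 powR_gt0.
  by rewrite /spow gtr0_sg// mulr1 (gtr0_norm a0) gt0_ltr_powR// nnegrE ltW.
have homo : {homo spow p : x y / x < y}.
  move=> a b ab; have [a0|a0] := leP 0 a; first exact: pos.
  have [b0|b0] := leP b 0.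
    by rewrite -ltrN2 -!spowN; apply: pos; rewrite ?oppr_ge0// ltrN2.
  apply: (@lt_trans _ _ 0); last by have := pos 0 b (lexx 0) b0; rewrite spow0.
  rewrite -oppr_gt0 -spowN; have := pos 0 (- a) (lexx 0); rewrite spow0 oppr_gt0; exact.
by apply: leW_mono; apply: le_mono.
Qed.

Lemma spow_monotone a b : 0 <= (spow p a - spow p b) * (a - b).
Proof.
have [ab|ab] := leP b a; last first.
  by apply: mulr_le0; rewrite subr_le0 ltW// ltr_spow.
by apply: mulr_ge0; rewrite subr_ge0// leNgt ltr_spow -leNgt.
Qed.

Lemma spow_monotone_eq a b : (spow p a - spow p b) * (a - b) = 0 -> a = b.
Proof.
move=> /eqP; rewrite mulf_eq0 !subr_eq0 => /orP[/eqP E|/eqP//].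
by have [ab|ba|//] := ltgtP a b; [move: ab|move: ba]; rewrite -ltr_spow E ltxx.
Qed.

(** Young's inequality with exponents [p] and [p / (p - 1)], multiplied by [p]. *)
Lemma spow_young z w : p * (spow p z * w) <= (p - 1) * `|z| `^ p + `|w| `^ p.
Proof.
have q0 : 0 < p / (p - 1) by rewrite divr_gt0.
have pq : p^-1 + (p / (p - 1))^-1 = 1.
  by rewrite invf_div -{1}[p^-1]mul1r -mulrDl addrC subrK divff// gt_eqF.
have := @conjugate_powR R `|w| (`|z| `^ (p - 1)) p _ (normr_ge0 _) (powR_ge0 _ _) p0 q0 pq.
rewrite -powRrM mulrCA divff ?gt_eqF// mulr1 => h.
have h1 : spow p z * w <= `|w| * `|z| `^ (p - 1).
  by apply: le_trans (ler_norm _) _; rewrite normrM norm_spow mulrC.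
have := ler_wpM2l (ltW p0) (le_trans h1 h); move/le_trans; apply.
rewrite le_eqVlt; apply/orP; left; apply/eqP; rewrite invf_div.
field; rewrite !gt_eqF//.
Qed.

(** Convexity of the [p]-th power in subgradient form, drawn from Young's inequality without
    differentiation. *)
Lemma spow_subgradient z h : `|z| `^ p + p * (spow p z * h) <= `|z + h| `^ p.
Proof.
by have := spow_young z (z + h); rewrite mulrDr spow_mul; lra.
Qed.

Lemma spow_continuous : continuous (spow p).
Proof.
have pos z : 0 < z -> {for z, continuous (spow p)}.
  move=> z0; have h1 : {for z, continuous (fun y : R => y `^ (p - 1))}.
    apply: differentiable_continuous; apply/derivable1_diffP.
    by apply: derivable_powR; rewrite in_itv/= z0.
  have spowE y : 0 < y -> spow p y = y `^ (p - 1).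
    by move=> y0; rewrite /spow (gtr0_sg y0) mulr1 (gtr0_norm y0).
  have h2 : spow p @ z --> z `^ (p - 1).
    apply: cvg_trans h1; apply: near_eq_cvg; near=> y.
    by rewrite spowE//; near: y; exact: lt_nbhsr.
  by move: h2; rewrite -spowE.
move=> z; have [z0|z0|->] := ltgtP z 0.
- have := pos (- z); rewrite oppr_gt0 => /(_ z0) h.
  have -> : spow p = (fun y => - spow p (- y)).
    by apply/funext => y; rewrite spowN opprK.
  apply: cvgN; apply: continuous_comp; [exact: opp_continuous|exact: h].
- exact: pos.
- apply/cvgrPdist_lt => eps eps0.
  have e0 : 0 < eps `^ (p - 1)^-1 by rewrite powR_gt0.
  have : \forall y \near (0 : R), `|y| < eps `^ (p - 1)^-1 by exact: nbhs0_lt.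
  apply: filterS => y hy; rewrite spow0 sub0r normrN norm_spow.
  have -> : eps = (eps `^ (p - 1)^-1) `^ (p - 1).
    by rewrite -powRrM mulVf ?gt_eqF// powRr1// ltW.
  by apply: gt0_ltr_powR => //; rewrite ?nnegrE ?normr_ge0 ?ltW.
Unshelve. all: by end_near. Qed.

End signed_powers.

Section weak_functions.
Context {R : realType} {n : nat} (Omega : set 'rV[R]_n.+1) (M : mesh R n)
  (beta : cells M -> 'rV[R]_n.+1) (c : cells M -> R).
Hypothesis meshM : polytopal_partition Omega M.
Local Notation vec := 'rV[R]_n.+1.
Implicit Types (s l : @weak_fun R n M) (v : cells M -> vec -> R).

(** All linearity of the forms is expressed through this combination; differences are [wlin 1 (-1)]
    and the zero function is [wlin 0 0]. *)
Definition wlin (a b : R) l s : weak_fun M :=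
  WeakFun (fun T x => a * w0 l T x + b * w0 s T x) (fun E x => a * wb l E x + b * wb s E x).

Lemma is_poly_lin r (a b : R) (f g : vec -> R) : is_poly r f -> is_poly r g ->
  is_poly r (fun x => a * f x + b * g x).
Proof. by move=> hf hg; apply: is_polyD; exact: is_polyZ. Qed.

Lemma in_W_lin j a b l s : in_W j l -> in_W j s -> in_W j (wlin a b l s).
Proof. by move=> [l0 lb] [s0 sb]; split=> ?; exact: is_poly_lin. Qed.

Lemma in_W0_lin j a b l s : in_W0 Omega beta j l -> in_W0 Omega beta j s ->
  in_W0 Omega beta j (wlin a b l s).
Proof.
move=> [hl l0] [hs s0]; split; first exact: in_W_lin.
by move=> E EG x Ex /=; rewrite (l0 E)// (s0 E)// !mulr0 addr0.
Qed.

Lemma in_M_lin r a b v v' : in_M r v -> in_M r v' ->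
  in_M r (fun T x => a * v T x + b * v' T x).
Proof. by move=> h h' T; exact: is_poly_lin. Qed.

Lemma dot_gradM (b : vec) (f g : vec -> R) x : C1 f -> C1 g ->
  dot b (grad (fun y => f y * g y) x) = f x * dot b (grad g x) + g x * dot b (grad f x).
Proof.
move=> f1 g1; rewrite /dot !mulr_sumr -big_split/=; apply: eq_bigr => i _.
by rewrite !mxE pderivM//; ring.
Qed.

Lemma dot_grad_lin (b : vec) (f g : vec -> R) (u v : R) x : C1 f -> C1 g ->
  dot b (grad (fun y => u * f y + v * g y) x) = u * dot b (grad f x) + v * dot b (grad g x).
Proof.
move=> f1 g1; rewrite /dot !mulr_sumr -big_split/=; apply: eq_bigr => i _.
rewrite !mxE pderivD; [|exact: C1Z..]; rewrite !pderivZ//; ring.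
Qed.

Lemma dot_grad_continuous (b : vec) (f : vec -> R) : C1 f ->
  continuous (fun x => dot b (grad f x)).
Proof.
move=> f1; rewrite (_ : (fun x => _) = fun x => \sum_i b ord0 i * pderiv i f x).
  apply: continuous_sumr => i _; apply: continuousMr; last exact: C1_pderiv.
  by move=> x; exact: cst_continuous.
by apply/funext => x; apply: eq_bigr => i _; rewrite mxE.
Qed.

Lemma is_poly_dot_grad r (b : vec) (f : vec -> R) : is_poly r f ->
  is_poly r (fun x => dot b (grad f x)).
Proof.
move=> pf; apply: is_poly_sum => i _; under eq_fun do rewrite mxE.
by apply: is_polyZ; exact: is_poly_pderiv.
Qed.

Lemma residual_poly j s T : in_W j s -> is_poly j (residual beta c s T).
Proof.
move=> [s0 _]; apply: is_polyB; first exact: is_poly_dot_grad.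
exact: is_polyZ.
Qed.

Lemma residual_lin j a b l s T x : in_W j l -> in_W j s ->
  residual beta c (wlin a b l s) T x = a * residual beta c l T x + b * residual beta c s T x.
Proof.
move=> [l0 _] [s0 _]; rewrite /residual/= dot_grad_lin; [|exact: is_poly_C1..].
by ring.
Qed.

Lemma is_poly_continuous r (f : vec -> R) : is_poly r f -> continuous f.
Proof. by move=> /is_poly_C1/C1_continuous. Qed.

Lemma cell_int_lin T (a b : R) (f g : vec -> R) : continuous f -> continuous g ->
  @cell_int R n M T (fun x => a * f x + b * g x) = a * cell_int T f + b * cell_int T g.
Proof.
move=> cf cg; have cc (u : R) : continuous (fun _ : vec => u) by move=> x; exact: cst_continuous.
by rewrite (cell_intD meshM) ?(cell_intZ meshM)//; exact: continuousMr.
Qed.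

Lemma face_int_lin E (a b : R) (f g : vec -> R) : continuous f -> continuous g ->
  @face_int R n M E (fun x => a * f x + b * g x) = a * face_int E f + b * face_int E g.
Proof.
move=> cf cg; have cc (u : R) : continuous (fun _ : vec => u) by move=> x; exact: cst_continuous.
by rewrite (face_intD meshM) ?(face_intZ meshM)//; exact: continuousMr.
Qed.

(* Integration by parts on each cell trades the weak gradient for the strong
   residual and the jumps [sigma_b - sigma_0]. *)
Lemma form_bE r j v s : in_M r v -> in_W j s ->
  form_b beta c r v s =
  \sum_T (cell_int T (fun x => v T x * residual beta c s T x) +
    \sum_(E | incident T E) dot (beta T) (normal T E) *
      face_int E (fun x => v T x * (wb s E x - w0 s T x))).
Proof.
move=> pv ps; apply: eq_bigr => T _.
have v1 := is_poly_C1 (pv T); have s1 := is_poly_C1 (ps.1 T).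
have vc := C1_continuous v1; have sc := C1_continuous s1.
have sbc E := is_poly_continuous (ps.2 E).
have [pG _] := is_wgradP meshM ps r T.
have Gc : continuous (fun x => dot (beta T) (wgrad r s T x)).
  apply: continuous_sumr => i _; apply: continuousMr; last exact: is_poly_continuous (pG i).
  by move=> x; exact: cst_continuous.
have sgc := dot_grad_continuous (b := beta T) s1.
have vgc := dot_grad_continuous (b := beta T) v1.
have key := cell_divergence meshM T (beta T) (C1M v1 s1).
have parts : cell_int T (fun x => dot (beta T) (grad (fun y => v T y * w0 s T y) x)) =
    cell_int T (fun x => v T x * dot (beta T) (grad (w0 s T) x)) +
    cell_int T (fun x => w0 s T x * dot (beta T) (grad (v T) x)).
  rewrite -(cell_intD meshM); [|exact: continuousMr..].
  by apply: eq_cell_int => x _; rewrite dot_gradM.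
rewrite parts in key.
rewrite (@eq_cell_int _ _ _ T _ (fun x => 1 * (v T x * dot (beta T) (wgrad r s T x)) +
   (- c T) * (v T x * w0 s T x))); last by move=> x _; ring.
rewrite cell_int_lin ?mul1r; [|exact: continuousMr..].
rewrite (wgrad_dot meshM ps)//.
rewrite [in RHS](@eq_cell_int _ _ _ T _ (fun x => 1 * (v T x * dot (beta T) (grad (w0 s T) x)) +
   (- c T) * (v T x * w0 s T x))); last by move=> x _; rewrite /residual; ring.
rewrite [in RHS]cell_int_lin ?mul1r; [|exact: continuousMr..].
have -> : \sum_(E | incident T E) dot (beta T) (normal T E) *
      face_int E (fun x => v T x * (wb s E x - w0 s T x)) =
  \sum_(E | incident T E) dot (beta T) (normal T E) * face_int E (fun x => wb s E x * v T x) -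
  \sum_(E | incident T E) dot (beta T) (normal T E) * face_int E (fun x => v T x * w0 s T x).
  rewrite -sumrB; apply: eq_bigr => E _; rewrite -mulrBr; congr (_ * _).
  rewrite (@eq_face_int _ _ _ E _ (fun x => 1 * (wb s E x * v T x) + (-1) * (v T x * w0 s T x))).
    by rewrite face_int_lin ?mul1r ?mulN1r//; exact: continuousMr.
  by move=> x _; ring.
move: key; set A1 := cell_int T (fun x => v T x * dot _ (grad (w0 s T) x)).
set A2 := cell_int T (fun x => w0 s T x * _); set A3 := cell_int T (fun x => v T x * w0 s T x).
set S1 := \sum_(E | _) _ * face_int E (fun x => wb s E x * _).
by clearbody A1 A2 A3 S1 => <-; ring.
Qed.

Lemma form_b_linr r j a b v l s : in_M r v -> in_W j l -> in_W j s ->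
  form_b beta c r v (wlin a b l s) = a * form_b beta c r v l + b * form_b beta c r v s.
Proof.
move=> pv pl ps; rewrite (form_bE pv (in_W_lin a b pl ps)) (form_bE pv pl) (form_bE pv ps).
rewrite !mulr_sumr -big_split/=; apply: eq_bigr => T _.
have vc := is_poly_continuous (pv T).
have lc := is_poly_continuous (pl.1 T); have sc := is_poly_continuous (ps.1 T).
have lbc E := is_poly_continuous (pl.2 E); have sbc E := is_poly_continuous (ps.2 E).
have lrc := is_poly_continuous (residual_poly T pl).
have src := is_poly_continuous (residual_poly T ps).
rewrite (@eq_cell_int _ _ _ T _ (fun x => a * (v T x * residual beta c l T x) +
   b * (v T x * residual beta c s T x))); last first.
  by move=> x _; rewrite (residual_lin _ _ _ _ pl ps); ring.
rewrite cell_int_lin; [|exact: continuousMr..].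
rewrite !mulrDr addrACA; congr (_ + _); rewrite !mulr_sumr -big_split/=.
apply: eq_bigr => E _.
have dc (w : @weak_fun R n M) : continuous (wb w E) -> continuous (w0 w T) ->
    continuous (fun x => v T x * (wb w E x - w0 w T x)).
  by move=> c1 c2; apply: continuousMr => // x; apply: continuousB; [exact: c1|exact: c2].
rewrite (@eq_face_int _ _ _ E _ (fun x => a * (v T x * (wb l E x - w0 l T x)) +
   b * (v T x * (wb s E x - w0 s T x)))); last by move=> x _ /=; ring.
rewrite face_int_lin; [|exact: dc..].
by ring.
Qed.

Lemma form_b_linl r j a b v v' s : in_M r v -> in_M r v' -> in_W j s ->
  form_b beta c r (fun T x => a * v T x + b * v' T x) s =
  a * form_b beta c r v s + b * form_b beta c r v' s.
Proof.
move=> pv pv' ps; rewrite (form_bE (in_M_lin a b pv pv') ps) (form_bE pv ps) (form_bE pv' ps).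
rewrite !mulr_sumr -big_split/=; apply: eq_bigr => T _.
have vc := is_poly_continuous (pv T); have vc' := is_poly_continuous (pv' T).
have sc := is_poly_continuous (ps.1 T); have sbc E := is_poly_continuous (ps.2 E).
have src := is_poly_continuous (residual_poly T ps).
rewrite (@eq_cell_int _ _ _ T _ (fun x => a * (v T x * residual beta c s T x) +
   b * (v' T x * residual beta c s T x))); last by move=> x _; ring.
rewrite cell_int_lin; [|exact: continuousMr..].
rewrite !mulrDr addrACA; congr (_ + _); rewrite !mulr_sumr -big_split/=.
apply: eq_bigr => E _.
have dc : continuous (fun x => wb s E x - w0 s T x).
  by move=> x; apply: continuousB; [exact: sbc|exact: sc].
rewrite (@eq_face_int _ _ _ E _ (fun x => a * (v T x * (wb s E x - w0 s T x)) +
   b * (v' T x * (wb s E x - w0 s T x)))); last by move=> x _ /=; ring.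
rewrite face_int_lin; [|exact: continuousMr..].
by ring.
Qed.

End weak_functions.

(** * Uniqueness of the multiplier *)

Lemma continuousBr (R : realType) (T : topologicalType) (f g : T -> R) :
  continuous f -> continuous g -> continuous (fun x => f x - g x).
Proof. by move=> cf cg x; apply: cvgB; [exact: cf|exact: cg]. Qed.

Lemma continuous_compr (R : realType) (T : topologicalType) (f : T -> R) (g : R -> R) :
  continuous f -> continuous g -> continuous (fun x => g (f x)).
Proof. by move=> cf cg x; exact: (continuous_comp (cf x) (cg _)). Qed.

Section Lp_lemmas.
Context d (T : measurableType d) {R : realType} (mu : {measure set T -> \bar R}).
Variables (D : set T) (p : R).
Hypotheses (mD : measurable D) (p_ge1 : 1 <= p).

Let p0 : 0 < p. Proof. exact: lt_le_trans p_ge1. Qed.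

(** The larger absolute value carries the estimate. A crude constant suffices, since only finiteness
    and convergence to zero of sums are derived from it. *)
Lemma powR_normD (a b : R) : `|a + b| `^ p <= 2 `^ p * (`|a| `^ p + `|b| `^ p).
Proof.
wlog ab : a b / `|a| <= `|b|.
  move=> h; have [ab|ab] := leP `|a| `|b|; first exact: h.
  by rewrite addrC [X in _ * X]addrC; apply: h; exact: ltW.
apply: (@le_trans _ _ ((2 * `|b|) `^ p)).
  apply: ge0_ler_powR; [exact: ltW|by rewrite nnegrE|by rewrite nnegrE mulr_ge0|].
  apply: le_trans (ler_normD _ _) _; move: ab; lra.
by rewrite powRM// ler_wpM2l ?powR_ge0// lerDr powR_ge0.
Qed.

Let mpow (f : T -> R) : measurable_fun D f ->
  measurable_fun D (fun x => (`|f x| `^ p)%:E).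
Proof. by move=> mf; apply/measurable_EFinP; exact: measurable_norm_powR. Qed.

Lemma Lp_integralD_le : exists2 C : R, 0 <= C & forall f g : T -> R,
  measurable_fun D f -> measurable_fun D g ->
  (\int[mu]_(x in D) (`|f x + g x| `^ p)%:E <=
   C%:E * (\int[mu]_(x in D) (`|f x| `^ p)%:E + \int[mu]_(x in D) (`|g x| `^ p)%:E))%E.
Proof.
exists (2 `^ p); first exact: powR_ge0.
move=> f g mf mg; have := @powR_normD; have := powR_ge0 2 p.
move: (2 `^ p) => C C0 hC.
rewrite -ge0_integralD//; [|exact: mpow..].
rewrite -ge0_integralZl//; [|by apply: emeasurable_funD; exact: mpow|
  by move=> x _; rewrite -EFinD lee_fin addr_ge0// powR_ge0].
apply: ge0_le_integral => //.
- by apply: (mpow (f := fun x => f x + g x)); exact: measurable_funD.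
- by apply: measurable_funeM; apply: emeasurable_funD; exact: mpow.
- by move=> x _; rewrite -EFinD -EFinM lee_fin hC.
Qed.

Lemma in_LpD (f g : T -> R) : in_Lp mu p D f -> in_Lp mu p D g ->
  in_Lp mu p D (fun x => f x + g x).
Proof.
move=> [mf fo] [mg go]; split; first exact: measurable_funD.
have [C C0 hC] := Lp_integralD_le.
have key (a b e : \bar R) : (e <= C%:E * (a + b) -> a < +oo -> b < +oo -> e < +oo)%E.
  move=> eab ao bo; apply: le_lt_trans eab _.
  by apply: lte_mul_pinfty => //; exact: lte_add_pinfty.
exact: key (hC f g mf mg) fo go.
Qed.

Lemma Lp_cvgD (f_ g_ : nat -> T -> R) (f g : T -> R) :
  (forall m, measurable_fun D (f_ m)) -> (forall m, measurable_fun D (g_ m)) ->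
  measurable_fun D f -> measurable_fun D g ->
  Lp_cvg mu p D f_ f -> Lp_cvg mu p D g_ g ->
  Lp_cvg mu p D (fun m x => f_ m x + g_ m x) (fun x => f x + g x).
Proof.
move=> mf_ mg_ mf mg; rewrite /Lp_cvg; have [C C0 hC] := Lp_integralD_le.
move=> fc gc.
have key (a b e : nat -> \bar R) : (forall m, 0 <= e m)%E ->
    (forall m, e m <= C%:E * (a m + b m))%E ->
    a @ \oo --> 0%E -> b @ \oo --> 0%E -> e @ \oo --> 0%E.
  move=> e0 eab ac bc.
  have abc : (fun m => a m + b m)%E @ \oo --> (0 + 0)%E by exact: cvgeD.
  have Cc : (fun m => C%:E * (a m + b m))%E @ \oo --> (C%:E * (0 + 0))%E by exact: cvgeZl.
  rewrite adde0 mule0 in Cc.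
  by apply: (squeeze_cvge _ (cvg_cst 0%E) Cc); apply: nearW => m; rewrite e0 eab.
apply: (key _ _ _ _ _ fc gc) => m.
  by apply: integral_ge0 => x _; rewrite lee_fin powR_ge0.
rewrite [leLHS](_ : _ = \int[mu]_(x in D) (`|(f_ m x - f x) + (g_ m x - g x)| `^ p)%:E)%E.
  by apply: (hC (fun x => f_ m x - f x) (fun x => g_ m x - g x)); exact: measurable_funB.
by apply: eq_integral => x _; rewrite opprD addrACA.
Qed.

Hypothesis Dfin : (mu D < +oo)%E.

Lemma ler_norm_1_powR (a : R) : `|a| <= 1 + `|a| `^ p.
Proof.
have [a1|a1] := leP `|a| 1; first by rewrite (le_trans a1)// lerDl powR_ge0.
by rewrite (le_trans (le1r_powR (ltW a1) p_ge1))// lerDr.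
Qed.

Lemma in_Lp_integrable (f : T -> R) : in_Lp mu p D f -> mu.-integrable D (EFin \o f).
Proof.
move=> [mf fo]; have ip : mu.-integrable D (fun x => (`|f x| `^ p)%:E).
  apply/integrableP; split; first exact: mpow.
  rewrite (eq_integral (fun x => (`|f x| `^ p)%:E))// => x _.
  by rewrite gee0_abs// lee_fin powR_ge0.
have i1 : mu.-integrable D (EFin \o cst 1).
  apply: (@bounded_integrable _ _ _ mu D (cst 1) 1 mD Dfin (measurable_cst _)).
  by move=> x _; rewrite normr1.
apply: (le_integrable mD _ _ (integrableD mD i1 ip)); first exact/measurable_EFinP.
move=> x _ /=; rewrite lee_fin [leRHS]ger0_norm; last by rewrite addr_ge0// powR_ge0.
exact: ler_norm_1_powR.
Qed.

Lemma integrable_mul_bounded (f g : T -> R) (K : R) : mu.-integrable D (EFin \o f) ->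
  measurable_fun D g -> (forall x, D x -> `|g x| <= K) ->
  mu.-integrable D (EFin \o (fun x => f x * g x)).
Proof.
move=> fi mg gK; have mf : measurable_fun D f by exact/measurable_EFinP/measurable_int/fi.
apply: (le_integrable mD _ _ (integrableZl mD K fi)).
  by apply/measurable_EFinP; exact: measurable_funM.
move=> x Dx /=; rewrite lee_fin !normrM mulrC ler_wpM2r//.
by apply: le_trans (gK x Dx) _; exact: ler_norm.
Qed.

End Lp_lemmas.

Section W1p_sum.
Context {R : realType} {n : nat} (Omega : set 'rV[R]_n.+1) (M : mesh R n)
  (beta : cells M -> 'rV[R]_n.+1) (c : cells M -> R) (p : R).
Hypotheses (meshM : polytopal_partition Omega M) (domOmega : lipschitz_domain Omega).
Hypothesis p_gt1 : 1 < p.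
Local Notation vec := 'rV[R]_n.+1.
Local Notation mu := (lebesgue_rV n.+1).

Lemma in_W1p0D v v' G G' t t' : in_W1p0 Omega beta p v G t -> in_W1p0 Omega beta p v' G' t' ->
  in_W1p0 Omega beta p (fun x => v x + v' x) (fun x => G x + G' x) (fun x => t x + t' x).
Proof.
move=> [[vL GL vw] [tL [phi [phi1 pv pG pt]]] t0] [[vL' GL' vw'] [tL' [phi' [phi1' pv' pG' pt']]] t0'].
have mO : measurable Omega by exact: domain_measurable.
have Ofin := domain_finite domOmega.
have bO : bounded_set Omega by have [] := domOmega.
have p1 := ltW p_gt1.
have mE (E : faces M) : measurable (face_ref E) by exact: (@face_ref_measurable _ _ _ _ meshM).
have C1m f : C1 f -> measurable_fun Omega f.
  by move=> f1; apply: continuous_measurable_rV => //; exact: C1_continuous.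
have C1dm f i : C1 f -> measurable_fun Omega (pderiv i f).
  by move=> f1; apply: continuous_measurable_rV => //; exact: C1_pderiv.
have chc E : continuous (@chart _ _ M E) by exact: chart_continuous.
have C1E f (E : faces M) : C1 f -> measurable_fun (face_ref E) (f \o chart E).
  move=> f1; apply: continuous_measurable_rV => // y.
  have cf := C1_continuous f1; exact: (continuous_comp (chc E y) (cf _)).
split.
- split; first exact: in_LpD.
    move=> i; rewrite (_ : (fun x => (G x + G' x) ord0 i) = fun x => G x ord0 i + G' x ord0 i).
      exact: (in_LpD mO p1 (GL i) (GL' i)).
    by apply/funext => x; rewrite mxE.
  move=> psi tpsi i; have [psiCk _] := tpsi; have psi1 : C1 psi by exact: Ck_C1.
  have [K _ hK] := continuous_bounded_rV (C1_continuous psi1) bO.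
  have [K' _ hK'] := continuous_bounded_rV (C1_pderiv (i := i) psi1) bO.
  have i1 f : in_Lp mu p Omega f -> mu.-integrable Omega (EFin \o (fun x => f x * pderiv i psi x)).
    move=> fL; apply: (integrable_mul_bounded (K := K') mO (in_Lp_integrable mO p1 Ofin fL)) => //.
    exact: C1dm.
  have i2 f : in_Lp mu p Omega f -> mu.-integrable Omega (EFin \o (fun x => f x * psi x)).
    move=> fL; apply: (integrable_mul_bounded (K := K) mO (in_Lp_integrable mO p1 Ofin fL)) => //.
    exact: C1m.
  under eq_Rintegral do rewrite mulrDl.
  under [in RHS]eq_Rintegral do rewrite mxE mulrDl.
  rewrite RintegralD//; [|exact: i1..]; rewrite RintegralD//; [|exact: i2 (GL i)|exact: i2 (GL' i)].
  by rewrite vw// vw'// opprD.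
- split; first by move=> E EO; apply: in_LpD => //; [exact: tL|exact: tL'].
  exists (fun m x => phi m x + phi' m x); split.
  + by move=> m; exact: (C1D (phi1 m) (phi1' m)).
  + exact: (Lp_cvgD mO p1 (fun m => C1m _ (phi1 m)) (fun m => C1m _ (phi1' m)) vL.1 vL'.1 pv pv').
  + move=> i; rewrite (_ : (fun m => _) = fun m x => pderiv i (phi m) x + pderiv i (phi' m) x); last first.
      by apply/funext => m; rewrite (pderivD i (phi1 m) (phi1' m)).
    rewrite (_ : (fun x => (G x + G' x) ord0 i) = fun x => G x ord0 i + G' x ord0 i); last first.
      by apply/funext => x; rewrite mxE.
    exact: (Lp_cvgD mO p1 (fun m => C1dm _ i (phi1 m)) (fun m => C1dm _ i (phi1' m))
      (GL i).1 (GL' i).1 (pG i) (pG' i)).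
  + move=> E EO; exact: (Lp_cvgD (mE E) p1 (fun m => C1E _ E (phi1 m))
      (fun m => C1E _ E (phi1' m)) (tL E EO).1 (tL' E EO).1 (pt E EO) (pt' E EO)).
- move=> E EG; have h := t0 E EG; have h' := t0' E EG.
  by apply: filterS2 h h' => y /= hy hy' Ey; rewrite hy// hy'// addr0.
Qed.

(** A homogeneous solution added to a solution for the datum [theta] gives another one, so
    uniqueness for this one datum is enough. *)
Lemma adjoint_homogeneous theta v G t : adjoint_well_posed Omega beta c p theta ->
  in_W1p0 Omega beta p v G t ->
  ae_eq_on mu Omega (fun x => dot (betaf beta x) (G x) - cf c x * v x) (fun=> 0) ->
  ae_eq_on mu Omega v (fun=> 0).
Proof.
move=> [[Psi hPsi] uPsi] vW v0; have [G' [t' [PW Peq]]] := hPsi.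
have sol : adjoint_solution Omega beta c p theta (fun x => Psi x + v x).
  exists (fun x => G' x + G x), (fun x => t' x + t x); split; first exact: in_W1p0D.
  apply: filterS2 Peq v0 => x h1 h2 Ox; rewrite -h1// dotDr mulrDr opprD addrACA h2//.
  by rewrite addr0.
have := uPsi _ _ sol hPsi; apply: filterS => x h Ox.
by apply: (@addrI _ (Psi x)); rewrite addr0 h.
Qed.

End W1p_sum.

Section multiplier_uniqueness.
Context {R : realType} {n : nat} (Omega : set 'rV[R]_n.+1) (M : mesh R n)
  (beta : cells M -> 'rV[R]_n.+1) (c : cells M -> R) (p rho tau : R) (k j : nat).
Hypotheses (meshM : polytopal_partition Omega M) (domOmega : lipschitz_domain Omega).
Hypotheses (p_gt1 : 1 < p) (rho_gt0 : 0 < rho) (tau_ge0 : 0 <= tau).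
Hypothesis degrees : j = k.-1 \/ (j = k /\ 0 < tau).
Variable theta : 'rV[R]_n.+1 -> R.
Hypothesis adjoint_wp : adjoint_well_posed Omega beta c p theta.
Local Notation vec := 'rV[R]_n.+1.
Local Notation mu := (lebesgue_rV n.+1).
Implicit Types (s l : @weak_fun R n M) (v : cells M -> vec -> R).

Lemma meshsize_gt0 (T : cells M) : 0 < meshsize T.
Proof.
have [[x Tx] _ _] := cell_polytope meshM T.
have /nbhs_rV_normP[e e0 he] : nbhs x (cell T).
  by apply: open_nbhs_nbhs; split=> //; exact: (@cell_open _ _ _ _ meshM).
have [K K0 hK] := iffLR (bounded_rVP _) (@cell_bounded _ _ _ _ meshM T).
pose w : vec := (e / 2) *: delta_mx ord0 ord0.
have w0 : w != 0.
  apply/eqP => /matrixP/(_ ord0 ord0); rewrite !mxE !eqxx mulr1 => /eqP.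
  by rewrite gt_eqF// divr_gt0.
have Txw : cell T (x + w).
  apply: he; rewrite addrAC subrr add0r normrZ gtr0_norm ?divr_gt0//.
  apply: (@le_lt_trans _ _ (e / 2)); last by rewrite ltr_pdivrMr// ltr_pMr// ltr1n.
  have e2 : 0 <= e / 2 by rewrite ltW// divr_gt0.
  by rewrite ler_piMr//; exact: rV_norm_delta.
have ew : 0 < enorm w.
  rewrite /enorm sqrtr_gt0 lt_neqAle eq_sym sumr_ge0 ?andbT; last first.
    by move=> i _; rewrite -expr2 sqr_ge0.
  apply/eqP => /eqP; rewrite psumr_eq0; last by move=> i _; rewrite -expr2 sqr_ge0.
  move=> /allP h; move/eqP: w0; apply; apply/rowP => i; rewrite [RHS]mxE.
  by have := h i (mem_index_enum _); rewrite /= mulf_eq0 orbb => /eqP.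
apply: (lt_le_trans ew); rewrite /meshsize /diam; apply: sup_ubound.
  exists (n.+1%:R * (K + K)) => _ [[y z] [Ty Tz] <-].
  apply: le_trans (enorm_le_norm _) _; rewrite ler_wpM2l//.
  by apply: le_trans (ler_normB _ _) _; apply: lerD; apply/ltW/hK.
by exists (x + w, x) => //=; rewrite addrAC subrr add0r.
Qed.

Definition jump_spow l s T (E : faces M) (x : vec) : R :=
  spow p (w0 l T x - wb l E x) * (w0 s T x - wb s E x).

Lemma jump_continuous s T E : in_W j s -> continuous (fun x => w0 s T x - wb s E x).
Proof.
move=> [s0 sb]; apply: continuousBr.
  exact: (is_poly_continuous (s0 T)).
exact: (is_poly_continuous (sb E)).
Qed.

Lemma jump_spow_continuous l s T E : in_W j l -> in_W j s -> continuous (jump_spow l s T E).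
Proof.
move=> pl ps; apply: continuousMr; last exact: jump_continuous.
apply: continuous_compr; [exact: jump_continuous|exact: spow_continuous].
Qed.

Lemma residual_spow_continuous l s T : in_W j l -> in_W j s ->
  continuous (fun x => spow p (residual beta c l T x) * residual beta c s T x).
Proof.
move=> pl ps; apply: continuousMr; last exact: is_poly_continuous (residual_poly _ _ _ ps).
apply: continuous_compr; last exact: spow_continuous.
exact: is_poly_continuous (residual_poly _ _ _ pl).
Qed.

Lemma form_s_linr a b l s s' : in_W j l -> in_W j s -> in_W j s' ->
  form_s beta c p rho tau l (wlin a b s s') =
  a * form_s beta c p rho tau l s + b * form_s beta c p rho tau l s'.
Proof.
move=> pl ps ps'; rewrite !mulr_sumr -big_split/=; apply: eq_bigr => T _.
rewrite (@eq_cell_int _ _ _ T _ (fun x =>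
    a * (spow p (residual beta c l T x) * residual beta c s T x) +
    b * (spow p (residual beta c l T x) * residual beta c s' T x))); last first.
  by move=> x _; rewrite (residual_lin _ _ _ _ _ _ ps ps'); ring.
rewrite (cell_int_lin meshM); [|exact: residual_spow_continuous..].
have -> : cell_bnd_int T (fun E x => spow p (w0 l T x - wb l E x) *
      (w0 (wlin a b s s') T x - wb (wlin a b s s') E x)) =
    a * cell_bnd_int T (fun E x => jump_spow l s T E x) +
    b * cell_bnd_int T (fun E x => jump_spow l s' T E x).
  rewrite /cell_bnd_int !mulr_sumr -big_split/=; apply: eq_bigr => E _.
  rewrite -(face_int_lin meshM); [|exact: jump_spow_continuous..].
  by apply: eq_face_int => x _; rewrite /jump_spow/=; ring.
rewrite /jump_spow.
move: (cell_bnd_int T _) (cell_bnd_int T _) (cell_int T _) (cell_int T _) => x1 x2 x3 x4.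
by ring.
Qed.

(** The difference of the two sides is a positively weighted sum of integrals of continuous
    nonnegative functions. All of them vanish, and strict monotonicity of [spow] turns a zero
    integrand into equal arguments. *)
Lemma form_s_monotone l l' : in_W j l -> in_W j l' ->
  form_s beta c p rho tau l (wlin 1 (-1) l l') =
    form_s beta c p rho tau l' (wlin 1 (-1) l l') ->
  (forall T E x, incident T E -> face E x ->
    w0 (wlin 1 (-1) l l') T x = wb (wlin 1 (-1) l l') E x) /\
  (0 < tau -> forall T x, cell T x -> residual beta c (wlin 1 (-1) l l') T x = 0).
Proof.
move=> pl pl'; set e := wlin 1 (-1) l l'; have pe : in_W j e by exact: in_W_lin.
have cl T E := @jump_continuous l T E pl; have cl' T E := @jump_continuous l' T E pl'.
pose fD T E (x : vec) : R := (spow p (w0 l T x - wb l E x) - spow p (w0 l' T x - wb l' E x)) *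
  ((w0 l T x - wb l E x) - (w0 l' T x - wb l' E x)).
pose cD T (x : vec) : R := (spow p (residual beta c l T x) - spow p (residual beta c l' T x)) *
  (residual beta c l T x - residual beta c l' T x).
have cfD T E : continuous (fD T E).
  have sc := spow_continuous p_gt1.
  apply: continuousMr; apply: continuousBr; [| |exact: cl|exact: cl'].
    by apply: continuous_compr => //; exact: cl.
  by apply: continuous_compr => //; exact: cl'.
have cr l1 T : in_W j l1 -> continuous (residual beta c l1 T).
  by move=> p1; exact: is_poly_continuous (residual_poly _ _ _ p1).
have ccD T : continuous (cD T).
  have sc := spow_continuous p_gt1.
  apply: continuousMr; apply: continuousBr; [| |exact: cr|exact: cr].
    by apply: continuous_compr => //; exact: cr.
  by apply: continuous_compr => //; exact: cr.
have fD0 T E x : 0 <= fD T E x by exact: spow_monotone.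
have cD0 T x : 0 <= cD T x by exact: spow_monotone.
have ifD T E : 0 <= face_int E (fD T E) by apply: Rintegral_ge0 => y _; exact: fD0.
have icD T : 0 <= cell_int T (cD T) by apply: Rintegral_ge0 => y _; exact: cD0.
pose A T := rho * meshsize T `^ (1 - p) * cell_bnd_int T (fD T) + tau * cell_int T (cD T).
have h0 (T : cells M) : 0 < rho * meshsize T `^ (1 - p).
  by rewrite mulr_gt0// powR_gt0// meshsize_gt0.
have bnd0 T : 0 <= cell_bnd_int T (fD T) by apply: sumr_ge0 => E _.
have A0 T : 0 <= A T by rewrite addr_ge0// mulr_ge0// ltW.
have diff : form_s beta c p rho tau l e - form_s beta c p rho tau l' e = \sum_T A T.
  rewrite -sumrB; apply: eq_bigr => T _; rewrite /A.
  have -> : cell_bnd_int T (fD T) =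
      cell_bnd_int T (jump_spow l e T) - cell_bnd_int T (jump_spow l' e T).
    rewrite /cell_bnd_int -sumrB; apply: eq_bigr => E _.
    rewrite (@eq_face_int _ _ _ E (fD T E) (fun x => 1 * jump_spow l e T E x + (-1) * jump_spow l' e T E x)).
      by rewrite (face_int_lin meshM) ?mul1r ?mulN1r//; exact: jump_spow_continuous.
    by move=> x _; rewrite /fD /jump_spow /=; ring.
  rewrite (@eq_cell_int _ _ _ T (cD T) (fun x =>
     1 * (spow p (residual beta c l T x) * residual beta c e T x) +
     (-1) * (spow p (residual beta c l' T x) * residual beta c e T x))); last first.
    by move=> x _; rewrite /cD (residual_lin _ _ _ _ _ _ pl pl'); ring.
  rewrite (cell_int_lin meshM); [|exact: residual_spow_continuous..].
  rewrite /jump_spow.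
  move: (cell_bnd_int T _) (cell_bnd_int T _) (cell_int T _) (cell_int T _) => x1 x2 x3 x4.
  by ring.
move=> /eqP; rewrite -subr_eq0 diff psumr_eq0; last by move=> T _.
move=> /allP AT; have {}AT T : A T = 0 by apply/eqP; exact: (AT T (mem_index_enum _)).
have AB T : cell_bnd_int T (fD T) = 0 /\ tau * cell_int T (cD T) = 0.
  have := AT T => /eqP; rewrite paddr_eq0; [|by rewrite mulr_ge0// ltW|by rewrite mulr_ge0].
  by rewrite mulf_eq0 gt_eqF//= => /andP[/eqP ? /eqP ?].
split=> [T E x TE Ex|tau0 T x Tx].
  have /eqP := (AB T).1; rewrite /cell_bnd_int psumr_eq0//.
  move=> /allP/(_ E (mem_index_enum _)); rewrite TE/= => /eqP iE.
  move: Ex => [y Ey <-].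
  have chc : continuous (@chart _ _ M E) by exact: chart_continuous.
  have cE : continuous (fD T E \o chart E) by move=> z; exact: (continuous_comp (chc z) (@cfD T E _)).
  have : (fD T E \o chart E) y = 0.
    apply: (ge0_continuous_Rintegral_eq0 cE _ _ _ iE Ey).
    - exact: (@face_ref_open _ _ _ _ meshM).
    - exact: (@face_ref_bounded _ _ _ _ meshM).
    - by move=> z _; exact: fD0.
  by move=> /= /(spow_monotone_eq p_gt1) /=; lra.
have /eqP := (AB T).2; rewrite mulf_eq0 gt_eqF//= => /eqP iT.
have : cD T x = 0.
  apply: (ge0_continuous_Rintegral_eq0 (@ccD T) _ _ _ iT Tx).
  - exact: (@cell_open _ _ _ _ meshM).
  - exact: (@cell_bounded _ _ _ _ meshM).
  - by move=> z _; exact: cD0.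
move=> /(spow_monotone_eq p_gt1); rewrite (residual_lin _ _ _ _ _ _ pl pl') => ->.
by ring.
Qed.

(** Single-valued face components are what makes the pieces agree across faces and vanish on the
    outflow. Once the pieces vanish, continuity up to the boundary of a cell makes the face
    components vanish as well. *)
Lemma trace_free_zero e : in_W0 Omega beta j e ->
  (forall T E x, incident T E -> face E x -> w0 e T x = wb e E x) ->
  (forall T x, cell T x -> residual beta c e T x = 0) ->
  (forall T x, cell T x -> w0 e T x = 0) /\ (forall E x, face E x -> wb e E x = 0).
Proof.
move=> [[pe0 peb] eG] e0b res0.
have e1 T : C1 (w0 e T) by exact: is_poly_C1 (pe0 T).
have agree T T' E x : incident T E -> incident T' E -> face E x -> w0 e T x = w0 e T' x.
  by move=> TE T'E Ex; rewrite (e0b T E)// (e0b T' E).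
have Gp T E x : incident T E -> face E `<=` Gamma_plus Omega beta -> face E x -> w0 e T x = 0.
  by move=> TE EG Ex; rewrite (e0b T E)//; exact: eG.
have [t vW] := glued_in_W1p0 meshM domOmega p_gt1 e1 agree Gp.
have cells0 : ae_eq_on mu Omega
    (fun x => dot (betaf beta x) (glued_grad (w0 e) x) - cf c x * cell_sum (w0 e) x) (fun=> 0).
  have := ae_cells meshM; apply: filterS => x h Ox; have [T Tx] := h Ox.
  rewrite (cell_sumE meshM _ Tx) /glued_grad (cell_sum_vecE meshM _ Tx).
  rewrite [betaf _ _](cell_sum_vecE meshM (fun T _ => beta T) Tx).
  by rewrite [cf _ _](cell_sumE meshM (fun T _ => c T) Tx); exact: res0.
have v0 := adjoint_homogeneous meshM domOmega p_gt1 adjoint_wp vW cells0.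
have zero T x : cell T x -> w0 e T x = 0.
  apply: (continuous_ae_eq_rV (f := w0 e T) (g := fun=> 0)).
  - exact: C1_continuous.
  - by move=> y; exact: cst_continuous.
  - exact: (@cell_open _ _ _ _ meshM).
  - apply: filterS v0 => y h Ty; rewrite -(cell_sumE meshM _ Ty) h//.
    exact: cell_subset meshM domOmega _ _ Ty.
split=> // E x Ex; have [T TE] := face_incident meshM E.
rewrite -(e0b T E x TE Ex).
have cZ : closed [set y | w0 e T y = 0].
  apply: (closed_comp (f := w0 e T) (D := [set 0])); last exact: closed_eq.
  by move=> y _; exact: C1_continuous.
apply: cZ; have := iffLR (incidentE meshM T E) TE _ Ex.
rewrite (boundary_cellE meshM) => -[cx _]; apply: closureS cx => y; exact: zero.
Qed.

(** Here the two choices of degree part. For [j = k - 1] the residual is an admissible [v] because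
    the coefficients are constant on a cell and differentiation does not raise the degree. *)
Lemma jump_free_residual e : in_W0 Omega beta j e ->
  (forall T E x, incident T E -> face E x -> w0 e T x = wb e E x) ->
  (0 < tau -> forall T x, cell T x -> residual beta c e T x = 0) ->
  (forall v, in_M k.-1 v -> form_b beta c k.-1 v e = 0) ->
  forall T x, cell T x -> residual beta c e T x = 0.
Proof.
move=> [pe _] e0b restau be0 T x Tx; case: degrees => [jk|[_ /restau h]]; last exact: h.
have pr U : is_poly k.-1 (residual beta c e U) by rewrite -jk; exact: residual_poly.
have := be0 (fun U => residual beta c e U) pr.
rewrite (form_bE beta c meshM (pr : in_M k.-1 _) pe) => h.
have rc U := is_poly_continuous (pr U).
have : \sum_U cell_int U (fun x => residual beta c e U x * residual beta c e U x) = 0.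
  apply: etrans h; apply: eq_bigr => U _; rewrite [X in _ = _ + X]big1 ?addr0// => E UE.
  by rewrite face_int_eq0 ?mulr0// => y Ey; rewrite (e0b U E)// subrr mulr0.
move=> /eqP; rewrite psumr_eq0; last first.
  by move=> U _; apply: Rintegral_ge0 => y _; rewrite -expr2 sqr_ge0.
move=> /allP/(_ T (mem_index_enum _))/eqP i0.
exact: (cell_int0_poly meshM (rc T) i0 Tx).
Qed.

(** The third conclusion is the link to the primal variable: with equal stabilizer terms,
    subtracting the first equations leaves [b(u - u', s) = 0] for every test function. *)
Lemma multiplier_unique f g u l u' l' : PDWG_solution Omega beta c p rho tau k j f g u l ->
  PDWG_solution Omega beta c p rho tau k j f g u' l' ->
  [/\ forall T x, cell T x -> w0 l T x = w0 l' T x,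
      forall E x, face E x -> wb l E x = wb l' E x &
      forall s, form_s beta c p rho tau l s = form_s beta c p rho tau l' s].
Proof.
move=> [pu pl eq1 eq2] [pu' pl' eq1' eq2'].
pose e := wlin 1 (-1) l l'; have pe : in_W0 Omega beta j e by exact: in_W0_lin.
have be0 v : in_M k.-1 v -> form_b beta c k.-1 v e = 0.
  by move=> pv; rewrite (form_b_linr _ _ meshM _ _ pv pl.1 pl'.1) eq2// eq2'// !mulr0 addr0.
have se : form_s beta c p rho tau l e = form_s beta c p rho tau l' e.
  have := eq1 e pe; have := eq1' e pe; rewrite !be0// !addr0 => -> ->.
  by [].
have [h1 h2] := form_s_monotone pl.1 pl'.1 se.
have r0 := jump_free_residual pe h1 h2 be0.
have [z0 zb] := trace_free_zero pe h1 r0.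
split=> [T x /z0|E x /zb|s] /=; [by lra..|].
apply: eq_bigr => T _; congr (_ * _ + _ * _).
  apply: eq_bigr => E TE; apply: eq_face_int => x Ex; congr (spow p _ * _).
  by have /= := h1 T E x TE Ex; lra.
apply: eq_cell_int => x Tx; congr (spow p _ * _).
by have := r0 T x Tx; rewrite (residual_lin _ _ _ _ _ _ pl.1 pl'.1); lra.
Qed.

End multiplier_uniqueness.

(** * Uniqueness of the primal variable *)

Lemma cvg_sumr (R : realType) (I : finType) (f : I -> nat -> R) (a : I -> R) :
  (forall i, f i @ \oo --> a i) -> (fun m => \sum_i f i m) @ \oo --> \sum_i a i.
Proof.
move=> fa; elim: (index_enum I) => [|i r IH].
  by under eq_fun do rewrite big_nil; rewrite big_nil; exact: cvg_cst.
by under eq_fun do rewrite big_cons; rewrite big_cons; exact: cvgD.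
Qed.

Section Lp_duality.
Context d (T : measurableType d) {R : realType} (mu : {measure set T -> \bar R}).
Variables (D : set T) (p : R).
Hypotheses (mD : measurable D) (p_ge1 : 1 <= p).

Let p0 : 0 < p. Proof. exact: lt_le_trans p_ge1. Qed.

Lemma in_LpM_bounded (f g : T -> R) (K : R) : in_Lp mu p D f -> measurable_fun D g ->
  (forall x, D x -> `|g x| <= K) -> in_Lp mu p D (fun x => g x * f x).
Proof.
move=> [mf fo] mg gK; split; first exact: measurable_funM.
have Kp0 : 0 <= `|K| `^ p by exact: powR_ge0.
have mpow (h : T -> R) : measurable_fun D h -> measurable_fun D (fun x => (`|h x| `^ p)%:E).
  by move=> mh; apply/measurable_EFinP; exact: measurable_norm_powR.
have le : (\int[mu]_(x in D) (`|g x * f x| `^ p)%:E <=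
    (`|K| `^ p)%:E * \int[mu]_(x in D) (`|f x| `^ p)%:E)%E.
  rewrite -ge0_integralZl//; [|exact: mpow].
  apply: ge0_le_integral => //.
  - by apply: (mpow (fun x => g x * f x)); exact: measurable_funM.
  - by apply: measurable_funeM; exact: mpow.
  - move=> x Dx; rewrite -EFinM lee_fin normrM powRM// ler_wpM2r ?powR_ge0//.
    apply: ge0_ler_powR; [exact: ltW|by rewrite nnegrE|by rewrite nnegrE|].
    by apply: le_trans (gK x Dx) _; exact: ler_norm.
apply: le_lt_trans le _; exact: lte_mul_pinfty.
Qed.

Lemma in_Lp_sum (I : finType) (f : I -> T -> R) : (forall i, in_Lp mu p D (f i)) ->
  in_Lp mu p D (fun x => \sum_i f i x).
Proof.
move=> hf; elim: (index_enum I) => [|i r IH].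
  under eq_fun do rewrite big_nil; split; first exact: measurable_cst.
  rewrite integral0_eq ?ltry// => x _.
  by rewrite normr0 powR0// gt_eqF.
by under eq_fun do rewrite big_cons; exact: (in_LpD mD p_ge1 (hf i) IH).
Qed.

Lemma in_Lp_young (q : R) (f g : T -> R) : 0 < q -> p^-1 + q^-1 = 1 ->
  in_Lp mu q D f -> in_Lp mu p D g -> mu.-integrable D (EFin \o (fun x => f x * g x)).
Proof.
move=> q0 pq [mf fo] [mg go].
have pint (r : R) (h : T -> R) : measurable_fun D h ->
    (\int[mu]_(x in D) (`|h x| `^ r)%:E < +oo)%E ->
    mu.-integrable D (EFin \o (fun x => `|h x| `^ r)).
  move=> mh ho; apply/integrableP; split.
    by apply/measurable_EFinP; exact: measurable_norm_powR.
  rewrite (eq_integral (fun x => (`|h x| `^ r)%:E))// => x _.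
  by rewrite gee0_abs// lee_fin powR_ge0.
have i1 := integrableZl mD p^-1 (pint p g mg go).
have i2 := integrableZl mD q^-1 (pint q f mf fo).
apply: (le_integrable mD _ _ (integrableD mD i1 i2)).
  by apply/measurable_EFinP; exact: measurable_funM.
move=> x _ /=; rewrite lee_fin [leRHS]ger0_norm; last first.
  by rewrite addr_ge0// mulr_ge0 ?powR_ge0// invr_ge0 ltW.
have := @conjugate_powR R `|g x| `|f x| p q (normr_ge0 _) (normr_ge0 _) p0 q0 pq.
by rewrite normrM mulrC [p^-1 * _]mulrC [q^-1 * _]mulrC.
Qed.

Hypothesis Dfin : (mu D < +oo)%E.

(** Above the threshold [eps] the factor [(|a| / eps)^(p-1)] is at least one. On a set of finite
    measure this yields L^1 convergence from L^p convergence in place of Holder's inequality. *)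
Lemma ler_norm_eps_powR (eps a : R) : 0 < eps -> `|a| <= eps + eps `^ (1 - p) * `|a| `^ p.
Proof.
move=> e0; have [ae|ae] := leP `|a| eps.
  by rewrite (le_trans ae)// lerDl mulr_ge0// powR_ge0.
have a0 : 0 < `|a| by exact: lt_trans ae.
rewrite -[leLHS]add0r lerD ?(ltW e0)//.
have -> : `|a| `^ p = `|a| * `|a| `^ (p - 1) by rewrite mulr_powRB1.
rewrite mulrCA ler_peMr// (_ : 1 - p = - (p - 1)); last by rewrite opprB.
rewrite powRN mulrC ler_pdivlMr ?powR_gt0// mul1r.
apply: ge0_ler_powR; [by rewrite subr_ge0|by rewrite nnegrE ltW|by rewrite nnegrE|].
exact: ltW.
Qed.

Lemma Lp_cvg_Rintegral (f_ : nat -> T -> R) (f g : T -> R) (K : R) :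
  (forall m, in_Lp mu p D (f_ m)) -> in_Lp mu p D f -> measurable_fun D g ->
  (forall x, D x -> `|g x| <= K) -> Lp_cvg mu p D f_ f ->
  (fun m => \int[mu]_(x in D) (g x * f_ m x)) @ \oo --> \int[mu]_(x in D) (g x * f x).
Proof.
move=> f_L fL mg gK fcv.
have gi h : in_Lp mu p D h -> mu.-integrable D (EFin \o (fun x => g x * h x)).
  move=> hL; have := integrable_mul_bounded mD (in_Lp_integrable mD p_ge1 Dfin hL) mg gK.
  by apply: eq_integrable => // x _ /=; rewrite mulrC.
have mdiff m : measurable_fun D (fun x => f_ m x - f x).
  by apply: measurable_funB; [exact: (f_L m).1|exact: fL.1].
pose I m := (\int[mu]_(x in D) (`|f_ m x - f x| `^ p)%:E)%E.
have Dfn : mu D \is a fin_num by rewrite ge0_fin_numE.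
have K0 : 0 <= `|K| by [].
have bound (eps : R) m : 0 < eps ->
    (`|(\int[mu]_(x in D) (g x * f_ m x) - \int[mu]_(x in D) (g x * f x))%:E| <=
     (`|K| * eps)%:E * mu D + (`|K| * eps `^ (1 - p))%:E * I m)%E.
  move=> eps0; rewrite -(RintegralB mD (gi _ (f_L m)) (gi _ fL)).
  have ii : mu.-integrable D (EFin \o (fun x => g x * f_ m x - g x * f x)).
    by have := integrableB mD (gi _ (f_L m)) (gi _ fL); apply: eq_integrable.
  rewrite /Rintegral fineK; last exact: integrable_fin_num.
  apply: le_trans (le_abse_integral mu mD _) _; first exact: measurable_int ii.
  have e1 : (0 <= `|K| * eps)%R by rewrite mulr_ge0// ltW.
  have e2 : (0 <= `|K| * eps `^ (1 - p))%R by rewrite mulr_ge0// powR_ge0.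
  have mp : measurable_fun D (fun x => (`|f_ m x - f x| `^ p)%:E).
    by apply/measurable_EFinP; exact: (measurable_norm_powR p (mdiff m)).
  have mg1 : measurable_fun D (fun x => (`|K| * eps)%:E + (`|K| * eps `^ (1 - p))%:E * (`|f_ m x - f x| `^ p)%:E)%E.
    by apply: emeasurable_funD => //; exact: measurable_funeM.
  apply: (@le_trans _ _ (\int[mu]_(x in D)
      ((`|K| * eps)%:E + (`|K| * eps `^ (1 - p))%:E * (`|f_ m x - f x| `^ p)%:E))%E).
    apply: ge0_le_integral => //.
    - by apply: measurableT_comp => //; exact: measurable_int ii.
    - move=> x Dx /=; rewrite -EFinM -EFinD lee_fin -mulrBr normrM.
      apply: (@le_trans _ _ (`|K| * `|f_ m x - f x|)).
        by rewrite ler_wpM2r// (le_trans (gK x Dx))// ler_norm.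
      rewrite -!mulrA -mulrDr ler_wpM2l//; exact: ler_norm_eps_powR.
  rewrite ge0_integralD//; last 2 first.
  - by move=> x _; rewrite mule_ge0// lee_fin// powR_ge0.
  - exact: measurable_funeM.
  by rewrite ge0_integralZl// integral_cst.
apply/cvgrPdist_lt => e e0.
(* With this [eps] the first term of [bound] stays below [e / 2] for all [m]; with [eps] fixed, the
   second one tends to zero. The added [1] keeps the denominator positive. *)
pose eps := e / 2 / (`|K| * fine (mu D) + 1).
have d0 : 0 < `|K| * fine (mu D) + 1 by rewrite ltr_wpDl// mulr_ge0// fine_ge0.
have eps0 : 0 < eps by rewrite divr_gt0// divr_gt0.
have small : `|K| * eps * fine (mu D) < e / 2.
  have -> : e / 2 = eps * (`|K| * fine (mu D) + 1) by rewrite /eps divfK// gt_eqF.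
  by rewrite (_ : `|K| * eps * _ = eps * (`|K| * fine (mu D))) ?ltr_pM2l ?ltrDl//; ring.
pose C := `|K| * eps `^ (1 - p) + 1.
have C0 : 0 < C by rewrite ltr_wpDl// mulr_ge0// powR_ge0.
have IC : \forall m \near \oo, (I m < (e / 2 / C)%:E)%E.
  have ec : (0 < (e / 2 / C)%:E)%E by rewrite lte_fin divr_gt0// divr_gt0.
  have : nbhs (0%E : \bar R) [set y | (y < (e / 2 / C)%:E)%E].
    by apply: open_nbhs_nbhs; split; [exact: open_ereal_lt_ereal|exact: ec].
  exact: fcv.
apply: filterS IC => m hm; rewrite distrC.
have I0 : (0 <= I m)%E by apply: integral_ge0 => x _; rewrite lee_fin powR_ge0.
have Ifin : I m \is a fin_num by rewrite ge0_fin_numE// (lt_trans hm)// ltry.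
have := bound eps m eps0; rewrite -(fineK Dfn) -(fineK Ifin) -!EFinM -EFinD lee_fin.
move/le_lt_trans; apply.
move: hm; rewrite -(fineK Ifin) lte_fin => hm.
rewrite [ltRHS]splitr; apply: ltr_leD => //.
apply: (@le_trans _ _ (C * fine (I m))).
  by rewrite /= ler_wpM2r ?fine_ge0// /C lerDl.
by rewrite mulrC -ler_pdivlMr// ltW.
Qed.

End Lp_duality.

Section primal_uniqueness.
Context {R : realType} {n : nat} (Omega : set 'rV[R]_n.+1) (M : mesh R n)
  (beta : cells M -> 'rV[R]_n.+1) (c : cells M -> R) (p q : R) (k j : nat).
Hypotheses (meshM : polytopal_partition Omega M) (domOmega : lipschitz_domain Omega).
Hypotheses (p_gt1 : 1 < p) (pq : p^-1 + q^-1 = 1) (kj : (k.-1 <= j)%N).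
Local Notation vec := 'rV[R]_n.+1.
Local Notation mu := (lebesgue_rV n.+1).
Implicit Types (s : @weak_fun R n M) (w : cells M -> vec -> R).

Lemma is_poly_widen r r' (f : vec -> R) : (r <= r')%N -> is_poly r f -> is_poly r' f.
Proof.
move=> rr /is_polyP[a ->]; apply: is_poly_sum => al alr; apply: is_polyZ.
pose be : @multi_index n.+1 r' := [ffun i => inord (al i)].
have beE i : be i = al i :> nat.
  by rewrite ffunE inordK// ltnS (leq_trans _ rr)// -ltnS.
have -> : (monomial al : vec -> R) = monomial be.
  by apply/funext => x; apply: eq_bigr => i _; rewrite beE.
by apply: is_poly_monomial; under eq_bigr do rewrite beE; exact: leq_trans rr.
Qed.

Lemma Rintegral_cells (h : vec -> R) : mu.-integrable Omega (EFin \o h) ->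
  \int[mu]_(x in Omega) h x = \sum_(T : cells M) cell_int T h.
Proof.
move=> hi; have mO : measurable Omega by exact: domain_measurable.
have mT (T : cells M) : measurable (cell T) by exact: (@cell_measurable _ _ _ _ meshM).
pose U := \big[setU/set0]_(T <- index_enum (cells M)) cell T.
have UP x : U x <-> exists T : cells M, cell T x.
  rewrite /U -bigcup_seq; split=> [[T _ Tx]|[T Tx]]; first by exists T.
  by exists T => //=; exact: mem_index_enum.
have mU : measurable U by exact: bigsetU_measurable.
pose N := Omega `\` U; have mN : measurable N by exact: measurableD.
have N0 : mu N = 0%E.
  apply: measure_negligible => //; apply: negligibleS (ae_cells meshM) => x [Ox nU] /= nh.
  by apply: nU; apply/UP; exact: nh.
have UO : U `<=` Omega by move=> x /UP[T Tx]; exact: cell_subset meshM domOmega _ _ Tx.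
have ON : Omega `\` N = U.
  apply/seteqP; split=> [x [Ox nN]|x Ux]; last by split; [exact: UO|move=> [_]].
  by apply: contrapT => nU; apply: nN.
have hU : mu.-integrable U (EFin \o h) by exact: integrableS hi.
apply: EFin_inj; rewrite /Rintegral fineK; last exact: integrable_fin_num.
rewrite (negligible_integral mN mO hi N0) ON integral_bigsetU_EFin//; last 3 first.
- exact: index_enum_uniq.
- apply/trivIsetP => T T' _ _ TT'; exact: (cell_disjoint meshM TT').
- exact: measurable_int hU.
rewrite -sumEFin; apply: eq_bigr => T _; rewrite /cell_int /Rintegral fineK//.
apply: integrable_fin_num => //; apply: integrableS hi => //.
exact: cell_subset meshM domOmega T.
Qed.

(** Summed with outward normals, this is the jump of the normal flux across an interior face and the
    flux itself on a boundary face. *)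
Definition normal_flux w (E : faces M) (x : vec) : R :=
  \sum_(T | incident T E) dot (beta T) (normal T E) * w T x.

(** In contrast to [form_bE] the derivatives fall on [w], so that the cell and face components of
    the test function appear undifferentiated and can be chosen independently. *)
Lemma form_b_parts r w s : in_M r w -> in_W j s ->
  form_b beta c r w s =
  - \sum_T cell_int T (fun x => w0 s T x * (dot (beta T) (grad (w T) x) + c T * w T x)) +
  \sum_E face_int E (fun x => wb s E x * normal_flux w E x).
Proof.
move=> pw ps.
have w1 T := is_poly_C1 (pw T); have wc T := C1_continuous (w1 T).
have sc T := is_poly_continuous (ps.1 T); have sbc E := is_poly_continuous (ps.2 E).
have wgc T := dot_grad_continuous (b := beta T) (w1 T).
have cc (a : R) : continuous (fun _ : vec => a) by move=> x; exact: cst_continuous.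
have -> : \sum_E face_int E (fun x => wb s E x * normal_flux w E x) =
    \sum_T \sum_(E | incident T E) dot (beta T) (normal T E) * face_int E (fun x => wb s E x * w T x).
  rewrite (exchange_big_dep xpredT)//=; apply: eq_bigr => E _.
  transitivity (\sum_(T | incident T E) face_int E (fun x => dot (beta T) (normal T E) * (wb s E x * w T x))).
    rewrite -(face_int_sum meshM); last by move=> T _; apply: continuousMr => //; exact: continuousMr.
    by apply: eq_face_int => x _; rewrite mulr_sumr; apply: eq_bigr => T _; rewrite mulrCA.
  by apply: eq_bigr => T _; rewrite (face_intZ meshM)//; exact: continuousMr.
rewrite -sumrN -big_split/=; apply: eq_bigr => T _.
have [pG _] := is_wgradP meshM ps r T.
have Gc : continuous (fun x => dot (beta T) (wgrad r s T x)).
  by apply: continuous_sumr => i _; apply: continuousMr => //; exact: is_poly_continuous (pG i).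
rewrite (@eq_cell_int _ _ _ T _ (fun x => 1 * (w T x * dot (beta T) (wgrad r s T x)) +
   (- c T) * (w T x * w0 s T x))); last by move=> x _; ring.
rewrite (cell_int_lin meshM) ?mul1r; [|exact: continuousMr..].
rewrite (wgrad_dot meshM ps)//.
rewrite [in RHS](@eq_cell_int _ _ _ T _ (fun x => 1 * (w0 s T x * dot (beta T) (grad (w T) x)) +
   c T * (w T x * w0 s T x))); last by move=> x _; ring.
rewrite (cell_int_lin meshM) ?mul1r; [|exact: continuousMr..].
move: (cell_int T _) (cell_int T _) (\sum_(E | incident T E) _) => x1 x2 x3.
by ring.
Qed.

(** The tests are the residual itself on a single cell and the flux itself on a single face. They
    are admissible since [k - 1 <= j], and the face test satisfies the constraint because its face
    is not contained in the outflow boundary. *)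
Lemma form_b_kernel w : in_M k.-1 w ->
  (forall s, in_W0 Omega beta j s -> form_b beta c k.-1 w s = 0) ->
  (forall T x, cell T x -> dot (beta T) (grad (w T) x) + c T * w T x = 0) /\
  (forall E, ~ face E `<=` Gamma_plus Omega beta -> forall x, face E x -> normal_flux w E x = 0).
Proof.
move=> pw bw0.
have pD T : is_poly k.-1 (fun x => dot (beta T) (grad (w T) x) + c T * w T x).
  by apply: is_polyD; [exact: is_poly_dot_grad|exact: is_polyZ].
have pF E : is_poly k.-1 (normal_flux w E).
  by apply: is_poly_sum => T _; exact: is_polyZ.
have p0 : is_poly j (fun _ : vec => 0 : R) by exact: is_poly0.
split=> [T x Tx|E EG x Ex].
  pose s : weak_fun M := WeakFun
    (fun T' x => if T' == T then dot (beta T) (grad (w T) x) + c T * w T x else 0) (fun _ _ => 0).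
  have ps : in_W0 Omega beta j s.
    split=> //; split=> //= T'; case: eqP => _ //.
    exact: is_poly_widen (pD T).
  have := bw0 s ps; rewrite (form_b_parts pw ps.1) [X in _ + X]big1 ?addr0; last first.
    by move=> E _; apply: face_int_eq0 => y _; rewrite mul0r.
  rewrite (bigD1 T)//= [X in _ + X]big1 ?addr0; last first.
    by move=> T' /negPf T'T; apply: cell_int_eq0 => y _; rewrite T'T mul0r.
  move=> /eqP; rewrite oppr_eq0 eqxx => /eqP h.
  exact: (cell_int0_poly meshM (is_poly_continuous (pD T)) h Tx).
pose s : weak_fun M := WeakFun (fun _ _ => 0)
  (fun E' x => if E' == E then normal_flux w E x else 0).
have ps : in_W0 Omega beta j s.
  split; first by split=> //= E'; case: eqP => _ //; exact: is_poly_widen (pF E).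
  by move=> E' EG' y _ /=; case: eqP => // E'E; case: EG; rewrite -E'E.
have := bw0 s ps; rewrite (form_b_parts pw ps.1) [X in - X]big1 ?oppr0 ?add0r; last first.
  by move=> T _; apply: cell_int_eq0 => y _; rewrite mul0r.
rewrite (bigD1 E)//= [X in _ + X]big1 ?addr0; last first.
  by move=> E' /negPf E'E; apply: face_int_eq0 => y _; rewrite E'E mul0r.
rewrite eqxx => h; have fc := is_poly_continuous (pF E).
move: Ex => [y Ey <-].
have chc : continuous (@chart _ _ M E) by exact: chart_continuous.
have cf : continuous (normal_flux w E \o chart E).
  by move=> z; exact: (continuous_comp (chc z) (fc _)).
have : (normal_flux w E \o chart E) y * (normal_flux w E \o chart E) y = 0.
  apply: (ge0_continuous_Rintegral_eq0 (f := fun z => (normal_flux w E \o chart E) z *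
    (normal_flux w E \o chart E) z) _ _ _ _ h Ey).
  - exact: continuousMr.
  - exact: (@face_ref_open _ _ _ _ meshM).
  - exact: (@face_ref_bounded _ _ _ _ meshM).
  - by move=> z _; rewrite -expr2 sqr_ge0.
by move/eqP; rewrite mulf_eq0 orbb => /eqP.
Qed.

Lemma betaf_coord x i : betaf beta x ord0 i = cell_sum (fun T _ => beta T ord0 i) x.
Proof. exact: (cell_sum_vec_coord (fun T _ => beta T)). Qed.

Let mO : measurable Omega. Proof. exact: domain_measurable. Qed.
Let Ofin : (mu Omega < +oo)%E. Proof. exact: domain_finite. Qed.
Let p1 : 1 <= p. Proof. exact: ltW. Qed.

Lemma cell_sum_mul g h x : cell_sum (M := M) g x * cell_sum h x = cell_sum (fun T x => g T x * h T x) x.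
Proof.
have [[T Tx]|nT] := pselect (exists T : cells M, cell T x).
  by rewrite !(cell_sumE meshM _ Tx).
have z (f : cells M -> vec -> R) : cell_sum f x = 0.
  rewrite /cell_sum big1// => T _; rewrite indicE memNset ?mul0r// => Tx.
  by apply: nT; exists T.
by rewrite !z mul0r.
Qed.

Lemma transport_integrand_in_Lp v (G : vec -> vec) :
  in_Lp mu p Omega v -> (forall i, in_Lp mu p Omega (fun x => G x ord0 i)) ->
  in_Lp mu p Omega (fun x => dot (betaf beta x) (G x) - cf c x * v x).
Proof.
move=> vL GL.
have cst_c (a : cells M -> R) : forall T, continuous (fun _ : vec => a T).
  by move=> T x; exact: cst_continuous.
have bounded (a : cells M -> R) f : in_Lp mu p Omega f ->
    in_Lp mu p Omega (fun x => cell_sum (fun T _ => a T) x * f x).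
  move=> fL; have [K _ hK] := cell_sum_bounded meshM (cst_c a).
  apply: (in_LpM_bounded (K := K) mO p1 fL) => //.
  exact: (measurable_cell_sum meshM mO (cst_c a)).
have -> : (fun x => dot (betaf beta x) (G x) - cf c x * v x) =
   (fun x => \sum_i cell_sum (fun T _ => beta T ord0 i) x * G x ord0 i +
      cell_sum (fun T _ => - c T) x * v x).
  apply/funext => x; congr (_ + _).
    by apply: eq_bigr => i _; rewrite betaf_coord.
  rewrite -mulNr; congr (_ * _); rewrite /cf /cell_sum -sumrN.
  by apply: eq_bigr => T _; rewrite mulrN.
exact: (in_LpD mO p1 (in_Lp_sum mO p1 (fun i => bounded _ _ (GL i))) (bounded _ _ vL)).
Qed.

Lemma Rintegral_sum (I : Type) (r : seq I) (h : I -> vec -> R) :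
  (forall i, mu.-integrable Omega (EFin \o h i)) ->
  mu.-integrable Omega (EFin \o (fun x => \sum_(i <- r) h i x)) /\
  \int[mu]_(x in Omega) \sum_(i <- r) h i x = \sum_(i <- r) \int[mu]_(x in Omega) h i x.
Proof.
move=> hi; elim: r => [|i r [IH1 IH2]].
  under [X in EFin \o X]eq_fun do rewrite big_nil.
  under eq_Rintegral do rewrite big_nil.
  by split; [exact: integrable0|rewrite big_nil /Rintegral integral0].
under [X in EFin \o X]eq_fun do rewrite big_cons.
under eq_Rintegral do rewrite big_cons.
split.
  by have := integrableD mO (hi i) IH1; apply: eq_integrable.
by rewrite (RintegralD mO (hi i) IH1) IH2 big_cons.
Qed.

Section kernel.
Variable w : cells M -> vec -> R.
Hypotheses (w_poly : in_M k.-1 w)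
  (w_cell : forall T x, cell T x -> dot (beta T) (grad (w T) x) + c T * w T x = 0)
  (w_face : forall E, ~ face E `<=` Gamma_plus Omega beta ->
    forall x, face E x -> normal_flux w E x = 0).

Let w1 T : C1 (w T). Proof. exact: is_poly_C1 (w_poly T). Qed.
Let wc T : continuous (w T). Proof. exact: C1_continuous. Qed.
Let adv i := cell_sum (fun T x => w T x * beta T ord0 i).
Let rea := cell_sum (fun T x => - (w T x * c T)).

Let adv_cont i T : continuous (fun x => w T x * beta T ord0 i).
Proof. by apply: continuousMr => // x; exact: cst_continuous. Qed.

Let rea_cont T : continuous (fun x => - (w T x * c T)).
Proof.
apply: (is_poly_continuous (r := k.-1)); apply: is_polyN.
by under eq_fun do rewrite mulrC; exact: is_polyZ.
Qed.

Lemma transport_integrandE v (G : vec -> vec) x :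
  cell_sum w x * (dot (betaf beta x) (G x) - cf c x * v x) =
  \sum_i adv i x * G x ord0 i + rea x * v x.
Proof.
have -> : rea x = - (cell_sum w x * cf c x).
  rewrite [cf c x]/(cell_sum (fun T _ => c T) x) cell_sum_mul /rea /cell_sum -sumrN.
  by apply: eq_bigr => T _; rewrite mulrN.
rewrite mulrBr mulrA mulNr; congr (_ - _); rewrite mulr_sumr; apply: eq_bigr => i _.
by rewrite betaf_coord mulrA cell_sum_mul.
Qed.

Lemma weighted_integrable (g : cells M -> vec -> R) v : (forall T, continuous (g T)) ->
  in_Lp mu p Omega v -> mu.-integrable Omega (EFin \o (fun x => cell_sum g x * v x)).
Proof.
move=> gc vL; have [K _ hK] := cell_sum_bounded meshM gc.
have := integrable_mul_bounded mO (in_Lp_integrable mO p1 Ofin vL)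
  (measurable_cell_sum meshM mO gc) (fun x _ => hK x).
by apply: eq_integrable => // x _ /=; rewrite mulrC.
Qed.

Lemma transport_integralE v (G : vec -> vec) : in_Lp mu p Omega v ->
  (forall i, in_Lp mu p Omega (fun x => G x ord0 i)) ->
  \int[mu]_(x in Omega) (cell_sum w x * (dot (betaf beta x) (G x) - cf c x * v x)) =
  \sum_i \int[mu]_(x in Omega) (adv i x * G x ord0 i) + \int[mu]_(x in Omega) (rea x * v x).
Proof.
move=> vL GL; under eq_Rintegral do rewrite transport_integrandE.
have [i1 i2] := @Rintegral_sum _ (index_enum 'I_n.+1) (fun i x => adv i x * G x ord0 i)
  (fun i => weighted_integrable (@adv_cont i) (GL i)).
by rewrite (RintegralD mO i1 (weighted_integrable rea_cont vL)) i2.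
Qed.

Lemma C1_in_Lp (phi : vec -> R) : continuous phi -> in_Lp mu p Omega phi.
Proof.
move=> cphi; have bO : bounded_set Omega by have [] := domOmega.
have [K _ hK] := continuous_bounded_rV cphi bO.
apply: (@bounded_in_Lp _ _ _ mu Omega _ K) => //; first exact: lt_trans p_gt1.
exact: continuous_measurable_rV.
Qed.

(** The divergence theorem for [w T] times [phi] on each cell; the equation satisfied by [w] turns
    the volume term into the integrand. *)
Lemma transport_integral_C1 (phi : vec -> R) : C1 phi ->
  \int[mu]_(x in Omega) (cell_sum w x * (dot (betaf beta x) (grad phi x) - cf c x * phi x)) =
  \sum_E face_int E (fun x => normal_flux w E x * phi x).
Proof.
move=> phi1; have cphi := C1_continuous phi1.
have gL i : in_Lp mu p Omega (fun x => grad phi x ord0 i).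
  have -> : (fun x => grad phi x ord0 i) = pderiv i phi by apply/funext => x; rewrite mxE.
  by apply: C1_in_Lp; exact: C1_pderiv.
have hi : mu.-integrable Omega (EFin \o (fun x =>
    cell_sum w x * (dot (betaf beta x) (grad phi x) - cf c x * phi x))).
  apply: weighted_integrable => //; apply: transport_integrand_in_Lp => //.
  exact: C1_in_Lp.
rewrite (Rintegral_cells hi).
have -> : \sum_E face_int E (fun x => normal_flux w E x * phi x) =
    \sum_T \sum_(E | incident T E) dot (beta T) (normal T E) * face_int E (fun x => w T x * phi x).
  rewrite (exchange_big_dep xpredT)//=; apply: eq_bigr => E _.
  transitivity (\sum_(T | incident T E) face_int E (fun x => dot (beta T) (normal T E) * (w T x * phi x))).
    rewrite -(face_int_sum meshM); last first.
      move=> T _; apply: continuousMr; last exact: continuousMr.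
      by move=> x; exact: cst_continuous.
    by apply: eq_face_int => x _; rewrite mulr_suml; apply: eq_bigr => T _; rewrite mulrA.
  by apply: eq_bigr => T _; rewrite (face_intZ meshM)//; exact: continuousMr.
apply: eq_bigr => T _; rewrite -(cell_divergence meshM T (beta T) (C1M (w1 T) phi1)).
apply: eq_cell_int => x Tx; rewrite (cell_sumE meshM _ Tx).
rewrite [betaf _ _](cell_sum_vecE meshM (fun T _ => beta T) Tx).
rewrite [cf _ _](cell_sumE meshM (fun T _ => c T) Tx) dot_gradM//.
have /eqP := w_cell Tx; rewrite addr_eq0 => /eqP ->; ring.
Qed.

(** The approximants of [v] need not vanish on the outflow boundary, so the face terms are kept and
    only their limit is zero: off the outflow faces the flux of [w] vanishes, and on them the
    approximants converge to the trace, which is zero. *)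
Lemma homogeneous_transport v G t : in_W1p0 Omega beta p v G t ->
  \int[mu]_(x in Omega) (cell_sum w x * (dot (betaf beta x) (G x) - cf c x * v x)) = 0.
Proof.
move=> [[vL GL _] [tL [phi [phi1 pv pG pt]]] t0].
have phiL m : in_Lp mu p Omega (phi m) by apply: C1_in_Lp; exact: C1_continuous (phi1 m).
have dphiL i m : in_Lp mu p Omega (pderiv i (phi m)).
  by apply: C1_in_Lp; exact: (C1_pderiv (phi1 m)).
have gphiE m i : (fun x => grad (phi m) x ord0 i) = pderiv i (phi m).
  by apply/funext => x; rewrite mxE.
have lim1 : (fun m => \sum_i \int[mu]_(x in Omega) (adv i x * pderiv i (phi m) x) +
      \int[mu]_(x in Omega) (rea x * phi m x)) @ \oo -->
    \sum_i \int[mu]_(x in Omega) (adv i x * G x ord0 i) + \int[mu]_(x in Omega) (rea x * v x).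
  apply: cvgD.
    apply: cvg_sumr => i; have [K _ hK] := cell_sum_bounded meshM (@adv_cont i).
    exact: (Lp_cvg_Rintegral mO p1 Ofin (dphiL i) (GL i)
      (measurable_cell_sum meshM mO (@adv_cont i)) (fun x _ => hK x) (pG i)).
  have [K _ hK] := cell_sum_bounded meshM rea_cont.
  exact: (Lp_cvg_Rintegral mO p1 Ofin phiL vL
    (measurable_cell_sum meshM mO rea_cont) (fun x _ => hK x) pv).
have lim2 : (fun m => \sum_E face_int E (fun x => normal_flux w E x * phi m x)) @ \oo -->
    \sum_(E : faces M) (0 : R).
  apply: cvg_sumr => E.
  have [EG|nEG] := pselect (face E `<=` Gamma_plus Omega beta); last first.
    rewrite (_ : (fun m => _) = cst 0); first exact: cvg_cst.
    by apply/funext => m; apply: face_int_eq0 => x Ex; rewrite w_face ?mul0r.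
  have EO : face E `<=` boundary Omega by move=> x /EG[].
  have mE : measurable (face_ref E) by exact: (@face_ref_measurable _ _ _ _ meshM).
  have bE : bounded_set (face_ref E) by exact: (@face_ref_bounded _ _ _ _ meshM).
  have Efin : (lebesgue_rV n (face_ref E) < +oo)%E by exact: lebesgue_rV_bounded_lty.
  have chc : continuous (@chart _ _ M E) by exact: chart_continuous.
  have fc : continuous (normal_flux w E \o chart E).
    move=> y; apply: (continuous_comp (chc y)); apply: (is_poly_continuous (r := k.-1)).
    by apply: is_poly_sum => T _; exact: is_polyZ.
  have [K _ hK] := continuous_bounded_rV fc bE.
  have phiE m : in_Lp (lebesgue_rV n) p (face_ref E) (phi m \o chart E).
    have pc : continuous (phi m \o chart E).
      by move=> y; have cf := C1_continuous (phi1 m); exact: (continuous_comp (chc y) (cf _)).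
    have [K' _ hK'] := continuous_bounded_rV pc bE.
    apply: (@bounded_in_Lp _ _ _ (lebesgue_rV n) _ _ K') => //.
      exact: lt_trans p_gt1.
    exact: continuous_measurable_rV.
  have mf : measurable_fun (face_ref E) (normal_flux w E \o chart E) by exact: continuous_measurable_rV.
  have mt := (tL E EO).1.
  have z : \int[lebesgue_rV n]_(y in face_ref E)
      ((normal_flux w E \o chart E) y * (t \o chart E) y) = 0.
    rewrite /Rintegral (@ae_eq_integral _ _ _ _ _ (cst 0%E))//; first by rewrite integral0.
      by apply/measurable_EFinP; exact: measurable_funM.
    by apply: filterS (t0 E EG) => y h Ey; rewrite (h Ey) mulr0.
  have := Lp_cvg_Rintegral mE p1 Efin phiE (tL E EO) mf hK (pt E EO).
  by rewrite z.
rewrite (transport_integralE vL GL).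
rewrite big1_eq in lim2.
apply: (cvg_unique (@Rhausdorff R) lim1).
rewrite (_ : (fun m => _) = fun m => \sum_E face_int E (fun x => normal_flux w E x * phi m x))//.
apply/funext => m.
have gL i : in_Lp mu p Omega (fun x => grad (phi m) x ord0 i) by rewrite gphiE.
rewrite -(transport_integral_C1 (phi1 m)) (transport_integralE (phiL m) gL).
congr (_ + _); apply: eq_bigr => i _; apply: eq_Rintegral => x _.
by rewrite mxE.
Qed.

End kernel.

(** Adding the piecewise polynomial [w] to a solution of the transport problem gives a second
    solution for the same data, so [w] vanishes almost everywhere and, by continuity, everywhere on
    the cells. *)
Lemma primal_kernel f g w : transport_well_posed Omega beta c p q f g -> in_M k.-1 w ->
  (forall s, in_W0 Omega beta j s -> form_b beta c k.-1 w s = 0) ->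
  forall T x, cell T x -> w T x = 0.
Proof.
move=> [[u0 hu0] uniq] pw bw0; have [wcell wface] := form_b_kernel pw bw0.
have wc T : continuous (w T) by exact: is_poly_continuous (pw T).
have p0 : 0 < p by exact: lt_trans p_gt1.
have ip1 : p^-1 < 1 by rewrite invf_lt1.
have iq0 : 0 < q^-1 by move: pq ip1; lra.
have q0 : 0 < q by rewrite -invr_gt0.
have ip0 : 0 < p^-1 by rewrite invr_gt0.
have iq1 : q^-1 < 1 by move: pq ip0; lra.
have q1 : 1 < q by rewrite -invf_lt1.
have WL := cell_sum_in_Lp meshM domOmega q1 wc.
have sol : transport_solution Omega beta c p q f g (fun x => u0 x + cell_sum w x).
  split; first exact: (in_LpD mO (ltW q1) hu0.1 WL).
  move=> v G t vW; rewrite -(hu0.2 v G t vW).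
  have [[vL GL _] _ _] := vW.
  have hL := transport_integrand_in_Lp vL GL.
  under eq_Rintegral do rewrite mulrDl.
  rewrite (RintegralD mO (in_Lp_young mO p1 q0 pq hu0.1 hL) (weighted_integrable wc hL)).
  by rewrite (homogeneous_transport pw wcell wface vW) addr0.
have w0 := uniq _ _ sol hu0.
move=> T x Tx; apply: (continuous_ae_eq_rV (f := w T) (g := fun=> 0) (A := cell T)) => //.
- by move=> y; exact: cst_continuous.
- exact: (@cell_open _ _ _ _ meshM).
- apply: filterS w0 => y h Ty.
  have Oy : Omega y by exact: cell_subset meshM domOmega _ _ Ty.
  by apply: (@addrI _ (u0 y)); rewrite addr0 -(cell_sumE meshM _ Ty) h.
Qed.

End primal_uniqueness.

(** * Existence *)

(** Among the matrices whose row space satisfies [P], one of maximal rank is taken; a further vector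
    satisfying [P] outside its row space could be adjoined and would raise the rank. *)
Lemma linear_predicate_mx (R : fieldType) (N : nat) (P : 'rV[R]_N -> Prop) :
  P 0 -> (forall a x y, P x -> P y -> P (a *: x + y)) ->
  exists A : 'M[R]_N, forall x : 'rV_N, (x <= A)%MS <-> P x.
Proof.
move=> P0 Plin.
pose Q r := `[< exists A : 'M[R]_N, (forall x : 'rV_N, (x <= A)%MS -> P x) /\ \rank A = r >].
have exQ : exists r, Q r.
  exists 0%N; apply/asboolP; exists 0; split; last by rewrite mxrank0.
  by move=> x /submx0null ->.
have ubQ r : Q r -> (r <= N)%N by move=> /asboolP[A [_ <-]]; exact: rank_leq_row.
have [r /asboolP[A [AP rA]] rmax] := ex_maxnP exQ ubQ.
exists A => x; split; first exact: AP.
move=> Px; apply: contrapT => /negP xA.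
have : Q (\rank (A + x)%MS).
  apply/asboolP; exists (A + x)%MS; split=> // y /sub_addsmxP[[u v] /= ->].
  have -> : v *m x = v ord0 ord0 *: x by rewrite -mul_scalar_mx -mx11_scalar.
  by rewrite addrC; apply: Plin => //; apply: AP; exact: submxMl.
move/rmax; rewrite -rA leqNgt => /negP; apply.
rewrite ltn_neqAle mxrankS ?addsmxSl// andbT; apply/negP => /eqP rE.
move/negP: xA; apply; have := mxrank_leqif_sup (addsmxSl A x).
move=> [_]; rewrite rE eqxx => /esym h.
by apply: submx_trans h; exact: addsmxSr.
Qed.

Section scalar_functions.
Context {R : realType} (N : nat).
Local Notation V := 'rV[R]_N.

Lemma scalar_fun0 (phi : V -> R) : (forall a y z, phi (a *: y + z) = a * phi y + phi z) -> phi 0 = 0.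
Proof. by move=> lin; have := lin 1 0 0; rewrite scaler0 add0r mul1r; lra. Qed.

Lemma scalar_funZ (phi : V -> R) : (forall a y z, phi (a *: y + z) = a * phi y + phi z) ->
  forall a y, phi (a *: y) = a * phi y.
Proof. by move=> lin a y; rewrite -[a *: y]addr0 lin (scalar_fun0 lin) addr0. Qed.

Lemma scalar_funD (phi : V -> R) : (forall a y z, phi (a *: y + z) = a * phi y + phi z) ->
  forall y z, phi (y + z) = phi y + phi z.
Proof. by move=> lin y z; rewrite -[y]scale1r lin mul1r scale1r. Qed.

Lemma scalar_funE (phi : V -> R) : (forall a y z, phi (a *: y + z) = a * phi y + phi z) ->
  forall x, phi x = \sum_j x ord0 j * phi (delta_mx ord0 j).
Proof.
move=> lin x; rewrite {1}[x]row_sum_delta.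
elim: (index_enum 'I_N) => [|j r IH]; first by rewrite !big_nil (scalar_fun0 lin).
by rewrite !big_cons lin IH.
Qed.

End scalar_functions.

(** * Minimisation of a convex homogeneous energy on a subspace *)

Section variational_problem.
Context {R : realType} (N : nat) (p : R).
Local Notation V := 'rV[R]_N.
Variables (S : V -> R) (A : V -> V -> R) (F : V -> R) (Z : V -> Prop).
Hypothesis p_gt1 : 1 < p.
Hypotheses (Z0 : Z 0) (Z_lin : forall a x y, Z x -> Z y -> Z (a *: x + y)).
Hypothesis A_lin : forall x a y z, A x (a *: y + z) = a * A x y + A x z.
Hypothesis F_lin : forall a y z, F (a *: y + z) = a * F y + F z.
Hypothesis S_ge0 : forall x, 0 <= S x.
Hypothesis S_homo : forall t x, S (t *: x) = `|t| `^ p * S x.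
Hypothesis S_subgradient : forall x h, S x + p * A x h <= S (x + h).
Hypothesis A_hemicontinuous : forall x h,
  (fun m : nat => A (x + m.+1%:R^-1 *: h) h) @ \oo --> A x h.
Hypothesis S_kernel : forall x, Z x -> S x = 0 -> F x = 0 /\ forall y, A y x = 0.

Let p0 : 0 < p. Proof. exact: lt_trans p_gt1. Qed.

Let S0 : S 0 = 0.
Proof. by rewrite -(scale0r 0) S_homo normr0 powR0 ?gt_eqF// mul0r. Qed.

(** Jensen's inequality for [x] as the average of the vectors [N * x_j] times the [j]-th unit
    vector, whose energies are given by homogeneity. Convexity enters through the subgradient at the
    average. *)
Lemma energy_locally_bounded (K : R) : exists2 B : R, 0 <= B & forall x, `|x| <= K -> S x <= B.
Proof.
have [N0|N0] := eqVneq N 0%N.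
  exists 0 => // x _; have -> : x = 0 by apply/rowP => i; have := ltn_ord i; rewrite [X in (_ < X)%N]N0.
  by rewrite S0.
have Npos : 0 < N%:R :> R by rewrite ltr0n lt0n.
pose e (j : 'I_N) : V := delta_mx ord0 j.
exists (\sum_j (N%:R * `|K|) `^ p * S (e j)).
  by apply: sumr_ge0 => j _; rewrite mulr_ge0// powR_ge0.
move=> x xK.
have jensen (y : 'I_N -> V) z : z = N%:R^-1 *: \sum_j y j -> N%:R * S z <= \sum_j S (y j).
  move=> zE; have h j : S z + p * A z (y j - z) <= S (y j).
    by have := S_subgradient z (y j - z); rewrite addrCA subrr addr0.
  have := ler_sum (index_enum 'I_N) (fun j (_ : xpredT j) => h j).
  rewrite big_split/= sumr_const card_ord -mulr_sumr.
  rewrite (_ : \sum_j A z (y j - z) = 0) ?mulr0 ?addr0 ?mulr_natl//.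
  have sumA (r : seq 'I_N) : \sum_(j <- r) A z (y j - z) = A z (\sum_(j <- r) (y j - z)).
    elim: r => [|j r IH]; first by rewrite !big_nil (scalar_fun0 (A_lin z)).
    by rewrite !big_cons IH -(scalar_funD (A_lin z)).
  have E : \sum_j (y j - z) = 0.
    rewrite sumrB sumr_const card_ord -(scaler_nat _ z) zE scalerA mulfV ?gt_eqF// scale1r.
    exact: subrr.
  by rewrite sumA E; exact: (scalar_fun0 (A_lin _)).
have xE : x = N%:R^-1 *: \sum_j (N%:R * x ord0 j) *: e j.
  under eq_bigr do rewrite -scalerA.
  by rewrite -scaler_sumr scalerA mulVf ?gt_eqF// scale1r -row_sum_delta.
have h := jensen (fun j => (N%:R * x ord0 j) *: e j) x xE.
have h1 : S x <= N%:R * S x by rewrite ler_peMl// ler1n lt0n.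
apply: le_trans h1 (le_trans h _); apply: ler_sum => j _.
rewrite S_homo ler_wpM2r//; apply: ge0_ler_powR; [exact: ltW|by rewrite nnegrE|by rewrite nnegrE mulr_ge0|].
rewrite normrM (ger0_norm (ltW Npos)) ler_pM2l//.
by apply: le_trans (rV_norm_coord _ _) _; apply: le_trans xK _; exact: ler_norm.
Qed.

(** A locally bounded convex function is locally Lipschitz: values at distance one bound the
    subgradient. *)
Lemma energy_continuous : continuous S.
Proof.
move=> x; apply: (iffRL (@cvgrPdist_lt _ _ _ (nbhs x) (nbhs_filter x) S (S x))).
move=> eps eps0.
have [B B0 hB] := energy_locally_bounded (`|x| + 2).
have e1 (s : R) j : `|s| = 1 -> `|s *: delta_mx ord0 j : V| <= 1.
  by move=> s1; rewrite normrZ s1 mul1r; exact: rV_norm_delta.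
have Ae a j : `|a| <= `|x| + 1 -> p * `|A a (delta_mx ord0 j)| <= B.
  move=> ax; have bnd (s : R) : `|s| = 1 -> p * (s * A a (delta_mx ord0 j)) <= B.
    move=> s1; rewrite -(scalar_funZ (A_lin a)).
    have := S_subgradient a (s *: delta_mx ord0 j).
    have := hB (a + s *: delta_mx ord0 j); have := S_ge0 a.
    have : `|a + s *: delta_mx ord0 j| <= `|x| + 2.
      by apply: le_trans (ler_normD _ _) _; have := e1 s j s1; move: ax; lra.
    move=> h1 h2 h3; have := h3 h1; move: h2; lra.
  have [A0|A0] := leP 0 (A a (delta_mx ord0 j)).
    by rewrite ger0_norm//; have := bnd 1 (normr1 _); rewrite mul1r.
  by rewrite ltr0_norm//; have := bnd (-1); rewrite normrN1 mulN1r; exact.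
have lip a b : `|a| <= `|x| + 1 -> S a - S b <= N%:R * B * `|a - b|.
  move=> ax; have h := S_subgradient a (b - a).
  have ab : a + (b - a) = b by rewrite addrCA subrr addr0.
  rewrite ab in h.
  apply: (@le_trans _ _ (p * A a (a - b))).
    have : A a (b - a) = - A a (a - b).
      by rewrite -opprB -scaleN1r (scalar_funZ (A_lin a)) mulN1r.
    by move=> E; move: h; rewrite E; lra.
  have -> : N%:R * B * `|a - b| = \sum_(j < N) B * `|a - b|.
    by rewrite sumr_const card_ord -mulrA mulr_natl.
  rewrite (scalar_funE (A_lin a)) mulr_sumr; apply: ler_sum => j _.
  apply: (@le_trans _ _ (`|(a - b) ord0 j| * (p * `|A a (delta_mx ord0 j)|))).
    rewrite mulrCA; apply: le_trans (ler_norm _) _; rewrite normrM normrM (gtr0_norm p0).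
    exact: lexx.
  rewrite mulrC; apply: ler_pM; [by rewrite mulr_ge0// ltW|exact: normr_ge0|exact: Ae|].
  exact: rV_norm_coord.
apply/nbhs_rV_normP; exists (Num.min 1 (eps / (N%:R * B + 1))).
  by rewrite lt_min ltr01 divr_gt0// ltr_wpDl// mulr_ge0.
move=> y; rewrite lt_min => /andP[y1 ye].
have NB1 : 0 < N%:R * B + 1 by rewrite ltr_wpDl// mulr_ge0.
have small : N%:R * B * `|y - x| < eps.
  move: ye; rewrite ltr_pdivlMr// => ye; apply: le_lt_trans ye.
  by rewrite mulrC ler_wpM2l// lerDl.
have yx : `|y| <= `|x| + 1.
  rewrite -(subrK x y) addrC; apply: le_trans (ler_normD _ _) _.
  by rewrite lerD2l ltW.
have xx : `|x| <= `|x| + 1 by rewrite lerDl.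
have := lip x y xx; have := lip y x yx; rewrite distrC => h1 h2.
by rewrite ltr_norml; move: h1 h2 small; rewrite distrC; lra.
Qed.

Lemma kernel_complement : exists r (W : 'M[R]_(r, N)),
  [/\ forall y : 'rV_r, Z (y *m W), forall y : 'rV_r, S (y *m W) = 0 -> y = 0 &
      forall h, Z h -> exists (y : 'rV_r) k, [/\ h = y *m W + k, Z k & S k = 0]].
Proof.
have [AZ hAZ] := linear_predicate_mx Z0 Z_lin.
have [|AK hAK] := @linear_predicate_mx R N (fun x => Z x /\ S x = 0) (conj Z0 S0).
  move=> a x y [Zx Sx] [Zy Sy]; split; first exact: Z_lin.
  set z := a *: x + y.
  (* With this, the subgradient inequality at [z] in the direction [- z] reads [S z <= S 0 = 0], so
     null vectors are closed under linear combinations. *)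
  have Az : A z (- z) = 0.
    rewrite -scaleN1r (scalar_funZ (A_lin z)) {2}/z A_lin.
    by rewrite (S_kernel Zx Sx).2 (S_kernel Zy Sy).2 mulr0 addr0 mulr0.
  apply/eqP; rewrite eq_le S_ge0 andbT; have := S_subgradient z (- z).
  by rewrite Az mulr0 addr0 subrr S0.
pose C := (AZ :\: AK)%MS.
exists (\rank C), (row_base C).
have CE (y : 'rV_(\rank C)) : (y *m row_base C <= C)%MS.
  by apply: submx_trans (submxMl _ _) _; rewrite eq_row_base.
have ZW (y : 'rV_(\rank C)) : Z (y *m row_base C).
  by apply/hAZ; apply: submx_trans (CE y) _; exact: diffmxSl.
split=> // [y Sy|h /hAZ hZ].
  have yK : (y *m row_base C <= AK)%MS by apply/hAK.
  have : (y *m row_base C <= C :&: AK)%MS by rewrite sub_capmx CE.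
  rewrite capmx_diff => /submx0null y0.
  have [B hB] := row_freeP (row_base_free C).
  by rewrite -[y]mulmx1 -hB mulmxA y0 mul0mx.
have : (h <= C + (AZ :&: AK))%MS by rewrite addsmx_diff_cap_eq.
move=> /sub_addsmxP[[u v] /= hE].
have : (u *m C <= row_base C)%MS by rewrite eq_row_base submxMl.
move=> /submxP[y yE]; exists y, (v *m (AZ :&: AK)%MS); split; first by rewrite hE yE.
  by apply/hAZ; apply: submx_trans (submxMl _ _) _; exact: capmxSl.
have : (v *m (AZ :&: AK)%MS <= AK)%MS by apply: submx_trans (submxMl _ _) _; exact: capmxSr.
by move/hAK => [].
Qed.

(** The minimum on the unit sphere is positive and homogeneity extends the bound; for [r = 0] the
    sphere is empty, hence the separate case. *)
Lemma energy_coercive r (W : 'M[R]_(r, N)) : (forall y : 'rV_r, S (y *m W) = 0 -> y = 0) ->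
  exists2 m : R, 0 < m & forall y : 'rV_r, m * `|y| `^ p <= S (y *m W).
Proof.
move=> SW; have [r0|r0] := eqVneq r 0%N.
  exists 1 => // y; have -> : y = 0 by apply/rowP => i; have := ltn_ord i; rewrite [X in (_ < X)%N]r0.
  by rewrite normr0 powR0 ?gt_eqF// mulr0.
pose B : set 'rV[R]_r := [set y | `|y| = 1].
have cB : compact B.
  apply: bounded_closed_compact.
    by apply/bounded_rVP; exists 2 => // y ->; rewrite ltr1n.
  apply: (closed_comp (f := fun y : 'rV[R]_r => `|y|) (D := [set 1])); last exact: closed_eq.
  by move=> y _; exact: norm_continuous.
have cS : continuous (fun y : 'rV[R]_r => S (y *m W)).
  by move=> y; exact: (continuous_comp (@mulmx_continuous _ _ _ W y) (@energy_continuous _)).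
have B0 : B !=set0.
  have r0' : (0 < r)%N by rewrite lt0n.
  exists (delta_mx ord0 (Ordinal r0')); apply/eqP; rewrite eq_le; apply/andP; split.
    exact: rV_norm_delta.
  apply: le_trans (rV_norm_coord _ (Ordinal r0')).
  by rewrite mxE !eqxx normr1.
have [y0 By0 hmin] := EVT_min_rV B0 cB (continuous_subspaceT cS).
have {}By0 : `|y0| = 1 by move: By0; rewrite inE.
have Sy0 : 0 < S (y0 *m W).
  rewrite lt_neqAle S_ge0 andbT eq_sym; apply/eqP => /SW y00.
  by move: By0; rewrite y00 normr0 => /esym/eqP; rewrite oner_eq0.
exists (S (y0 *m W)) => // y.
have [->|y1] := eqVneq y 0; first by rewrite normr0 powR0 ?gt_eqF// mulr0.
have ny : 0 < `|y| by rewrite normr_gt0.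
have -> : y *m W = `|y| *: ((`|y|^-1 *: y) *m W).
  by rewrite -scalemxAl scalerA mulfV ?gt_eqF// scale1r.
rewrite S_homo normr_id mulrC ler_wpM2l ?powR_ge0//; apply: hmin.
by rewrite inE /B/= normrZ normfV normr_id mulVf// gt_eqF.
Qed.

Lemma variational_solution : exists x, Z x /\ forall h, Z h -> A x h = F h.
Proof.
have [r [W [ZW SW Zdec]]] := kernel_complement.
have [m m0 hm] := energy_coercive SW.
pose FW (y : 'rV_r) := F (y *m W).
have FWlin a y z : FW (a *: y + z) = a * FW y + FW z.
  by rewrite /FW mulmxDl -scalemxAl F_lin.
pose CF := \sum_j `|FW (delta_mx ord0 j)|.
have CF0 : 0 <= CF by apply: sumr_ge0.
have FWle y : FW y <= CF * `|y|.
  rewrite (scalar_funE FWlin) /CF mulr_suml; apply: ler_sum => j _.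
  by apply: le_trans (ler_norm _) _; rewrite normrM mulrC ler_wpM2l// rV_norm_coord.
pose J (y : 'rV_r) := S (y *m W) - p * FW y.
have J0 : J 0 = 0 by rewrite /J mul0mx S0 (scalar_fun0 FWlin) mulr0 subr0.
(* The solution of [m * rho^(p-1) = p * CF]: beyond this radius the energy dominates the linear term
   and [J] is at least [J 0 = 0]. *)
pose rho := (p * CF / m) `^ (p - 1)^-1.
have pCm : 0 <= p * CF / m by rewrite divr_ge0 ?(ltW m0)// mulr_ge0// ltW.
have p10 : 0 < p - 1 by rewrite subr_gt0.
have Jge0 y : rho <= `|y| -> 0 <= J y.
  move=> hy; rewrite /J subr_ge0; apply: le_trans (hm y).
  apply: (@le_trans _ _ (p * (CF * `|y|))); first by rewrite ler_wpM2l// ltW.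
  have -> : p * (CF * `|y|) = `|y| * (p * CF) by ring.
  have -> : m * `|y| `^ p = `|y| * (m * `|y| `^ (p - 1)) by rewrite -(mulr_powRB1 (normr_ge0 y) p0); ring.
  rewrite ler_wpM2l// -ler_pdivrMl// mulrC.
  have -> : p * CF / m = rho `^ (p - 1) by rewrite /rho -powRrM mulVf ?gt_eqF// powRr1.
  by apply: ge0_ler_powR; [exact: ltW|rewrite nnegrE powR_ge0|by rewrite nnegrE|].
pose K : set 'rV[R]_r := [set y | `|y| <= rho + 1].
have cK : compact K.
  apply: bounded_closed_compact.
    apply/bounded_rVP; exists (rho + 2); first by rewrite ltr_wpDl// powR_ge0.
    by move=> y Ky; apply: le_lt_trans Ky _; rewrite ltrD2l ltr1n.
  rewrite (_ : K = (fun y : 'rV[R]_r => `|y|) @^-1` [set z | z <= rho + 1])//.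
  apply: closed_comp; last exact: closed_le.
  by move=> y _; exact: norm_continuous.
have FWc : continuous FW.
  rewrite (_ : FW = fun y => \sum_j y ord0 j * FW (delta_mx ord0 j)).
    apply: continuous_sumr => j _; apply: continuousMr; last by move=> y; exact: cst_continuous.
    by move=> y; apply: differentiable_continuous; exact: differentiable_coord.
  by apply/funext => y; exact: scalar_funE.
have Jc : continuous J.
  apply: continuousBr.
    by move=> y; exact: (continuous_comp (@mulmx_continuous _ _ _ W y) (@energy_continuous _)).
  by apply: continuousMr => // y; exact: cst_continuous.
have K0 : K !=set0 by exists 0; rewrite /K/= normr0 addr_ge0// powR_ge0.
have [ys Kys ymin'] := EVT_min_rV K0 cK (continuous_subspaceT Jc).
have ymin y : J ys <= J y.
  have [Ky|Ky] := leP `|y| (rho + 1); first by apply: ymin'; rewrite inE.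
  apply: (@le_trans _ _ (J 0)); first by apply: ymin'; rewrite inE /K/= normr0 addr_ge0// powR_ge0.
  by rewrite J0; apply: Jge0; apply: le_trans (ltW Ky); rewrite lerDl.
(* Minimality compares [ys] with [ys + t *: h], and the subgradient at the latter point gives
   [FW h <= A (ys + t h) h] up to the embedding [W]. Hemicontinuity lets [t] tend to zero, so
   differentiability of the energy is never invoked; the direction [- h] gives the converse. *)
have Age h : FW h <= A (ys *m W) (h *m W).
  have hc := @A_hemicontinuous (ys *m W) (h *m W).
  rewrite -(cvg_lim (@Rhausdorff R) hc); apply: limr_ge; first exact: cvgP hc.
  apply: nearW => k; set t := k.+1%:R^-1; have t0 : 0 < t :> R by rewrite invr_gt0.
  have := ymin (ys + t *: h); rewrite /J mulmxDl -scalemxAl.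
  have := S_subgradient (ys *m W + t *: (h *m W)) (- (t *: (h *m W))).
  rewrite addrK -scaleNr (scalar_funZ (A_lin _)) => h1 h2.
  have E : FW (ys + t *: h) = FW ys + t * FW h by rewrite addrC FWlin addrC.
  rewrite E in h2; rewrite -(ler_pM2l t0) -(ler_pM2l p0).
  move: h1 h2; set x1 := S _; set x2 := S _; set x3 := A _ _; set x4 := FW ys; set x5 := FW h.
  by rewrite mulNr mulrN mulrDr; lra.
have Aeq h : A (ys *m W) (h *m W) = FW h.
  apply/eqP; rewrite eq_le Age andbT.
  have := Age (- h); rewrite -scaleN1r -scalemxAl (scalar_funZ FWlin) (scalar_funZ (A_lin _)).
  by rewrite !mulN1r lerN2.
exists (ys *m W); split=> // h /Zdec[y [k [-> Zk Sk]]].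
have [Fk Ak] := S_kernel Zk Sk.
by rewrite (scalar_funD (A_lin _)) Ak addr0 Aeq (scalar_funD F_lin) Fk addr0.
Qed.

End variational_problem.

Section integral_lemmas.
Context d (T : measurableType d) {R : realType} (mu : {measure set T -> \bar R}).
Variable D : set T.
Hypothesis mD : measurable D.

Lemma Rintegral_lin (a b : R) (f g : T -> R) : mu.-integrable D (EFin \o f) ->
  mu.-integrable D (EFin \o g) ->
  \int[mu]_(x in D) (a * f x + b * g x) = a * \int[mu]_(x in D) f x + b * \int[mu]_(x in D) g x.
Proof.
move=> fi gi.
have iZ (u : R) (h : T -> R) : mu.-integrable D (EFin \o h) ->
    mu.-integrable D (EFin \o (fun x => u * h x)) by move=> hi; exact: (integrableZl mD u hi).
by rewrite RintegralD ?RintegralZl//; exact: iZ.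
Qed.

End integral_lemmas.

Section pencils.
Context {R : realType} (d : nat) (p : R).
Hypothesis p_gt1 : 1 < p.

Lemma spow_pencil_cvg (D : set 'rV[R]_d) (a b : 'rV[R]_d -> R) :
  measurable D -> bounded_set D -> continuous a -> continuous b ->
  (fun m : nat => \int[lebesgue_rV d]_(x in D) (spow p (a x + m.+1%:R^-1 * b x) * b x)) @ \oo -->
  \int[lebesgue_rV d]_(x in D) (spow p (a x) * b x).
Proof.
move=> mD bD ca cb.
have p10 : 0 < p - 1 by rewrite subr_gt0.
have sc := spow_continuous p_gt1.
have cc (t : R) : continuous (fun _ : 'rV[R]_d => t) by move=> x; exact: cst_continuous.
have cm (t : R) : continuous (fun x => spow p (a x + t * b x) * b x).
  apply: continuousMr => //; apply: continuous_compr => //.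
  by apply: continuousDr => //; exact: continuousMr.
have [Ka Ka0 hKa] := continuous_bounded_rV ca bD.
have [Kb Kb0 hKb] := continuous_bounded_rV cb bD.
apply: (bounded_cvg_Rintegral (K := (Ka + Kb) `^ (p - 1) * Kb)) => //.
- exact: lebesgue_rV_bounded_lty.
- by move=> m; apply: continuous_measurable_rV => //; exact: cm.
- apply: continuous_measurable_rV => //; apply: continuousMr => //; exact: continuous_compr.
- move=> m x Dx; rewrite normrM; apply: ler_pM => //; last exact: hKb.
  rewrite norm_spow//; apply: ge0_ler_powR; [exact: ltW|by rewrite nnegrE|by rewrite nnegrE ltW// addr_gt0|].
  apply: le_trans (ler_normD _ _) _; apply: lerD; first exact: hKa.
  rewrite normrM; apply: le_trans (hKb x Dx); rewrite ler_piMl//.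
  by rewrite ger0_norm ?invr_ge0// invf_le1 ?ler1n.
- apply: nearW => x Dx; apply: cvgM; last exact: cvg_cst.
  have h : (fun m : nat => a x + m.+1%:R^-1 * b x) @ \oo --> a x + 0 * b x.
    by apply: cvgD; [exact: cvg_cst|apply: cvgM; [exact: cvg_harmonic|exact: cvg_cst]].
  rewrite mul0r addr0 in h.
  exact: (cvg_comp _ _ h (sc (a x))).
Qed.

End pencils.

(** * The stabilizer as a convex energy *)

Section stabilizer_energy.
Context {R : realType} {n : nat} (Omega : set 'rV[R]_n.+1) (M : mesh R n)
  (beta : cells M -> 'rV[R]_n.+1) (c : cells M -> R) (p rho tau : R) (j : nat).
Hypotheses (meshM : polytopal_partition Omega M).
Hypotheses (p_gt1 : 1 < p) (rho_gt0 : 0 < rho) (tau_ge0 : 0 <= tau).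
Local Notation vec := 'rV[R]_n.+1.
Implicit Types (s l h : @weak_fun R n M).
Local Notation S l s := (form_s beta c p rho tau l s).

Lemma ler_cell_int T (f g : vec -> R) : continuous f -> continuous g ->
  (forall x, f x <= g x) -> @cell_int R n M T f <= cell_int T g.
Proof.
move=> cf cg fg; rewrite -subr_ge0 -[_ - _](_ : cell_int T (fun x => 1 * g x + (-1) * f x) = _).
  by apply: Rintegral_ge0 => x _; rewrite mul1r mulN1r subr_ge0.
by rewrite (cell_int_lin meshM)// mul1r mulN1r.
Qed.

Lemma ler_face_int E (f g : vec -> R) : continuous f -> continuous g ->
  (forall x, f x <= g x) -> @face_int R n M E f <= face_int E g.
Proof.
move=> cf cg fg; rewrite -subr_ge0 -[_ - _](_ : face_int E (fun x => 1 * g x + (-1) * f x) = _).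
  by apply: Rintegral_ge0 => x _; rewrite mul1r mulN1r subr_ge0.
by rewrite (face_int_lin meshM)// mul1r mulN1r.
Qed.

Let weight_gt0 (T : cells M) : 0 < rho * meshsize T `^ (1 - p).
Proof. by rewrite mulr_gt0// powR_gt0// (meshsize_gt0 meshM). Qed.

Lemma form_s_ge0 l : 0 <= S l l.
Proof.
apply: sumr_ge0 => T _; apply: addr_ge0; apply: mulr_ge0 => //; first exact: ltW.
  by apply: sumr_ge0 => E _; apply: Rintegral_ge0 => y _; rewrite spow_mul// powR_ge0.
by apply: Rintegral_ge0 => y _; rewrite spow_mul// powR_ge0.
Qed.

Lemma form_s_homogeneous t l : in_W j l -> S (wlin t 0 l l) (wlin t 0 l l) = `|t| `^ p * S l l.
Proof.
move=> pl; rewrite mulr_sumr; apply: eq_bigr => T _.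
have -> : cell_bnd_int T (jump_spow p (wlin t 0 l l) (wlin t 0 l l) T) =
    `|t| `^ p * cell_bnd_int T (jump_spow p l l T).
  rewrite /cell_bnd_int mulr_sumr; apply: eq_bigr => E _.
  rewrite -(face_intZ meshM); last exact: (jump_spow_continuous p_gt1 pl pl).
  apply: eq_face_int => x _; rewrite /jump_spow !spow_mul// -powRM// -normrM /=.
  by congr (`|_| `^ p); ring.
rewrite (@eq_cell_int _ _ _ T _ (fun x =>
   `|t| `^ p * (spow p (residual beta c l T x) * residual beta c l T x))); last first.
  move=> x _; rewrite !spow_mul// -powRM// -normrM (residual_lin _ _ _ _ _ _ pl pl).
  by congr (`|_| `^ p); ring.
rewrite (cell_intZ meshM); last exact: (residual_spow_continuous p_gt1 pl pl).
rewrite /jump_spow; move: (cell_bnd_int T _) (cell_int T _) => x1 x2; ring.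
Qed.

Lemma form_s_subgradient l h : in_W j l -> in_W j h ->
  S l l + p * S l h <= S (wlin 1 1 l h) (wlin 1 1 l h).
Proof.
move=> pl ph; have pe : in_W j (wlin 1 1 l h) by exact: in_W_lin.
have jc l1 l2 T E : in_W j l1 -> in_W j l2 -> continuous (jump_spow p l1 l2 T E).
  by move=> p1 p2; exact: (jump_spow_continuous p_gt1 p1 p2).
have rc l1 l2 T : in_W j l1 -> in_W j l2 ->
    continuous (fun x => spow p (residual beta c l1 T x) * residual beta c l2 T x).
  by move=> p1 p2; exact: (residual_spow_continuous p_gt1 p1 p2).
have linc (f g : vec -> R) (a b : R) : continuous f -> continuous g ->
    continuous (fun x => a * f x + b * g x).
  move=> cf cg; have cc (t : R) : continuous (fun _ : vec => t) by move=> y; exact: cst_continuous.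
  by apply: continuousDr; exact: continuousMr.
rewrite mulr_sumr -big_split/=; apply: ler_sum => T _.
have hB : cell_bnd_int T (jump_spow p l l T) + p * cell_bnd_int T (jump_spow p l h T) <=
    cell_bnd_int T (jump_spow p (wlin 1 1 l h) (wlin 1 1 l h) T).
  rewrite /cell_bnd_int mulr_sumr -big_split/=; apply: ler_sum => E _.
  rewrite -[X in X + _]mul1r -(face_int_lin meshM); [|exact: jc..].
  apply: ler_face_int; [apply: linc; exact: jc|exact: jc|] => x.
  rewrite /jump_spow !spow_mul// mul1r.
  apply: le_trans (spow_subgradient p_gt1 _ _) _; rewrite le_eqVlt; apply/orP; left; apply/eqP.
  by congr (`|_| `^ p) => /=; ring.
have hC : cell_int T (fun x => spow p (residual beta c l T x) * residual beta c l T x) +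
    p * cell_int T (fun x => spow p (residual beta c l T x) * residual beta c h T x) <=
    cell_int T (fun x => spow p (residual beta c (wlin 1 1 l h) T x) * residual beta c (wlin 1 1 l h) T x).
  rewrite -[X in X + _]mul1r -(cell_int_lin meshM); [|exact: rc..].
  apply: ler_cell_int; [apply: linc; exact: rc|exact: rc|] => x.
  rewrite !spow_mul// mul1r (residual_lin _ _ _ _ _ _ pl ph) !mul1r.
  exact: spow_subgradient.
have := ler_wpM2l (ltW (weight_gt0 T)) hB; have := ler_wpM2l tau_ge0 hC.
rewrite /jump_spow; move: (cell_bnd_int T _) (cell_bnd_int T _) (cell_bnd_int T _)
  (cell_int T _) (cell_int T _) (cell_int T _) => x1 x2 x3 x4 x5 x6.
by lra.
Qed.

Lemma form_s_hemicontinuous l h : in_W j l -> in_W j h ->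
  (fun m : nat => S (wlin 1 m.+1%:R^-1 l h) h) @ \oo --> S l h.
Proof.
move=> pl ph; apply: cvg_sumr => T; apply: cvgD; apply: cvgMr.
  rewrite /cell_bnd_int; under eq_fun do rewrite big_mkcond.
  rewrite big_mkcond; apply: cvg_sumr => E; case: ifP => _; last exact: cvg_cst.
  have chc : continuous (@chart _ _ M E) by exact: chart_continuous.
  have jc s (ps : in_W j s) : continuous (fun y => w0 s T (chart E y) - wb s E (chart E y)).
    by move=> y; exact: (continuous_comp (chc y) (@jump_continuous _ _ _ _ s T E ps _)).
  have mE : measurable (face_ref E) by exact: (@face_ref_measurable _ _ _ _ meshM).
  have bE : bounded_set (face_ref E) by exact: (@face_ref_bounded _ _ _ _ meshM).
  have := spow_pencil_cvg p_gt1 mE bE (jc l pl) (jc h ph).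
  apply: cvg_trans; apply: near_eq_cvg; apply: nearW => m; apply: eq_Rintegral => y _ /=.
  by congr (spow p _ * _); ring.
have mT : measurable (cell T) by exact: (@cell_measurable _ _ _ _ meshM).
have bT : bounded_set (cell T) by exact: (@cell_bounded _ _ _ _ meshM).
have rc s (ps : in_W j s) := is_poly_continuous (residual_poly beta c T ps).
have := spow_pencil_cvg p_gt1 mT bT (rc l pl) (rc h ph).
apply: cvg_trans; apply: near_eq_cvg; apply: nearW => m; apply: eq_Rintegral => y _ /=.
by rewrite (residual_lin _ _ _ _ _ _ pl ph) mul1r.
Qed.

Lemma form_s_null l s : (forall T E x, incident T E -> face E x -> w0 s T x = wb s E x) ->
  (forall T x, cell T x -> residual beta c s T x = 0) -> S l s = 0.
Proof.
move=> sb s0; apply: big1 => T _; rewrite [X in _ * X + _]big1; last first.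
  by move=> E TE; apply: face_int_eq0 => x Ex; rewrite (sb T E)// subrr mulr0.
by rewrite cell_int_eq0 ?mulr0 ?addr0// => x Tx; rewrite s0// mulr0.
Qed.

Lemma form_s0l l h : in_W j l -> S (wlin 0 0 l l) h = 0.
Proof.
move=> pl; apply: big1 => T _; rewrite [X in _ * X + _]big1; last first.
  by move=> E TE; apply: face_int_eq0 => x Ex /=; rewrite !mul0r addr0 subrr spow0 mul0r.
rewrite cell_int_eq0 ?mulr0 ?addr0// => x Tx.
by rewrite (residual_lin _ _ _ _ _ _ pl pl) !mul0r addr0 spow0 mul0r.
Qed.

Lemma form_s_eqr l s s' : w0 s = w0 s' -> (forall E x, face E x -> wb s E x = wb s' E x) ->
  S l s = S l s'.
Proof.
move=> s0 sb; apply: eq_bigr => T _; congr (_ * _ + _ * _).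
  by apply: eq_bigr => E _; apply: eq_face_int => x Ex; rewrite s0 sb.
by apply: eq_cell_int => x _; rewrite /residual s0.
Qed.

Lemma form_b_eqr r v s s' : in_M r v -> in_W j s -> in_W j s' ->
  w0 s = w0 s' -> (forall E x, face E x -> wb s E x = wb s' E x) ->
  form_b beta c r v s = form_b beta c r v s'.
Proof.
move=> pv ps ps' s0 sb; rewrite (form_bE beta c meshM pv ps) (form_bE beta c meshM pv ps').
apply: eq_bigr => T _; congr (_ + _).
  by apply: eq_cell_int => x _; rewrite /residual s0.
by apply: eq_bigr => E _; congr (_ * _); apply: eq_face_int => x Ex; rewrite s0 sb.
Qed.

End stabilizer_energy.

Section load_functional.
Context {R : realType} {n : nat} (Omega : set 'rV[R]_n.+1) (M : mesh R n)
  (beta : cells M -> 'rV[R]_n.+1) (q : R) (j : nat) (f g : 'rV[R]_n.+1 -> R).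
Hypotheses (meshM : polytopal_partition Omega M) (domOmega : lipschitz_domain Omega).
Hypotheses (q_ge1 : 1 <= q) (fLq : in_Lp (lebesgue_rV n.+1) q Omega f)
  (gLq : in_Lp_bnd M q (Gamma_minus Omega beta) g).
Local Notation vec := 'rV[R]_n.+1.
Implicit Types (s l h : @weak_fun R n M).

Definition load s : R := inflow_int Omega beta (fun E x => wb s E x * g x) -
  \sum_T cell_int T (fun x => f x * w0 s T x).

Lemma load_eq s s' : (forall T x, cell T x -> w0 s T x = w0 s' T x) ->
  (forall E x, face E x -> wb s E x = wb s' E x) -> load s = load s'.
Proof.
move=> s0 sb; congr (_ - _).
  apply: eq_bigr => E _; apply: eq_bigr => T _.
  by apply: eq_face_int => x Ex; rewrite sb.
by apply: eq_bigr => T _; apply: eq_cell_int => x Tx; rewrite s0.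
Qed.

Lemma load_lin a b l s : in_W j l -> in_W j s ->
  load (wlin a b l s) = a * load l + b * load s.
Proof.
move=> pl ps.
have mT (T : cells M) : measurable (cell T) by exact: (@cell_measurable _ _ _ _ meshM).
have mE (E : faces M) : measurable (face_ref E) by exact: (@face_ref_measurable _ _ _ _ meshM).
have fi (T : cells M) (w : vec -> R) : continuous w ->
    (lebesgue_rV n.+1).-integrable (cell T) (EFin \o (fun x => f x * w x)).
  move=> cw; have bO : bounded_set Omega by have [] := domOmega.
  have mO : measurable Omega by exact: domain_measurable.
  have [K _ hK] := continuous_bounded_rV cw bO.
  have fO := in_Lp_integrable mO q_ge1 (domain_finite domOmega) fLq.
  have fT : (lebesgue_rV n.+1).-integrable (cell T) (EFin \o f).
    by apply: integrableS fO => //; exact: (cell_subset meshM domOmega).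
  apply: (integrable_mul_bounded (K := K) (mT T) fT); first exact: continuous_measurable_rV.
  by move=> x Tx; apply: hK; exact: (cell_subset meshM domOmega Tx).
have gi (E : faces M) (w : vec -> R) : face E `<=` Gamma_minus Omega beta -> continuous w ->
    (lebesgue_rV n).-integrable (face_ref E) (EFin \o (fun y => w (chart E y) * g (chart E y))).
  move=> EG cw; have bE : bounded_set (face_ref E) by exact: (@face_ref_bounded _ _ _ _ meshM).
  have chc : continuous (@chart _ _ M E) by exact: chart_continuous.
  have cwE : continuous (w \o chart E) by move=> y; exact: (continuous_comp (chc y) (cw _)).
  have [K _ hK] := continuous_bounded_rV cwE bE.
  have gE := in_Lp_integrable (mE E) q_ge1 (lebesgue_rV_bounded_lty (mE E) bE) (gLq EG).
  rewrite (_ : (fun y => _) = fun y => (g \o chart E) y * (w \o chart E) y).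
    by apply: (integrable_mul_bounded (K := K) (mE E) gE) => //; exact: continuous_measurable_rV.
  by apply/funext => y /=; rewrite mulrC.
rewrite /load.
have -> : inflow_int Omega beta (fun E x => wb (wlin a b l s) E x * g x) =
    a * inflow_int Omega beta (fun E x => wb l E x * g x) +
    b * inflow_int Omega beta (fun E x => wb s E x * g x).
  rewrite !mulr_sumr -big_split/=; apply: eq_bigr => E /asboolP EG.
  rewrite !mulr_sumr -big_split/=; apply: eq_bigr => T _; rewrite /face_int.
  have gl := gi E (wb l E) EG (is_poly_continuous (pl.2 E)).
  have gs := gi E (wb s E) EG (is_poly_continuous (ps.2 E)).
  have := @Rintegral_lin _ _ _ _ _ (mE E) a b _ _ gl gs.
  have cl : (lebesgue_rV n).-integrable (face_ref E) (EFin \o (fun y => a * (wb l E (chart E y) * g (chart E y)) + b * (wb s E (chart E y) * g (chart E y)))).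
    exact: (integrableD (mE E) (integrableZl (mE E) a gl) (integrableZl (mE E) b gs)).
  rewrite (RintegralZr _ (mE E) gl) (RintegralZr _ (mE E) gs) => h.
  rewrite !mulrA -mulrDl -h -(RintegralZr _ (mE E) cl).
  by apply: eq_Rintegral => y _ /=; ring.
have -> : \sum_T cell_int T (fun x => f x * w0 (wlin a b l s) T x) =
    a * (\sum_T cell_int T (fun x => f x * w0 l T x)) + b * (\sum_T cell_int T (fun x => f x * w0 s T x)).
  rewrite !mulr_sumr -big_split/=; apply: eq_bigr => T _; rewrite /cell_int.
  have fl := fi T (w0 l T) (is_poly_continuous (pl.1 T)).
  have fs := fi T (w0 s T) (is_poly_continuous (ps.1 T)).
  rewrite -(Rintegral_lin (mT T))//; apply: eq_Rintegral => x _ /=; ring.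
ring.
Qed.

End load_functional.

Section existence.
Context {R : realType} {n : nat} (Omega : set 'rV[R]_n.+1) (M : mesh R n)
  (beta : cells M -> 'rV[R]_n.+1) (c : cells M -> R) (p q rho tau : R) (k j : nat)
  (f g theta : 'rV[R]_n.+1 -> R).
Hypotheses (meshM : polytopal_partition Omega M) (domOmega : lipschitz_domain Omega).
Hypotheses (p_gt1 : 1 < p) (pq : p^-1 + q^-1 = 1) (rho_gt0 : 0 < rho) (tau_ge0 : 0 <= tau).
Hypothesis degrees : j = k.-1 \/ (j = k /\ 0 < tau).
Hypotheses (fLq : in_Lp (lebesgue_rV n.+1) q Omega f)
  (gLq : in_Lp_bnd M q (Gamma_minus Omega beta) g).
Hypothesis adjoint_wp : adjoint_well_posed Omega beta c p theta.
Local Notation vec := 'rV[R]_n.+1.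
Implicit Types (s l h : @weak_fun R n M).

Definition dofs : finType :=
  ((cells M * @multi_index n.+1 j) + (faces M * @multi_index n.+1 j))%type.

Local Notation V := 'rV[R]_#|dofs|.

(** The coefficients of faces in the outflow boundary are ignored, so that every vector yields an
    element of the constrained space. The map is not injective: vanishing monomials, ignored
    coefficients, and face polynomials written in ambient coordinates all produce redundancy. *)
Definition dof_fun (a : V) : @weak_fun R n M := WeakFun
  (fun T => poly_sum (fun al : @multi_index n.+1 j => a ord0 (enum_rank (inl (T, al) : dofs))))
  (fun E => if `[< face E `<=` Gamma_plus Omega beta >] then fun=> 0 else
     poly_sum (fun al : @multi_index n.+1 j => a ord0 (enum_rank (inr (E, al) : dofs)))).

Lemma poly_sum_lin r (a b : R) (u v : @multi_index n.+1 r -> R) x :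
  poly_sum (fun al => a * u al + b * v al) x = a * poly_sum u x + b * poly_sum v x.
Proof. by rewrite /poly_sum !mulr_sumr -big_split/=; apply: eq_bigr => al _; ring. Qed.

Lemma dof_fun_lin a b x y : dof_fun (a *: x + b *: y) = wlin a b (dof_fun x) (dof_fun y).
Proof.
congr WeakFun; apply/funext => T; apply/funext => z /=.
  by rewrite -poly_sum_lin; apply: eq_bigr => al _; rewrite !mxE.
case: ifP => _; first by rewrite !mulr0 addr0.
by rewrite -poly_sum_lin; apply: eq_bigr => al _; rewrite !mxE.
Qed.

Lemma dof_fun_W0 x : in_W0 Omega beta j (dof_fun x).
Proof.
split; first split=> [T|E] /=.
- by apply/is_poly_sumP; eexists.
- by case: ifP => _; [exact: is_poly0|apply/is_poly_sumP; eexists].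
- by move=> E EG y Ey /=; rewrite asboolT.
Qed.

(** On an outflow face the polynomial [wb s E] vanishes on the face but perhaps not elsewhere, so
    face components can be matched on the faces only. *)
Lemma dof_fun_surj s : in_W0 Omega beta j s -> exists2 x,
  w0 s = w0 (dof_fun x) & forall E y, face E y -> wb s E y = wb (dof_fun x) E y.
Proof.
move=> [[s0 sb] sG].
have [a aE] := choice (fun T => iffLR (is_poly_sumP _ _) (s0 T)).
have [b bE] := choice (fun E => iffLR (is_poly_sumP _ _) (sb E)).
exists (\row_i match (enum_val i : dofs) with inl (T, al) => a T al | inr (E, al) => b E al end).
  apply/funext => T; rewrite aE; apply/funext => y /=.
  by apply: eq_bigr => al _; rewrite mxE enum_rankK.
move=> E y Ey /=; case: asboolP => EG; first exact: sG.
by rewrite bE; apply: eq_bigr => al _; rewrite mxE enum_rankK.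
Qed.

Definition basis_fun r (i : cells M * @multi_index n.+1 r) (T : cells M) (x : vec) : R :=
  if T == i.1 then mon i.2 x else 0.

Lemma basis_fun_M r (i : cells M * @multi_index n.+1 r) : in_M r (basis_fun i).
Proof.
by move=> T; rewrite /basis_fun; case: eqP => _; [exact: is_poly_mon|exact: is_poly0].
Qed.

Lemma form_b_basis r s (u : cells M * @multi_index n.+1 r -> R) : in_W j s ->
  form_b beta c r (fun T => poly_sum (fun al => u (T, al))) s =
  \sum_i u i * form_b beta c r (basis_fun i) s.
Proof.
move=> ps; have -> : (fun T => poly_sum (fun al => u (T, al))) =
    fun T x => \sum_i u i * basis_fun i T x.
  apply/funext => T; apply/funext => x.
  have -> : \sum_i u i * basis_fun i T x =
      \sum_T' \sum_(al : @multi_index n.+1 r) u (T', al) * basis_fun (T', al) T x.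
    by rewrite pair_bigA/=; apply: eq_bigr => -[].
  rewrite (bigD1 T)//= [X in _ = _ + X]big1 ?addr0; last first.
    move=> T' T'T; apply: big1 => al _.
    by rewrite /basis_fun/= eq_sym (negbTE T'T) mulr0.
  by apply: eq_bigr => al _; rewrite /basis_fun/= eqxx.
have pS I (e : seq I) (w : I -> R) (v : I -> cells M -> vec -> R) : (forall i, in_M r (v i)) ->
    in_M r (fun T x => \sum_(i <- e) w i * v i T x) /\
    form_b beta c r (fun T x => \sum_(i <- e) w i * v i T x) s =
      \sum_(i <- e) w i * form_b beta c r (v i) s.
  move=> pv; elim: e => [|i e [IH1 IH2]].
    rewrite big_nil (_ : (fun T x => _) = fun _ _ => 0); last first.
      by apply/funext => T; apply/funext => x; rewrite big_nil.
    split=> [T|]; first exact: is_poly0.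
    by apply: big1 => T _; apply: cell_int_eq0 => x _; rewrite mul0r.
  rewrite big_cons (_ : (fun T x => _) =
      fun T x => w i * v i T x + 1 * \sum_(i <- e) w i * v i T x); last first.
    by apply/funext => T; apply/funext => x; rewrite big_cons mul1r.
  split; first exact: in_M_lin.
  by rewrite (form_b_linl _ _ meshM _ _ (pv i) IH1 ps) mul1r IH2.
exact: (pS _ _ _ _ (@basis_fun_M r)).2.
Qed.

Lemma PDWG_exists : exists u l, PDWG_solution Omega beta c p rho tau k j f g u l.
Proof.
have p0 : 0 < p by exact: lt_trans p_gt1.
have q_ge1 : 1 <= q.
  have qE : q^-1 = 1 - p^-1 by rewrite -pq addrAC subrr add0r.
  have ip : 0 < p^-1 < 1 by rewrite invr_gt0 p0 invf_lt1.
  have q0 : 0 < q by rewrite -invr_gt0 qE subr_gt0; case/andP: ip.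
  by rewrite -(invf_le1 q0) qE; case/andP: ip => /ltW; lra.
have W0x x := dof_fun_W0 x; have Wx x := (W0x x).1.
pose A (x h : V) := form_s beta c p rho tau (dof_fun x) (dof_fun h).
pose F (x : V) := load Omega beta f g (dof_fun x).
pose B v (x : V) := form_b beta c k.-1 v (dof_fun x).
have unit1 (a : R) (y z : V) : a *: y + z = a *: y + 1 *: z by rewrite scale1r.
have A_lin x a y z : A x (a *: y + z) = a * A x y + A x z.
  rewrite /A unit1 dof_fun_lin (form_s_linr beta c rho tau meshM p_gt1 _ _ (Wx x) (Wx y) (Wx z)).
  by rewrite mul1r.
have F_lin a y z : F (a *: y + z) = a * F y + F z.
  by rewrite /F unit1 dof_fun_lin (load_lin meshM domOmega q_ge1 fLq gLq _ _ (Wx y) (Wx z)) mul1r.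
have B_lin v a y z : in_M k.-1 v -> B v (a *: y + z) = a * B v y + B v z.
  by move=> pv; rewrite /B unit1 dof_fun_lin (form_b_linr _ _ meshM _ _ pv (Wx y) (Wx z)) mul1r.
pose Z (x : V) := forall v, in_M k.-1 v -> B v x = 0.
have [|||||||||x [Zx hx]] := @variational_solution R #|dofs| p (fun x => A x x) A F Z p_gt1.
- move=> v pv; have := B_lin v 1 0 0 pv; rewrite scaler0 addr0 mul1r; lra.
- by move=> a x y Zx Zy v pv; rewrite B_lin// Zx// Zy// mulr0 addr0.
- exact: A_lin.
- exact: F_lin.
- by move=> x; exact: (form_s_ge0 beta c meshM p_gt1 rho_gt0 tau_ge0).
- move=> t x; rewrite /A; have -> : t *: x = t *: x + 0 *: x by rewrite scale0r addr0.
  by rewrite dof_fun_lin (form_s_homogeneous _ _ _ _ meshM p_gt1 _ (Wx x)).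
- move=> x h; rewrite /A; have -> : x + h = 1 *: x + 1 *: h by rewrite !scale1r.
  by rewrite dof_fun_lin; exact: (form_s_subgradient beta c meshM p_gt1 rho_gt0 tau_ge0 (Wx x) (Wx h)).
- move=> x h; have := @form_s_hemicontinuous _ _ _ _ beta c p rho tau j meshM p_gt1 _ _ (Wx x) (Wx h).
  apply: cvg_trans; apply: near_eq_cvg; apply: nearW => m.
  by rewrite /A -dof_fun_lin scale1r.
- move=> x Zx Sx.
  set l := dof_fun x; have pl : in_W j l by exact: Wx.
  (* The uniqueness argument is reused for the pair formed by [l] and the zero function. It shows
     that a null vector represents zero on all cells and faces, which makes the load and the
     stabilizer vanish on it. *)
  pose e := wlin 1 (-1) l (wlin 0 0 l l).
  have pz : in_W0 Omega beta j (wlin 0 0 l l) by apply: in_W0_lin; exact: W0x.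
  have pe : in_W0 Omega beta j e by apply: in_W0_lin => //; exact: W0x.
  have se : form_s beta c p rho tau l e = form_s beta c p rho tau (wlin 0 0 l l) e.
    rewrite [RHS](@form_s0l _ _ _ _ _ _ _ _ j); last exact: pl.
    rewrite (form_s_linr beta c rho tau meshM p_gt1 _ _ pl pl pz.1).
    rewrite (form_s_linr beta c rho tau meshM p_gt1 _ _ pl pl pl).
    by rewrite (Sx : form_s beta c p rho tau l l = 0); ring.
  have be0 v : in_M k.-1 v -> form_b beta c k.-1 v e = 0.
    move=> pv; rewrite (form_b_linr _ _ meshM _ _ pv pl pz.1) (form_b_linr _ _ meshM _ _ pv pl pl).
    by rewrite (Zx v pv : form_b beta c k.-1 v l = 0); ring.
  have [h1 h2] := form_s_monotone meshM p_gt1 rho_gt0 tau_ge0 pl pz.1 se.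
  have r0 := jump_free_residual meshM degrees pe h1 h2 be0.
  have [z0 zb] := trace_free_zero meshM domOmega p_gt1 adjoint_wp pe h1 r0.
  have e0 T y : w0 e T y = w0 l T y by move=> /=; ring.
  have eb E y : wb e E y = wb l E y by move=> /=; ring.
  split.
    rewrite /F -/l (@load_eq _ _ _ _ _ _ _ l (wlin 0 0 l l)).
    - by rewrite (load_lin meshM domOmega q_ge1 fLq gLq _ _ pl pl) !mul0r addr0.
    - by move=> T y Ty; rewrite -e0 z0//= !mul0r addr0.
    - by move=> E y Ey; rewrite -eb zb//= !mul0r addr0.
  move=> y; apply: form_s_null => [T E z TE Ez|T z Tz]; first by rewrite -e0 -eb (h1 T E).
  rewrite -(r0 T z Tz) /residual e0.
  by rewrite (_ : w0 e T = w0 (dof_fun x) T)//; apply/funext => w; exact: e0.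
pose delta i : V := delta_mx ord0 i.
(* [F - A x] vanishes on the kernel of the constraints, and the constraints for [basis_fun] imply
   all the others by [form_b_basis]. The coefficients [U] obtained by duality are those of the
   primal variable. *)
have [U hU] : exists U : cells M * @multi_index n.+1 k.-1 -> R, forall i,
    \sum_m U m * B (basis_fun m) (delta i) = F (delta i) - A x (delta i).
  apply: row_space_duality => d hd; pose y : V := \row_i d i.
  have sumE (phi : V -> R) : (forall a y z, phi (a *: y + z) = a * phi y + phi z) ->
      phi y = \sum_i phi (delta i) * d i.
    by move=> lin; rewrite (scalar_funE lin); apply: eq_bigr => i _; rewrite mxE mulrC.
  have Zy : Z y.
    move=> v pv; have [a aE] := choice (fun T => iffLR (is_poly_sumP _ _) (pv T)).
    rewrite /B (_ : v = fun T => poly_sum (fun al => a T al)); last by apply/funext.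
    rewrite (form_b_basis (fun m => a m.1 m.2) (Wx y)); apply: big1 => m _.
    rewrite -/(B _ y) sumE ?hd ?mulr0// => t u w; apply: B_lin; exact: basis_fun_M.
  under eq_bigr do rewrite mulrBl; rewrite sumrB -!sumE//; by rewrite (hx y Zy) subrr.
have pU : in_M k.-1 (fun T : cells M => poly_sum (fun al => U (T, al))).
  by move=> T; apply/is_poly_sumP; eexists.
exists (fun T => poly_sum (fun al => U (T, al))), (dof_fun x); split=> // s ps.
have [y s0 sb] := dof_fun_surj ps.
rewrite (form_s_eqr beta c p rho tau _ s0 sb) (form_b_eqr beta c meshM pU ps.1 (Wx y) s0 sb).
rewrite -/(load Omega beta f g s).
rewrite (@load_eq _ _ _ _ _ _ _ s (dof_fun y)); [|by move=> T z _; rewrite s0|exact: sb].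
rewrite (form_b_basis _ (Wx y)) -/(A x y) -/(F y).
(* The defect of the first equation is linear in the coefficient vector, and [hU] says that it
   vanishes on the unit vectors. *)
pose G (y : V) := \sum_m U m * B (basis_fun m) y - (F y - A x y).
suff : G y = 0 by rewrite /G /B; lra.
have G_lin a y1 y2 : G (a *: y1 + y2) = a * G y1 + G y2.
  rewrite /G F_lin A_lin (eq_bigr (fun m => a * (U m * B (basis_fun m) y1) + U m * B (basis_fun m) y2)).
    by rewrite big_split/= -mulr_sumr; ring.
  by move=> m _; rewrite B_lin; [ring|exact: basis_fun_M].
by rewrite (scalar_funE G_lin); apply: big1 => i _; rewrite /G hU subrr mulr0.
Qed.

End existence.

Lemma PDWG_solvable (R : realType) (n : nat) (Omega : set 'rV[R]_n.+1) (M : mesh R n)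
    (p q rho tau : R) (k j : nat) (beta : cells M -> 'rV[R]_n.+1) (c : cells M -> R)
    (f g theta : 'rV[R]_n.+1 -> R) :
  lipschitz_domain Omega -> polytopal_partition Omega M -> 1 < p -> p^-1 + q^-1 = 1 ->
  in_Lp (lebesgue_rV n.+1) q Omega f -> in_Lp_bnd M q (Gamma_minus Omega beta) g ->
  transport_well_posed Omega beta c p q f g -> adjoint_well_posed Omega beta c p theta ->
  0 < rho -> 0 <= tau -> j = k.-1 \/ (j = k /\ 0 < tau) ->
  PDWG_uniquely_solvable Omega beta c p rho tau k j f g.
Proof.
move=> domOmega meshM p_gt1 pq fLq gLq transport_wp adjoint_wp rho_gt0 tau_ge0 degrees.
split; first exact: (PDWG_exists meshM domOmega p_gt1 pq rho_gt0 tau_ge0 degrees fLq gLq adjoint_wp).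
move=> u l u' l' sol sol'.
have [hl hb hs] :=
  multiplier_unique meshM domOmega p_gt1 rho_gt0 tau_ge0 degrees adjoint_wp sol sol'.
split=> // T x Tx.
have [pu _ eq1 _] := sol; have [pu' _ eq1' _] := sol'.
have kj : (k.-1 <= j)%N by case: degrees => [->//|[-> _]]; exact: leq_pred.
have pw := in_M_lin 1 (-1) pu pu'.
have bw s : in_W0 Omega beta j s ->
    form_b beta c k.-1 (fun T x => 1 * u T x + (-1) * u' T x) s = 0.
  move=> ps; rewrite (form_b_linl _ _ meshM _ _ pu pu' ps.1).
  by have := eq1 s ps; have := eq1' s ps; rewrite hs; lra.
by have := primal_kernel meshM domOmega p_gt1 pq kj transport_wp pw bw Tx; lra.
Qed.

Theorem theorem4p2 (R : realType) (n : nat) (Omega : set 'rV[R]_n.+1)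
    (M : mesh R n) (gamma p q rho tau : R) (k j : nat)
    (beta : cells M -> 'rV[R]_n.+1) (c : cells M -> R)
    (f g theta : 'rV[R]_n.+1 -> R)
    (dim23 : n.+1 = 2%N \/ n.+1 = 3%N)
    (domOmega : lipschitz_domain Omega)
    (meshM : polytopal_partition Omega M)
    (gamma_gt0 : 0 < gamma) (regM : shape_regular gamma M)
    (p_gt1 : 1 < p) (pq : p^-1 + q^-1 = 1)
    (fLq : in_Lp (lebesgue_rV n.+1) q Omega f)
    (gLq : in_Lp_bnd M q (Gamma_minus Omega beta) g)
    (thetaLq : in_Lp (lebesgue_rV n.+1) q Omega theta)
    (transport_wp : transport_well_posed Omega beta c p q f g)
    (adjoint_wp : adjoint_well_posed Omega beta c p theta)
    (k_ge1 : (1 <= k)%N) (rho_gt0 : 0 < rho) (tau_ge0 : 0 <= tau) :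
  (j = k.-1 -> PDWG_uniquely_solvable Omega beta c p rho tau k j f g) /\
  (j = k -> 0 < tau -> PDWG_uniquely_solvable Omega beta c p rho tau k j f g).
Proof.
split=> [jk|jk tau_gt0].
  by apply: (PDWG_solvable domOmega meshM p_gt1 pq fLq gLq transport_wp adjoint_wp) => //; left.
by apply: (PDWG_solvable domOmega meshM p_gt1 pq fLq gLq transport_wp adjoint_wp) => //; right.
Qed.
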